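(* Let $\mathcal{B}_{\mathcal{A}}(\Omega)$ be an $\ell^2$-valued Bergman-type space satisfying in addition property (A.8), and let $T\in\mathcal{L}(\mathcal{B}_{\mathcal{A}}(\Omega))$. Then $T$ is compact if and only if $\limsup_{\mathfrak{d}(z,0)\to\infty}\widetilde{T}(z)=0$, meaning $$\limsup_{\mathfrak{d}(z,0)\to\infty}\left|\left\langle\widetilde{T}(z)e_k,e_i\right\rangle_{\ell^2}\right|=0\quad\text{for all }i,k\in\mathbb{N},$$ and $T\in\mathcal{T}_{L^\infty_{\mathrm{fin}}}$.
   Context: Notation: $A\lesssim B$ means $A\le CB$ for some constant $C$, and $A\simeq B$ means $A\lesssim B$ and $B\lesssim A$. $\{e_k\}_{k\ge1}$ is the standard orthonormal basis of $\ell^2$. A function $f:\Omega\to\ell^2$ is measurable (analytic) if every $\langle f(\cdot),e_k\rangle_{\ell^2}$ is. $L^2(\Omega,\ell^2;d\sigma)$ has inner product $\int_\Omega\langle f,g\rangle_{\ell^2}d\sigma$. $\mathcal{L}(X)$ is the space of bounded linear operators on $X$. An $\ell^2$-valued Bergman-type space $\mathcal{B}(\Omega)$ is given by the following data and assumptions. (A.1) $\Omega\subset\mathbb{C}^n$ is a connected open set containing $0$; for each $z\in\Omega$ there is an involution $\varphi_z\in\mathrm{Aut}(\Omega)$ with $\varphi_z(0)=z$. (A.2) $\mathfrak{d}$ is a metric on $\Omega$ that is quasi-invariant under $\varphi_z$: $\mathfrak{d}(u,v)\simeq\mathfrak{d}(\varphi_z(u),\varphi_z(v))$ with implied constants independent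 of $u,v\in\Omega$; $(\Omega,\mathfrak{d})$ is separable and its closed balls are compact. $D(z,r)$ is the $\mathfrak{d}$-ball of center $z$ and radius $r$. (A.3) $\sigma$ is a finite Borel measure on $\Omega$. $\mathcal{B}(\Omega)$ is the space of analytic $f:\Omega\to\ell^2$ in $L^2(\Omega,\ell^2;d\sigma)$, and $\mathcal{B}(\Omega,\mathbb{C})$ the space of scalar analytic functions in $L^2(\Omega,\mathbb{C};d\sigma)$, with the inherited norms and inner products. They are reproducing kernel Hilbert spaces: there are $K_z\in\mathcal{B}(\Omega,\mathbb{C})$ with $f(z)=\int_\Omega\overline{K_z(w)}f(w)\,d\sigma(w)$ for all $z\in\Omega$ and all $f$ in $\mathcal{B}(\Omega,\mathbb{C})$ or in $\mathcal{B}(\Omega)$ (coordinatewise integral). $k_z:=K_z/\|K_z\|_{\mathcal{B}(\Omega,\mathbb{C})}$, and $z\mapsto\|K_z\|_{\mathcal{B}(\Omega,\mathbb{C})}$ is continuous on $(\Omega,\mathfrak{d})$. (A.4) $d\lambda(z):=\|K_z\|^2_{\mathcal{B}(\Omega,\mathbb{C})}d\sigma(z)$ satisfies $\lambda(E)\simeq\lambda(\varphi_z(E))$ for every Borel $E\subset\Omega$ with implied constants independent of $z\in\Omega$, and is doubling: $\lambda(D(z,2r))\le C\lambda(D(z,r))$ for all $z\in\Omega$, $r>0$, for some $C>1$. (A.5) $|\langle k_z,k_w\rangle_{\mathcal{B}(\Omega,\mathbb{C})}|\simeq 1/\|K_{\varphi_z(w)}\|_{\mathcal{B}(\Omega,\mathbb{C})}$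 with implied constants independent of $z,w\in\Omega$. (A.6) Either there is $0<\kappa<2$ such that $$\int_\Omega\frac{|\langle K_z,K_w\rangle|^{(r+s)/2}}{\|K_z\|^s\|K_w\|^r}\,d\lambda(w)\le C(r,s)<\infty\quad\text{for all }z\in\Omega$$ (norms and inner products in $\mathcal{B}(\Omega,\mathbb{C})$) for all $r>\kappa>s>0$; or this holds for all $r=s>0$, in which case one sets $\kappa=0$. (A.7) $\|K_z\|_{\mathcal{B}(\Omega,\mathbb{C})}\to\infty$ as $\mathfrak{d}(z,0)\to\infty$. Property (A.8): if $\mu$ is a scalar-valued measure on $\Omega$ whose total variation $|\mu|$ is Carleson with respect to $\sigma$ (there is $C$ with $\int_\Omega|f|^2d|\mu|\le C\int_\Omega|f|^2d\sigma$ for all $f\in\mathcal{B}(\Omega,\mathbb{C})$), then the operator $T_\mu$ on $\mathcal{B}(\Omega,\mathbb{C})$, $(T_\mu f)(z)=\int_\Omega\langle K_w,K_z\rangle_{\mathcal{B}(\Omega,\mathbb{C})}f(w)\,d\mu(w)$, belongs to $\mathcal{T}_{\mathrm{BUC}}$, the (norm-closed) algebra of operators on $\mathcal{B}(\Omega,\mathbb{C})$ generated by the Toeplitz operators $f\mapsto P(af)$ with $a:(\Omega,\mathfrak{d})\to\mathbb{C}$ bounded and uniformly continuous ($P$ the orthogonal projection of $L^2(\Omega,\mathbb{C};d\sigma)$ onto $\mathcal{B}(\Omega,\mathbb{C})$). When (A.8) holds, $\mathcal{B}(\Omega)$ is written $\mathcal{B}_{\mathcal{A}}(\Omega)$. For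 $e\in\ell^2$, $k_ze$ denotes the function $w\mapsto k_z(w)e$. The Berezin transform of $T$ is the operator-valued function $\widetilde{T}$ on $\Omega$ with $\langle\widetilde{T}(z)e_k,e_i\rangle_{\ell^2}:=\langle T(k_ze_k),k_ze_i\rangle_{\mathcal{B}(\Omega)}$. $L^\infty_{\mathrm{fin}}$ is the set of $u:\Omega\to\mathcal{L}(\ell^2)$ that are measurable (all $\langle u(\cdot)e_k,e_i\rangle_{\ell^2}$ measurable), with $\|u(\cdot)\|_{\mathcal{L}(\ell^2)}\in L^\infty(\Omega,\mathbb{C};d\sigma)$, and finite: there is $d\in\mathbb{N}$ such that for all $z$, $\langle u(z)e_i,e_k\rangle_{\ell^2}=0$ whenever $i>d$ or $k>d$. $T_u=PM_u$ with $(M_uf)(z)=u(z)f(z)$ and $P$ the orthogonal projection of $L^2(\Omega,\ell^2;d\sigma)$ onto $\mathcal{B}(\Omega)$. $\mathcal{T}_{L^\infty_{\mathrm{fin}}}$ is the closure in the operator norm of the set of finite sums of finite products of operators $T_u$, $u\in L^\infty_{\mathrm{fin}}$. *)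

(* Defs.v *)
From HB Require Import structures.
From mathcomp Require Import all_boot all_order all_algebra.
From mathcomp Require Import complex.
From mathcomp Require Import all_classical all_reals all_analysis.

Set Implicit Arguments.
Unset Strict Implicit.
Unset Printing Implicit Defensive.

Import Order.TTheory GRing.Theory Num.Theory.
Import numFieldNormedType.Exports.

Local Open Scope classical_set_scope.
Local Open Scope ring_scope.

(* [R[i]^o] is the complex field as a normed space over itself; complex
   moduli are taken in [R] (library: [ComplexField.Normc.normc]). *)
Notation cmod := ComplexField.Normc.normc.
Notation cRe := (@complex.Re _).
Notation cIm := (@complex.Im _).

(* A Hilbert space is presented as a set of vectors [H] of an ambient space
   [V] with an inner product that is only meaningful on [H].  An operator on
   [H] is a function [V -> V] of which only the values on [H] matter.  The
   axioms of a Hilbert space are not part of this record: [ell2] satisfies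
   them, and for the Bergman-type spaces they come from [reproducing_kernel]. *)
Record hspace (R : realType) (V : lmodType R[i]) := HSpace {
  hset :> V -> Prop ;
  hip : V -> V -> R[i] }.

Section operators.
Context {R : realType} {V : lmodType R[i]} (H : hspace V).
Implicit Types (f g : V) (S T : V -> V) (G : set (V -> V)).

Definition hnorm f : R := Num.sqrt (cRe (hip H f f)).

Definition hcvg (f : nat -> V) g :=
  (fun m => hnorm (f m - g)) @ \oo --> (0 : R).

Definition hcomplete := forall f : nat -> V, (forall m, H (f m)) ->
  (forall e : R, 0 < e -> exists N, forall m p, (N <= m)%N -> (N <= p)%N ->
     hnorm (f m - f p) < e) ->
  exists2 g, H g & hcvg f g.

Definition bounded_op T := [/\ forall f, H f -> H (T f),
  forall (a : R[i]) f g, H f -> H g -> T (a *: f + g) = a *: T f + T g &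
  exists M : R, forall f, H f -> hnorm (T f) <= M * hnorm f].

Definition opnorm T : R :=
  sup [set hnorm (T f) | f in [set f | H f /\ hnorm f <= 1]].

Definition compact_op T := forall f : nat -> V, (forall m, H (f m)) ->
  (exists M : R, forall m, hnorm (f m) <= M) ->
  exists2 s : nat -> nat, {homo s : i j / (i < j)%N} &
    exists2 g, H g & hcvg (T \o f \o s) g.

Definition op_closure G : set (V -> V) := [set T | bounded_op T /\
  forall e : R, 0 < e -> exists2 S, G S &
    forall f, H f -> hnorm (T f - S f) <= e * hnorm f].

(* The orthogonal projection onto [H], defined on any ambient vectors having
   well-defined inner products with the elements of [H]. *)
Definition oproj f : V :=
  xget 0 [set g | H g /\ forall h, H h -> hip H (f - g) h = 0].

Inductive fin_products G : set (V -> V) :=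
| fp_gen S : G S -> fin_products G S
| fp_mul S T : fin_products G S -> fin_products G T -> fin_products G (S \o T).

Inductive fin_sums G : set (V -> V) :=
| fs_gen S : G S -> fin_sums G S
| fs_add S T : fin_sums G S -> fin_sums G T -> fin_sums G (fun f => S f + T f).

Inductive gen_algebra G : set (V -> V) :=
| ga_gen S : G S -> gen_algebra G S
| ga_add S T : gen_algebra G S -> gen_algebra G T ->
    gen_algebra G (fun f => S f + T f)
| ga_scale (a : R[i]) S : gen_algebra G S -> gen_algebra G (fun f => a *: S f)
| ga_mul S T : gen_algebra G S -> gen_algebra G T -> gen_algebra G (S \o T).

End operators.

Section ell2.
Context (R : realType).
Implicit Types x y : nat -> R[i]^o.

Definition csum (u : nat -> R[i]) : R[i] :=
  (limn (series (cRe \o u)) +i* limn (series (cIm \o u)))%C.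

Definition sqnorm x : \bar R := (\sum_(k <oo) (cmod (x k) ^+ 2)%:E)%E.

Definition ell2 : hspace (nat -> R[i]^o) :=
  HSpace [set x | (sqnorm x < +oo)%E] (fun x y => csum (fun k => x k * (y k)^*%C)).

(* Indices start at 0: [ell2_basis k] is the basis vector $e_{k+1}$. *)
Definition ell2_basis (k : nat) : nat -> R[i]^o := fun j => (j == k)%:R.

End ell2.

Record domain (R : realType) (n : nat) := Domain {
  dset :> set 'rV[R[i]^o]_n ;
  dset0 : dset 0 }.

(* The points of the domain, with the Euclidean topology and its Borel sets. *)
Definition pt (R : realType) (n : nat) (D : domain R n) : Type := set_type D.

Definition origin (R : realType) (n : nat) (D : domain R n) : pt D :=
  SigSub (mem_set (dset0 D)).

HB.instance Definition _ R n (D : domain R n) :=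
  Topological.copy (pt D) (set_type D).
HB.instance Definition _ R n (D : domain R n) := isPointed.Build (pt D) (origin D).
HB.instance Definition _ R n (D : domain R n) :=
  Measurable.copy (pt D) (g_sigma_algebraType (@open (pt D))).

Section functions.
Context {R : realType} {n : nat} {D : domain R n}.
Implicit Types f : pt D -> R[i]^o.

(* Complex (Frechet) differentiability at every point of [D], which is assumed
   to be open; ['valL_ 0 f] extends [f] by 0 outside [D]. *)
Definition analytic f := forall z : pt D,
  differentiable
    ('valL_ 0 (f : set_type D -> R[i]^o) : 'rV[R[i]^o]_n -> R[i]^o) (set_val z).

Definition analytic_map (phi : pt D -> pt D) :=
  forall j, analytic (fun z => set_val (phi z) ord0 j).

Definition automorphism (phi : pt D -> pt D) := analytic_map phi /\
  exists psi, [/\ analytic_map psi, cancel phi psi & cancel psi phi].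

Definition cmeasurable f :=
  measurable_fun setT (cRe \o f) /\ measurable_fun setT (cIm \o f).

Definition cintegral (mu : {measure set (pt D) -> \bar R}) f : R[i] :=
  ((\int[mu]_z cRe (f z)) +i* (\int[mu]_z cIm (f z)))%C.

End functions.

Section complex_measures.
Context {R : realType} {n : nat} (D : domain R n).

(* Charges are finite; so is any measure covered by the Carleson condition
   below, because the constants belong to the Bergman-type space. *)
Record cmeasure := CMeasure {
  mre : {charge set (pt D) -> \bar R} ;
  mim : {charge set (pt D) -> \bar R} }.

Definition cmeasure_val (mu : cmeasure) (E : set (pt D)) : R[i] :=
  (fine (mre mu E) +i* fine (mim mu E))%C.

Definition cmeasure_variation (mu : cmeasure) (E : set (pt D)) : \bar R :=
  ereal_sup [set (\sum_(k <oo) (cmod (cmeasure_val mu (F k)))%:E)%E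
            | F in [set F : nat -> set (pt D) | [/\ forall k, measurable (F k),
                      trivIset setT F & \bigcup_k F k = E]]].

Definition hahn (nu : {charge set (pt D) -> \bar R}) :=
  svalP (cid (svalP (cid (Hahn_decomposition nu)))).

Definition charge_integral (nu : {charge set (pt D) -> \bar R}) (f : pt D -> R[i]^o) :=
  cintegral (jordan_pos (hahn nu)) f - cintegral (jordan_neg (hahn nu)) f.

Definition cmeasure_integral (mu : cmeasure) (f : pt D -> R[i]^o) : R[i] :=
  charge_integral (mre mu) f + 'i%C * charge_integral (mim mu) f.

End complex_measures.

Record bergman_data (R : realType) (n : nat) := BergmanData {
  dom : domain R n ;
  inv_aut : pt dom -> pt dom -> pt dom ;
  dist : pt dom -> pt dom -> R ;
  distxx : forall x, dist x x = 0 ;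
  dist_eq0 : forall x y, dist x y = 0 -> x = y ;
  distC : forall x y, dist x y = dist y x ;
  dist_triangle : forall y x z, dist x z <= dist x y + dist y z ;
  sigma : {finite_measure set (pt dom) -> \bar R} ;
  ker : pt dom -> pt dom -> R[i]^o  (* [ker z w] is $K_z(w)$ *) }.

(* The same set of points with the metric [dist] (the Euclidean topology and
   the Borel sets are attached to [pt]). *)
Definition mpt (R : realType) (n : nat) (B : bergman_data R n) : Type := pt (dom B).

HB.instance Definition _ R n (B : bergman_data R n) := Choice.copy (mpt B) (pt (dom B)).
HB.instance Definition _ R n (B : bergman_data R n) :=
  isMetric.Build R (mpt B) (@distxx _ _ B) (@dist_eq0 _ _ B) (@distC _ _ B)
    (@dist_triangle _ _ B).

Definition separable (M : topologicalType) := exists2 A : set M, countable A & dense A.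

Section bergman.
Context {R : realType} {n : nat} (B : bergman_data R n).
Local Notation D := (dom B).
Local Notation phi := (@inv_aut _ _ B).
Local Notation d := (@dist _ _ B).
Local Notation K := (@ker _ _ B).
Implicit Types (z w u v : pt D) (E : set (pt D)).

Definition dball z (r : R) : set (pt D) := [set w | d z w < r].

Definition scalar_bergman : hspace (pt D -> R[i]^o) :=
  HSpace [set f | [/\ analytic f, cmeasurable f &
            (\int[sigma B]_z ((cmod (f z)) ^+ 2)%:E < +oo)%E]]
         (fun f g => cintegral (sigma B) (fun z => f z * (g z)^*%C)).

Definition bergman : hspace (pt D -> nat -> R[i]^o) :=
  HSpace [set f | [/\ forall z, ell2 R (f z),
            forall k, analytic (f ^~ k),
            forall k, cmeasurable (f ^~ k) &
            (\int[sigma B]_z sqnorm (f z) < +oo)%E]]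
         (fun f g => cintegral (sigma B) (fun z => hip (ell2 R) (f z) (g z))).

Definition kerip z w : R[i] := hip scalar_bergman (K z) (K w).
Definition knorm z : R := hnorm scalar_bergman (K z).
Definition nker z : pt D -> R[i]^o := fun w => K z w / (knorm z)%:C%C.

Definition lambda E : \bar R := (\int[sigma B]_(z in E) (knorm z ^+ 2)%:E)%E.

Definition homogeneous_domain := [/\ open (D : set 'rV[R[i]^o]_n),
  connected (D : set 'rV[R[i]^o]_n) &
  forall z, [/\ automorphism (phi z), involutive (phi z) & phi z (origin D) = z]].

(* The constant of the quasi-invariance is uniform in [z]. *)
Definition quasi_invariant_metric := [/\
  exists2 C : R, 0 < C & forall z u v,
    d u v <= C * d (phi z u) (phi z v) /\ d (phi z u) (phi z v) <= C * d u v,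
  separable (mpt B) &
  forall z r, compact ([set w | d z w <= r] : set (mpt B))].

Definition reproducing_kernel := [/\ hcomplete scalar_bergman, hcomplete bergman,
  forall z, scalar_bergman (K z),
  (forall z f, scalar_bergman f ->
     f z = cintegral (sigma B) (fun w => (K z w)^*%C * f w)) /\
  (forall z f, bergman f -> forall k,
     f z k = cintegral (sigma B) (fun w => (K z w)^*%C * f w k)) &
  continuous (knorm : mpt B -> R)].

(* That the metric balls are Borel sets is implicit in the doubling condition. *)
Definition doubling_measure := [/\
  exists2 C : R, 0 < C & forall z E, measurable E ->
    (lambda E <= C%:E * lambda (phi z @` E))%E /\
    (lambda (phi z @` E) <= C%:E * lambda E)%E,
  forall z r, measurable (dball z r) &
  exists2 C : R, 1 < C & forall z r, 0 < r ->
    (lambda (dball z (2 * r)) <= C%:E * lambda (dball z r))%E].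

Definition kernel_estimate := exists2 C : R, 0 < C & forall z w,
  cmod (hip scalar_bergman (nker z) (nker w)) <= C * (1 / knorm (phi z w)) /\
  1 / knorm (phi z w) <= C * cmod (hip scalar_bergman (nker z) (nker w)).

Definition schur_bound (r s : R) := exists C : R, forall z,
  (\int[lambda]_w ((cmod (kerip z w)) `^ ((r + s) / 2)
                     / (knorm z `^ s * knorm w `^ r))%:E <= C%:E)%E.

Definition rudin_forelli :=
  (exists2 kappa : R, 0 < kappa < 2 &
     forall r s, 0 < s -> s < kappa -> kappa < r -> schur_bound r s) \/
  (forall r, 0 < r -> schur_bound r r).

Definition dinfty : set_system (mpt B) :=
  filter_from setT (fun r : R => [set z | r < d z (origin D)]).

Definition kernel_blowup := (knorm : mpt B -> R) @ dinfty --> +oo.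

Definition bergman_type_space :=
  homogeneous_domain /\ quasi_invariant_metric /\ reproducing_kernel /\
  doubling_measure /\ kernel_estimate /\ rudin_forelli /\ kernel_blowup.

Definition buc_symbol (a : pt D -> R[i]^o) :=
  (exists M : R, forall z, cmod (a z) <= M) /\
  unif_continuous (a : mpt B -> R[i]^o).

Definition scalar_toeplitz (a f : pt D -> R[i]^o) : pt D -> R[i]^o :=
  oproj scalar_bergman (fun z => a z * f z).

Definition toeplitz_BUC := op_closure scalar_bergman
  (gen_algebra [set scalar_toeplitz a | a in buc_symbol]).

Definition toeplitz_cmeasure (mu : cmeasure D) (f : pt D -> R[i]^o) :
    pt D -> R[i]^o :=
  fun z => cmeasure_integral mu (fun w => kerip w z * f w).

Definition carleson (m : set (pt D) -> \bar R) := exists C : R,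
  forall f, scalar_bergman f ->
    (\int[m]_z ((cmod (f z)) ^+ 2)%:E <=
     C%:E * \int[sigma B]_z ((cmod (f z)) ^+ 2)%:E)%E.

Definition carleson_toeplitz_BUC := forall mu : cmeasure D,
  carleson (cmeasure_variation mu) -> toeplitz_BUC (toeplitz_cmeasure mu).

(* The function $k_z e$. *)
Definition nker_vec z (e : nat -> R[i]^o) : pt D -> nat -> R[i]^o :=
  fun w => nker z w *: e.

Definition berezin (T : (pt D -> nat -> R[i]^o) -> (pt D -> nat -> R[i]^o)) z
    (x : nat -> R[i]^o) : nat -> R[i]^o :=
  fun i => hip bergman (T (nker_vec z x)) (nker_vec z (ell2_basis R i)).

Definition Linf_fin (u : pt D -> (nat -> R[i]^o) -> (nat -> R[i]^o)) := [/\
  forall z, bounded_op (ell2 R) (u z),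
  forall i k, cmeasurable (fun z =>
    (hip (ell2 R) (u z (ell2_basis R k)) (ell2_basis R i) : R[i]^o)),
  (fun z => opnorm (ell2 R) (u z)) \in Lfun (sigma B) +oo%E &
  exists N : nat, forall z i k, (N <= i)%N || (N <= k)%N ->
    hip (ell2 R) (u z (ell2_basis R i)) (ell2_basis R k) = 0].

Definition toeplitz (u : pt D -> (nat -> R[i]^o) -> (nat -> R[i]^o))
    (f : pt D -> nat -> R[i]^o) : pt D -> nat -> R[i]^o :=
  oproj bergman (fun z => u z (f z)).

Definition toeplitz_Linf_fin := op_closure bergman
  (fin_sums (fin_products [set toeplitz u | u in Linf_fin])).

(* The limit superior of a nonnegative function as the distance to the origin
   tends to infinity, computed in $[0, +\infty]$: the [maxe 0] only matters
   when [dist] is bounded, where a supremum over the empty set is 0 and not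
   the value -oo of [ereal_sup]. *)
Definition limsup_infty (g : pt D -> R) : \bar R :=
  maxe 0%E (limf_esup ((fun z => (g z)%:E) : mpt B -> \bar R) dinfty).

End bergman.

(* Main.v *)
Require Import Defs.
From HB Require Import structures.
From mathcomp Require Import all_boot all_order all_algebra.
From mathcomp Require Import complex.
From mathcomp Require Import all_classical all_reals all_analysis.
From mathcomp Require Import measurable_realfun ring lra.

Set Implicit Arguments.
Unset Strict Implicit.
Unset Printing Implicit Defensive.

Import Order.TTheory GRing.Theory Num.Theory.
Import numFieldNormedType.Exports.

Local Open Scope classical_set_scope.
Local Open Scope ring_scope.

(* An operator in the Toeplitz closure is, up to a small error, a finite block
   matrix of scalar operators on [L2] that are band-dominated: modulo small
   norm, the value of the image at [w] only depends on the function near [w].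
   For the projection this follows from Schur's test with a power of the kernel
   norm as weight (A.6); multiplications are local.  So compactness reduces to a
   scalar statement: if [T] is band-dominated and its Berezin transform vanishes
   at infinity, then [T] maps weakly null sequences to norm null ones.

   First, [T k_z] tends to 0 in norm.  Transporting by the involutions, the forms
   [(f, g) |-> <T U_z^* f, U_z^* g>] have limits along ultrafilters, which vanish
   on pairs of equal kernels; being sesquiholomorphic they vanish on all pairs
   (power series in one complex variable and the identity theorem), and
   band-domination controls what happens away from the diagonal.  Then the local
   norms of [T f] are compared with [T k_z] and averaged against the doubling
   measure [lambda], which bounds [T f] far from the origin.  Near the origin
   dominated convergence applies.

   Conversely, the normalized kernels [k_z e] tend weakly to 0, so a compact
   operator has vanishing Berezin transform.  It is a limit of finite sums of
   rank-one operators [f |-> <f, K_w e_i> K_z e_j]; these lie in the Toeplitz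
   closure because (A.8) for the point mass at [w] produces [f |-> f(w) K_w],
   and the composition of two such operators is a nonzero multiple of
   [f |-> f(w) K_z]. *)

(** * Complex moduli, null sequences, limits along ultrafilters *)

(** The Berezin transform sees only the pairs [(k_z, k_z)], whereas [|T k_z|] depends on all pairs
    [(k_z, k_w)]; holomorphy has to bridge this gap. The transport by [phi_z] is the weighted
    composition [f |-> (f o phi_z) k_z]. Under (A.5) it need not be unitary; what matters is that it
    is bounded uniformly in [z] and that its adjoint sends [K_w] to a multiple of [K_{phi_z(w)}]
    whose norm is comparable to that of [K_w], above and below.

    The projection is band-dominated because (A.6) provides a convergent Schur integral for some
    power [ga < 1] of the normalized kernel: the surplus power [1 - ga] is uniformly small far from
    the diagonal, by (A.5) and (A.7). Quasi-invariance and doubling give all balls of one radius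
    comparable [lambda]-volume, so this volume cancels when local estimates are averaged.

    The metric and the Euclidean topology are not assumed to agree. Measurability therefore comes
    from countable dense sets and orthogonal expansions rather than from continuity. *)

Section complex_modulus.
Context {R : realType}.
Implicit Types (x y : R[i]) (a : R).

Lemma cmodE x : cmod x ^+ 2 = cRe x ^+ 2 + cIm x ^+ 2.
Proof. by case: x => a b /=; rewrite sqr_sqrtr// addr_ge0 ?sqr_ge0. Qed.

Lemma cmod_norm x : (cmod x)%:C%C = `|x|.
Proof. by []. Qed.

Lemma cmod_ge0 x : 0 <= cmod x.
Proof. by case: x => a b /=; rewrite sqrtr_ge0. Qed.
#[local] Hint Extern 0 (is_true (0 <= cmod _)) => exact: cmod_ge0 : core.

Lemma cmod0 : cmod (0 : R[i]) = 0.
Proof. exact: ComplexField.Normc.normc0. Qed.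

Lemma cmod1 : cmod (1 : R[i]) = 1.
Proof. exact: ComplexField.Normc.normc1. Qed.

Lemma cmodM x y : cmod (x * y) = cmod x * cmod y.
Proof. exact: ComplexField.Normc.normcM. Qed.

Lemma cmodV x : cmod x^-1 = (cmod x)^-1.
Proof. exact: ComplexField.Normc.normcV. Qed.

Lemma cmodN x : cmod (- x) = cmod x.
Proof. exact: normcN. Qed.

Lemma cmodD x y : cmod (x + y) <= cmod x + cmod y.
Proof. exact: le_normcD. Qed.

Lemma cmodB x y : cmod (x - y) <= cmod x + cmod y.
Proof. by rewrite -(cmodN y); exact: cmodD. Qed.

Lemma cmodBC x y : cmod (x - y) = cmod (y - x).
Proof. by rewrite -cmodN opprB. Qed.

Lemma cmod_eq0 x : (cmod x == 0) = (x == 0).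
Proof.
by apply/eqP/eqP => [/ComplexField.Normc.eq0_normc//|->]; rewrite cmod0.
Qed.

Lemma cmod_gt0 x : (0 < cmod x) = (x != 0).
Proof. by rewrite lt_neqAle cmod_ge0 andbT eq_sym cmod_eq0. Qed.

Lemma cmodX x k : cmod (x ^+ k) = cmod x ^+ k.
Proof. by elim: k => [|k IH]; rewrite ?expr0 ?cmod1// !exprS cmodM IH. Qed.

Lemma cmodJ x : cmod (x^*%C) = cmod x.
Proof. by case: x => a b /=; rewrite sqrrN. Qed.

Lemma cmodr a : cmod (a%:C%C) = `|a|.
Proof. by rewrite /= expr0n addr0 sqrtr_sqr. Qed.

Lemma cmod_i : cmod ('i%C : R[i]) = 1.
Proof. by rewrite /= expr0n add0r expr1n sqrtr1. Qed.

Lemma cmod_sum I (r : seq I) (P : pred I) (F : I -> R[i]) :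
  cmod (\sum_(i <- r | P i) F i) <= \sum_(i <- r | P i) cmod (F i).
Proof.
elim/big_rec2: _ => [|i u v _ h]; first by rewrite cmod0.
by rewrite (le_trans (cmodD _ _))// lerD2l.
Qed.

Lemma normr_cRe x : `|cRe x| <= cmod x.
Proof.
rewrite -(@ler_sqr _ `|cRe x|) ?nnegrE ?cmod_ge0//.
by rewrite cmodE -normrX ger0_norm ?sqr_ge0// lerDl sqr_ge0.
Qed.

Lemma normr_cIm x : `|cIm x| <= cmod x.
Proof.
rewrite -(@ler_sqr _ `|cIm x|) ?nnegrE ?cmod_ge0//.
by rewrite cmodE -normrX ger0_norm ?sqr_ge0// lerDr sqr_ge0.
Qed.

Lemma cRe_le_cmod x : cRe x <= cmod x.
Proof. exact: le_trans (ler_norm _) (normr_cRe x). Qed.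

Lemma cmod_leRI x : cmod x <= `|cRe x| + `|cIm x|.
Proof.
rewrite -(@ler_sqr _ (cmod x)) ?nnegrE ?cmod_ge0 ?addr_ge0//.
rewrite cmodE sqrrD -2!normrX !(ger0_norm (sqr_ge0 _)).
by rewrite lerD2r lerDl mulrn_wge0// mulr_ge0.
Qed.

Lemma cReD x y : cRe (x + y) = cRe x + cRe y.
Proof. by case: x y => [a b] [c d]. Qed.

Lemma cImD x y : cIm (x + y) = cIm x + cIm y.
Proof. by case: x y => [a b] [c d]. Qed.

Lemma cReN x : cRe (- x) = - cRe x. Proof. by case: x. Qed.

Lemma cImN x : cIm (- x) = - cIm x. Proof. by case: x. Qed.

Lemma cReB x y : cRe (x - y) = cRe x - cRe y.
Proof. by rewrite cReD cReN. Qed.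

Lemma cImB x y : cIm (x - y) = cIm x - cIm y.
Proof. by rewrite cImD cImN. Qed.

Lemma cReM x y : cRe (x * y) = cRe x * cRe y - cIm x * cIm y.
Proof. by case: x y => [a b] [c d]. Qed.

Lemma cImM x y : cIm (x * y) = cRe x * cIm y + cIm x * cRe y.
Proof. by case: x y => [a b] [c d]. Qed.

Lemma cRe_sum I (r : seq I) (P : pred I) (F : I -> R[i]) :
  cRe (\sum_(i <- r | P i) F i) = \sum_(i <- r | P i) cRe (F i).
Proof. by elim/big_rec2: _ => // i u v _ <-; rewrite cReD. Qed.

Lemma cIm_sum I (r : seq I) (P : pred I) (F : I -> R[i]) :
  cIm (\sum_(i <- r | P i) F i) = \sum_(i <- r | P i) cIm (F i).
Proof. by elim/big_rec2: _ => // i u v _ <-; rewrite cImD. Qed.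

Lemma cReJ x : cRe (x^*%C) = cRe x. Proof. by case: x. Qed.

Lemma cImJ x : cIm (x^*%C) = - cIm x. Proof. by case: x. Qed.

Lemma complex_ext x y : cRe x = cRe y -> cIm x = cIm y -> x = y.
Proof. by case: x y => [a b] [c d] /= -> ->. Qed.

Lemma mulcJ x : x * x^*%C = (cmod x ^+ 2)%:C%C.
Proof.
apply: complex_ext; rewrite ?cReM ?cImM cReJ cImJ/=.
  by rewrite cmodE mulrN opprK.
by rewrite mulrN addrC mulrC subrr.
Qed.

Lemma conjcB x y : (x - y)^*%C = x^*%C - y^*%C.
Proof. exact: rmorphB. Qed.

Lemma conjcD x y : (x + y)^*%C = x^*%C + y^*%C.
Proof. exact: rmorphD. Qed.

Lemma conjcM x y : (x * y)^*%C = x^*%C * y^*%C.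
Proof. exact: rmorphM. Qed.

Lemma conjcX x k : (x ^+ k)^*%C = x^*%C ^+ k.
Proof. exact: rmorphXn. Qed.

Lemma conjc_sum I (r : seq I) (P : pred I) (F : I -> R[i]) :
  (\sum_(i <- r | P i) F i)^*%C = \sum_(i <- r | P i) (F i)^*%C.
Proof. exact: rmorph_sum. Qed.

End complex_modulus.
#[global] Hint Extern 0 (is_true (0 <= cmod _)) => exact: cmod_ge0 : core.

Lemma le_eps {R : realType} (x y : R) : (forall e : R, 0 < e -> x <= y + e) -> x <= y.
Proof. by move=> h; apply/ler_addgt0Pr. Qed.

Section null_sequences.
Context {R : realType}.
Implicit Types u v : nat -> R.

(* Only meant for sequences of nonnegative numbers. *)
Definition null_seq u := forall e : R, 0 < e ->
  exists N, forall m, (N <= m)%N -> u m < e.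

Lemma null_seq_le u v : (forall m, u m <= v m) -> null_seq v -> null_seq u.
Proof.
move=> uv v0 e e0; have [N hN] := v0 _ e0.
by exists N => m /hN; exact: le_lt_trans.
Qed.

Lemma null_seqD u v : null_seq u -> null_seq v -> null_seq (fun m => u m + v m).
Proof.
move=> u0 v0 e e0; have e20 : 0 < e / 2 by rewrite divr_gt0.
have [N hN] := u0 _ e20; have [M hM] := v0 _ e20.
exists (maxn N M) => m; rewrite geq_max => /andP[/hN h1 /hM h2].
by rewrite (splitr e) ltrD.
Qed.

Lemma null_seqZ u (a : R) : 0 <= a -> null_seq u -> null_seq (fun m => a * u m).
Proof.
move=> a0 u0 e e0; have a10 : 0 < a + 1 by rewrite ltr_wpDl.
have [N hN] := u0 _ (divr_gt0 e0 a10).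
exists N => m /hN; rewrite ltr_pdivlMr// => h.
have [um0|um0] := leP (u m) 0.
  by apply: le_lt_trans e0; rewrite mulr_ge0_le0.
by apply: le_lt_trans h; rewrite mulrC ler_wpM2l ?(ltW um0)// lerDl.
Qed.

Lemma null_seq_sum I (r : seq I) (F : I -> nat -> R) :
  (forall i, null_seq (F i)) -> null_seq (fun m => \sum_(i <- r) F i m).
Proof.
move=> F0; elim: r => [|i r IH].
  by move=> e e0; exists 0%N => m _; rewrite big_nil.
by apply: null_seq_le (null_seqD (F0 i) IH) => m; rewrite big_cons.
Qed.

Lemma null_seq_sub u (s : nat -> nat) : {homo s : i j / (i < j)%N} ->
  null_seq u -> null_seq (u \o s).
Proof.
move=> hs u0 e e0; have [N hN] := u0 _ e0; exists N => m Nm.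
apply: hN; apply: leq_trans Nm _; elim: m => // m IH.
by apply: leq_ltn_trans IH _; exact: hs.
Qed.

Lemma null_seq_le0 (a : R) : null_seq (fun=> a) -> a <= 0.
Proof.
move=> h; rewrite leNgt; apply/negP => a0.
by have [N /(_ N (leqnn _))] := h _ a0; rewrite ltxx.
Qed.

Lemma null_seq_inv : null_seq (fun m => m.+1%:R^-1).
Proof.
move=> e e0; exists (Num.truncn e^-1) => m hm.
rewrite invf_plt ?posrE ?ltr0n//.
by apply: lt_le_trans (truncnS_gt _) _; rewrite ler_nat ltnS.
Qed.

Lemma not_null_seq u : (forall m, 0 <= u m) -> ~ null_seq u ->
  exists2 e : R, 0 < e & exists2 s : nat -> nat,
    {homo s : i j / (i < j)%N} & forall m, e <= u (s m).
Proof.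
move=> _ /existsNP[e /not_implyP[e0 /forallNP hN]]; exists e => //.
have {}hN : forall N, exists m, (N <= m)%N /\ e <= u m.
  move=> N; have /existsNP[m /not_implyP[Nm /negP]] := hN N.
  by rewrite -leNgt; exists m.
pose f N := projT1 (cid (hN N)).
have fP N : (N <= f N)%N /\ e <= u (f N) by rewrite /f; case: cid.
exists (fun m => iter m (fun k => f k.+1) (f 0)).
  apply: homo_ltn => [i j k|i]; first exact: ltn_trans.
  by rewrite iterS; have [] := fP (iter i (fun k => f k.+1) (f 0)).+1.
by case=> [|m]; rewrite ?iterS; [have [] := fP 0|
  have [] := fP (iter m (fun k => f k.+1) (f 0)).+1].
Qed.

Lemma geometric_null (a q : R) : 0 <= a -> 0 <= q -> q < 1 ->
  null_seq (fun m => a * q ^+ m).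
Proof.
move=> a0 q0 q1; apply: null_seqZ => // e e0.
have : (fun m => q ^+ m) @ \oo --> (0 : R) by apply: cvg_expr; rewrite ger0_norm.
move/cvgrPdist_lt => /(_ _ e0)[N _ hN]; exists N => m /hN /=.
by rewrite sub0r normrN ger0_norm// exprn_ge0.
Qed.

End null_sequences.

Section ultrafilter_limits.
Context {R : realType} (U : set_system nat) {UU : UltraFilter U}.

Definition ulim_to (u : nat -> R[i]) (l : R[i]) :=
  forall e : R, 0 < e -> U [set m | cmod (u m - l) < e].

(** The limit is the supremum of the [t] that lie below [u] on a set of [U]. The upper estimate uses
    that a set or its complement belongs to [U]. *)
Lemma ulim_real (u : nat -> R) (M : R) : (forall m, `|u m| <= M) ->
  exists l, forall e : R, 0 < e -> U [set m | `|u m - l| < e].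
Proof.
move=> uM; pose E := [set t : R | U [set m | t <= u m]].
have EM : E (- M).
  apply: filterS filterT => m _ /=.
  by have := uM m; rewrite ler_norml => /andP[].
have Eub : ubound E M.
  move=> t Et; rewrite leNgt; apply/negP => Mt.
  have [m /=] := filter_ex Et; apply/negP; rewrite -ltNge.
  exact: le_lt_trans (ler_norm _) (le_lt_trans (uM m) Mt).
have supE : has_sup E by split; [exists (- M)|exists M].
exists (sup E) => e e0.
have [t Et ht] := sup_adherent e0 supE.
have [U1|U1] := in_ultra_setVsetC [set m | sup E + e / 2 <= u m] UU.
  have := ub_le_sup (proj2 supE) U1; rewrite leNgt ltrDl.
  by rewrite divr_gt0.
apply: filterS (filterI Et U1) => m /= [h1 /negP]; rewrite -ltNge => h2.
rewrite ltr_distl; apply/andP; split; first exact: lt_le_trans h1.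
by rewrite (lt_trans h2)// ltrD2l; lra.
Qed.

Lemma ulim_ex (u : nat -> R[i]) (M : R) : (forall m, cmod (u m) <= M) ->
  exists l, ulim_to u l.
Proof.
move=> uM.
have [a ha] := @ulim_real (fun m => cRe (u m)) M
  (fun m => le_trans (normr_cRe _) (uM m)).
have [b hb] := @ulim_real (fun m => cIm (u m)) M
  (fun m => le_trans (normr_cIm _) (uM m)).
exists (a +i* b)%C => e e0; have e20 : 0 < e / 2 by rewrite divr_gt0.
apply: filterS (filterI (ha _ e20) (hb _ e20)) => m /= [h1 h2].
by rewrite (le_lt_trans (cmod_leRI _))// cReB cImB/= (splitr e) ltrD.
Qed.

Lemma ulim_unique u (l l' : R[i]) : ulim_to u l -> ulim_to u l' -> l = l'.
Proof.
move=> h h'; apply/eqP; rewrite -subr_eq0 -cmod_eq0 eq_le cmod_ge0 andbT.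
apply/ler_addgt0Pr => e e0; rewrite add0r.
have e20 : 0 < e / 2 by rewrite divr_gt0.
have [m [/= h1 h2]] := filter_ex (filterI (h _ e20) (h' _ e20)).
rewrite (_ : l - l' = (u m - l') - (u m - l)); last by ring.
by rewrite (le_trans (cmodB _ _))// (splitr e) lerD// ltW.
Qed.

Lemma ulim_le u (l : R[i]) (M : R) : ulim_to u l -> (forall m, cmod (u m) <= M) ->
  cmod l <= M.
Proof.
move=> h uM; apply/ler_addgt0Pr => e e0.
have [m /= h1] := filter_ex (h _ e0).
rewrite (_ : l = u m - (u m - l)); last by ring.
by rewrite (le_trans (cmodB _ _))// lerD// ltW.
Qed.

Lemma ulimD u v (a b : R[i]) (c : R[i]) : ulim_to u a -> ulim_to v b ->
  ulim_to (fun m => c * u m + v m) (c * a + b).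
Proof.
move=> ha hb e e0; have e20 : 0 < e / 2 by rewrite divr_gt0.
have c0 : 0 < cmod c + 1 by rewrite ltr_wpDl.
apply: filterS (filterI (ha _ (divr_gt0 e20 c0)) (hb _ e20)) => m /= [h1 h2].
rewrite (_ : _ - _ = c * (u m - a) + (v m - b)); last by ring.
rewrite (le_lt_trans (cmodD _ _))// cmodM (splitr e) ltr_leD ?(ltW h2)//.
move: h1; rewrite ltr_pdivlMr// => h1; apply: le_lt_trans h1.
by rewrite mulrDr mulr1 mulrC lerDl cmod_ge0.
Qed.

Lemma ulimJ u (l : R[i]) : ulim_to u l ->
  ulim_to (fun m => (u m)^*%C) (l^*%C).
Proof. by move=> h e /h; apply: filterS => m /=; rewrite -conjcB cmodJ. Qed.

Lemma ulim_null u : \oo `<=` U -> null_seq (fun m => cmod (u m)) ->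
  ulim_to u 0.
Proof.
move=> oU u0 e e0; have [N hN] := u0 _ e0.
by apply: oU; exists N => // m /= /hN; rewrite subr0.
Qed.

End ultrafilter_limits.

(** Limits along such a [U] exist for all bounded sequences and agree with ordinary limits whenever
    these exist. *)
Lemma ultra_oo : exists U : set_system nat, UltraFilter U /\ \oo `<=` U.
Proof. exact: ultraFilterLemma. Qed.

(* A single ultrafilter provides the limits of all the columns at once, so that
   no nested extraction of subsequences is needed. *)
Lemma diagonal_extraction {R : realType} (x : nat -> nat -> R[i]) (M : nat -> R) :
  (forall m a, cmod (x m a) <= M a) ->
  exists2 s : nat -> nat, {homo s : i j / (i < j)%N} &
    forall a, exists l, null_seq (fun m => cmod (x (s m) a - l)).
Proof.
move=> xM; have [U [UU oU]] := ultra_oo.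
have /choice[l hl] : forall a, exists l, ulim_to U (fun m => x m a) l.
  by move=> a; apply: ulim_ex => m; exact: xM.
(* Stage [k] imposes finitely many conditions, on the columns below [k] with precision
   [1 / (k + 1)], so the good indices form a set of [U]. *)
pose good k m := forall a, (a < k)%N -> cmod (x m a - l a) < k.+1%:R^-1.
have ex N k : exists m, (N < m)%N /\ good k m.
  have : U ([set m | (N < m)%N] `&` [set m | good k m]).
    apply: filterI; first by apply: oU; exists N.+1.
    have e0 : 0 < (k.+1%:R^-1 : R) by rewrite invr_gt0.
    suff : forall j, U [set m | forall a, (a < j)%N ->
        cmod (x m a - l a) < k.+1%:R^-1] by exact.
    elim=> [|j IH]; first exact: filterS filterT.
    apply: filterS (filterI IH (hl j _ e0)) => m /= [h1 h2] a.
    by rewrite ltnS leq_eqVlt => /orP[/eqP->//|]; exact: h1.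
  by move/filter_ex => [m []]; exists m.
pose f N k := projT1 (cid (ex N k)).
have fP N k : (N < f N k)%N /\ good k (f N k) by rewrite /f; case: cid.
pose s := fix s m := if m is k.+1 then f (s k) k.+1 else f 0%N 0%N.
exists s.
  apply: homo_ltn => [i j k|i]; first exact: ltn_trans.
  by have [] := fP (s i) i.+1.
move=> a; exists (l a) => e e0; have [N hN] := null_seq_inv e0.
exists (maxn N a.+1) => -[|m]; rewrite geq_max => /andP[Nm am]//.
apply: lt_trans (hN m.+1 Nm).
by have [_ /(_ a)] := fP (s m) m.+1; apply.
Qed.

(** * Hilbert spaces and compact operators *)

Section hilbert.
Context {R : realType} {V : lmodType R[i]}.
Implicit Types (H : hspace V) (f g h : V) (a : R[i]).

(** The form is only positive semidefinite: the elements of [L2] below are functions rather than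
    classes, and one of norm 0 need not vanish. *)
Record prehilbert (H : hspace V) : Prop := Prehilbert {
  ph0 : H 0 ;
  phL : forall a f g, H f -> H g -> H (a *: f + g) ;
  ph_ipL : forall a f g h, H f -> H g -> H h ->
    hip H (a *: f + g) h = a * hip H f h + hip H g h ;
  ph_ipC : forall f g, H f -> H g -> hip H g f = (hip H f g)^*%C ;
  ph_ge0 : forall f, H f -> 0 <= cRe (hip H f f) }.

Definition hdefinite H := forall f, H f -> hnorm H f = 0 -> f = 0.

Section prehilbert_theory.
Context {H : hspace V} (HH : prehilbert H).
Local Notation "<< f , g >>" := (hip H f g).
Local Notation nrm := (hnorm H).

Lemma hD f g : H f -> H g -> H (f + g).
Proof. by move=> hf hg; rewrite -[f]scale1r; exact: phL. Qed.

Lemma hZ a f : H f -> H (a *: f).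
Proof. by move=> hf; rewrite -[_ *: _]addr0; apply: phL => //; exact: ph0. Qed.

Lemma hN f : H f -> H (- f).
Proof. by rewrite -scaleN1r; exact: hZ. Qed.

Lemma hsubr f g : H f -> H g -> H (f - g).
Proof. by move=> hf hg; apply: hD => //; exact: hN. Qed.

Lemma hsum I (r : seq I) (P : pred I) (F : I -> V) :
  (forall i, P i -> H (F i)) -> H (\sum_(i <- r | P i) F i).
Proof.
by move=> hF; elim/big_rec: _ => [|i x Pi]; [exact: ph0|apply: hD; exact: hF].
Qed.

Lemma hipDl f g h : H f -> H g -> H h -> <<f + g, h>> = <<f, h>> + <<g, h>>.
Proof. by move=> *; rewrite -{1}[f]scale1r ph_ipL// mul1r. Qed.

Lemma hip0l h : H h -> <<0, h>> = 0.
Proof.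
move=> hh; have := hipDl (ph0 HH) (ph0 HH) hh.
by rewrite addr0 => /eqP; rewrite -subr_eq0 opprD addNKr oppr_eq0 => /eqP.
Qed.

Lemma hipZl a f h : H f -> H h -> <<a *: f, h>> = a * <<f, h>>.
Proof.
move=> hf hh; rewrite -[_ *: _]addr0 ph_ipL ?hip0l ?addr0//; exact: ph0.
Qed.

Lemma hipNl f h : H f -> H h -> <<- f, h>> = - <<f, h>>.
Proof. by move=> *; rewrite -scaleN1r hipZl// mulN1r. Qed.

Lemma hipBl f g h : H f -> H g -> H h -> <<f - g, h>> = <<f, h>> - <<g, h>>.
Proof. by move=> *; rewrite hipDl ?hipNl//; exact: hN. Qed.

Lemma hipC f g : H f -> H g -> <<g, f>> = (<<f, g>>)^*%C.
Proof. exact: ph_ipC. Qed.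

Lemma hipDr f g h : H f -> H g -> H h -> <<h, f + g>> = <<h, f>> + <<h, g>>.
Proof.
move=> hf hg hh; rewrite hipC ?hipDl ?conjcD//; last exact: hD.
by rewrite -!hipC.
Qed.

Lemma hipZr a f h : H f -> H h -> <<h, a *: f>> = a^*%C * <<h, f>>.
Proof. by move=> hf hh; rewrite hipC ?hipZl ?conjcM -?hipC//; exact: hZ. Qed.

Lemma hip0r h : H h -> <<h, 0>> = 0.
Proof. by move=> hh; rewrite hipC ?hip0l ?conjc0//; exact: ph0. Qed.

Lemma hipNr f h : H f -> H h -> <<h, - f>> = - <<h, f>>.
Proof. by move=> hf hh; rewrite -scaleN1r hipZr// rmorphN rmorph1 mulN1r. Qed.

Lemma hipBr f g h : H f -> H g -> H h -> <<h, f - g>> = <<h, f>> - <<h, g>>.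
Proof. by move=> *; rewrite hipDr ?hipNr//; exact: hN. Qed.

Lemma hip_suml I (r : seq I) (P : pred I) (F : I -> V) h :
  (forall i, P i -> H (F i)) -> H h ->
  <<\sum_(i <- r | P i) F i, h>> = \sum_(i <- r | P i) <<F i, h>>.
Proof.
move=> hF hh; elim: r => [|i r IH]; first by rewrite !big_nil hip0l.
rewrite !big_cons; case: ifP => // Pi; rewrite hipDl ?IH//; first exact: hF.
exact: hsum.
Qed.

Lemma hip_sumr I (r : seq I) (P : pred I) (F : I -> V) h :
  (forall i, P i -> H (F i)) -> H h ->
  <<h, \sum_(i <- r | P i) F i>> = \sum_(i <- r | P i) <<h, F i>>.
Proof.
move=> hF hh; rewrite hipC ?hip_suml// ?conjc_sum; last exact: hsum.
by apply: eq_bigr => i Pi; rewrite -hipC//; exact: hF.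
Qed.

Lemma hnorm_ge0 f : 0 <= (nrm f).
Proof. exact: sqrtr_ge0. Qed.
Hint Extern 0 (is_true (0 <= hnorm _ _)) => exact: hnorm_ge0 : core.

Lemma hnorm2 f : H f -> (nrm f) ^+ 2 = cRe <<f, f>>.
Proof. by move=> hf; rewrite sqr_sqrtr//; exact: ph_ge0. Qed.

Lemma hipff f : H f -> <<f, f>> = ((nrm f) ^+ 2)%:C%C.
Proof.
move=> hf; apply: complex_ext; rewrite /= ?hnorm2//.
have := congr1 (fun x => cIm x) (hipC hf hf); rewrite cImJ => h; lra.
Qed.

Lemma hnormZ a f : H f -> (nrm (a *: f)) = cmod a * (nrm f).
Proof.
move=> hf; apply/eqP; rewrite -(@eqrXn2 _ 2) ?mulr_ge0 ?cmod_ge0//.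
rewrite exprMn !hnorm2 ?hipZl ?hipZr//; try exact: hZ.
by rewrite mulrA mulcJ hipff// -rmorphM/=.
Qed.

Lemma hnorm0 : (nrm 0) = 0.
Proof. by rewrite /hnorm hip0l ?sqrtr0//; exact: ph0. Qed.

Lemma hnormN f : H f -> (nrm (- f)) = (nrm f).
Proof. by move=> hf; rewrite -scaleN1r hnormZ// cmodN cmod1 mul1r. Qed.

Lemma hnormD2 f g : H f -> H g ->
  (nrm (f + g)) ^+ 2 = (nrm f) ^+ 2 + 2 * cRe <<f, g>> + (nrm g) ^+ 2.
Proof.
move=> hf hg; rewrite !hnorm2//; last exact: hD.
rewrite hipDl ?hipDr//; last exact: hD.
by rewrite !cReD (hipC hf hg) cReJ; ring.
Qed.

Lemma hnormB2 f g : H f -> H g ->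
  (nrm (f - g)) ^+ 2 = (nrm f) ^+ 2 - 2 * cRe <<f, g>> + (nrm g) ^+ 2.
Proof.
move=> hf hg; rewrite hnormD2 ?hipNr ?hnormN ?cReN//; last exact: hN.
by ring.
Qed.

Lemma hnormBC f g : H f -> H g -> (nrm (f - g)) = (nrm (g - f)).
Proof. by move=> hf hg; rewrite -hnormN ?opprB//; exact: hsubr. Qed.

Lemma cauchy_schwarz f g : H f -> H g -> cmod <<f, g>> <= (nrm f) * (nrm g).
Proof.
move=> hf hg; rewrite -(@ler_sqr _ (cmod _)) ?nnegrE ?mulr_ge0// exprMn.
have key (t : R) : 0 <= (nrm f) ^+ 2 - 2 * t * cmod <<f, g>> ^+ 2
    + t ^+ 2 * cmod <<f, g>> ^+ 2 * (nrm g) ^+ 2.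
  have := sqr_ge0 (nrm (f - (t%:C%C * <<f, g>>) *: g)).
  rewrite hnormB2//; last exact: hZ.
  rewrite hipZr// conjcM conjc_real -mulrA (mulrC _^*%C) mulcJ hnormZ//.
  by rewrite !exprMn cmodM cmodr exprMn real_normK ?num_real// -rmorphM/= mulrA.
set b := cmod _ ^+ 2 in key *; have b0 : 0 <= b by exact: sqr_ge0.
have [g0|g0] := eqVneq ((nrm g) ^+ 2) 0.
  rewrite g0 mulr0 leNgt; apply/negP => bpos.
  (* When [|g| = 0] the quadratic expression is linear in [t], and this [t] makes it negative. *)
  have := key (((nrm f) ^+ 2 + 1) / b); rewrite g0 mulr0 addr0.
  rewrite -mulrA divfK ?gt_eqF//; have := sqr_ge0 (nrm f); lra.
have {}g0 : 0 < (nrm g) ^+ 2 by rewrite lt_neqAle eq_sym g0 sqr_ge0.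
have := key ((nrm g) ^+ 2)^-1.
rewrite (_ : _ + _ = (nrm f) ^+ 2 - ((nrm g) ^+ 2)^-1 * b); last first.
  by field; rewrite -sqrf_eq0 gt_eqF.
by rewrite subr_ge0 mulrC ler_pdivrMr.
Qed.

Lemma hnormD f g : H f -> H g -> (nrm (f + g)) <= (nrm f) + (nrm g).
Proof.
move=> hf hg; rewrite -(@ler_sqr _ (nrm (f + g))) ?nnegrE ?addr_ge0//.
rewrite hnormD2// sqrrD lerD2r lerD2l mulr2n; have -> (x : R) : 2 * x = x + x by ring.
suff h : cRe <<f, g>> <= nrm f * nrm g by exact: lerD.
exact: le_trans (cRe_le_cmod _) (cauchy_schwarz hf hg).
Qed.

Lemma hnormB f g : H f -> H g -> (nrm (f - g)) <= (nrm f) + (nrm g).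
Proof. by move=> hf hg; rewrite -(hnormN hg) hnormD//; exact: hN. Qed.

Lemma hnorm_tri g f h : H f -> H g -> H h ->
  (nrm (f - h)) <= (nrm (f - g)) + (nrm (g - h)).
Proof.
by move=> hf hg hh; rewrite -[f - h](subrKA g); apply: hnormD; exact: hsubr.
Qed.

Lemma hnorm_sum I (r : seq I) (P : pred I) (F : I -> V) :
  (forall i, P i -> H (F i)) ->
  (nrm (\sum_(i <- r | P i) F i)) <= \sum_(i <- r | P i) (nrm (F i)).
Proof.
move=> hF; elim: r => [|i r IH]; first by rewrite !big_nil hnorm0.
rewrite !big_cons; case: ifP => // Pi.
rewrite (le_trans (hnormD _ _)) ?lerD2l//; [exact: hF|exact: hsum].
Qed.

Lemma hip_norm0 f g : H f -> H g -> (nrm f) = 0 -> <<f, g>> = 0.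
Proof.
move=> hf hg f0; apply/eqP; rewrite -cmod_eq0 eq_le cmod_ge0 andbT.
by rewrite (le_trans (cauchy_schwarz hf hg))// f0 mul0r.
Qed.

Lemma hcvgP (f : nat -> V) g :
  hcvg H f g <-> null_seq (fun m => (nrm (f m - g))).
Proof.
split=> [/cvgrPdist_lt fg e e0|fg].
  have [N _ hN] := fg _ e0; exists N => m /hN /=.
  by rewrite sub0r normrN ger0_norm.
apply/cvgrPdist_lt => e e0; have [N hN] := fg _ e0; exists N => // m /hN.
by rewrite sub0r normrN ger0_norm.
Qed.

Lemma hip_bound_le f (M : R) : H f -> 0 <= M ->
  (forall g, H g -> cmod <<f, g>> <= M * (nrm g)) -> (nrm f) <= M.
Proof.
move=> hf M0 h; have [f0|f0] := eqVneq (nrm f) 0; first by rewrite f0.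
have {}f0 : 0 < (nrm f) by rewrite lt_neqAle eq_sym f0 /=.
have := h f hf; rewrite hipff// cmodr ger0_norm ?sqr_ge0// expr2.
by rewrite ler_pM2r.
Qed.

Lemma bounded_op0 T : bounded_op H T -> T 0 = 0.
Proof.
case=> _ lin _; have := lin 1 0 0 (ph0 HH) (ph0 HH).
by rewrite !scale1r addr0 => /eqP; rewrite -subr_eq0 opprD addNKr oppr_eq0 => /eqP.
Qed.

Lemma bounded_opD T f g : bounded_op H T -> H f -> H g -> T (f + g) = T f + T g.
Proof. by case=> _ lin _ hf hg; rewrite -{1}[f]scale1r lin// scale1r. Qed.

Lemma bounded_opZ T a f : bounded_op H T -> H f -> T (a *: f) = a *: T f.
Proof.
move=> bT hf; have T0 := bounded_op0 bT; case: bT => _ lin _.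
by rewrite -[a *: f]addr0 lin ?T0 ?addr0//; exact: ph0.
Qed.

Lemma bounded_opN T f : bounded_op H T -> H f -> T (- f) = - T f.
Proof. by move=> bT hf; rewrite -scaleN1r bounded_opZ// scaleN1r. Qed.

Lemma bounded_opB T f g : bounded_op H T -> H f -> H g -> T (f - g) = T f - T g.
Proof.
by move=> bT hf hg; rewrite (bounded_opD bT) ?(bounded_opN bT)//; exact: hN.
Qed.

Lemma bounded_op_sum T I (r : seq I) (P : pred I) (F : I -> V) :
  bounded_op H T -> (forall i, P i -> H (F i)) ->
  T (\sum_(i <- r | P i) F i) = \sum_(i <- r | P i) T (F i).
Proof.
move=> bT hF; elim: r => [|i r IH]; first by rewrite !big_nil bounded_op0.
rewrite !big_cons; case: ifP => // Pi.
by rewrite (bounded_opD bT) ?IH//; [exact: hF|exact: hsum].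
Qed.

Lemma bounded_op_bound T : bounded_op H T ->
  exists2 M : R, 0 < M & forall f, H f -> (nrm (T f)) <= M * (nrm f).
Proof.
case=> _ _ [M hM]; exists (`|M| + 1); first by rewrite ltr_wpDl.
move=> f hf; apply: le_trans (hM f hf) _; rewrite ler_wpM2r//.
by rewrite (le_trans (ler_norm _))// lerDl.
Qed.

Lemma bounded_op_comp S T : bounded_op H S -> bounded_op H T ->
  bounded_op H (S \o T).
Proof.
move=> bS bT; have [M M0 hM] := bounded_op_bound bS.
have [N N0 hN] := bounded_op_bound bT.
case: bS => S1 S2 _; case: bT => T1 T2 _; split => [f hf|a f g hf hg|].
- exact/S1/T1.
- by rewrite /= T2// S2//; exact: T1.
- exists (M * N) => f hf /=; apply: le_trans (hM _ (T1 _ hf)) _.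
  by rewrite -mulrA ler_wpM2l ?(ltW M0) ?hN.
Qed.

Lemma bounded_op_lin a S T : bounded_op H S -> bounded_op H T ->
  bounded_op H (fun f => a *: S f + T f).
Proof.
move=> bS bT; have [M M0 hM] := bounded_op_bound bS.
have [N N0 hN] := bounded_op_bound bT.
case: bS => S1 S2 _; case: bT => T1 T2 _; split => [f hf|b f g hf hg|].
- by apply: phL => //; [exact: S1|exact: T1].
- rewrite S2// T2// !scalerDr !scalerA (mulrC a b) -!addrA; congr (_ + _).
  by rewrite addrCA.
- exists (cmod a * M + N) => f hf; rewrite mulrDl.
  apply: le_trans (hnormD (hZ _ (S1 _ hf)) (T1 _ hf)) _.
  rewrite lerD ?hN// hnormZ; last exact: S1.
  by rewrite -mulrA ler_wpM2l ?cmod_ge0 ?hM.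
Qed.

End prehilbert_theory.
#[local] Hint Extern 0 (is_true (0 <= hnorm _ _)) => exact: hnorm_ge0 : core.

(* A minimizing sequence of [|f|^2 - 2 Re (l f)] is Cauchy by the parallelogram
   law, and its limit represents [l]. *)
Lemma riesz H (HH : prehilbert H) (cH : hcomplete H) (l : V -> R[i]) (M : R) :
  (forall a f g, H f -> H g -> l (a *: f + g) = a * l f + l g) ->
  (forall f, H f -> cmod (l f) <= M * hnorm H f) ->
  exists2 g, H g & forall f, H f -> l f = hip H f g.
Proof.
move=> lin bl.
have lD f g : H f -> H g -> l (f + g) = l f + l g.
  by move=> hf hg; rewrite -{1}[f]scale1r lin// mul1r.
have l0 : l 0 = 0.
  have := lD _ _ (ph0 HH) (ph0 HH).
  by rewrite addr0 => /eqP; rewrite -subr_eq0 opprD addNKr oppr_eq0 => /eqP.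
have lZ a f : H f -> l (a *: f) = a * l f.
  by move=> hf; rewrite -[a *: f]addr0 lin ?l0 ?addr0//; exact: ph0.
pose J f := hnorm H f ^+ 2 - 2 * cRe (l f).
have Jlb f : H f -> - M ^+ 2 <= J f.
  move=> hf; have := bl f hf; have := cRe_le_cmod (l f).
  have := sqr_ge0 (hnorm H f - M); rewrite /J !expr2; nra.
pose E := [set J f | f in [set f | H f]].
have infE : has_inf E.
  split; first by exists (J 0), 0 => //; exact: ph0.
  by exists (- M ^+ 2) => _ [f hf <-]; exact: Jlb.
have /choice[x xP] : forall m : nat, exists f, H f /\ J f < inf E + m.+1%:R^-1.
  move=> m; have [|_ [f hf <-] ?] := @inf_adherent _ E (m.+1%:R^-1) _ infE.
    by rewrite invr_gt0.
  by exists f.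
have xH m : H (x m) by have [] := xP m.
have Jinf f : H f -> inf E <= J f.
  by move=> hf; apply: ge_inf => //; [exact: (proj2 infE)|exists f].
have xC (m p : nat) :
    hnorm H (x m - x p) ^+ 2 <= 2 * (m.+1%:R^-1 + p.+1%:R^-1).
  have [_ h1] := xP m; have [_ h2] := xP p.
  have hD' := hD HH (xH m) (xH p).
  have := Jinf _ (hZ HH (2^-1)%:C%C hD').
  rewrite /J in h1 h2 *; rewrite hnormZ// lZ// lD// exprMn cmodr.
  rewrite hnormB2// hnormD2// cReM cReD/= mul0r subr0.
  rewrite ger0_norm ?invr_ge0//.
  move: (hnorm H (x m) ^+ 2) (hnorm H (x p) ^+ 2) (cRe (hip H _ _)) h1 h2.
  move: (inf E) (m.+1%:R^-1) (p.+1%:R^-1) (cRe (l (x m))) (cRe (l (x p))).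
  by move=> i m' p' lm lp A1 A2 A3; rewrite expr2; lra.
have [|g hg] := cH x xH.
  move=> e e0; have e2 : 0 < e ^+ 2 / 4 by rewrite divr_gt0 ?exprn_gt0.
  have [N hN] := null_seq_inv e2; exists N => m p /hN h1 /hN h2.
  rewrite -(@ltr_sqr _ (hnorm _ _)) ?nnegrE ?hnorm_ge0 ?(ltW e0)//.
  apply: le_lt_trans (xC m p) _.
  by move: (m.+1%:R^-1) (p.+1%:R^-1) h1 h2 => a b h1 h2; lra.
move/hcvgP => xg; exists g => // h hh.
have Jg : J g <= inf E.
  apply/ler_addgt0Pr => /= e e0.
  (* [J g - J (x m)] is at most [A] times the distance [d] from [x m] to [g]. *)
  pose A := 2 * (hnorm H g + `|M| + 1).
  have A0 : 0 < A by rewrite mulr_gt0// ltr_wpDl ?addr_ge0 ?hnorm_ge0.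
  have e20 : 0 < e / 2 by rewrite divr_gt0.
  have [N1 hN1] := xg _ (divr_gt0 e20 A0).
  have [N2 hN2] := null_seq_inv e20.
  pose m := maxn N1 N2.
  have /hN1 : (N1 <= m)%N by rewrite leq_maxl.
  have /hN2 : (N2 <= m)%N by rewrite leq_maxr.
  have [_ xm] := xP m; set d := hnorm H (x m - g) => h2 h1.
  have hdl := bl _ (hsubr HH (xH m) hg); rewrite -/d in hdl.
  have hxg : l (x m) = l g + l (x m - g) by rewrite -lD ?subrKC//; exact: hsubr.
  have hxg2 : hnorm H (x m) ^+ 2 =
      hnorm H g ^+ 2 + 2 * cRe (hip H g (x m - g)) + d ^+ 2.
    by rewrite -hnormD2 ?subrKC//; exact: hsubr.
  have h3 := cauchy_schwarz HH hg (hsubr HH (xH m) hg); rewrite -/d in h3.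
  move: xm; rewrite /J hxg2 hxg cReD.
  have h4 := cRe_le_cmod (l (x m - g)).
  have h5 := normr_cRe (hip H g (x m - g)).
  have h6 : - `|cRe (hip H g (x m - g))| <= cRe (hip H g (x m - g)).
    by rewrite lerNl -normrN ler_norm.
  have h7 : d * A < e / 2 by rewrite -ltr_pdivlMr.
  have h8 : M * d <= `|M| * d by rewrite ler_wpM2r ?hnorm_ge0// ler_norm.
  have h9 : 0 <= d ^+ 2 by exact: sqr_ge0.
  move: h7; rewrite /A; have d0 : 0 <= d by exact: hnorm_ge0.
  by move: (m.+1%:R^-1) h2 => mi h2 h7 h10; lra.
(* Variation of the minimizer in the direction [t dlt^* h]: the term of first order in [t] is
   [- 2 t |dlt|^2], which would lower [J] unless [dlt = 0]. *)
pose dlt := l h - hip H h g.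
have key (t : R) : 0 < t -> 0 <= - (2 * cmod dlt ^+ 2) + t * (cmod dlt ^+ 2 * hnorm H h ^+ 2).
  move=> t0; pose a := t%:C%C * dlt^*%C.
  have := le_trans Jg (Jinf _ (hD HH hg (hZ HH a hh))).
  rewrite /J hnormD2 ?lD ?lZ//; try exact: hZ.
  rewrite hnormZ// hipZr// (hipC HH hh hg) -conjcM cReJ cReD exprMn.
  rewrite /a cmodM cmodr cmodJ exprMn real_normK ?num_real//.
  have -> : l h = hip H h g + dlt by rewrite /dlt subrKC.
  rewrite (mulrDr (t%:C%C * dlt^*%C)) cReD -!mulrA (mulrC _^*%C dlt) mulcJ -rmorphM/=.
  move=> h1.
  have {h1} : 0 <= t * (- (2 * cmod dlt ^+ 2) + t * (cmod dlt ^+ 2 * hnorm H h ^+ 2)).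
    by move: h1; rewrite !expr2; lra.
  by rewrite pmulr_rge0// !expr2 !mulrA.
apply/eqP; rewrite -subr_eq0 -/dlt -cmod_eq0 -sqrf_eq0 eq_le sqr_ge0 andbT.
rewrite leNgt; apply/negP => d0.
have c0 : 0 < hnorm H h ^+ 2 + 1 by rewrite ltr_wpDl ?sqr_ge0.
have tpos : 0 < (hnorm H h ^+ 2 + 1)^-1 by rewrite invr_gt0.
have := key _ tpos; rewrite mulrCA.
have h1 : (hnorm H h ^+ 2 + 1)^-1 * hnorm H h ^+ 2 <= 1.
  by rewrite mulrC ler_pdivrMr// mul1r lerDl.
nra.
Qed.

Lemma adjoint_ex H (HH : prehilbert H) (cH : hcomplete H) T : bounded_op H T ->
  exists2 S, (forall g, H g -> H (S g)) &
    forall f g, H f -> H g -> hip H (T f) g = hip H f (S g).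
Proof.
move=> bT; have [M M0 hM] := bounded_op_bound bT; case: bT => T1 T2 _.
have /choice[S hS] : forall g, exists Sg, H g -> H Sg /\
    forall f, H f -> hip H (T f) g = hip H f Sg.
  move=> g; have [hg|] := pselect (H g); last by exists 0.
  have [||Sg hSg SgE] := @riesz H HH cH (fun f => hip H (T f) g)
      (M * hnorm H g).
  - by move=> a f h hf hh; rewrite T2// ph_ipL//; exact: T1.
  - move=> f hf; apply: le_trans (cauchy_schwarz HH (T1 _ hf) hg) _.
    by rewrite mulrAC ler_wpM2r ?hnorm_ge0 ?hM.
  by exists Sg.
by exists S => [g /hS[]//|f g hf /hS[_]]; exact.
Qed.

Inductive hspan (X : set V) : V -> Prop :=
| hspan0 : hspan X 0
| hspanL a x f : X x -> hspan X f -> hspan X (a *: x + f).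

Lemma hspan_gen (X : set V) x : X x -> hspan X x.
Proof. by move=> Xx; rewrite -[x]addr0 -[x]scale1r; apply: hspanL => //; exact: hspan0. Qed.

Lemma hspan_lin (X : set V) a f g : hspan X f -> hspan X g -> hspan X (a *: f + g).
Proof.
move=> + hg; elim=> [|b x u Xx _ IH]; first by rewrite scaler0 add0r.
by rewrite scalerDr scalerA -addrA; exact: hspanL.
Qed.

End hilbert.
#[global] Hint Extern 0 (is_true (0 <= hnorm _ _)) => exact: hnorm_ge0 : core.

(** * Weakly null sequences, compactness and finite-rank approximation *)

Section completeness.
Context {R : realType} {V : lmodType R[i]} {H : hspace V} (HH : prehilbert H) (cH : hcomplete H).
Local Notation nrm := (hnorm H).

Lemma hspan_sub (X : set V) f : (forall x, X x -> H x) -> hspan X f -> H f.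
Proof. by move=> XH; elim=> [|a x u /XH hx _ hu]; [exact: ph0|exact: phL]. Qed.

(* The Riesz representation on the closure of [X] gives the orthogonal projection. *)
Lemma dense_total (X : set V) : (forall x, X x -> H x) ->
  (forall f, H f -> (forall x, X x -> hip H f x = 0) -> nrm f = 0) ->
  forall f (e : R), H f -> 0 < e -> exists2 x, hspan X x & nrm (f - x) < e.
Proof.
move=> XH Xtot f e hf e0.
pose cl := [set g | H g /\ forall d : R, 0 < d -> exists2 x, hspan X x & nrm (g - x) < d].
pose M := HSpace cl (hip H).
have Xcl x : hspan X x -> cl x.
  move=> Xx; split; first exact: hspan_sub XH Xx.
  by move=> d d0; exists x; rewrite ?subrr ?(hnorm0 HH).
have HM : prehilbert M.
  split; [| |by move=> a u v h [hu _] [hv _] [hh _]; exact: (ph_ipL HH)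
           |by move=> u v [hu _] [hv _]; exact: (ph_ipC HH)
           |by move=> u [hu _]; exact: (ph_ge0 HH)].
    by apply: Xcl; exact: hspan0.
  move=> a g h [hg g1] [hh h1]; split; first exact: phL.
  move=> d d0; have a0 : 0 < cmod a + 1 by rewrite ltr_wpDl ?cmod_ge0.
  have d20 : 0 < d / 2 by rewrite divr_gt0.
  have [x Xx gx] := g1 _ (divr_gt0 d20 a0); have [y Xy hy] := h1 _ d20.
  exists (a *: x + y); first exact: hspan_lin.
  have hx := hspan_sub XH Xx; have hy' := hspan_sub XH Xy.
  rewrite opprD addrACA -scalerBr.
  apply: le_lt_trans (hnormD HH (hZ HH a (hsubr HH hg hx)) (hsubr HH hh hy')) _.
  rewrite (splitr d) (hnormZ HH)//; last exact: hsubr.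
  rewrite ltr_leD// ?(ltW hy)//; move: gx; rewrite ltr_pdivlMr//.
  by apply: le_lt_trans; rewrite mulrDr mulr1 [leLHS]mulrC lerDl.
have cM : hcomplete M.
  move=> u uM uC; have [|g hg ug] := cH _ uC; first by move=> m; have [] := uM m.
  have ug' : hcvg M u g by exact: ug.
  move/hcvgP in ug; exists g => //.
  suff : cl g by [].
  rewrite /cl/=; split=> // d d0.
  have d20 : 0 < d / 2 by rewrite divr_gt0.
  have [N /(_ N (leqnn _)) hN] := ug _ d20; have [huN /(_ _ d20)[x Xx ux]] := uM N.
  exists x => //; apply: le_lt_trans (hnorm_tri HH hg huN (hspan_sub XH Xx)) _.
  by rewrite (splitr d) ltrD// (hnormBC HH).
have [||g [hg g1] gE] := riesz HM cM (l := fun h => hip H h f) (M := nrm f).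
- by move=> a u v [hu _] [hv _]; exact: ph_ipL.
- by move=> u [hu _]; rewrite mulrC; exact: cauchy_schwarz.
have fg0 : nrm (f - g) = 0.
  apply: Xtot; first exact: hsubr.
  move=> x Xx; have hx := XH _ Xx; rewrite (hipC HH hx (hsubr HH hf hg)).
  by rewrite (hipBr HH)// gE ?subrr ?conjc0//; apply: Xcl; exact: hspan_gen.
have [x Xx gx] := g1 e e0; exists x => //; have hx := hspan_sub XH Xx.
by apply: le_lt_trans (hnorm_tri HH hf hg hx) _; rewrite fg0 add0r.
Qed.

Definition weakly_null (g : nat -> V) := [/\ forall m, H (g m),
  exists M : R, forall m, nrm (g m) <= M &
  forall h, H h -> null_seq (fun m => cmod (hip H (g m) h))].

Lemma weakly_null_total (X : set V) (g : nat -> V) (M : R) :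
  (forall x, X x -> H x) ->
  (forall f, H f -> (forall x, X x -> hip H f x = 0) -> nrm f = 0) ->
  (forall m, H (g m)) -> (forall m, nrm (g m) <= M) ->
  (forall x, X x -> null_seq (fun m => cmod (hip H (g m) x))) ->
  weakly_null g.
Proof.
move=> XH Xtot gH gM g0; split => //; first by exists M.
have g0' x : hspan X x -> null_seq (fun m => cmod (hip H (g m) x)).
  elim=> [|a y u Xy hu IH].
    move=> e e0; exists 0%N => m _.
    by rewrite (hip0r HH) ?cmod0.
  apply: null_seq_le (null_seqD (null_seqZ (cmod_ge0 a) (g0 _ Xy)) IH) => m.
  have hu' := hspan_sub XH hu; have hy := XH _ Xy.
  rewrite (hipDr HH) ?(hipZr HH)//; last exact: hZ.
  by apply: le_trans (cmodD _ _) _; rewrite cmodM cmodJ.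
have M0 : 0 <= M by exact: le_trans (hnorm_ge0 _) (gM 0%N).
move=> h hh e e0; have e20 : 0 < e / 2 by rewrite divr_gt0.
have M10 : 0 < M + 1 by rewrite ltr_wpDl.
have [x Xx hx] := dense_total XH Xtot hh (divr_gt0 e20 M10).
have hx' := hspan_sub XH Xx; have [N hN] := g0' _ Xx _ e20.
exists N => m /hN h1; rewrite -[h](subrK x) (hipDr HH)//; last exact: hsubr.
apply: le_lt_trans (cmodD _ _) _; rewrite (splitr e) ler_ltD//.
apply: le_trans (cauchy_schwarz HH (gH m) (hsubr HH hh hx')) _.
have h2 : (M + 1) * (e / 2 / (M + 1)) = e / 2 by rewrite mulrC divfK ?gt_eqF.
rewrite -h2 ler_pM// ?(ltW hx)//.
by apply: le_trans (gM m) _; rewrite lerDl.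
Qed.

(** If [T (g m)] tends to [y] along a subsequence, then [<y, y>] is the limit of [<g m, S y>] with
    [S] the adjoint, hence 0. *)
Lemma compact_weakly_null T g : bounded_op H T -> compact_op H T ->
  weakly_null g -> null_seq (fun m => nrm (T (g m))).
Proof.
move=> bT cT [gH [M gM] g0]; apply: contrapT => h0.
have [|e e0 [s hs hse]] := not_null_seq _ h0; first by move=> m; exact: hnorm_ge0.
have [|s' hs' [y hy Tgy]] := cT (g \o s) (fun m => gH _); first by exists M => m; exact: gM.
move/hcvgP in Tgy.
have [S SH SE] := adjoint_ex HH cH bT.
have TH f : H f -> H (T f) by case: bT => + _ _; exact.
have y0 : nrm y = 0.
  suff : cmod (hip H y y) <= 0.
    rewrite (hipff HH hy) cmodr ger0_norm ?sqr_ge0// => h1.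
    by apply/eqP; rewrite -sqrf_eq0 eq_le h1 sqr_ge0.
  apply: null_seq_le0; pose f m := T (g (s (s' m))).
  have fH m : H (f m) by exact: TH.
  apply: (@null_seq_le _ _ (fun m => nrm y * nrm (f m - y) + cmod (hip H (f m) y))).
    move=> m; have -> : hip H y y = - hip H (f m - y) y + hip H (f m) y.
      by rewrite (hipBl HH)//; ring.
    apply: le_trans (cmodD _ _) _; rewrite lerD2r cmodN mulrC.
    by apply: cauchy_schwarz => //; exact: hsubr.
  apply: null_seqD; first exact: null_seqZ.
  apply: (@null_seq_le _ _ ((fun m => cmod (hip H (g m) (S y))) \o (s \o s'))).
    by move=> m; rewrite /= -SE.
  by apply: null_seq_sub; [move=> i j ij; exact/hs/hs'|apply: g0; exact: SH].
have [N /(_ N (leqnn _))] := Tgy _ e0.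
apply/negP; rewrite -leNgt; apply: le_trans (hse (s' N)) _.
have := hnormD HH (hsubr HH (TH _ (gH (s (s' N)))) hy) hy.
by rewrite subrK y0 addr0.
Qed.

(** A bounded sequence has a subsequence whose pairings with all [x a] converge. If its images were
    not Cauchy, differences of far terms would be weakly null with images bounded away from 0. *)
Lemma compact_of_weakly_null T (x : nat -> V) : bounded_op H T ->
  (forall a, H (x a)) ->
  (forall f, H f -> (forall a, hip H f (x a) = 0) -> nrm f = 0) ->
  (forall g, weakly_null g -> null_seq (fun m => nrm (T (g m)))) ->
  compact_op H T.
Proof.
move=> bT xH xtot Tnull f fH [M fM].
have M0 : 0 <= M by exact: le_trans (hnorm_ge0 _) (fM 0%N).
have [|s hs hl] := @diagonal_extraction R (fun m a => hip H (f m) (x a))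
    (fun a => M * nrm (x a)).
  by move=> m a; apply: le_trans (cauchy_schwarz HH (fH m) (xH a)) _; rewrite ler_wpM2r.
exists s => //; have TH u : H u -> H (T u) by case: bT => + _ _; exact.
apply: cH => [m|e e0]; first exact/TH/fH.
apply: contrapT => /forallNP hN.
have /choice[mp mpP] : forall N : nat, exists mp : nat * nat,
    [/\ (N <= mp.1)%N, (N <= mp.2)%N & e <= nrm (T (f (s mp.1)) - T (f (s mp.2)))].
  move=> N; have /existsNP[m /existsNP[p]] := hN N.
  move=> /not_implyP[Nm /not_implyP[Np /negP]]; rewrite -leNgt => h.
  by exists (m, p).
pose g N := f (s (mp N).1) - f (s (mp N).2).
have gH N : H (g N) by exact: hsubr.
have [|N /(_ N (leqnn _))] := Tnull g _ e e0; last first.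
  by rewrite ltNge (bounded_opB HH bT)//; have [_ _ ->] := mpP N.
apply: (@weakly_null_total (range x) _ (M + M)) => //.
- by move=> _ [a _ <-].
- by move=> u hu ux; apply: xtot => // a; apply: ux; exists a.
- by move=> m; apply: le_trans (hnormB HH (fH _) (fH _)) _; rewrite lerD.
move=> _ [a _ <-] d d0; have d20 : 0 < d / 2 by rewrite divr_gt0.
have [l hl'] := hl a; have [N hN'] := hl' _ d20.
exists N => m Nm; have [h1 h2 _] := mpP m.
rewrite (hipBl HH)// (_ : _ - _ = (hip H (f (s (mp m).1)) (x a) - l)
  - (hip H (f (s (mp m).2)) (x a) - l)); last by ring.
apply: le_lt_trans (cmodB _ _) _; rewrite (splitr d).
by rewrite ltrD//; apply: hN'; exact: leq_trans Nm _.
Qed.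

(* [residual x N f] is [f] minus its orthogonal projection onto the span of
   [x 0, ..., x N.-1]; a vector [y] of norm [0] contributes nothing, because
   its coefficient is then [_ / 0 = 0]. *)
Fixpoint residual (x : nat -> V) (N : nat) (f : V) : V :=
  if N is k.+1 then
    let y := residual x k (x k) in
    residual x k f - (hip H f y / hip H y y) *: y
  else f.

Section residual_theory.
Variables (x : nat -> V) (xH : forall a, H (x a)).
Local Notation Q := (residual x).
Local Notation "<< f , g >>" := (hip H f g).

Lemma residualH N f : H f -> H (Q N f).
Proof.
by elim: N f => //= N IH f hf; apply: hsubr => //; [exact: IH|apply: hZ => //; exact: IH].
Qed.

Lemma residual_sym N f g : H f -> H g -> <<Q N f, g>> = <<f, Q N g>>.
Proof.
elim: N f g => //= N IH f g hf hg.
move: (Q N (x N)) (residualH N (xH N)) => y hy.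
rewrite (hipBl HH) ?(hipBr HH) ?(hipZl HH) ?(hipZr HH) ?IH//;
  try exact: residualH; try exact: hZ.
by congr (_ - _); rewrite conjcM conjc_inv -!hipC//; ring.
Qed.

Lemma residualB N f g : H f -> H g -> Q N (f - g) = Q N f - Q N g.
Proof.
elim: N f g => //= N IH f g hf hg; rewrite IH// (hipBl HH)//; last exact: residualH.
by rewrite mulrBl scalerBl !opprB addrACA [RHS]addrACA; congr (_ + _); exact: addrC.
Qed.

Lemma residualZ N a f : H f -> Q N (a *: f) = a *: Q N f.
Proof.
elim: N f => //= N IH f hf; rewrite IH// (hipZl HH)//; last exact: residualH.
by rewrite scalerBr scalerA mulrA.
Qed.

Lemma residualD N f g : H f -> H g -> Q N (f + g) = Q N f + Q N g.
Proof.
move=> hf hg; rewrite -[g]opprK residualB//; last exact: hN.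
rewrite opprK; congr (_ + _).
by rewrite -[X in Q N X]scaleN1r residualZ// scaleN1r opprK.
Qed.

Lemma residual_idem N f : H f -> Q N (Q N f) = Q N f.
Proof.
elim: N f => //= N IH f hf; set y := Q N (x N); have hy : H y by exact: residualH.
have hQ : H (Q N f) by exact: residualH.
have Qy : Q N y = y by exact: IH.
rewrite residualB ?residualZ//; last exact: hZ.
rewrite IH// Qy (hipBl HH)//; last exact: hZ.
rewrite residual_sym// Qy (hipZl HH)//.
have [y0|y0] := eqVneq <<y, y>> 0; last by rewrite divfK// subrr mul0r scale0r subr0.
by rewrite y0 invr0 !mulr0 scale0r !subr0.
Qed.

Lemma residual_perp N f a : H f -> (a < N)%N -> <<Q N f, x a>> = 0.
Proof.
elim: N f => //= N IH f hf; set y := Q N (x N); have hy : H y by exact: residualH.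
have hQ : H (Q N f) by exact: residualH.
rewrite (hipBl HH) ?(hipZl HH)//; last exact: hZ.
rewrite ltnS leq_eqVlt => /orP[/eqP->|aN]; last first.
  by rewrite IH// {2}/y IH// mulr0 subrr.
rewrite residual_sym// -/y.
have -> : <<y, x N>> = <<y, y>>.
  by rewrite {1}/y -(residual_idem N (xH N)) residual_sym.
have [y0|y0] := eqVneq <<y, y>> 0; last by rewrite divfK// subrr.
rewrite y0 mulr0 subr0 (hipC HH hy hf) (hip_norm0 HH hy hf) ?conjc0//.
apply/eqP; rewrite -sqrf_eq0; have /= := congr1 (fun z => cRe z) y0.
by rewrite -(hnorm2 HH hy) => ->.
Qed.

Lemma residual_le N f : H f -> nrm (Q N f) <= nrm f.
Proof.
move=> hf; have hQ := residualH N hf; have [->|Q0] := eqVneq (nrm (Q N f)) 0; first by [].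
have {}Q0 : 0 < nrm (Q N f) by rewrite lt_neqAle eq_sym Q0 /=.
rewrite -(ler_pM2r Q0) -expr2 -(ger0_norm (sqr_ge0 _)) -cmodr -(hipff HH hQ).
rewrite -residual_sym// residual_idem//; rewrite residual_sym//.
exact: cauchy_schwarz.
Qed.

Lemma residual_null f :
  (forall h, H h -> (forall a, <<h, x a>> = 0) -> nrm h = 0) ->
  H f -> null_seq (fun N => nrm (Q N f)).
Proof.
move=> xtot hf e e0.
have xH' u : range x u -> H u by case=> a _ <-.
have [|u Xu fu] := dense_total xH' _ hf e0.
  by move=> h hh hx; apply: xtot => // a; apply: hx; exists a.
have hu := hspan_sub xH' Xu.
suff [N hN] : exists N, forall m, (N <= m)%N -> nrm (Q m u) = 0.
  exists N => m /hN h1; have h2 := hsubr HH hf hu.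
  apply: le_lt_trans fu; apply: le_trans (residual_le m h2).
  rewrite residualB//.
  have := hnormD HH (hsubr HH (residualH m hf) (residualH m hu)) (residualH m hu).
  by rewrite subrK h1 addr0.
elim: Xu {fu} => [|a y v [k _ <-] hv [N hN]].
  exists 0%N => m _; have := residual_le m (ph0 HH).
  by rewrite (hnorm0 HH) => h1; apply/eqP; rewrite eq_le h1 hnorm_ge0.
exists (maxn N k.+1) => m; rewrite geq_max => /andP[/hN h1 km].
have hv' := hspan_sub xH' hv.
have Qx0 : nrm (Q m (x k)) = 0.
  apply/eqP; rewrite -sqrf_eq0 (hnorm2 HH); last exact: residualH.
  by rewrite -residual_sym ?residual_idem ?residual_perp//; exact: residualH.
apply/eqP; rewrite eq_le hnorm_ge0 andbT residualD ?residualZ//; last exact: hZ.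
apply: le_trans (hnormD HH (hZ HH a (residualH m (xH k))) (residualH m hv')) _.
by rewrite (hnormZ HH) ?Qx0 ?h1 ?mulr0 ?add0r//; exact: residualH.
Qed.

Lemma residual_span N k : (k <= N)%N -> hspan (range x) (Q k (x N)).
Proof.
elim: k N => [|k IH] N kN /=; first by apply: hspan_gen; exists N.
rewrite -scaleNr addrC; apply: hspan_lin; [exact: IH|apply: IH; exact: ltnW].
Qed.

Lemma residualE N f : f - Q N f =
  \sum_(k < N) (<<f, Q k (x k)>> / <<Q k (x k), Q k (x k)>>) *: Q k (x k).
Proof.
elim: N => [|N IH] /=; first by rewrite big_ord0 subrr.
by rewrite big_ord_recr/= -IH opprB addrCA addrC.
Qed.

(** Otherwise vectors [g N] in the unit ball satisfy [|Q N (T (g N))| > e]. Along a subsequence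
    [T (g N)] tends to some [y]; as the [Q N] are contractions and [Q N y] tends to 0, this is
    impossible. *)
Lemma compact_residual T (e : R) :
  (forall h, H h -> (forall a, <<h, x a>> = 0) -> nrm h = 0) ->
  bounded_op H T -> compact_op H T -> 0 < e ->
  exists N, forall f, H f -> nrm (Q N (T f)) <= e * nrm f.
Proof.
move=> xtot bT cT e0; apply: contrapT => /forallNP hN.
have TH u : H u -> H (T u) by case: bT => + _ _; exact.
have /choice[g gP] : forall N : nat, exists g,
    [/\ H g, nrm g <= 1 & e < nrm (Q N (T g))].
  move=> N; have /existsNP[f /not_implyP[hf /negP]] := hN N.
  rewrite -ltNge => h1; have [f0|f0] := eqVneq (nrm f) 0.
    have [M M0 /(_ _ hf)] := bounded_op_bound bT; rewrite f0 mulr0 => h2.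
    have := le_lt_trans (mulr_ge0 (ltW e0) (hnorm_ge0 f)) h1.
    by rewrite ltNge (le_trans (residual_le N (TH _ hf))).
  have {}f0 : 0 < nrm f by rewrite lt_neqAle eq_sym f0 /=.
  exists ((nrm f)^-1%:C%C *: f); split; first exact: hZ.
    by rewrite (hnormZ HH)// cmodr ger0_norm ?invr_ge0// mulVf ?gt_eqF.
  rewrite (bounded_opZ HH)// residualZ ?(hnormZ HH)//; try by [exact: TH|apply: residualH; exact: TH].
  by rewrite cmodr ger0_norm ?invr_ge0// mulrC ltr_pdivlMr.
have [|s hs [y hy Tgy]] := cT g (fun N => let: And3 h _ _ := gP N in h).
  by exists 1 => N; have [] := gP N.
move/hcvgP in Tgy.
have e20 : 0 < e / 2 by rewrite divr_gt0.
have [N1 hN1] := Tgy _ e20; have [N2 hN2] := null_seq_sub hs (residual_null xtot hy) e20.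
pose N := maxn N1 N2; have /hN1/= h1 : (N1 <= N)%N by rewrite leq_maxl.
have /hN2/= h2 : (N2 <= N)%N by rewrite leq_maxr.
have [hg _] := gP (s N); apply/negP; rewrite -leNgt.
have hTg := TH _ hg.
have := hnormD HH (hsubr HH (residualH (s N) hTg) (residualH (s N) hy)) (residualH (s N) hy).
rewrite subrK -residualB// => /le_trans; apply; rewrite [leRHS]splitr lerD ?(ltW h2)//.
by apply: le_trans (residual_le _ (hsubr HH hTg hy)) (ltW h1).
Qed.

(** [T - Q N T] has finite rank, with functionals given by multiples of [S (u k)] for the adjoint
    [S]. These vectors need not lie in the span of [x] and are approximated from it; having both
    [u k] and [v k] in the span later reduces everything to kernels. *)
Lemma compact_finite_rank T (e : R) :
  (forall h, H h -> (forall a, <<h, x a>> = 0) -> nrm h = 0) ->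
  bounded_op H T -> compact_op H T -> 0 < e ->
  exists N (u v : nat -> V), [/\ forall k, hspan (range x) (u k),
    forall k, hspan (range x) (v k) &
    forall f, H f -> nrm (T f - \sum_(k < N) <<f, v k>> *: u k) <= e * nrm f].
Proof.
move=> xtot bT cT e0; have e20 : 0 < e / 2 by rewrite divr_gt0.
have TH u : H u -> H (T u) by case: bT => + _ _; exact.
have [N hN] := compact_residual xtot bT cT e20.
have [S SH SE] := adjoint_ex HH cH bT.
have xH' u : range x u -> H u by case=> a _ <-.
pose u k := Q k (x k); have uH k : H (u k) by exact: residualH.
pose w k := (<<u k, u k>>^-1)^*%C *: S (u k).
have wH k : H (w k) by apply: hZ => //; exact: SH.
(* The [N] errors add up to at most [e / 2]; the successors keep the divisor positive. *)
pose dl k := e / 2 / (N.+1%:R * (nrm (u k) + 1)).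
have dl0 k : 0 < dl k by rewrite divr_gt0// mulr_gt0// ltr_wpDl.
have /choice[v vP] : forall k, exists v, hspan (range x) v /\ nrm (w k - v) < dl k.
  move=> k; have [|v Xv wv] := dense_total xH' _ (wH k) (dl0 k); last by exists v.
  by move=> h hh hx; apply: xtot => // a; apply: hx; exists a.
have vH k : H (v k) by have [+ _] := vP k; exact: hspan_sub.
exists N, u, v; split => [k|k|f hf].
- exact: residual_span.
- by have [] := vP k.
have hT := TH _ hf.
have -> : T f - \sum_(k < N) <<f, v k>> *: u k =
    Q N (T f) + \sum_(k < N) <<f, w k - v k>> *: u k.
  have -> : \sum_(k < N) <<f, w k - v k>> *: u k =
      \sum_(k < N) (<<T f, u k>> / <<u k, u k>>) *: u k
      - \sum_(k < N) <<f, v k>> *: u k.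
    rewrite -sumrB; apply: eq_bigr => k _; rewrite -scalerBl; congr (_ *: _).
    rewrite (hipBr HH)//; congr (_ - _); rewrite /w (hipZr HH) ?conjcK; [|exact: SH|by []].
    by rewrite SE// mulrC.
  by rewrite -residualE addrA subrKC.
apply: le_trans (hnormD HH (residualH _ hT) _) _.
  by apply: hsum => // k _; exact: hZ.
rewrite [e in leRHS]splitr mulrDl lerD ?hN//.
apply: le_trans (hnorm_sum HH _ _) _; first by move=> k _; exact: hZ.
have h k : nrm (<<f, w k - v k>> *: u k) <= e / 2 / N.+1%:R * nrm f.
  rewrite (hnormZ HH)//.
  apply: (@le_trans _ _ (nrm f * dl k * (nrm (u k) + 1))).
    rewrite ler_pM ?cmod_ge0 ?lerDl//.
    apply: le_trans (cauchy_schwarz HH hf (hsubr HH (wH k) (vH k))) _.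
    by rewrite ler_wpM2l// ltW//; have [] := vP k.
  rewrite /dl invfM -!mulrA mulVf ?mulr1; last by rewrite gt_eqF// ltr_wpDl.
  by rewrite le_eqVlt; apply/orP; left; apply/eqP; ring.
apply: le_trans (ler_sum _ (fun (k : 'I_N) _ => h k)) _.
rewrite sumr_const card_ord -[_ *+ N]mulr_natr.
rewrite (_ : _ * N%:R = e / 2 * nrm f * (N%:R / N.+1%:R)); last by ring.
rewrite ler_piMr ?mulr_ge0 ?(ltW e0)//.
by rewrite ler_pdivrMr ?ltr0n// mul1r ler_nat leqnSn.
Qed.

End residual_theory.
End completeness.

(** * Cauchy's theorem on a square *)

Section segment_integral.
Context {R : realType}.
Local Notation leb := (@lebesgue_measure R).
Implicit Types (a b c d x y : R) (u v : R -> R[i]).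

Definition cont_on {T : Type} (dT : T -> T -> R) (P : T -> Prop) (F : T -> R[i]) :=
  forall z, P z -> forall e : R, 0 < e -> exists2 dl : R, 0 < dl &
    forall w, P w -> dT w z < dl -> cmod (F w - F z) < e.

Definition seg_cont a b u :=
  cont_on (fun y x => `|y - x|) (fun x => a <= x <= b) u.

Definition cint a b u : R[i] :=
  ((\int[leb]_(x in `[a, b]) cRe (u x)) +i* (\int[leb]_(x in `[a, b]) cIm (u x)))%C.

Lemma within_cont a b (f : R -> R) :
  (forall x, a <= x <= b -> forall e : R, 0 < e -> exists2 dl : R, 0 < dl &
    forall y, a <= y <= b -> `|y - x| < dl -> `|f y - f x| < e) ->
  {within `[a, b], continuous f}.
Proof.
move=> h; apply/subspace_continuousP => x xab.
have {}xab : a <= x <= b by move: xab; rewrite /= in_itv.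
apply/cvgrPdistC_lt => e e0; have [dl dl0 hdl] := h x xab e e0.
near=> y; apply: hdl.
  have : `[a, b]%classic y by near: y; exact: withinT.
  by rewrite /= in_itv.
near: y; apply: (@cvg_within _ (nbhs x) _ `[a, b]%classic).
by have := @nbhsx_ballx _ _ x dl dl0; apply: filterS => y; rewrite /ball/= distrC.
Unshelve. all: by end_near.
Qed.

Lemma seg_integrable a b (f : R -> R) :
  {within `[a, b], continuous f} -> leb.-integrable `[a, b] (EFin \o f).
Proof. by move=> h; apply: continuous_compact_integrable => //; exact: segment_compact. Qed.

Lemma seg_contRe a b u : seg_cont a b u ->
  leb.-integrable `[a, b] (EFin \o (fun x => cRe (u x))).
Proof.
move=> h; apply: seg_integrable; apply: within_cont => x xab e e0.
have [dl dl0 hdl] := h x xab e e0; exists dl => // y yab yx.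
by rewrite -cReB; apply: le_lt_trans (normr_cRe _) (hdl y yab yx).
Qed.

Lemma seg_contIm a b u : seg_cont a b u ->
  leb.-integrable `[a, b] (EFin \o (fun x => cIm (u x))).
Proof.
move=> h; apply: seg_integrable; apply: within_cont => x xab e e0.
have [dl dl0 hdl] := h x xab e e0; exists dl => // y yab yx.
by rewrite -cImB; apply: le_lt_trans (normr_cIm _) (hdl y yab yx).
Qed.

Lemma leb_itv a b : a <= b -> leb `[a, b] = (b - a)%:E.
Proof.
rewrite le_eqVlt => /predU1P[->|ab]; rewrite lebesgue_measure_itv/= lte_fin.
  by rewrite ltxx subrr.
by rewrite ab.
Qed.

Lemma cint_ext a b u v : (forall x, a <= x <= b -> u x = v x) ->
  cint a b u = cint a b v.
Proof.
move=> uv; congr (_ +i* _)%C; apply: eq_Rintegral => x;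
  by rewrite inE/= in_itv/= => /uv->.
Qed.

Lemma cintL a b (k : R[i]) u v : seg_cont a b u -> seg_cont a b v ->
  cint a b (fun x => k * u x + v x) = k * cint a b u + cint a b v.
Proof.
move=> cu cv.
have uR := seg_contRe cu; have uI := seg_contIm cu.
have vR := seg_contRe cv; have vI := seg_contIm cv.
have mD : measurable (`[a, b] : set R) by exact: measurable_itv.
have Z (r : R) (f : R -> R) : leb.-integrable `[a, b] (EFin \o f) ->
    leb.-integrable `[a, b] (EFin \o (fun x => r * f x)).
  by move=> hf; rewrite (_ : _ \o _ = (fun x => (r%:E * (f x)%:E)%E))//; exact: integrableZl.
apply: complex_ext; rewrite ?cReD ?cImD ?cReM ?cImM/=.
  under eq_Rintegral do rewrite cReD cReM.
  rewrite RintegralD ?RintegralB ?RintegralZl//; try exact: Z.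
  rewrite (_ : _ \o _ = (fun x => ((cRe k * cRe (u x))%:E - (cIm k * cIm (u x))%:E)%E))//.
  by apply: integrableB => //; exact: Z.
under eq_Rintegral do rewrite cImD cImM.
rewrite RintegralD ?RintegralD ?RintegralZl//; try exact: Z.
rewrite (_ : _ \o _ = (fun x => ((cRe k * cIm (u x))%:E + (cIm k * cRe (u x))%:E)%E))//.
by apply: integrableD => //; exact: Z.
Qed.

Lemma rint_cst a b (r : R) : a <= b -> \int[leb]_(x in `[a, b]) r = r * (b - a).
Proof.
move=> ab; rewrite Rintegral_cst; last exact: measurable_itv.
by congr (_ * _); exact: (congr1 fine (leb_itv ab)).
Qed.

Lemma cint_cst a b (k : R[i]) : a <= b -> cint a b (fun=> k) = k * (b - a)%:C%C.
Proof.
move=> ab; apply: complex_ext; rewrite ?cReM ?cImM/= rint_cst//;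
  by rewrite mulr0 ?subr0 ?add0r.
Qed.

Lemma seg_cont_cst a b (k : R[i]) : seg_cont a b (fun=> k).
Proof. by move=> x _ e e0; exists 1 => // y _ _; rewrite subrr cmod0. Qed.

Lemma rint_bound a b (f : R -> R) (M : R) : a <= b ->
  leb.-integrable `[a, b] (EFin \o f) -> (forall x, a <= x <= b -> `|f x| <= M) ->
  `|\int[leb]_(x in `[a, b]) f x| <= M * (b - a).
Proof.
move=> ab If fM.
have mD : measurable (`[a, b] : set R) by exact: measurable_itv.
have h : `|\int[leb]_(x in `[a, b]) f x| <= \int[leb]_(x in `[a, b]) `|f x|.
  by apply: le_normr_Rintegral.
apply: (le_trans h).
rewrite -rint_cst//.
apply: le_Rintegral => //.
- by rewrite (_ : _ \o _ = (fun x => `|(f x)%:E|%E))//; exact: integrable_abse.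
- apply: seg_integrable; apply: within_cont => x _ e e0.
  by exists 1 => // y _ _; rewrite subrr normr0.
Qed.

Lemma rint_ge a b (f : R -> R) (M : R) : a <= b ->
  leb.-integrable `[a, b] (EFin \o f) -> (forall x, a <= x <= b -> M <= f x) ->
  M * (b - a) <= \int[leb]_(x in `[a, b]) f x.
Proof.
move=> ab If fM.
have mD : measurable (`[a, b] : set R) by exact: measurable_itv.
rewrite -rint_cst//.
apply: le_Rintegral => //.
apply: seg_integrable; apply: within_cont => x _ e e0.
by exists 1 => // y _ _; rewrite subrr normr0.
Qed.

Lemma rint_ub a b (f : R -> R) (M : R) : a <= b ->
  leb.-integrable `[a, b] (EFin \o f) -> (forall x, a <= x <= b -> f x <= M) ->
  \int[leb]_(x in `[a, b]) f x <= M * (b - a).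
Proof.
move=> ab If fM.
have mD : measurable (`[a, b] : set R) by exact: measurable_itv.
rewrite -rint_cst//.
apply: le_Rintegral => //.
apply: seg_integrable; apply: within_cont => x _ e e0.
by exists 1 => // y _ _; rewrite subrr normr0.
Qed.

(** The factor 2 is the price of estimating real and imaginary parts separately. *)
Lemma cint_bound a b u (M : R) : a <= b -> seg_cont a b u ->
  (forall x, a <= x <= b -> cmod (u x) <= M) ->
  cmod (cint a b u) <= 2 * M * (b - a).
Proof.
move=> ab cu uM; apply: le_trans (cmod_leRI _) _ => /=.
rewrite -mulrA mulr_natl mulr2n; apply: lerD; apply: rint_bound => //.
- exact: seg_contRe.
- by move=> x /uM; exact: le_trans (normr_cRe _).
- exact: seg_contIm.
- by move=> x /uM; exact: le_trans (normr_cIm _).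
Qed.

Lemma rint_split a m b (f : R -> R) : a <= m -> m <= b ->
  leb.-integrable `[a, b] (EFin \o f) ->
  \int[leb]_(x in `[a, b]) f x =
  \int[leb]_(x in `[a, m]) f x + \int[leb]_(x in `[m, b]) f x.
Proof.
move=> am mb If; have := @Rintegral_itvB R f (BLeft a) (BRight b) m If.
rewrite !bnd_simp => /(_ am mb) /eqP; rewrite subr_eq addrC => /eqP ->.
congr (_ + _); apply: Rintegral_itv_obnd_cbnd.
apply: integrableS If => //; try exact: measurable_itv.
by apply: subset_itvr; rewrite bnd_simp.
Qed.

Lemma cint_split a m b u : a <= m -> m <= b -> seg_cont a b u ->
  cint a b u = cint a m u + cint m b u.
Proof.
move=> am mb cu; apply: complex_ext; rewrite ?cReD ?cImD/=; apply: rint_split => //.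
- exact: seg_contRe.
- exact: seg_contIm.
Qed.

End segment_integral.

(** * Bisection of rectangles *)

Section nested_rectangles.
Context {R : realType}.
Implicit Types (a b c d : R) (z w : R[i]).

Definition in_rect a b c d z := a <= cRe z <= b /\ c <= cIm z <= d.

Record rect := Rect { rx0 : R ; rx1 : R ; ry0 : R ; ry1 : R }.

Definition valid (r : rect) := rx0 r <= rx1 r /\ ry0 r <= ry1 r.

Definition sub_rect (r' r : rect) := [/\ rx0 r <= rx0 r', rx1 r' <= rx1 r,
  ry0 r <= ry0 r' & ry1 r' <= ry1 r].

Definition len (r : rect) := (rx1 r - rx0 r) + (ry1 r - ry0 r).

Definition quarter (r' r : rect) := [/\ valid r', sub_rect r' r,
  rx1 r' - rx0 r' = (rx1 r - rx0 r) / 2 & ry1 r' - ry0 r' = (ry1 r - ry0 r) / 2].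

Definition inr (r : rect) z := in_rect (rx0 r) (rx1 r) (ry0 r) (ry1 r) z.

Lemma quarter_len r' r : quarter r' r -> len r' = len r / 2.
Proof. by case=> _ _ h1 h2; rewrite /len h1 h2 -mulrDl. Qed.

Lemma sub_rect_trans r2 r1 r3 : sub_rect r1 r2 -> sub_rect r2 r3 -> sub_rect r1 r3.
Proof.
move=> [h1 h2 h3 h4] [k1 k2 k3 k4].
by split; [exact: le_trans h1|exact: le_trans k2|exact: le_trans h3|exact: le_trans k4].
Qed.

(** Bisection in the abstract: a property that each rectangle hands on to one of its quarters
    concentrates at a point. It yields both the boundedness of continuous functions and Goursat's
    theorem. *)
Lemma nested_rect (P : rect -> Prop) (r0 : rect) : valid r0 -> P r0 ->
  (forall r, valid r -> sub_rect r r0 -> P r -> exists2 r', quarter r' r & P r') ->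
  exists2 z, inr r0 z & forall dl : R, 0 < dl -> exists r,
    [/\ valid r, sub_rect r r0, inr r z, P r &
        len r < dl /\ (0 < len r0 -> 0 < len r)].
Proof.
move=> v0 P0 step.
have sub0 : sub_rect r0 r0 by split.
pose S := {r | [/\ valid r, sub_rect r r0 & P r]}.
have /choice[f fP] : forall s : S, exists s' : S, quarter (sval s') (sval s).
  move=> [r [vr sr Pr]]; have [r' qr Pr'] := step r vr sr Pr.
  have [vr' sr' _ _] := qr.
  by exists (exist _ r' (And3 vr' (sub_rect_trans sr' sr) Pr')).
pose s n : S := iter n f (exist _ r0 (And3 v0 sub0 P0)).
pose r n := sval (s n).
have rq n : quarter (r n.+1) (r n) by exact: fP.
have rv n : valid (r n) by rewrite /r; case: (sval _) (svalP (s n)) => ? ? ? ? [].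
have rP n : P (r n) by have [] := svalP (s n).
have rs n : sub_rect (r n) r0 by have [] := svalP (s n).
have mono n k : sub_rect (r (n + k)%N) (r n).
  elim: k => [|k IH]; first by rewrite addn0; split.
  by apply: sub_rect_trans IH; rewrite addnS; have [] := rq (n + k)%N.
have rlen n : len (r n) = len r0 / 2 ^+ n.
  elim: n => [|n IH]; first by rewrite expr0 divr1.
  by rewrite (quarter_len (rq n)) IH exprS invfM; ring.
have cross n m : rx0 (r n) <= rx1 (r m) /\ ry0 (r n) <= ry1 (r m).
  have [h1 h2 h3 h4] := mono n m; have [k1 k2 k3 k4] := mono m n.
  have [v1 v2] := rv (n + m)%N; rewrite addnC in k1 k2 k3 k4.
  by split; [exact: le_trans h1 (le_trans v1 k2)|exact: le_trans h3 (le_trans v2 k4)].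
pose X := sup (range (rx0 \o r)); pose Y := sup (range (ry0 \o r)).
have sX : has_sup (range (rx0 \o r)).
  split; first by exists (rx0 (r 0%N)), 0%N.
  by exists (rx1 (r 0%N)) => _ [n _ <-]; have [] := cross n 0%N.
have sY : has_sup (range (ry0 \o r)).
  split; first by exists (ry0 (r 0%N)), 0%N.
  by exists (ry1 (r 0%N)) => _ [n _ <-]; have [] := cross n 0%N.
have hX n : rx0 (r n) <= X <= rx1 (r n).
  apply/andP; split; first by apply: ub_le_sup; [exact: (proj2 sX)|exists n].
  by apply: ge_sup; [exact: (proj1 sX)|move=> _ [m _ <-]; have [] := cross m n].
have hY n : ry0 (r n) <= Y <= ry1 (r n).
  apply/andP; split; first by apply: ub_le_sup; [exact: (proj2 sY)|exists n].
  by apply: ge_sup; [exact: (proj1 sY)|move=> _ [m _ <-]; have [] := cross m n].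
exists (X +i* Y)%C; first by split => /=; [exact: (hX 0%N)|exact: (hY 0%N)].
move=> dl dl0.
have l0 : 0 <= len r0 by have [? ?] := v0; rewrite /len addr_ge0 ?subr_ge0.
have [|//|N /(_ N (leqnn _)) hN] := @geometric_null R (len r0) 2^-1 l0 _ _ dl dl0.
- by rewrite invr_ge0.
- by rewrite invf_lt1// ltr1n.
exists (r N); split; [exact: rv|exact: rs|by split; [exact: hX|exact: hY]|exact: rP|].
split; first by rewrite rlen -exprVn.
by move=> l0'; rewrite rlen divr_gt0// exprn_gt0.
Qed.

Lemma rect_dist r z w : inr r z -> inr r w -> cmod (w - z) <= len r.
Proof.
move=> [/andP[h1 h2] /andP[h3 h4]] [/andP[k1 k2] /andP[k3 k4]].
apply: (le_trans (cmod_leRI _)); rewrite cReB cImB /len lerD// ler_norml; apply/andP; split; lra.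
Qed.

Lemma quarters (r : rect) : valid r -> let mx := (rx0 r + rx1 r) / 2 in
  let my := (ry0 r + ry1 r) / 2 in
  [/\ quarter (Rect (rx0 r) mx (ry0 r) my) r, quarter (Rect (rx0 r) mx my (ry1 r)) r,
      quarter (Rect mx (rx1 r) (ry0 r) my) r & quarter (Rect mx (rx1 r) my (ry1 r)) r].
Proof. by case: r => a b c d [/= h1 h2]; split; split => /=; try split => /=; lra. Qed.

(** Unboundedness is handed on to a quarter, hence to arbitrarily small rectangles around one point,
    against continuity there. *)
Lemma cont_rect_bounded (F : R[i] -> R[i]) (r : rect) : valid r ->
  cont_on (fun w z => cmod (w - z)) (inr r) F ->
  exists M : R, forall z, inr r z -> cmod (F z) <= M.
Proof.
move=> vr cF; apply: contrapT => /forallNP unb.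
have [||z rz hz] := @nested_rect
    (fun r => forall M : R, exists2 z, inr r z & M < cmod (F z)) r vr.
- by move=> M; have /existsNP[z /not_implyP[h1 /negP]] := unb M; rewrite -ltNge => h2; exists z.
- move=> q vq _ hq; have [q1 q2 q3 q4] := quarters vq.
  apply: contrapT => nq.
  have key q' : quarter q' q -> exists M : R, forall z, inr q' z -> cmod (F z) <= M.
    move=> qq'; apply: contrapT => h; apply: nq; exists q' => // M.
    apply: contrapT => h'; apply: h; exists M => z h1; rewrite leNgt; apply/negP => h2.
    by apply: h'; exists z.
  have [M1 h1] := key _ q1; have [M2 h2] := key _ q2.
  have [M3 h3] := key _ q3; have [M4 h4] := key _ q4.
  have [z [/andP[z1 z2] /andP[z3 z4]]] := hq (Num.max (Num.max M1 M2) (Num.max M3 M4)).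
  rewrite !gt_max => /andP[/andP[g1 g2] /andP[g3 g4]].
  have [zx|zx] := leP (cRe z) ((rx0 q + rx1 q) / 2);
  have [zy|zy] := leP (cIm z) ((ry0 q + ry1 q) / 2).
  + by move: g1; apply/negP; rewrite -leNgt; apply: h1; split => /=; apply/andP.
  + by move: g2; apply/negP; rewrite -leNgt; apply: h2; split => /=; apply/andP; split => //; exact: ltW.
  + by move: g3; apply/negP; rewrite -leNgt; apply: h3; split => /=; apply/andP; split => //; exact: ltW.
  + by move: g4; apply/negP; rewrite -leNgt; apply: h4; split => /=; apply/andP; split => //; exact: ltW.
have [dl dl0 hdl] := cF z rz 1 ltr01.
have [q [vq [s1 s2 s3 s4] qz qP [ql _]]] := hz dl dl0.
have [w qw] := qP (cmod (F z) + 1); apply/negP; rewrite -leNgt.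
have rw : inr r w.
  case: qw => /andP[h1 h2] /andP[h3 h4]; split; apply/andP; split.
  - exact: le_trans h1.
  - exact: le_trans s2.
  - exact: le_trans h3.
  - exact: le_trans s4.
have := hdl w rw (le_lt_trans (rect_dist qz qw) ql) => h.
rewrite -[F w](subrK (F z)) addrC.
by apply: le_trans (cmodD _ _) _; rewrite lerD2l ltW.
Qed.

End nested_rectangles.

(** * Complex derivatives, with all estimates in real moduli *)

Section complex_derivative.
Context {R : realType}.
Implicit Types (z w : R[i]) (F G : R[i] -> R[i]).

Definition cdist z w : R := cmod (z - w).

Definition cdiff F z := exists a, forall e : R, 0 < e -> exists2 dl : R, 0 < dl &
  forall w, cmod (w - z) < dl -> cmod (F w - F z - a * (w - z)) <= e * cmod (w - z).

Definition ccont F z := forall e : R, 0 < e -> exists2 dl : R, 0 < dl &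
  forall w, cmod (w - z) < dl -> cmod (F w - F z) < e.

Lemma cdiff_cont F z : cdiff F z -> ccont F z.
Proof.
move=> [a ha] e e0; have [dl dl0 hdl] := ha 1 ltr01.
have A0 : 0 < cmod a + 1 by rewrite ltr_wpDl.
exists (Num.min dl (e / (cmod a + 1))); first by rewrite lt_min dl0 divr_gt0.
move=> w; rewrite lt_min => /andP[/hdl h1]; rewrite ltr_pdivlMr// => h2.
apply: le_lt_trans h2; rewrite -[F w - F z](subrK (a * (w - z))).
by apply: (le_trans (cmodD _ _)); rewrite cmodM; lra.
Qed.

Lemma ccont_on (P : R[i] -> Prop) F : (forall z, P z -> ccont F z) -> cont_on cdist P F.
Proof. by move=> h z /h cF e /cF[dl dl0 hdl]; exists dl => // w _; exact: hdl. Qed.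

Lemma ccont_cst k z : ccont (fun=> k) z.
Proof. by move=> e e0; exists 1 => // w _; rewrite subrr cmod0. Qed.

Lemma ccont_id z : ccont id z.
Proof. by move=> e e0; exists e. Qed.

Lemma ccontL (k : R[i]) F G z : ccont F z -> ccont G z ->
  ccont (fun w => k * F w + G w) z.
Proof.
move=> cF cG e e0; have e20 : 0 < e / 2 by rewrite divr_gt0.
have k0 : 0 < cmod k + 1 by rewrite ltr_wpDl.
have [d1 d10 h1] := cF _ (divr_gt0 e20 k0); have [d2 d20 h2] := cG _ e20.
exists (Num.min d1 d2); first by rewrite lt_min d10.
move=> w; rewrite lt_min => /andP[/h1 {}h1 /h2 {}h2].
rewrite (_ : _ - _ = k * (F w - F z) + (G w - G z)); last by ring.
apply: (le_lt_trans (cmodD _ _)); rewrite cmodM (splitr e) ler_ltD//.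
move: h1; rewrite ltr_pdivlMr// => /ltW; apply: le_trans.
by rewrite mulrDr mulr1 mulrC lerDl.
Qed.

Lemma ccontM F G z : ccont F z -> ccont G z -> ccont (fun w => F w * G w) z.
Proof.
move=> cF cG e e0; have e20 : 0 < e / 2 by rewrite divr_gt0.
have a0 : 0 < cmod (G z) + 1 by rewrite ltr_wpDl.
have b0 : 0 < cmod (F z) + 1 by rewrite ltr_wpDl.
have [d1 d10 h1] := cF _ (divr_gt0 e20 a0).
have [d2 d20 h2] := cG _ (divr_gt0 e20 b0).
have [d3 d30 h3] := cG _ ltr01.
exists (Num.min d1 (Num.min d2 d3)); first by rewrite !lt_min d10 d20.
move=> w; rewrite !lt_min => /and3P[/h1 {}h1 /h2 {}h2 /h3 {}h3].
rewrite (_ : _ - _ = (F w - F z) * G w + F z * (G w - G z)); last by ring.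
apply: (le_lt_trans (cmodD _ _)); rewrite !cmodM (splitr e) ler_ltD//.
  move: h1; rewrite ltr_pdivlMr// => /ltW; apply: le_trans.
  rewrite ler_wpM2l// -[G w](subrK (G z)) addrC; apply: (le_trans (cmodD _ _)).
  by rewrite lerD2l ltW.
move: h2; rewrite ltr_pdivlMr//; apply: le_lt_trans.
by rewrite mulrDr mulr1 mulrC lerDl.
Qed.

Lemma cmod_sub_lb z w : cmod z - cmod w <= cmod (z - w).
Proof. by rewrite lerBlDr -{1}[z](subrK w); exact: cmodD. Qed.

Lemma ccontV F z : ccont F z -> F z != 0 -> ccont (fun w => (F w)^-1) z.
Proof.
move=> cF Fz e e0; have Fz0 : 0 < cmod (F z) by rewrite cmod_gt0.
have A0 : 0 < e * cmod (F z) ^+ 2 / 2 by rewrite divr_gt0// mulr_gt0// exprn_gt0.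
have B0 : 0 < cmod (F z) / 2 by rewrite divr_gt0.
have [d1 d10 h1] := cF _ A0; have [d2 d20 h2] := cF _ B0.
exists (Num.min d1 d2); first by rewrite lt_min d10.
move=> w; rewrite lt_min => /andP[/h1 {}h1 /h2 {}h2].
have Fw : cmod (F z) / 2 < cmod (F w).
  have := cmod_sub_lb (F z) (F w); rewrite cmodBC; lra.
have Fw0 : F w != 0 by rewrite -cmod_gt0; exact: lt_trans Fw.
rewrite (_ : _ - _ = (F z - F w) / (F w * F z)); last by field; rewrite Fw0 Fz.
rewrite cmodM cmodV cmodM cmodBC ltr_pdivrMr ?mulr_gt0// ?(lt_trans _ Fw)//.
apply: (lt_le_trans h1); rewrite -mulrA ler_wpM2l ?(ltW e0)//.
by rewrite expr2 mulrAC ler_wpM2r ?ltW.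
Qed.

Lemma ccontX F z k : ccont F z -> ccont (fun w => F w ^+ k) z.
Proof.
move=> cF; elim: k => [|k IH].
  by under eq_fun do rewrite expr0; exact: ccont_cst.
by under eq_fun do rewrite exprS; exact: ccontM.
Qed.

Lemma cdiff_id z : cdiff id z.
Proof.
by exists 1 => e e0; exists 1 => // w _; rewrite mul1r subrr cmod0 mulr_ge0 ?(ltW e0).
Qed.

Lemma cdiffB F k z : cdiff F z -> cdiff (fun w => F w - k) z.
Proof.
move=> [a ha]; exists a => e /ha[dl dl0 h]; exists dl => // w /h.
by rewrite (_ : F w - F z = F w - k - (F z - k))//; ring.
Qed.

Lemma cdiffM F G z : cdiff F z -> cdiff G z -> cdiff (fun w => F w * G w) z.
Proof.
move=> dF dG; have cF := cdiff_cont dF; have cG := cdiff_cont dG.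
case: dF => a ha; case: dG => b hb.
exists (a * G z + F z * b) => e e0; have e30 : 0 < e / 3 by rewrite divr_gt0.
have G0 : 0 < cmod (G z) + 1 by rewrite ltr_wpDl.
have F0 : 0 < cmod (F z) + 1 by rewrite ltr_wpDl.
have A0 : 0 < cmod a + 1 by rewrite ltr_wpDl.
have [d1 d10 h1] := ha _ (divr_gt0 e30 G0).
have [d2 d20 h2] := hb _ (divr_gt0 e30 F0).
have [d3 d30 h3] := cG _ (divr_gt0 e30 A0).
have [d4 d40 h4] := cG _ ltr01.
exists (Num.min (Num.min d1 d2) (Num.min d3 d4)); first by rewrite !lt_min d10 d20 d30.
move=> w; rewrite !lt_min => /andP[/andP[/h1 {}h1 /h2 {}h2] /andP[/h3 {}h3 /h4 {}h4]].
rewrite (_ : _ - _ = (F w - F z - a * (w - z)) * G w + a * (w - z) * (G w - G z)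
  + F z * (G w - G z - b * (w - z))); last by ring.
apply: (le_trans (cmodD _ _)); rewrite (_ : e * _ = e / 3 * cmod (w - z)
  + e / 3 * cmod (w - z) + e / 3 * cmod (w - z)); last by field.
apply: lerD; first (apply: (le_trans (cmodD _ _)); apply: lerD); rewrite !cmodM.
- have hG : cmod (G w) <= cmod (G z) + 1.
    rewrite -[G w](subrK (G z)) addrC; apply: (le_trans (cmodD _ _)).
    by rewrite lerD2l ltW.
  apply: (le_trans (ler_pM _ _ h1 hG)) => //.
  by rewrite mulrAC divfK ?gt_eqF.
- rewrite mulrAC mulrC [leRHS]mulrC ler_wpM2l//.
  move: h3; rewrite ltr_pdivlMr// => /ltW; apply: le_trans.
  by rewrite mulrDr mulr1 mulrC lerDl.
- apply: (@le_trans _ _ ((cmod (F z) + 1) * (e / 3 / (cmod (F z) + 1) * cmod (w - z)))).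
    by rewrite ler_pM// lerDl.
  by rewrite [leLHS](_ : _ = e / 3 * cmod (w - z))//; field; rewrite gt_eqF.
Qed.

Lemma cdiffV F z : cdiff F z -> F z != 0 -> cdiff (fun w => (F w)^-1) z.
Proof.
move=> dF Fz; have cV := ccontV (cdiff_cont dF) Fz.
case: dF => a ha; exists (- a / F z ^+ 2) => e e0.
have Fz0 : 0 < cmod (F z) by rewrite cmod_gt0.
have e20 : 0 < e / 2 by rewrite divr_gt0.
have C0 : 0 < cmod (F z)^-1 + 1 by rewrite ltr_wpDl.
have A0 : 0 < cmod a / cmod (F z) + 1 by rewrite ltr_wpDl// divr_ge0.
have [d1 d10 h1] := ha _ (divr_gt0 (mulr_gt0 e20 Fz0) C0).
have [d2 d20 h2] := cV _ (divr_gt0 e20 A0).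
have [d3 d30 h3] := cV _ ltr01.
have [d4 d40 h4] := cdiff_cont (ex_intro _ a ha) Fz0.
exists (Num.min (Num.min d1 d2) (Num.min d3 d4)); first by rewrite !lt_min d10 d20 d30.
move=> w; rewrite !lt_min => /andP[/andP[/h1 {}h1 /h2 {}h2] /andP[/h3 {}h3 /h4 {}h4]].
have Fw0 : F w != 0.
  by apply: contraTneq h4 => ->; rewrite sub0r cmodN ltxx.
rewrite (_ : _ - _ = - (F w - F z - a * (w - z)) * (F w)^-1 / F z
  - a / F z * (w - z) * ((F w)^-1 - (F z)^-1)); last by field; rewrite Fw0 Fz.
apply: (le_trans (cmodB _ _)); rewrite (_ : e * _ = e / 2 * cmod (w - z)
  + e / 2 * cmod (w - z)); last by field.
apply: lerD; rewrite !cmodM.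
- have hV : cmod (F w)^-1 <= cmod (F z)^-1 + 1.
    rewrite -[(F w)^-1](subrK (F z)^-1) addrC; apply: (le_trans (cmodD _ _)).
    by rewrite lerD2l ltW.
  rewrite cmodN [cmod (F z)^-1]cmodV ler_pdivrMr//.
  apply: (le_trans (ler_pM _ _ h1 hV)) => //.
  by rewrite mulrAC divfK ?gt_eqF// mulrAC.
- rewrite mulrAC [cmod (F z)^-1]cmodV mulrC [leRHS]mulrC ler_wpM2l//.
  move: h2; rewrite ltr_pdivlMr// => /ltW; apply: le_trans.
  by rewrite mulrDr mulr1 mulrC lerDl.
Qed.

Lemma cdiff_local F G z (r : R) : 0 < r ->
  (forall w, cmod (w - z) < r -> F w = G w) -> cdiff F z -> cdiff G z.
Proof.
move=> r0 FG [a ha]; exists a => e /ha[dl dl0 hdl].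
exists (Num.min r dl); first by rewrite lt_min r0.
move=> w; rewrite lt_min => /andP[/FG <- /hdl].
by rewrite (FG z)// subrr cmod0.
Qed.

End complex_derivative.

(** * Contour integrals over rectangles and Goursat's theorem *)

Section cauchy.
Context {R : realType}.
Implicit Types (a b c d x y : R) (z w k : R[i]) (F G : R[i] -> R[i]).

Definition boundary a b c d z := in_rect a b c d z /\
  (cRe z = a \/ cRe z = b \/ cIm z = c \/ cIm z = d).

(** The counterclockwise contour integral over the boundary of the rectangle: bottom minus top, plus
    [i] times right minus left. *)
Definition qint a b c d F : R[i] :=
  cint a b (fun x => F (x +i* c)%C) - cint a b (fun x => F (x +i* d)%C)
  + 'i%C * (cint c d (fun y => F (b +i* y)%C) - cint c d (fun y => F (a +i* y)%C)).

Lemma cdist_h x x' y : cdist (x +i* y)%C (x' +i* y)%C = `|x - x'|.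
Proof. by rewrite /cdist /= subrr expr0n addr0 sqrtr_sqr. Qed.

Lemma cdist_v x y y' : cdist (x +i* y)%C (x +i* y')%C = `|y - y'|.
Proof. by rewrite /cdist /= subrr expr0n add0r sqrtr_sqr. Qed.

Lemma seg_h (P : R[i] -> Prop) F a b y : cont_on cdist P F ->
  (forall x, a <= x <= b -> P (x +i* y)%C) -> seg_cont a b (fun x => F (x +i* y)%C).
Proof.
move=> cF hP x xab e e0; have [dl dl0 hdl] := cF _ (hP x xab) e e0.
by exists dl => // x' x'ab h; apply: hdl; [exact: hP|rewrite cdist_h].
Qed.

Lemma seg_v (P : R[i] -> Prop) F c d x : cont_on cdist P F ->
  (forall y, c <= y <= d -> P (x +i* y)%C) -> seg_cont c d (fun y => F (x +i* y)%C).
Proof.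
move=> cF hP y ycd e e0; have [dl dl0 hdl] := cF _ (hP y ycd) e e0.
by exists dl => // y' y'cd h; apply: hdl; [exact: hP|rewrite cdist_v].
Qed.

Section on_rect.
Variables (a b c d : R) (ab : a <= b) (cd : c <= d).

Lemma bd_bot x : a <= x <= b -> boundary a b c d (x +i* c)%C.
Proof. by move=> h; split; [split=> //=; rewrite lexx|right; right; left]. Qed.

Lemma bd_top x : a <= x <= b -> boundary a b c d (x +i* d)%C.
Proof. by move=> h; split; [split=> //=; rewrite lexx andbT|right; right; right]. Qed.

Lemma bd_left y : c <= y <= d -> boundary a b c d (a +i* y)%C.
Proof. by move=> h; split; [split=> //=; rewrite lexx|left]. Qed.

Lemma bd_right y : c <= y <= d -> boundary a b c d (b +i* y)%C.
Proof. by move=> h; split; [split=> //=; rewrite lexx andbT|right; left]. Qed.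

Lemma qint_ext F G : (forall z, boundary a b c d z -> F z = G z) ->
  qint a b c d F = qint a b c d G.
Proof.
move=> FG; rewrite /qint; congr (_ - _ + _ * (_ - _)); apply: cint_ext => x h; apply: FG.
- exact: bd_bot.
- exact: bd_top.
- exact: bd_right.
- exact: bd_left.
Qed.

Lemma qintL k F G : cont_on cdist (boundary a b c d) F ->
  cont_on cdist (boundary a b c d) G ->
  qint a b c d (fun z => k * F z + G z) = k * qint a b c d F + qint a b c d G.
Proof.
move=> cF cG; rewrite /qint !cintL; try by [exact: seg_h cF bd_bot|exact: seg_h cG bd_bot|exact: seg_h cF bd_top|
  exact: seg_h cG bd_top|exact: seg_v cF bd_right|exact: seg_v cG bd_right|
  exact: seg_v cF bd_left|exact: seg_v cG bd_left].
by ring.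
Qed.

Lemma qint_le F (M : R) : cont_on cdist (boundary a b c d) F ->
  (forall z, boundary a b c d z -> cmod (F z) <= M) ->
  cmod (qint a b c d F) <= 4 * M * ((b - a) + (d - c)).
Proof.
move=> cF FM.
have h1 := cint_bound ab (seg_h cF bd_bot) (fun x h => FM _ (bd_bot h)).
have h2 := cint_bound ab (seg_h cF bd_top) (fun x h => FM _ (bd_top h)).
have h3 := cint_bound cd (seg_v cF bd_right) (fun x h => FM _ (bd_right h)).
have h4 := cint_bound cd (seg_v cF bd_left) (fun x h => FM _ (bd_left h)).
apply: (le_trans (cmodD _ _)); rewrite cmodM cmod_i mul1r.
apply: (le_trans (lerD (cmodB _ _) (cmodB _ _))); lra.
Qed.

Lemma qint_cst k : qint a b c d (fun=> k) = 0.
Proof. by rewrite /qint !subrr mulr0 addr0. Qed.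

Lemma qint_id : qint a b c d id = 0.
Proof.
have h (f g : R -> R[i]) k (p q : R) : p <= q -> seg_cont p q g ->
    (forall x, f x = k + g x) -> cint p q f - cint p q g = k * (q - p)%:C%C.
  move=> pq cg fg; apply/eqP; rewrite subr_eq; apply/eqP.
  rewrite -cint_cst// -[cint p q (fun=> k)]mul1r -cintL//; last exact: seg_cont_cst.
  by apply: cint_ext => x _; rewrite mul1r.
have cid' : cont_on cdist (boundary a b c d) id.
  by apply: ccont_on => z _; exact: ccont_id.
rewrite /qint (h _ _ ('i%C * (c - d)%:C%C) _ _ ab (seg_h cid' bd_top)); last first.
  by move=> x; apply: complex_ext; rewrite ?cReD ?cImD ?cReM ?cImM/=; ring.
rewrite (h _ _ (b - a)%:C%C _ _ cd (seg_v cid' bd_left)); last first.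
  by move=> x; apply: complex_ext; rewrite ?cReD ?cImD/=; ring.
by apply: complex_ext; rewrite ?cReD ?cImD ?cReM ?cImM/=; ring.
Qed.

Lemma boundary_in z : boundary a b c d z -> in_rect a b c d z.
Proof. by case. Qed.

End on_rect.

Lemma cont_onS (P Q : R[i] -> Prop) F : (forall z, P z -> Q z) ->
  cont_on cdist Q F -> cont_on cdist P F.
Proof.
move=> PQ cF z Pz e e0; have [dl dl0 h] := cF z (PQ z Pz) e e0.
by exists dl => // w /PQ; exact: h.
Qed.

Lemma qint_split_h a m b c d F : a <= m -> m <= b -> c <= d ->
  cont_on cdist (in_rect a b c d) F ->
  qint a b c d F = qint a m c d F + qint m b c d F.
Proof.
move=> am mb cd cF; rewrite /qint.
have hc : forall x, a <= x <= b -> in_rect a b c d (x +i* c)%C by split=> //=; rewrite lexx.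
have hd : forall x, a <= x <= b -> in_rect a b c d (x +i* d)%C.
  by split=> //=; rewrite lexx andbT.
by rewrite (cint_split am mb (seg_h cF hc)) (cint_split am mb (seg_h cF hd)); ring.
Qed.

Lemma qint_split_v a b c m d F : a <= b -> c <= m -> m <= d ->
  cont_on cdist (in_rect a b c d) F ->
  qint a b c d F = qint a b c m F + qint a b m d F.
Proof.
move=> ab cm md cF; rewrite /qint.
have ha : forall y, c <= y <= d -> in_rect a b c d (a +i* y)%C by split=> //=; rewrite lexx.
have hb : forall y, c <= y <= d -> in_rect a b c d (b +i* y)%C.
  by split=> //=; rewrite lexx andbT.
by rewrite (cint_split cm md (seg_v cF ha)) (cint_split cm md (seg_v cF hb)); ring.
Qed.

Definition qintr (r : rect) F := qint (rx0 r) (rx1 r) (ry0 r) (ry1 r) F.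

Lemma in_sub_rect (r' r : @rect R) z : sub_rect r' r -> inr r' z -> inr r z.
Proof.
move=> [s1 s2 s3 s4] [/andP[h1 h2] /andP[h3 h4]]; split; apply/andP; split.
- exact: le_trans h1.
- exact: le_trans s2.
- exact: le_trans h3.
- exact: le_trans s4.
Qed.

(* The bisection keeps [|qintr r F| / (len r)^2] from decreasing. *)
Lemma goursat a b c d F : a <= b -> c <= d ->
  (forall z, in_rect a b c d z -> cdiff F z) -> qint a b c d F = 0.
Proof.
move=> ab cd dF; pose r0 := Rect a b c d.
have v0 : valid r0 by [].
have cF : cont_on cdist (inr r0) F by apply: ccont_on => z /dF; exact: cdiff_cont.
have cFs r : sub_rect r r0 -> cont_on cdist (inr r) F.
  by move=> sr; apply: cont_onS cF => z; exact: in_sub_rect.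
(* For a single point the ratio followed by the bisection is meaningless, but the integral is
   bounded by the length. *)
have [l0|l0] := eqVneq (len r0) 0.
  have [M hM] := cont_rect_bounded v0 cF.
  apply/eqP; rewrite -cmod_eq0 eq_le cmod_ge0 andbT.
  have := @qint_le a b c d ab cd F M (cont_onS (@boundary_in a b c d) cF)
    (fun z hz => hM z (boundary_in hz)).
  by rewrite [_ + _]l0 mulr0.
have {}l0 : 0 < len r0 by rewrite lt_neqAle eq_sym l0 /len addr_ge0 ?subr_ge0.
pose P r := cmod (qintr r0 F) * len r ^+ 2 <= cmod (qintr r F) * len r0 ^+ 2.
have step r : valid r -> sub_rect r r0 -> P r -> exists2 r', quarter r' r & P r'.
  move=> vr sr Pr; have [q1 q2 q3 q4] := quarters vr.
  set mx := (rx0 r + rx1 r) / 2 in q1 q2 q3 q4; set my := (ry0 r + ry1 r) / 2 in q1 q2 q3 q4.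
  have cr := cFs r sr; have [vx vy] := vr.
  have mx1 : rx0 r <= mx by rewrite /mx; lra.
  have mx2 : mx <= rx1 r by rewrite /mx; lra.
  have my1 : ry0 r <= my by rewrite /my; lra.
  have my2 : my <= ry1 r by rewrite /my; lra.
  have E : qintr r F = (qintr (Rect (rx0 r) mx (ry0 r) my) F
      + qintr (Rect (rx0 r) mx my (ry1 r)) F) + (qintr (Rect mx (rx1 r) (ry0 r) my) F
      + qintr (Rect mx (rx1 r) my (ry1 r)) F).
    rewrite {1}/qintr (qint_split_h mx1 mx2 vy cr); congr (_ + _);
      apply: qint_split_v => //; apply: cont_onS cr => z [/andP[h1 h2] h3]; split=> //;
      apply/andP; split => //.
      exact: le_trans mx2.
    exact: le_trans h1.
  apply: contrapT => nq.
  have key q : quarter q r -> cmod (qintr q F) * len r0 ^+ 2 < cmod (qintr r0 F) * len r ^+ 2 / 4.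
    move=> qr; rewrite ltNge; apply/negP => h; apply: nq; exists q => //.
    by rewrite /P (quarter_len qr) expr_div_n mulrA (_ : 2 ^+ 2 = 4) //; ring.
  have := key _ q1; have := key _ q2; have := key _ q3; have := key _ q4.
  have l02 : 0 < len r0 ^+ 2 by rewrite exprn_gt0.
  have : cmod (qintr r F) * len r0 ^+ 2 <= (cmod (qintr (Rect (rx0 r) mx (ry0 r) my) F)
      + cmod (qintr (Rect (rx0 r) mx my (ry1 r)) F)
      + (cmod (qintr (Rect mx (rx1 r) (ry0 r) my) F)
      + cmod (qintr (Rect mx (rx1 r) my (ry1 r)) F))) * len r0 ^+ 2.
    rewrite ler_pM2r// E; apply: (le_trans (cmodD _ _)).
    by apply: lerD; exact: cmodD.
  have aux (x1 x2 x3 x4 t y L : R) : y <= (x1 + x2 + (x3 + x4)) * L -> x4 * L < t / 4 ->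
    x3 * L < t / 4 -> x2 * L < t / 4 -> x1 * L < t / 4 -> t <= y -> False by lra.
  by move=> h1 h2 h3 h4 h5; apply: (aux _ _ _ _ _ _ _ h1 h2 h3 h4 h5 Pr).
have [|z rz hz] := @nested_rect R P r0 v0 _ step; first by rewrite /P.
have [k hk] := dF z rz.
apply/eqP; rewrite -cmod_eq0 eq_le cmod_ge0 andbT -/(qintr r0 F).
apply: le_eps => e e0; rewrite add0r.
have l02 : 0 < len r0 ^+ 2 by rewrite exprn_gt0.
have A0 : 0 < e / (4 * len r0 ^+ 2) by rewrite divr_gt0// mulr_gt0.
have [dl dl0 hdl] := hk _ A0.
have [r [vr sr zr Pr [rdl /(_ l0) lr]]] := hz dl dl0.
have [vx vy] := vr; have cr := cFs r sr.
pose bd := boundary (rx0 r) (rx1 r) (ry0 r) (ry1 r).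
have cb : cont_on cdist bd F by apply: cont_onS cr => w; exact: boundary_in.
have cid' : cont_on cdist bd id by apply: ccont_on => w _; exact: ccont_id.
have ccst (q : R[i]) : cont_on cdist bd (fun=> q).
  by apply: ccont_on => w _; exact: ccont_cst.
pose err w := F w - F z - k * (w - z).
have caff : cont_on cdist bd (fun w => - k * w + (k * z - F z)).
  by apply: ccont_on => w _; apply: ccontL; [exact: ccont_id|exact: ccont_cst].
have cerr : cont_on cdist bd (fun w => 1 * F w + (- k * w + (k * z - F z))).
  apply: ccont_on => w bw; apply: ccontL; first by apply: cdiff_cont; apply/dF/(in_sub_rect sr)/boundary_in.
  by apply: ccontL; [exact: ccont_id|exact: ccont_cst].
(* Affine functions have integral 0, so [F] may be replaced by its first-order remainder at [z]. *)
have Er : qintr r F = qint (rx0 r) (rx1 r) (ry0 r) (ry1 r)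
    (fun w => 1 * F w + (- k * w + (k * z - F z))).
  rewrite qintL// qintL// ?qint_cst ?qint_id//.
  by rewrite mulr0 !addr0 mul1r.
have hr : cmod (qintr r F) <= 4 * (e / (4 * len r0 ^+ 2) * len r) * len r.
  rewrite Er; apply: qint_le => // w bw.
  have rw := boundary_in bw; have wz := rect_dist zr rw.
  rewrite (_ : _ + _ = F w - F z - k * (w - z)); last by ring.
  apply: (le_trans (hdl w (le_lt_trans wz rdl))).
  by rewrite ler_wpM2l// ltW.
have lr2 : 0 < len r ^+ 2 by rewrite exprn_gt0.
rewrite -(ler_pM2r lr2); apply: (le_trans Pr).
apply: (@le_trans _ _ (4 * (e / (4 * len r0 ^+ 2) * len r) * len r * len r0 ^+ 2)).
  by rewrite ler_pM2r.
by rewrite le_eqVlt; apply/orP; left; apply/eqP; field; rewrite gt_eqF.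
Qed.

(** Around a small square centred at [z] there remain four rectangles covered by [goursat], and the
    integral over the square tends to 0 with its size. This is needed for difference quotients,
    which are only known to be continuous at [z]. *)
Lemma goursat_point a b c d z F : a < cRe z < b -> c < cIm z < d ->
  (forall w, in_rect a b c d w -> ccont F w) ->
  (forall w, in_rect a b c d w -> w != z -> cdiff F w) -> qint a b c d F = 0.
Proof.
move=> /andP[az zb] /andP[cz zd] cF dF.
have [dl dl0 hdl] : exists2 dl : R, 0 < dl &
    forall w, cmod (w - z) < dl -> cmod (F w - F z) < 1.
  by apply: cF => //; split; rewrite !ltW.
have cFr : cont_on cdist (in_rect a b c d) F by exact: ccont_on.
apply/eqP; rewrite -cmod_eq0 eq_le cmod_ge0 andbT.
apply: le_eps => e e0; rewrite add0r.
pose M := cmod (F z) + 1; have M0 : 0 < M by rewrite ltr_wpDl.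
(* Half the side of the small square. The last two bounds make its points closer than [dl] to [z],
   and the estimate [16 M h] of the integral at most [e]. *)
pose h := Num.min (Num.min (Num.min (cRe z - a) (b - cRe z))
  (Num.min (cIm z - c) (d - cIm z))) (Num.min (dl / 3) (e / (16 * M))).
have h0 : 0 < h by rewrite !lt_min !subr_gt0 az zb cz zd !divr_gt0// mulr_gt0.
have : h <= h by []; rewrite {2}/h !le_min.
move=> /andP[/andP[/andP[h1 h2] /andP[h3 h4]] /andP[h5 h6]].
pose x0 := cRe z - h; pose x1 := cRe z + h; pose y0 := cIm z - h; pose y1 := cIm z + h.
have E1 : a <= x0 by rewrite /x0; lra.
have E2 : x0 <= x1 by rewrite /x0 /x1; lra.
have E3 : x1 <= b by rewrite /x1; lra.
have E4 : c <= y0 by rewrite /y0; lra.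
have E5 : y0 <= y1 by rewrite /y0 /y1; lra.
have E6 : y1 <= d by rewrite /y1; lra.
have cd : c <= d by lra.
have gz a' b' c' d' : a <= a' -> a' <= b' -> b' <= b -> c <= c' -> c' <= d' -> d' <= d ->
    ~ in_rect a' b' c' d' z -> qint a' b' c' d' F = 0.
  move=> e1 e2 e3 e4 e5 e6 nz; apply: goursat => // w wr; apply: dF.
    exact: (@in_sub_rect (Rect a' b' c' d') (Rect a b c d)).
  by apply/eqP => wz; apply: nz; rewrite -wz.
have sub a' b' c' d' : a <= a' -> b' <= b -> c <= c' -> d' <= d ->
    cont_on cdist (in_rect a' b' c' d') F.
  move=> e1 e2 e3 e4; apply: cont_onS cFr => w.
  exact: (@in_sub_rect (Rect a' b' c' d') (Rect a b c d)).
have x1a : a <= x1 by lra.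
have x0b : x0 <= b by lra.
have y1c : c <= y1 by lra.
have y0d : y0 <= d by lra.
rewrite (qint_split_h E1 x0b cd cFr) (@qint_split_h x0 x1 b)//; last exact: sub.
rewrite gz//; last by rewrite /in_rect /x0 => -[/andP[? ?] _]; lra.
rewrite [qint x1 b c d F]gz//; last by rewrite /in_rect /x1 => -[/andP[? ?] _]; lra.
rewrite (qint_split_v E2 E4 y0d (sub _ _ _ _ E1 E3 (lexx _) (lexx _))).
rewrite gz//; last by rewrite /in_rect /y0 => -[_ /andP[? ?]]; lra.
rewrite (qint_split_v E2 E5 E6 (sub _ _ _ _ E1 E3 E4 (lexx _))).
rewrite [qint x0 x1 y1 d F]gz//; last by rewrite /in_rect /y1 => -[_ /andP[? ?]]; lra.
rewrite !add0r !addr0.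
apply: (@le_trans _ _ (4 * M * ((x1 - x0) + (y1 - y0)))).
  apply: qint_le => //.
    apply: (@cont_onS _ (in_rect x0 x1 y0 y1)); [by move=> w; exact: boundary_in|exact: sub].
  move=> w /boundary_in [/andP[w1 w2] /andP[w3 w4]].
  rewrite -[F w](subrK (F z)) addrC; apply: (le_trans (cmodD _ _)).
  rewrite /M lerD2l ltW//; apply: hdl; apply: (le_lt_trans (cmod_leRI _)).
  rewrite cReB cImB.
  have : `|cRe w - cRe z| <= h by rewrite ler_norml; apply/andP; split; rewrite /x0 /x1 in w1 w2; lra.
  have : `|cIm w - cIm z| <= h by rewrite ler_norml; apply/andP; split; rewrite /y0 /y1 in w3 w4; lra.
  lra.
have : h * (16 * M) <= e by rewrite -ler_pdivlMr// mulr_gt0.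
rewrite /x0 /x1 /y0 /y1; lra.
Qed.

End cauchy.

(** * Cauchy's formula and power series on a square *)

Section square.
Context {R : realType} (s : R) (s0 : 0 < s).
Implicit Types (z w : R[i]) (F G : R[i] -> R[i]).

Definition oint F := qint (- s) s (- s) s F.
Local Notation sq := (in_rect (- s) s (- s) s).
Local Notation bd := (boundary (- s) s (- s) s).

Lemma Nss : - s <= s.
Proof. by rewrite (@le_trans _ _ 0) ?oppr_le0 ?ltW. Qed.

Lemma bd_cmod w : bd w -> s <= cmod w.
Proof.
case=> _ [h|[h|[h|h]]].
- by apply: le_trans (normr_cRe w); rewrite h normrN ler_norm.
- by apply: le_trans (normr_cRe w); rewrite h ler_norm.
- by apply: le_trans (normr_cIm w); rewrite h normrN ler_norm.
- by apply: le_trans (normr_cIm w); rewrite h ler_norm.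
Qed.

Lemma bd_neq0 w : bd w -> w != 0.
Proof. by move=> /bd_cmod h; rewrite -cmod_gt0; exact: lt_le_trans h. Qed.

Lemma bd_sub w z : bd w -> s - cmod z <= cmod (w - z).
Proof. by move=> /bd_cmod h; apply: le_trans (cmod_sub_lb _ _); rewrite lerD2r. Qed.

Lemma bd_sub_neq0 w z : bd w -> cmod z < s -> w - z != 0.
Proof.
by move=> bw zs; rewrite -cmod_gt0; apply: lt_le_trans (bd_sub z bw); rewrite subr_gt0.
Qed.

Lemma oint_le F (M : R) : cont_on cdist bd F -> (forall z, bd z -> cmod (F z) <= M) ->
  cmod (oint F) <= 16 * s * M.
Proof.
move=> cF FM; apply: (le_trans (qint_le Nss Nss cF FM)); lra.
Qed.

Lemma cont_subV z : cmod z < s -> cont_on cdist bd (fun w => (w - z)^-1).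
Proof.
move=> zs w bw e e0; have [||dl dl0 h] := @ccontV R (fun w => w - z) w _ _ e e0.
- move=> e' e0'; exists e' => // u.
  by rewrite (_ : u - z - (w - z) = u - w)//; ring.
- exact: bd_sub_neq0.
by exists dl => // u _; exact: h.
Qed.

Definition winding z := oint (fun w => (w - z)^-1).

(** The imaginary part is positive: every edge contributes a nonnegative amount, and the bottom edge
    a positive one. *)
Lemma winding_neq0 z : cmod z < s -> winding z != 0.
Proof.
move=> zs; suff : 0 < cIm (winding z) by apply: contraTneq => ->; rewrite ltxx.
have cV := cont_subV zs.
have ReV w : cRe w^-1 = cRe w / cmod w ^+ 2 by rewrite cmodE; case: w.
have ImV w : cIm w^-1 = - (cIm w / cmod w ^+ 2) by rewrite cmodE; case: w.
have := normr_cRe z; have := normr_cIm z.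
move=> /le_lt_trans/(_ zs); rewrite ltr_norml => /andP[I1 I2].
move=> /le_lt_trans/(_ zs); rewrite ltr_norml => /andP[R1 R2].
have zN : cmod z < s := zs.
have bdl w : bd w -> 0 < cmod (w - z) ^+ 2.
  by move=> bw; rewrite exprn_gt0// cmod_gt0 bd_sub_neq0.
have bdu w : bd w -> cmod (w - z) ^+ 2 <= (3 * s) ^+ 2.
  move=> [[/andP[w1 w2] /andP[w3 w4]] _]; rewrite ler_sqr ?nnegrE ?mulr_ge0 ?(ltW s0)//.
  apply: (le_trans (cmodB _ _)).
  have : cmod w <= 2 * s.
    apply: (le_trans (cmod_leRI _)).
    have : `|cRe w| <= s by rewrite ler_norml w1.
    have : `|cIm w| <= s by rewrite ler_norml w3.
    lra.
  lra.
rewrite /winding /oint /qint cImD cImB cImM cReB /= mul0r add0r mul1r.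
have sh := seg_h cV (@bd_bot _ _ _ _ _ Nss); have st := seg_h cV (@bd_top _ _ _ _ _ Nss).
have sr := seg_v cV (@bd_right _ _ _ _ _ Nss); have sl := seg_v cV (@bd_left _ _ _ _ _ Nss).
have s90 : 0 < (3 * s) ^+ 2 by rewrite exprn_gt0// mulr_gt0.
have B1 : (s + cIm z) / (3 * s) ^+ 2 * (s - - s) <=
    \int[lebesgue_measure]_(x in `[- s, s]) cIm ((x +i* (- s))%C - z)^-1.
  apply: rint_ge; [exact: Nss|exact: seg_contIm sh|move=> x xs].
  have bx := @bd_bot _ _ _ _ _ Nss _ xs.
  rewrite ImV -mulNr cImB/= opprB opprK addrC.
  by rewrite ler_pM2l ?lef_pV2 ?posrE ?bdl ?bdu//; lra.
have B2 : \int[lebesgue_measure]_(x in `[- s, s]) cIm ((x +i* s)%C - z)^-1 <= 0 * (s - - s).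
  apply: rint_ub; [exact: Nss|exact: seg_contIm st|move=> x xs].
  by rewrite ImV cImB/= oppr_le0 divr_ge0 ?sqr_ge0// subr_ge0 ltW.
have B3 : 0 * (s - - s) <= \int[lebesgue_measure]_(x in `[- s, s]) cRe ((s +i* x)%C - z)^-1.
  apply: rint_ge; [exact: Nss|exact: seg_contRe sr|move=> x xs].
  by rewrite ReV cReB/= divr_ge0 ?sqr_ge0// subr_ge0 ltW.
have B4 : \int[lebesgue_measure]_(x in `[- s, s]) cRe ((- s +i* x)%C - z)^-1 <= 0 * (s - - s).
  apply: rint_ub; [exact: Nss|exact: seg_contRe sl|move=> x xs].
  by rewrite ReV cReB/= mulr_le0_ge0 ?invr_ge0 ?sqr_ge0// subr_le0 ltW.
have B0 : 0 < (s + cIm z) / (3 * s) ^+ 2 * (s - - s).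
  by rewrite mulr_gt0 ?divr_gt0//; lra.
rewrite mul0r in B2; rewrite mul0r in B3; rewrite mul0r in B4.
apply: ltr_wpDr; first by rewrite subr_ge0 (le_trans B4).
by rewrite subr_gt0 (le_lt_trans B2)// (lt_le_trans B0).
Qed.

Lemma cauchy_formula F z : (forall w, sq w -> cdiff F w) -> cmod z < s ->
  oint (fun w => F w * (w - z)^-1) = F z * winding z.
Proof.
move=> dF zs.
have I1 : - s < cIm z < s by rewrite -ltr_norml; exact: le_lt_trans (normr_cIm z) zs.
have R1 : - s < cRe z < s by rewrite -ltr_norml; exact: le_lt_trans (normr_cRe z) zs.
have sqz : sq z.
  by move/andP: I1 => [i1 i2]; move/andP: R1 => [r1 r2]; split; rewrite !ltW.
have [a ha] := dF z sqz.
(* The difference quotient, completed by the derivative: continuous at [z] and differentiable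
   elsewhere, as [goursat_point] requires. *)
pose G w := if w == z then a else (F w - F z) * (w - z)^-1.
have dG w : sq w -> w != z -> cdiff G w.
  move=> sw wz; have r0 : 0 < cmod (w - z) by rewrite cmod_gt0 subr_eq0.
  apply: (@cdiff_local R (fun w => (F w - F z) * (w - z)^-1) G w _ r0).
    move=> u uw; rewrite /G; case: eqP => // uz; move: uw.
    by rewrite uz cmodBC ltxx.
  apply: cdiffM; first exact/cdiffB/dF.
  by apply: cdiffV; [apply: cdiffB; exact: cdiff_id|rewrite subr_eq0].
have cG w : sq w -> ccont G w.
  have [->|wz] := eqVneq w z; last by move=> sw; exact/cdiff_cont/dG.
  move=> _ e e0; have e20 : 0 < e / 2 by rewrite divr_gt0.
  have [dl dl0 hdl] := ha _ e20; exists dl => // u /hdl.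
  rewrite /G eqxx; case: eqP => [->|/eqP uz]; first by move=> _; rewrite subrr cmod0.
  have u0 : 0 < cmod (u - z) by rewrite cmod_gt0 subr_eq0.
  rewrite (_ : F u - F z - a * (u - z) = ((F u - F z) * (u - z)^-1 - a) * (u - z)).
    by rewrite cmodM ler_pM2r// => /le_lt_trans; apply; lra.
  by field; rewrite subr_eq0.
have G0 : oint G = 0 by exact: goursat_point R1 I1 cG dG.
have cV := cont_subV zs.
have cH : cont_on cdist bd (fun w => F w * (w - z)^-1).
  apply: ccont_on => w bw; apply: ccontM; first exact/cdiff_cont/dF/boundary_in.
  by apply: cdiff_cont; apply: cdiffV; [apply: cdiffB; exact: cdiff_id|exact: bd_sub_neq0].
have : oint G = - F z * winding z + oint (fun w => F w * (w - z)^-1).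
  rewrite /winding /oint -(qintL Nss Nss (- F z) cV cH).
  apply: (qint_ext Nss Nss) => w bw.
  have := bd_sub_neq0 bw zs; rewrite /G subr_eq0 => /negbTE ->; ring.
by rewrite G0 mulNr => /eqP; rewrite eq_sym addrC subr_eq0 => /eqP.
Qed.

(** For holomorphic [F] this is the [k]-th Taylor coefficient at 0, up to the factor [2 pi i]. *)
Definition coef F k := oint (fun w => F w * (w ^+ k.+1)^-1).

Lemma cont_coef F k : cont_on cdist bd F -> cont_on cdist bd (fun w => F w * (w ^+ k.+1)^-1).
Proof.
move=> cF w bw e e0.
have [||dl dl0 h] := @ccontV R (fun w => w ^+ k.+1) w _ _ 1 ltr01.
- by apply: ccontX; exact: ccont_id.
- by rewrite expf_neq0// bd_neq0.
have V0 : 0 < cmod (w ^+ k.+1)^-1 + 1 by rewrite ltr_wpDl.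
have F0 : 0 < cmod (F w) + 1 by rewrite ltr_wpDl.
have e20 : 0 < e / 2 by rewrite divr_gt0.
have [d1 d10 h1] := cF w bw _ (divr_gt0 e20 V0).
have [||d2 d20 h2] := @ccontV R (fun w => w ^+ k.+1) w _ _ _ (divr_gt0 e20 F0).
- by apply: ccontX; exact: ccont_id.
- by rewrite expf_neq0// bd_neq0.
exists (Num.min dl (Num.min d1 d2)); first by rewrite !lt_min dl0 d10.
move=> u bu; rewrite /cdist !lt_min => /and3P[/h {}h /(h1 _ bu) {}h1 /h2 {}h2].
rewrite (_ : _ - _ = (F u - F w) * (u ^+ k.+1)^-1
  + F w * ((u ^+ k.+1)^-1 - (w ^+ k.+1)^-1)); last by ring.
apply: (le_lt_trans (cmodD _ _)); rewrite !cmodM (splitr e) ler_ltD//.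
  move: h1; rewrite ltr_pdivlMr// => /ltW; apply: le_trans.
  rewrite ler_wpM2l// -[X in cmod X](subrK (w ^+ k.+1)^-1) addrC.
  by apply: (le_trans (cmodD _ _)); rewrite lerD2l ltW.
move: h2; rewrite ltr_pdivlMr//; apply: le_lt_trans.
by rewrite mulrDr mulr1 mulrC lerDl.
Qed.

Lemma coef_lin F G (a : R[i]) k : cont_on cdist bd F -> cont_on cdist bd G ->
  coef (fun w => a * F w + G w) k = a * coef F k + coef G k.
Proof.
move=> cF cG; rewrite /coef /oint -(qintL Nss Nss); try exact: cont_coef.
by apply: (qint_ext Nss Nss) => w _; ring.
Qed.

Lemma coef_le F k (M : R) : cont_on cdist bd F -> (forall z, bd z -> cmod (F z) <= M) ->
  cmod (coef F k) <= 16 * s * M / s ^+ k.+1.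
Proof.
move=> cF FM; rewrite -mulrA; apply: oint_le => [|w bw]; first exact: cont_coef.
rewrite cmodM cmodV cmodX.
have M0 : 0 <= M by apply: le_trans (FM w bw).
rewrite ler_pM// ?invr_ge0 ?exprn_ge0//; first exact: FM.
rewrite lef_pV2 ?posrE ?exprn_gt0//; last by rewrite cmod_gt0 bd_neq0.
by rewrite lerXn2r ?nnegrE ?(ltW s0)// bd_cmod.
Qed.

(** Geometric expansion of [1 / (w - z)] in Cauchy's formula: after [N] terms there remains the
    integral of [F w (z / w)^N / (w - z)]. *)
Lemma power_series F z (M : R) N : (forall w, sq w -> cdiff F w) -> cmod z < s ->
  (forall w, bd w -> cmod (F w) <= M) ->
  cmod (winding z * F z - \sum_(k < N) z ^+ k * coef F k) <=
    16 * s * M / (s - cmod z) * (cmod z / s) ^+ N.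
Proof.
move=> dF zs FM.
have cF : cont_on cdist bd F.
  by apply: ccont_on => w bw; exact/cdiff_cont/dF/boundary_in.
have zs0 : 0 < s - cmod z by rewrite subr_gt0.
have crem k : cont_on cdist bd (fun w => F w * (z / w) ^+ k * (w - z)^-1).
  apply: ccont_on => w bw; apply: ccontM; first apply: ccontM.
  - exact/cdiff_cont/dF/boundary_in.
  - apply: ccontX; apply: ccontM; first exact: ccont_cst.
    by apply: ccontV; [exact: ccont_id|exact: bd_neq0].
  - by apply: cdiff_cont; apply: cdiffV; [apply: cdiffB; exact: cdiff_id|exact: bd_sub_neq0].
have -> : winding z * F z - \sum_(k < N) z ^+ k * coef F k =
    oint (fun w => F w * (z / w) ^+ N * (w - z)^-1).
  rewrite mulrC -cauchy_formula//; elim: N => [|k IH].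
    by rewrite big_ord0 subr0; apply: (qint_ext Nss Nss) => w _; rewrite expr0 mulr1.
  rewrite big_ord_recr/= opprD addrA IH; apply/eqP; rewrite subr_eq addrC; apply/eqP.
  rewrite /coef /oint -(qintL Nss Nss); [|exact: cont_coef|exact: crem].
  apply: (qint_ext Nss Nss) => w bw; have w0 := bd_neq0 bw.
  have wz := bd_sub_neq0 bw zs; rewrite !expr_div_n !exprS.
  by field; rewrite wz w0 expf_neq0.
rewrite -!mulrA mulrA; apply: oint_le => // w bw.
have M0 : 0 <= M by apply: le_trans (FM w bw).
rewrite !cmodM cmodX cmodM !cmodV -mulrA ler_pM//.
- by rewrite mulr_ge0 ?exprn_ge0 ?mulr_ge0 ?invr_ge0.
- exact: FM.
rewrite mulrC ler_pM ?invr_ge0 ?exprn_ge0 ?mulr_ge0 ?invr_ge0//.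
  rewrite lef_pV2 ?posrE ?bd_sub//.
  by rewrite cmod_gt0 bd_sub_neq0.
rewrite lerXn2r ?nnegrE ?mulr_ge0 ?invr_ge0 ?(ltW s0)// ler_wpM2l//.
by rewrite lef_pV2 ?posrE ?bd_cmod// cmod_gt0 bd_neq0.
Qed.

End square.

(** * Sesquiholomorphic functions vanishing on the diagonal *)

Section identity_principle.
Context {R : realType} (s : R) (s0 : 0 < s).
Local Notation sq := (in_rect (- s) s (- s) s).
Local Notation bd := (boundary (- s) s (- s) s).

Lemma small_seq (r : R) : 0 < r -> exists t : nat -> R,
  [/\ forall n, 0 < t n, forall n, t n < r & null_seq t].
Proof.
move=> r0; exists (fun n => r / n.+2%:R); split => [n|n|].
- by rewrite divr_gt0.
- by rewrite ltr_pdivrMr// ltr_pMr// ltr1n.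
apply: (@null_seq_le _ _ (fun n => r * n.+1%:R^-1)).
  by move=> n; rewrite ler_pM2l// lef_pV2 ?posrE// ler_nat.
exact: null_seqZ (ltW r0) null_seq_inv.
Qed.

Lemma le_small (x C r : R) : 0 < r -> 0 <= C ->
  (forall t : R, 0 < t -> t < r -> x <= C * t) -> x <= 0.
Proof.
move=> r0 C0 h; have [t [t0 tr tn]] := small_seq r0.
apply: null_seq_le0; apply: null_seq_le (null_seqZ C0 tn) => n; exact: h.
Qed.

(** All coefficients vanish by induction: if those below [m] do, [power_series] at a small real [t]
    reads [t^m |coef s F m| <= C t^(m+1)]. *)
Lemma identity_square (F : R[i] -> R[i]) (rho : R) : 0 < rho ->
  (forall w, sq w -> cdiff F w) -> (forall w, cmod w < rho -> F w = 0) ->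
  forall z, cmod z < s -> F z = 0.
Proof.
move=> rho0 dF F0.
have vs : valid (Rect (- s) s (- s) s) by split; exact: Nss.
have [M hM] : exists M : R, forall z, sq z -> cmod (F z) <= M.
  by apply: (@cont_rect_bounded R F (Rect (- s) s (- s) s)) => //;
    apply: ccont_on => w /dF; exact: cdiff_cont.
have FM w : bd w -> cmod (F w) <= M by case=> /hM.
have M0 : 0 <= M by apply: le_trans (hM 0 _); rewrite ?cmod_ge0//; split => /=; rewrite oppr_le0 ltW.
have ps := fun z N zs => @power_series R s s0 F z M N dF zs FM.
have a0 m : coef s F m = 0.
  elim/ltn_ind: m => m IH; apply/eqP; rewrite -cmod_eq0 eq_le cmod_ge0 andbT.
  pose r := Num.min rho (s / 2); have r0 : 0 < r by rewrite lt_min rho0 divr_gt0.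
  pose C := 16 * s * M / (s / 2) / s ^+ m.+1.
  have C0 : 0 <= C by rewrite !divr_ge0 ?mulr_ge0 ?exprn_ge0 ?(ltW s0).
  apply: (le_small r0 C0) => t t0; rewrite lt_min => /andP[trho ts].
  have ct : cmod (t%:C%C) = t by rewrite cmodr ger0_norm ?ltW.
  have zs : cmod (t%:C%C) < s by rewrite ct; lra.
  have := ps t%:C%C m.+1 zs; rewrite F0 ?ct// mulr0 sub0r cmodN big_ord_recr/=.
  rewrite big1 ?add0r => [|j _]; last by rewrite IH ?mulr0.
  rewrite cmodM cmodX ct => h.
  rewrite -(ler_pM2l (exprn_gt0 m t0)); apply: (le_trans h).
  have -> : t ^+ m * (C * t) = 16 * s * M / (s / 2) * (t / s) ^+ m.+1.
    by rewrite /C expr_div_n [t ^+ m.+1]exprS; field; rewrite expf_neq0 gt_eqF.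
  rewrite ler_wpM2r ?exprn_ge0 ?divr_ge0 ?(ltW t0) ?(ltW s0)//.
  rewrite ler_wpM2l ?mulr_ge0 ?(ltW s0)//.
  rewrite lef_pV2 ?posrE ?divr_gt0 ?subr_gt0//; lra.
move=> z zs; have h : cmod (winding s z * F z) <= 0.
  apply: null_seq_le0.
  apply: null_seq_le (@geometric_null R (16 * s * M / (s - cmod z)) (cmod z / s) _ _ _).
  - move=> N; have := ps z N zs.
    by rewrite big1 ?subr0// => j _; rewrite a0 mulr0.
  - by rewrite divr_ge0 ?mulr_ge0 ?(ltW s0)// subr_ge0 ltW.
  - by rewrite divr_ge0 ?(ltW s0).
  - by rewrite ltr_pdivrMr// mul1r.
have : cmod (winding s z * F z) == 0 by rewrite eq_le h cmod_ge0.
by rewrite cmod_eq0 mulf_eq0 (negbTE (winding_neq0 s0 zs)) => /eqP.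
Qed.

End identity_principle.

(** * The uniform boundedness principle *)

Section uniform_boundedness.
Context {R : realType} {V : lmodType R[i]} {H : hspace V}.
Context (HH : prehilbert H) (cH : hcomplete H).
Local Notation nrm := (hnorm H).

(* Gliding hump: the signs are chosen so that the [n]-th functional is large on
   the [n]-th partial sum, and the remaining terms cannot cancel it. *)
Lemma banach_steinhaus (I : Type) (P : I -> Prop) (v : I -> V) :
  (forall i, P i -> H (v i)) ->
  (forall f, H f -> exists M : R, forall i, P i -> cmod (hip H f (v i)) <= M) ->
  exists M : R, forall i, P i -> nrm (v i) <= M.
Proof.
move=> vH pb; apply: contrapT => /forallNP unb.
(* Norms above [4^n] against steps of length [3^-n]: all later steps together undo at most half of
   what step [n] gains, so the [n]-th functional keeps at least [(4/3)^n / 2]. *)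
have /choice[i iP] : forall n : nat, exists i, P i /\ 4 ^+ n < nrm (v i).
  by move=> n; have /existsNP[i /not_implyP[Pi /negP]] := unb (4 ^+ n); rewrite -ltNge; exists i.
pose y n := v (i n); have yH n : H (y n) by apply: vH; have [] := iP n.
have y4 n : 4 ^+ n < nrm (y n) by have [] := iP n.
have y0 n : 0 < nrm (y n) by apply: lt_trans (y4 n); rewrite exprn_gt0.
pose c n : R[i] := ((3 ^+ n)^-1 / nrm (y n))%:C%C.
have c_nrm n : cmod (c n) * nrm (y n) = (3 ^+ n)^-1.
  by rewrite cmodr ger0_norm ?divfK ?gt_eqF// divr_ge0 ?invr_ge0 ?exprn_ge0.
pose step n f := if (3 ^+ n)^-1 * nrm (y n) <= cmod (hip H (f + c n *: y n) (y n))
  then f + c n *: y n else f - c n *: y n.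
pose f := fix f n := if n is k.+1 then step k (f k) else 0.
have fH n : H (f n).
  elim: n => [|n IH] /=; first exact: ph0.
  by rewrite /step; case: ifP => _; [apply: hD|apply: hsubr] => //; exact: hZ.
have big n : (3 ^+ n)^-1 * nrm (y n) <= cmod (hip H (f n.+1) (y n)).
  rewrite /= /step; case: ifP => // /negbT; rewrite -ltNge => h.
  move: h; rewrite (hipDl HH) ?(hipBl HH)//; try exact: hZ.
  set b := hip H (c n *: y n) (y n); set a := hip H (f n) (y n) => h.
  have cb : cmod b = (3 ^+ n)^-1 * nrm (y n).
    rewrite /b (hipZl HH)// cmodM (hipff HH)// [cmod (_ ^+ 2)%:C%C]cmodr.
    by rewrite ger0_norm ?sqr_ge0// expr2 mulrA c_nrm.
  have : cmod (2 * b) <= cmod (a + b) + cmod (a - b).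
    by rewrite (_ : 2 * b = (a + b) - (a - b)); [exact: cmodB|ring].
  rewrite cmodM (_ : cmod 2 = 2) ?cb; last first.
    have -> : (2 : R[i]) = (2 : R)%:C%C by rewrite rmorph_nat.
    by rewrite cmodr ger0_norm.
  lra.
have dist n : nrm (f n.+1 - f n) <= (3 ^+ n)^-1.
  rewrite /= /step -c_nrm; case: ifP => _; rewrite addrC addKr ?(hnormN HH) ?(hnormZ HH)//.
  exact: hZ.
have tail n k : nrm (f (n + k)%N - f n) <= 3 / 2 * (3 ^+ n)^-1 - 3 / 2 * (3 ^+ (n + k))^-1.
  elim: k => [|k IH]; first by rewrite addn0 !subrr (hnorm0 HH).
  rewrite addnS; apply: (le_trans (hnorm_tri HH (fH _) (fH (n + k)%N) (fH _))).
  have := dist (n + k)%N; rewrite [3 ^+ (n + k).+1]exprS invfM.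
  move: IH; move: (3 ^+ (n + k))^-1 (3 ^+ n)^-1 => p q; lra.
move: (cH fH) => [e e0|g hg /hcvgP fg].
  have [|//|//|N /(_ N (leqnn _)) hN] := @geometric_null R 3 3^-1 _ _ _ e e0 => //.
    by rewrite invf_lt1// ltr1n.
  have key m : (N <= m)%N -> nrm (f m - f N) <= 3 / 2 * (3 ^+ N)^-1.
    move=> Nm; have := tail N (m - N)%N; rewrite subnKC// => /le_trans; apply.
    by rewrite gerBl mulr_ge0 ?invr_ge0 ?exprn_ge0.
  exists N => m p /key h1 /key h2.
  apply: (le_lt_trans (hnorm_tri HH (fH m) (fH N) (fH p))).
  rewrite [nrm (f N - _)](hnormBC HH)//; rewrite exprVn in hN; lra.
have lim n : nrm (g - f n.+1) <= 2^-1 * (3 ^+ n)^-1.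
  apply: le_eps => e e0; have [N hN] := fg e e0.
  have := hN (n.+1 + N)%N (leq_addl _ _) => h1.
  apply: (le_trans (hnorm_tri HH hg (fH (n.+1 + N)%N) (fH _))).
  rewrite (hnormBC HH hg)// addrC lerD//; last exact: ltW.
  apply: (le_trans (tail _ _)); rewrite [3 ^+ n.+1]exprS invfM.
  have : 0 <= (3 ^+ (n.+1 + N) : R)^-1 by rewrite invr_ge0 exprn_ge0.
  lra.
have [M hM] := pb g hg.
have lb n : (4 / 3) ^+ n <= 2 * M.
  have [Pi _] := iP n; have := hM _ Pi; rewrite -/(y n) => h1.
  have h2 := big n.
  have h3 := cauchy_schwarz HH (hsubr HH hg (fH n.+1)) (yH n).
  have h4 : cmod (hip H (f n.+1) (y n)) <= cmod (hip H g (y n)) + cmod (hip H (g - f n.+1) (y n)).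
    rewrite (_ : hip H (f n.+1) _ = hip H g (y n) - hip H (g - f n.+1) (y n)); first exact: cmodB.
    by rewrite (hipBl HH)//; ring.
  have h5 : nrm (g - f n.+1) * nrm (y n) <= 2^-1 * (3 ^+ n)^-1 * nrm (y n).
    by rewrite ler_pM2r.
  have h6 : 2^-1 * (3 ^+ n)^-1 * nrm (y n) <= M by lra.
  have : 2^-1 * (3 ^+ n)^-1 * 4 ^+ n <= M.
    by apply: le_trans h6; apply: ler_wpM2l; [rewrite mulr_ge0 ?invr_ge0 ?exprn_ge0|exact: ltW].
  rewrite expr_div_n; lra.
have [|||N /(_ N (leqnn _))] := @geometric_null R (2 * M + 1) (3 / 4) _ _ _ 1 ltr01.
- by have := lb 0%N; rewrite expr0; lra.
- by rewrite divr_ge0.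
- by rewrite ltr_pdivrMr// mul1r ltr_nat.
rewrite ltNge => /negP; apply.
have := lb N; rewrite -(@ler_pM2r _ ((3 / 4) ^+ N)) ?exprn_gt0//.
rewrite -exprMn (_ : 4 / 3 * (3 / 4) = 1 :> R) ?expr1n; last by field.
move/le_trans; apply; rewrite ler_wpM2r ?exprn_ge0 ?divr_ge0//; lra.
Qed.

End uniform_boundedness.

(** * Power series of a weakly antiholomorphic family of vectors *)

Section kernel_series.
Context {R : realType} {V : lmodType R[i]} {H : hspace V}.
Context (HH : prehilbert H) (cH : hcomplete H).
Local Notation nrm := (hnorm H).
Variables (s : R) (s0 : 0 < s) (k : R[i] -> V).
Local Notation sq := (in_rect (- s) s (- s) s).
Local Notation bd := (boundary (- s) s (- s) s).
Hypothesis kH : forall z, sq z -> H (k z).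
(** [k] is only meaningful on the closed square, while [cdiff] at a boundary point looks at a full
    neighbourhood; hence the auxiliary extension [F]. *)
Hypothesis kan : forall f, H f -> exists F : R[i] -> R[i],
  forall z, sq z -> F z = hip H f (k z) /\ cdiff F z.

Let kf f := fun z => hip H f (k z).

Lemma cmod_sq z : cmod z < s -> sq z.
Proof.
move=> zs; split; rewrite -ler_norml ltW//; apply: le_lt_trans zs.
  exact: normr_cRe.
exact: normr_cIm.
Qed.

Lemma kf_cont f : H f -> cont_on cdist bd (kf f).
Proof.
move=> hf; have [F FP] := kan hf.
have cF : cont_on cdist bd F.
  by apply: ccont_on => z /boundary_in /FP[_ /cdiff_cont].
move=> z bz e e0; have [dl dl0 h] := cF z bz e e0; exists dl => // w bw wz.
have [E1 _] := FP z (boundary_in bz); have [E2 _] := FP w (boundary_in bw).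
by rewrite /kf -E1 -E2; exact: h.
Qed.

(* Normalizing by the factor [winding] replaces the evaluation of
   [winding s 0 = 2 pi i]. *)
Lemma kernel_series : exists (kap : nat -> V) (C : R), [/\ 0 <= C,
  forall j, H (kap j) &
  forall z N, cmod z < s ->
    nrm ((winding s z)^*%C *: k z - \sum_(j < N) (z^*%C ^+ j) *: kap j) <=
      C / (s - cmod z) * (cmod z / s) ^+ N].
Proof.
have vs : valid (Rect (- s) s (- s) s) by split; exact: Nss.
(* Each [<f, k z>] is continuous, hence bounded, on the square; uniform boundedness turns this into
   a bound on [|k z|]. *)
have [M hM] : exists M : R, forall z, sq z -> nrm (k z) <= M.
  apply: (banach_steinhaus HH cH) => // f hf; have [F FP] := kan hf.
  have [|M hM] := @cont_rect_bounded R F (Rect (- s) s (- s) s) vs.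
    by apply: ccont_on => w /FP[_]; exact: cdiff_cont.
  by exists M => z sz; have [<- _] := FP z sz; exact: hM.
have M0 : 0 <= M.
  apply: le_trans (hnorm_ge0 _) (hM 0 _); split => /=; rewrite oppr_le0 ltW//.
have kfM f z : H f -> bd z -> cmod (kf f z) <= M * nrm f.
  move=> hf /boundary_in sz; rewrite mulrC.
  by apply: (le_trans (cauchy_schwarz HH hf (kH sz))); rewrite ler_wpM2l ?hM.
(* The Taylor coefficients of [z |-> <f, k z>] are bounded linear functionals of [f], so they are
   represented by vectors. *)
have /choice[kap kapP] : forall j, exists g, H g /\
    forall f, H f -> coef s (kf f) j = hip H f g.
  move=> j; have [|f hf|g hg gP] := @riesz _ _ H HH cH (fun f => coef s (kf f) j)
      (16 * s * M / s ^+ j.+1); last by exists g.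
  - move=> a f g hf hg; rewrite -coef_lin//; try exact: kf_cont.
    apply: (qint_ext (Nss s0) (Nss s0)) => z /boundary_in sz.
    by rewrite /kf (ph_ipL HH)//; exact: kH.
  - apply: (le_trans (coef_le s0 _ (kf_cont hf) (fun z bz => kfM f z hf bz))).
    by rewrite le_eqVlt; apply/orP; left; apply/eqP; ring.
have kapH j : H (kap j) by have [] := kapP j.
exists kap, (16 * s * M); split => //; first by rewrite !mulr_ge0 ?(ltW s0).
move=> z N zs; have sz := cmod_sq zs.
have hS : H (\sum_(j < N) (z^*%C ^+ j) *: kap j) by apply: hsum => // j _; exact: hZ.
have hk : H ((winding s z)^*%C *: k z) by apply: hZ => //; exact: kH.
have D0 : 0 <= 16 * s * M / (s - cmod z) * (cmod z / s) ^+ N.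
  rewrite mulr_ge0 ?exprn_ge0 ?divr_ge0 ?mulr_ge0 ?(ltW s0)//.
  by rewrite subr_ge0 ltW.
apply: (hip_bound_le HH) => //; first exact: hsubr.
move=> f hf; rewrite -cmodJ -(hipC HH)//; last exact: hsubr.
rewrite (hipBr HH)// (hipZr HH) ?conjcK//; last exact: kH.
rewrite (hip_sumr HH)//; last by move=> j _; exact: hZ.
have -> : \sum_(j < N) hip H f ((z^*%C ^+ j) *: kap j) = \sum_(j < N) z ^+ j * coef s (kf f) j.
  apply: eq_bigr => j _; rewrite (hipZr HH)// conjcX conjcK.
  by have [_ ->] := kapP j.
have [F FP] := kan hf.
have [<- _] := FP z sz.
have cE j : coef s (kf f) j = coef s F j.
  by apply: (qint_ext (Nss s0) (Nss s0)) => w /boundary_in /FP[-> _].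
under eq_bigr do rewrite cE.
apply: (le_trans (@power_series R s s0 F z (M * nrm f) N _ zs _)).
- by move=> w /FP[].
- by move=> w bw; have [-> _] := FP w (boundary_in bw); exact: kfM.
by rewrite le_eqVlt; apply/orP; left; apply/eqP; ring.
Qed.

(* [u = (1 - it)/(1 + it)] runs through infinitely many points of the unit
   circle. *)
Lemma conj_poly_eq0 (m : nat) (l : nat -> R[i]) :
  (forall w : R[i], \sum_(j < m.+1) (w^*%C ^+ j) * w ^+ (m - j) * l j = 0) ->
  forall j, (j <= m)%N -> l j = 0.
Proof.
move=> h; pose p : {poly R[i]} := \poly_(j < m.+1) l j.
pose w (t : nat) : R[i] := (1 +i* t%:R)%C.
pose u t := (w t)^*%C / w t.
have w0 t : w t != 0 by rewrite eq_complex /= negb_and oner_eq0.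
have wJ0 t : (w t)^*%C != 0 by rewrite conjc_eq0.
have uinj : injective u.
  move=> t t' e; have : (w t)^*%C * w t' = (w t')^*%C * w t.
    have := congr1 (fun x => x * w t * w t') e.
    by rewrite /u divfK// [RHS]mulrAC divfK.
  move/(congr1 (fun x => cIm x)); rewrite /= !mul1r !mulr1 => e'.
  have : (t%:R : R) = t'%:R by lra.
  by move/eqP; rewrite eqr_nat => /eqP.
have pu t : root p (u t).
  apply/rootP; rewrite horner_poly -[LHS](mulfK (expf_neq0 m (w0 t))).
  have := h (w t); rewrite (_ : \sum_(j < m.+1) _ = (\sum_(j < m.+1) l j * u t ^+ j) * w t ^+ m).
    by move=> ->; rewrite mul0r.
  rewrite mulr_suml; apply: eq_bigr => j _.
  have jm : (j <= m)%N by rewrite -ltnS.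
  have -> : w t ^+ m = w t ^+ j * w t ^+ (m - j) by rewrite -exprD subnKC.
  by rewrite /u expr_div_n; field; rewrite expf_neq0.
have p0 : p = 0.
  apply/eqP/contraT => p0.
  have := @max_poly_roots _ p [seq u t | t <- iota 0 m.+1] p0.
  rewrite map_inj_uniq// iota_uniq size_map size_iota => /(_ _ isT) H1.
  have /H1 : all (root p) [seq u t | t <- iota 0 m.+1].
    by apply/allP => _ /mapP[t _ ->].
  by rewrite ltnNge size_poly.
move=> j jm; have := congr1 (fun q : {poly R[i]} => q`_j) p0.
by rewrite coef_poly ltnS jm coef0.
Qed.

Variables (L : V -> V -> R[i]) (CL : R).
Hypothesis CL0 : 0 <= CL.
Hypothesis LL : forall a f g h, H f -> H g -> H h -> L (a *: f + g) h = a * L f h + L g h.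
Hypothesis LR : forall a f g h, H f -> H g -> H h -> L h (a *: f + g) = a^*%C * L h f + L h g.
Hypothesis Lb : forall f g, H f -> H g -> cmod (L f g) <= CL * nrm f * nrm g.

Lemma form_suml I (r : seq I) (F : I -> V) (a : I -> R[i]) h : (forall i, H (F i)) -> H h ->
  L (\sum_(i <- r) a i *: F i) h = \sum_(i <- r) a i * L (F i) h.
Proof.
move=> hF hh; have L0 : L 0 h = 0.
  have := LL 1 (ph0 HH) (ph0 HH) hh; rewrite scale1r addr0 mul1r => /eqP.
  by rewrite -subr_eq0 opprD addNKr oppr_eq0 => /eqP.
elim: r => [|i r IH]; first by rewrite !big_nil.
by rewrite !big_cons LL ?IH//; apply: hsum => // j _; exact: hZ.
Qed.

Lemma form_sumr I (r : seq I) (F : I -> V) (a : I -> R[i]) h : (forall i, H (F i)) -> H h ->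
  L h (\sum_(i <- r) a i *: F i) = \sum_(i <- r) (a i)^*%C * L h (F i).
Proof.
move=> hF hh; have L0 : L h 0 = 0.
  have := LR 1 (ph0 HH) (ph0 HH) hh; rewrite scale1r addr0 conjc1 mul1r => /eqP.
  by rewrite -subr_eq0 opprD addNKr oppr_eq0 => /eqP.
elim: r => [|i r IH]; first by rewrite !big_nil.
by rewrite !big_cons LR ?IH//; apply: hsum => // j _; exact: hZ.
Qed.

Lemma formZl a f h : H f -> H h -> L (a *: f) h = a * L f h.
Proof.
move=> hf hh; have := @form_suml unit [:: tt] (fun=> f) (fun=> a) h (fun=> hf) hh.
by rewrite !big_seq1.
Qed.

Lemma formZr a f h : H f -> H h -> L h (a *: f) = a^*%C * L h f.
Proof.
move=> hf hh; have := @form_sumr unit [:: tt] (fun=> f) (fun=> a) h (fun=> hf) hh.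
by rewrite !big_seq1.
Qed.

Lemma formBl f g h : H f -> H g -> H h -> L (f - g) h = L f h - L g h.
Proof.
by move=> hf hg hh; rewrite addrC -[- g]scaleN1r LL// mulN1r addrC.
Qed.

Lemma formBr f g h : H f -> H g -> H h -> L h (f - g) = L h f - L h g.
Proof.
by move=> hf hg hh; rewrite addrC -[- g]scaleN1r LR// rmorphN rmorph1 mulN1r addrC.
Qed.

Lemma form_close x y x' y' (dx dy B : R) : H x -> H y -> H x' -> H y' ->
  nrm (x - x') <= dx -> nrm (y - y') <= dy -> nrm y <= B -> nrm x' <= B ->
  cmod (L x y - L x' y') <= CL * B * (dx + dy).
Proof.
move=> hx hy hx' hy' h1 h2 h3 h4.
rewrite (_ : _ - _ = L (x - x') y + L x' (y - y')); last first.
  by rewrite formBl// formBr//; ring.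
apply: (le_trans (cmodD _ _)).
apply: (le_trans (lerD (Lb (hsubr HH hx hx') hy) (Lb hx' (hsubr HH hy hy')))).
rewrite mulrDr lerD// -!mulrA ler_wpM2l//.
  by rewrite mulrC ler_pM.
by rewrite ler_pM.
Qed.

(** [L (k z) (k z)] is, up to a nonzero factor, a double power series in [z^*] and [z] with
    coefficients [L (kap i) (kap j)]. Along [z = t w] with [t] tending to 0 its homogeneous parts
    vanish one degree at a time, and [conj_poly_eq0] separates the terms of each. *)
Lemma polarization : (forall z, cmod z < s -> L (k z) (k z) = 0) ->
  forall z w, cmod z < s -> cmod w < s -> L (k z) (k w) = 0.
Proof.
move=> Ldiag; have [kap [C [C0 kapH ks]]] := kernel_series.
pose x z := (winding s z)^*%C *: k z.
pose xN N z := \sum_(j < N) (z^*%C ^+ j) *: kap j.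
have xH z : cmod z < s -> H (x z) by move=> zs; apply: hZ => //; exact/kH/cmod_sq.
have xNH N z : H (xN N z) by apply: hsum => // j _; exact: hZ.
have LxN N z w : L (xN N z) (xN N w) =
    \sum_(i < N) \sum_(j < N) z^*%C ^+ i * (w ^+ j * L (kap i) (kap j)).
  rewrite form_suml//; apply: eq_bigr => i _.
  rewrite form_sumr// mulr_sumr; apply: eq_bigr => j _.
  by rewrite conjcX conjcK.
have l0 m : forall i j, (i + j = m)%N -> L (kap i) (kap j) = 0.
  elim/ltn_ind: m => m IH i j ijm.
  suff key : forall i, (i <= m)%N -> L (kap i) (kap (m - i)%N) = 0.
    by rewrite -(key i) -?ijm ?leq_addr// addKn.
  apply: conj_poly_eq0 => w; apply/eqP; rewrite -cmod_eq0 eq_le cmod_ge0 andbT.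
  (* For [t < r] the number [q = t (|w| + 1)] dominates [|z|] and stays below [1] and [s / 2]. *)
  pose r := Num.min 1 (s / 2) / (cmod w + 1).
  have w10 : 0 < cmod w + 1 by rewrite ltr_wpDl.
  have r0 : 0 < r by rewrite divr_gt0// lt_min divr_gt0// ltr01.
  pose N := m.+1.
  pose B1 := \sum_(j < N) nrm (kap j).
  have B10 : 0 <= B1 by rewrite sumr_ge0.
  pose dl := C / (s / 2) / s ^+ N.
  have dl0 : 0 <= dl by rewrite !divr_ge0 ?exprn_ge0 ?(ltW s0).
  pose B := B1 + dl; have B0 : 0 <= B by rewrite addr_ge0.
  pose B2 := \sum_(i < N) \sum_(j < N) cmod (L (kap i) (kap j)).
  have B20 : 0 <= B2 by rewrite sumr_ge0// => i' _; rewrite sumr_ge0.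
  pose D := (CL * B * (dl + dl) + B2) * (cmod w + 1) ^+ N.
  apply: (@le_small R _ D r r0).
    by rewrite /D mulr_ge0 ?exprn_ge0 ?(ltW w10)// addr_ge0// !mulr_ge0// addr_ge0.
  move=> t t0 tr; pose z : R[i] := t%:C%C * w.
  have ct : cmod z = t * cmod w by rewrite cmodM cmodr ger0_norm ?ltW.
  pose q := t * (cmod w + 1).
  have q0 : 0 < q by rewrite mulr_gt0.
  have zq : cmod z <= q by rewrite ct ler_wpM2l ?(ltW t0)// lerDl.
  have : q < Num.min 1 (s / 2) by rewrite /q -ltr_pdivlMr.
  rewrite lt_min => /andP[q1 qs].
  have zs : cmod z < s by lra.
  have hx := ks z N zs; rewrite -/(x z) -/(xN N z) in hx.
  have dlq : nrm (x z - xN N z) <= dl * q ^+ N.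
    apply: (le_trans hx).
    rewrite (_ : dl * q ^+ N = C / (s / 2) * (q / s) ^+ N); last first.
      by rewrite /dl expr_div_n; ring.
    apply: ler_pM.
    - by rewrite divr_ge0// subr_ge0 ltW.
    - by rewrite exprn_ge0// divr_ge0 ?(ltW s0).
    - by rewrite ler_wpM2l// lef_pV2 ?posrE ?divr_gt0 ?subr_gt0//; lra.
    - rewrite lerXn2r ?nnegrE ?divr_ge0 ?(ltW q0) ?(ltW s0)//.
      by rewrite ler_wpM2r ?invr_ge0 ?(ltW s0).
  have qN1 : q ^+ N <= 1 by rewrite exprn_ile1// ltW.
  have z1 : cmod z <= 1 by lra.
  have xNB : nrm (xN N z) <= B1.
    apply: (le_trans (hnorm_sum HH _ _)); first by move=> j' _; exact: hZ.
    apply: ler_sum => j' _; rewrite (hnormZ HH)// cmodX cmodJ.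
    by rewrite ler_piMl// exprn_ile1.
  have xB : nrm (x z) <= B.
    rewrite -[x z](subrK (xN N z)) addrC; apply: (le_trans (hnormD HH _ _)) => //.
      exact/(hsubr HH)/xNH/xH.
    by rewrite lerD// (le_trans dlq)// ler_piMr.
  have kz := kH (cmod_sq zs).
  have Lx0 : L (x z) (x z) = 0.
    by rewrite /x formZl ?formZr ?Ldiag ?mulr0//; exact: hZ.
  (* Truncation after [N = m + 1] terms changes the value [L (x z) (x z) = 0] only by a multiple of
     [q^N]. *)
  have h1 : cmod (L (xN N z) (xN N z)) <= CL * B * (dl * q ^+ N + dl * q ^+ N).
    rewrite -cmodN -[- _]add0r -Lx0.
    apply: form_close => //; [exact: xH|exact: xH|].
    by apply: (le_trans xNB); rewrite lerDl.
  (* Only the terms of degree [m], where [j = rev_ord i], are kept: those of lower degree vanish by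
     induction and those of higher degree are bounded by multiples of [q^N]. *)
  have h2 : cmod (\sum_(i < N) z^*%C ^+ i * (z ^+ (m - i) * L (kap i) (kap (m - i)%N)))
      <= cmod (L (xN N z) (xN N z)) + B2 * q ^+ N.
    rewrite [X in cmod X](_ : _ = L (xN N z) (xN N z) - \sum_(i < N)
        \sum_(j < N | j != rev_ord i) z^*%C ^+ i * (z ^+ j * L (kap i) (kap j))); last first.
      rewrite LxN -sumrB; apply: eq_bigr => i' _.
      by rewrite [X in _ = X - _](bigD1 (rev_ord i'))//= addrK subSS.
    apply: (le_trans (cmodB _ _)); rewrite lerD2l.
    apply: (le_trans (cmod_sum _ _ _)); rewrite /B2 mulr_suml; apply: ler_sum => i' _.
    apply: (le_trans (cmod_sum _ _ _)); rewrite mulr_suml.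
    rewrite [leRHS](bigID (fun j => j != rev_ord i'))/=; apply: ler_wpDr.
      by rewrite sumr_ge0// => j' _; rewrite mulr_ge0 ?exprn_ge0 ?(ltW q0).
    apply: ler_sum => j' jr.
    have [lt|ge] := ltnP (i' + j') m.
      by rewrite (IH (i' + j')%N lt)// !mulr0 cmod0 mulr_ge0 ?exprn_ge0 ?(ltW q0).
    have {ge} : (N <= i' + j')%N.
      rewrite ltn_neqAle ge andbT; apply: contra jr => /eqP e; apply/eqP/val_inj => /=.
      by rewrite subSS e addKn.
    move=> ge; rewrite !cmodM !cmodX cmodJ mulrA -exprD mulrC ler_wpM2l//.
    apply: (@le_trans _ _ (q ^+ (i' + j'))); first by rewrite lerXn2r ?nnegrE ?(ltW q0).
    by rewrite ler_wiXn2l ?(ltW q0) ?(ltW q1).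
  have zJ : z^*%C = t%:C%C * w^*%C by rewrite /z conjcM conjc_real.
  have h3 : \sum_(i < N) z^*%C ^+ i * (z ^+ (m - i) * L (kap i) (kap (m - i)%N)) =
      (t%:C%C ^+ m) * \sum_(j0 < m.+1) w^*%C ^+ j0 * w ^+ (m - j0) * L (kap j0) (kap (m - j0)%N).
    rewrite mulr_sumr; apply: eq_bigr => i' _; rewrite zJ /z !exprMn.
    have im : (i' <= m)%N by rewrite -ltnS.
    have -> : t%:C%C ^+ m = t%:C%C ^+ i' * t%:C%C ^+ (m - i') by rewrite -exprD subnKC.
    by ring.
  move: h2; rewrite h3 cmodM cmodX cmodr (ger0_norm (ltW t0)) => h2.
  rewrite -(ler_pM2l (exprn_gt0 m t0)); apply: (le_trans h2).
  apply: (@le_trans _ _ (CL * B * (dl * q ^+ N + dl * q ^+ N) + B2 * q ^+ N)).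
    by rewrite lerD2r.
  rewrite le_eqVlt; apply/orP; left; apply/eqP.
  by rewrite /D /q /N exprMn [t ^+ m.+1]exprS; ring.
move=> z w zs ws.
have LxN0 N : L (xN N z) (xN N w) = 0.
  rewrite LxN big1// => i _; rewrite big1// => j _.
  by rewrite (l0 _ i j erefl) !mulr0.
pose dz u N := C / (s - cmod u) * (cmod u / s) ^+ N.
have su u : cmod u < s -> 0 < s - cmod u by move=> us; rewrite subr_gt0.
have dz0 u N : cmod u < s -> 0 <= dz u N.
  by move=> us; rewrite mulr_ge0 ?exprn_ge0 ?divr_ge0 ?(ltW s0) ?(ltW (su _ us)).
pose B := nrm (x w) + nrm (x z) + C / (s - cmod z).
have B0 : 0 <= B by rewrite !addr_ge0// divr_ge0// ltW// su.
have h : cmod (L (x z) (x w)) <= 0.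
  apply: null_seq_le0.
  have nz u : cmod u < s -> null_seq (dz u).
    move=> us; apply: geometric_null.
    - by rewrite divr_ge0// ltW// su.
    - by rewrite divr_ge0 ?(ltW s0).
    - by rewrite ltr_pdivrMr// mul1r.
  apply: null_seq_le (null_seqZ (_ : 0 <= CL * B) (null_seqD (nz z zs) (nz w ws))); last first.
    exact: mulr_ge0.
  move=> N; rewrite -[L _ _]subr0 -(LxN0 N).
  apply: form_close => //; [exact: xH|exact: xH|exact: ks|exact: ks|..].
    by rewrite /B -addrA lerDl addr_ge0// divr_ge0// ltW// su.
  rewrite -[xN N z](subrK (x z)); apply: (le_trans (hnormD HH (hsubr HH (xNH N z) (xH z zs)) (xH z zs))).
  rewrite (hnormBC HH (xNH N z) (xH z zs)) /B addrC -addrA.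
  apply: (@le_trans _ _ (nrm (x z) + C / (s - cmod z))); last by rewrite lerDr.
  rewrite lerD2l; apply: (le_trans (ks z N zs)).
  rewrite ler_piMr ?divr_ge0 ?(ltW (su z zs))// exprn_ile1 ?divr_ge0 ?(ltW s0)//.
  by rewrite ler_pdivrMr// mul1r ltW.
have kz := kH (cmod_sq zs); have kw := kH (cmod_sq ws).
have : cmod (L (x z) (x w)) == 0 by rewrite eq_le h cmod_ge0.
rewrite cmod_eq0 /x formZl ?formZr//; last exact: hZ.
rewrite conjcK !mulf_eq0 conjc_eq0 (negbTE (winding_neq0 s0 zs)).
by rewrite (negbTE (winding_neq0 s0 ws)) => /eqP.
Qed.

End kernel_series.

(** * Square-integrable functions and Schur's test *)

Section complex_measurable.
Context d (T : measurableType d) (R : realType).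
Implicit Types (f g : T -> R[i]).

Definition cmeas f := measurable_fun setT (fun x => cRe (f x)) /\
  measurable_fun setT (fun x => cIm (f x)).

Lemma cmeas_cst (k : R[i]) : cmeas (fun=> k).
Proof. by split; exact: measurable_cst. Qed.

Lemma cmeas_real (u : T -> R) : measurable_fun setT u -> cmeas (fun x => (u x)%:C%C).
Proof. by move=> mu; split => //=; exact: measurable_cst. Qed.

Lemma cmeasD f g : cmeas f -> cmeas g -> cmeas (fun x => f x + g x).
Proof.
move=> [f1 f2] [g1 g2]; split; [under eq_fun do rewrite cReD|under eq_fun do rewrite cImD];
  exact: measurable_funD.
Qed.

Lemma cmeasM f g : cmeas f -> cmeas g -> cmeas (fun x => f x * g x).
Proof.
move=> [f1 f2] [g1 g2]; split; [under eq_fun do rewrite cReM|under eq_fun do rewrite cImM].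
  by apply: measurable_funB; exact: measurable_funM.
by apply: measurable_funD; exact: measurable_funM.
Qed.

Lemma cmeasJ f : cmeas f -> cmeas (fun x => (f x)^*%C).
Proof.
move=> [f1 f2]; split; [under eq_fun do rewrite cReJ|under eq_fun do rewrite cImJ] => //.
exact: measurable_funN.
Qed.

Lemma cmeasN f : cmeas f -> cmeas (fun x => - f x).
Proof.
move=> [f1 f2]; split; [under eq_fun do rewrite cReN|under eq_fun do rewrite cImN];
  exact: measurable_funN.
Qed.

Lemma cmeas_sum I (r : seq I) (F : I -> T -> R[i]) : (forall i, cmeas (F i)) ->
  cmeas (fun x => \sum_(i <- r) F i x).
Proof.
move=> mF; elim: r => [|i r IH].
  by under eq_fun do rewrite big_nil; exact: cmeas_cst.
by under eq_fun do rewrite big_cons; exact: cmeasD.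
Qed.

Lemma cmeas_cmod2 f : cmeas f -> measurable_fun setT (fun x => cmod (f x) ^+ 2).
Proof.
move=> [f1 f2]; under eq_fun do rewrite cmodE.
by apply: measurable_funD; exact: measurable_funX.
Qed.

Lemma cmeas_cmod f : cmeas f -> measurable_fun setT (fun x => cmod (f x)).
Proof.
move=> mf; under eq_fun do rewrite -[cmod _]ger0_norm// -sqrtr_sqr.
apply: (measurableT_comp (f := @Num.sqrt R)); last exact: cmeas_cmod2.
by apply: continuous_measurable_fun; exact: sqrt_continuous.
Qed.

Lemma cmeas_cvg (h : nat -> T -> R[i]) f : (forall n, cmeas (h n)) ->
  (forall x, null_seq (fun n => cmod (h n x - f x))) -> cmeas f.
Proof.
move=> mh hf; split.
  apply: (@measurable_fun_cvg _ _ _ setT (fun n x => cRe (h n x))).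
    by move=> n; have [] := mh n.
  move=> x _; apply/cvgrPdistC_lt => e e0; have [N hN] := hf x e e0.
  exists N => // n /hN; apply: le_lt_trans; rewrite -cReB; exact: normr_cRe.
apply: (@measurable_fun_cvg _ _ _ setT (fun n x => cIm (h n x))).
  by move=> n; have [] := mh n.
move=> x _; apply/cvgrPdistC_lt => e e0; have [N hN] := hf x e e0.
exists N => // n /hN; apply: le_lt_trans; rewrite -cImB; exact: normr_cIm.
Qed.

End complex_measurable.

Section complex_integral.
Context d (T : measurableType d) (R : realType) (mu : {measure set T -> \bar R}).
Implicit Types (f g : T -> R[i]) (u v : T -> R).
Local Notation int u := (mu.-integrable setT (EFin \o u)).

Definition cinteg f : R[i] :=
  ((\int[mu]_x cRe (f x)) +i* (\int[mu]_x cIm (f x)))%C.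

Definition cintegrable f := int (fun x => cRe (f x)) /\ int (fun x => cIm (f x)).

Lemma int_le u v : measurable_fun setT u -> int v -> (forall x, `|u x| <= v x) -> int u.
Proof.
move=> mu' iv uv; apply: le_integrable iv => //.
  exact/measurable_EFinP.
move=> x _ /=; rewrite lee_fin; apply: le_trans (uv x) (ler_norm _).
Qed.

Lemma cintegrable_le f v : cmeas f -> int v -> (forall x, cmod (f x) <= v x) -> cintegrable f.
Proof.
move=> [f1 f2] iv fv; split; apply: int_le iv _ => // x; apply: le_trans (fv x).
  exact: normr_cRe.
exact: normr_cIm.
Qed.

Lemma intD u v : int u -> int v -> int (fun x => u x + v x).
Proof. by move=> iu iv; apply: eq_integrable (integrableD measurableT iu iv). Qed.

Lemma intZ (a : R) u : int u -> int (fun x => a * u x).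
Proof. by move=> iu; apply: eq_integrable (integrableZl measurableT a iu). Qed.

Lemma intB u v : int u -> int v -> int (fun x => u x - v x).
Proof. by move=> iu iv; apply: eq_integrable (integrableB measurableT iu iv). Qed.

Lemma cintegL (a : R[i]) f g : cintegrable f -> cintegrable g ->
  cinteg (fun x => a * f x + g x) = a * cinteg f + cinteg g.
Proof.
move=> [f1 f2] [g1 g2]; apply: complex_ext; rewrite ?cReD ?cImD ?cReM ?cImM/=.
  under eq_Rintegral do rewrite cReD cReM.
  rewrite RintegralD// ?RintegralB// ?RintegralZl//; try exact: intZ.
  by apply: intB; exact: intZ.
under eq_Rintegral do rewrite cImD cImM.
rewrite RintegralD// ?RintegralD// ?RintegralZl//; try exact: intZ.
by apply: intD; exact: intZ.
Qed.

Lemma cintegrableL (a : R[i]) f g : cintegrable f -> cintegrable g ->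
  cintegrable (fun x => a * f x + g x).
Proof.
move=> [f1 f2] [g1 g2]; split.
  under eq_fun do rewrite cReD cReM.
  by apply: intD => //; apply: intB; exact: intZ.
under eq_fun do rewrite cImD cImM.
by apply: intD => //; apply: intD; exact: intZ.
Qed.

Lemma cintegJ f : cintegrable f -> cinteg (fun x => (f x)^*%C) = (cinteg f)^*%C.
Proof.
move=> [f1 f2]; rewrite /cinteg /=; congr (_ +i* _)%C.
  by apply: eq_Rintegral => x _; rewrite cReJ.
rewrite -[RHS]mulN1r -RintegralZl//.
by apply: eq_Rintegral => x _; rewrite cImJ mulN1r.
Qed.

Lemma cinteg_ext f g : f =1 g -> cinteg f = cinteg g.
Proof. by move=> fg; congr (_ +i* _)%C; apply: eq_Rintegral => x _; rewrite fg. Qed.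

Lemma cinteg_le f v : cmeas f -> int v -> (forall x, cmod (f x) <= v x) ->
  cmod (cinteg f) <= 2 * \int[mu]_x v x.
Proof.
move=> mf iv fv; have [i1 i2] := cintegrable_le mf iv fv.
apply: (le_trans (cmod_leRI _)) => /=; rewrite mulr_natl mulr2n.
apply: lerD; apply: (le_trans (le_normr_Rintegral _ _)) => //;
  apply: le_Rintegral => //; try exact: integrable_norm.
  by move=> x _; exact: le_trans (normr_cRe _) (fv x).
by move=> x _; exact: le_trans (normr_cIm _) (fv x).
Qed.

Lemma Rint_ge0E u : (forall x, 0 <= u x) -> int u ->
  (\int[mu]_x u x)%:E = (\int[mu]_x (u x)%:E)%E.
Proof. by move=> u0 iu; rewrite /Rintegral fineK//; exact: integrable_fin_num. Qed.

Lemma int_lty u : measurable_fun setT u -> (forall x, 0 <= u x) ->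
  (\int[mu]_x (u x)%:E < +oo)%E -> int u.
Proof.
move=> mu' u0 h; apply/integrableP; split; first exact/measurable_EFinP.
by under eq_integral do rewrite /= ger0_norm//.
Qed.

Lemma int_lt u : int u -> (forall x, 0 <= u x) -> (\int[mu]_x (u x)%:E < +oo)%E.
Proof.
move=> /integrableP[_ h] u0; apply: le_lt_trans h.
rewrite le_eqVlt; apply/orP; left; apply/eqP.
by apply: eq_integral => x _ /=; rewrite ger0_norm.
Qed.

End complex_integral.

Section scalar_L2.
Context d (T : measurableType d) (R : realType) (mu : {measure set T -> \bar R}).
Implicit Types (f g : T -> R[i]^o) (u v : T -> R).
Local Notation int u := (mu.-integrable setT (EFin \o u)).

Definition sqint f : \bar R := (\int[mu]_x ((cmod (f x)) ^+ 2)%:E)%E.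

Definition L2 : hspace (T -> R[i]^o) :=
  HSpace [set f | cmeas f /\ (sqint f < +oo)%E]
         (fun f g => cinteg mu (fun x => f x * (g x)^*%C)).

Lemma L2_int f : L2 f -> int (fun x => cmod (f x) ^+ 2).
Proof.
by move=> [mf h]; apply: int_lty => //; [exact: cmeas_cmod2|move=> x; exact: sqr_ge0].
Qed.

Lemma L2P f : cmeas f -> int (fun x => cmod (f x) ^+ 2) -> L2 f.
Proof. by move=> mf h; split => //; apply: int_lt => // x; exact: sqr_ge0. Qed.

Lemma cmod_mul_le (x y : R[i]) : cmod (x * y^*%C) <= cmod x ^+ 2 + cmod y ^+ 2.
Proof.
rewrite cmodM cmodJ; have := sqr_ge0 (cmod x - cmod y); have := cmod_ge0 x.
have := cmod_ge0 y; rewrite !expr2; nra.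
Qed.

Lemma L2_cint f g : L2 f -> L2 g -> cintegrable mu (fun x => f x * (g x)^*%C).
Proof.
move=> hf hg; apply: (@cintegrable_le _ _ _ _ _ (fun x => cmod (f x) ^+ 2 + cmod (g x) ^+ 2)).
- by apply: cmeasM; [exact: (proj1 hf)|apply: cmeasJ; exact: (proj1 hg)].
- by apply: intD; exact: L2_int.
- by move=> x; exact: cmod_mul_le.
Qed.

Lemma cmod_add2 (x y : R[i]) : cmod (x + y) ^+ 2 <= 2 * cmod x ^+ 2 + 2 * cmod y ^+ 2.
Proof.
apply: (@le_trans _ _ ((cmod x + cmod y) ^+ 2)).
  by rewrite ler_sqr ?nnegrE ?addr_ge0// cmodD.
have := sqr_ge0 (cmod x - cmod y); rewrite !expr2; nra.
Qed.

Lemma L2_lin (a : R[i]) f g : L2 f -> L2 g -> L2 (a *: f + g).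
Proof.
move=> hf hg; have mfg : cmeas (a *: f + g).
  apply: cmeasD; last exact: (proj1 hg).
  by apply: cmeasM; [exact: cmeas_cst|exact: (proj1 hf)].
apply: L2P => //; apply: (@int_le _ _ _ _ _
  (fun x => 2 * (cmod a ^+ 2 * cmod (f x) ^+ 2) + 2 * cmod (g x) ^+ 2)).
- exact: cmeas_cmod2.
- by apply: intD; do ?apply: intZ; exact: L2_int.
move=> x; rewrite ger0_norm ?sqr_ge0// -exprMn -cmodM.
exact: cmod_add2.
Qed.

Lemma hip_L2ff f : hip L2 f f = (\int[mu]_x (cmod (f x) ^+ 2))%:C%C.
Proof.
rewrite /= /cinteg; congr (_ +i* _)%C.
  by apply: eq_Rintegral => x _; rewrite mulcJ.
transitivity (\int[mu]_x (0 : R)); last by rewrite Rintegral_cst ?mul0r.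
by apply: eq_Rintegral => x _; rewrite mulcJ.
Qed.

Lemma L2_ph : prehilbert L2.
Proof.
split.
- split; first exact: cmeas_cst.
  by rewrite /sqint integral0_eq ?lt0y// => x _; rewrite cmod0 expr0n.
- exact: L2_lin.
- move=> a f g h hf hg hh /=; rewrite -cintegL; try exact: L2_cint.
  by apply: cinteg_ext => x; rewrite !fctE mulrDl -mulrA.
- move=> f g hf hg.
  apply: etrans (_ : cinteg mu (fun x => (f x * (g x)^*%C)^*%C) = _); last first.
    exact/cintegJ/L2_cint.
  by apply: cinteg_ext => x; rewrite conjcM conjcK mulrC.
- by move=> f hf; rewrite hip_L2ff /= Rintegral_ge0// => x _; exact: sqr_ge0.
Qed.

Lemma hnorm_L2 f : L2 f -> (hnorm L2 f ^+ 2)%:E = sqint f.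
Proof.
move=> hf; rewrite (hnorm2 L2_ph hf) hip_L2ff /= Rint_ge0E//.
  by move=> x; exact: sqr_ge0.
exact: L2_int.
Qed.

Definition chi (E : set T) f : T -> R[i]^o := fun x => (\1_E x)%:C%C * f x.

Lemma chi_in E f x : E x -> chi E f x = f x.
Proof. by move=> Ex; rewrite /chi indicE mem_set// mul1r. Qed.

Lemma chi_out E f x : ~ E x -> chi E f x = 0.
Proof. by move=> Ex; rewrite /chi indicE memNset// mul0r. Qed.

Lemma cmod_chi E f x : cmod (chi E f x) ^+ 2 = \1_E x * cmod (f x) ^+ 2.
Proof.
rewrite cmodM cmodr exprMn ger0_norm//; congr (_ * _).
by rewrite indicE; case: (_ \in _); rewrite ?expr1n ?expr0n.
Qed.

Lemma L2_chi E f : measurable E -> L2 f -> L2 (chi E f).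
Proof.
move=> mE hf; have mc : cmeas (chi E f).
  apply: cmeasM; last exact: (proj1 hf).
  by apply: cmeas_real; exact: measurable_indic.
apply: L2P => //; apply: (int_le _ (L2_int hf)); first exact: cmeas_cmod2.
move=> x; rewrite ger0_norm ?sqr_ge0// cmod_chi ler_piMl ?sqr_ge0//.
Qed.

Lemma sqint_chi E f : sqint (chi E f) = (\int[mu]_x (\1_E x * cmod (f x) ^+ 2)%:E)%E.
Proof. by apply: eq_integral => x _; rewrite cmod_chi. Qed.

Lemma hnorm_chi E f : measurable E -> L2 f -> hnorm L2 (chi E f) <= hnorm L2 f.
Proof.
move=> mE hf; rewrite -ler_sqr ?nnegrE// -lee_fin !hnorm_L2//; last exact: L2_chi.
apply: ge0_le_integral => //.
- by move=> x _; rewrite lee_fin sqr_ge0.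
- by apply/measurable_EFinP; apply: cmeas_cmod2; exact: (proj1 (L2_chi mE hf)).
- by apply/measurable_EFinP; apply: cmeas_cmod2; exact: (proj1 hf).
move=> x _; rewrite lee_fin cmod_chi ler_piMl ?sqr_ge0//.
Qed.

End scalar_L2.

(** * Integration against a density *)

Section density.
Context d (T : measurableType d) (R : realType) (mu : {measure set T -> \bar R}).
Variables (w : T -> R) (mw : measurable_fun setT w) (w0 : forall x, 0 <= w x).

Definition wmeas (E : set T) : \bar R := (\int[mu]_(x in E) (w x)%:E)%E.

Let wm0 : wmeas set0 = 0%E.
Proof. by rewrite /wmeas integral_set0. Qed.

Let wm_ge0 E : (0 <= wmeas E)%E.
Proof. by apply: integral_ge0 => x _; rewrite lee_fin. Qed.

Let wm_sigma : semi_sigma_additive wmeas.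
Proof.
move=> F mF tF mU; rewrite /wmeas ge0_integral_bigcup//.
- apply: is_cvg_ereal_nneg_natsum_cond => n _ _.
  by apply: integral_ge0 => x _; rewrite lee_fin.
- by apply/measurable_EFinP; exact: measurable_funTS.
- by move=> x _; rewrite lee_fin.
Qed.

Definition wmeasure : {measure set T -> \bar R} :=
  HB.pack wmeas (isMeasure.Build _ _ _ wmeas wm0 wm_ge0 wm_sigma).

Lemma wmeas_indic E : measurable E -> wmeas E = (\int[mu]_x (\1_E x * w x)%:E)%E.
Proof.
move=> mE; rewrite /wmeas integral_mkcond; apply: eq_integral => x _.
by rewrite /patch indicE; case: (_ \in _); rewrite ?mul1r ?mul0r.
Qed.

Import HBNNSimple.

Let integral_wmeas_nnsfun (h : {nnsfun T >-> R}) :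
  (\int[wmeasure]_x (h x)%:E = \int[mu]_x (h x * w x)%:E)%E.
Proof.
under [LHS]eq_integral do rewrite fimfunE -fsumEFin//.
rewrite [LHS]ge0_integral_fsum//; last 2 first.
  - by move=> r; exact/measurable_EFinP/measurableT_comp.
  - by move=> n x _; rewrite EFinM nnfun_muleindic_ge0.
under [RHS]eq_integral.
  move=> x xD; rewrite EFinM muleC fimfunE -fsumEFin// ge0_mule_fsumr; last first.
    by move=> r; rewrite EFinM nnfun_muleindic_ge0.
  over.
rewrite [RHS]ge0_integral_fsum//; last 2 first.
  - move=> r; apply: emeasurable_funM; first exact/measurable_EFinP.
    exact/measurable_EFinP/measurableT_comp.
  - move=> n x _; apply: mule_ge0; first by rewrite lee_fin.
    by rewrite EFinM nnfun_muleindic_ge0.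
apply: eq_fsbigr => r _; have [r0|r0] := leP 0 r; last first.
  rewrite preimage_nnfun0// !integral0_eq// => x _;
    by rewrite indicE in_set0 mulr0 ?mule0.
have mA : measurable (h @^-1` [set r]) by exact: measurable_sfunP.
under eq_integral do rewrite EFinM.
rewrite ge0_integralZl//; last by apply/measurable_EFinP; exact: measurable_indic.
under [RHS]eq_integral do rewrite EFinM muleCA.
rewrite ge0_integralZl//; last 2 first.
  - apply: emeasurable_funM; first exact/measurable_EFinP.
    by apply/measurable_EFinP; exact: measurable_indic.
  - by move=> x _; rewrite mule_ge0 ?lee_fin.
rewrite integral_indic// setIT; congr (_ * _)%E.
rewrite -[LHS]/(wmeas _) (wmeas_indic mA).
by apply: eq_integral => x _; rewrite EFinM muleC.
Qed.

(** Simple functions and monotone convergence. It converts integrals against [lambda] into integrals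
    against [sigma]. *)
Lemma integral_wmeas (f : T -> R) : measurable_fun setT f -> (forall x, 0 <= f x) ->
  (\int[wmeasure]_x (f x)%:E = \int[mu]_x (f x * w x)%:E)%E.
Proof.
move=> mf f0; have mEf : measurable_fun setT (fun x => (f x)%:E) by exact/measurable_EFinP.
pose f_ := nnsfun_approx measurableT mEf.
have fcvg x : (fun n => (f_ n x)%:E) @ \oo --> (f x)%:E.
  by apply: cvg_nnsfun_approx => // y _; rewrite lee_fin.
have fnd x : {homo (fun n => f_ n x) : a b / (a <= b)%N >-> a <= b}.
  by move=> a b ab; apply/lefP; exact: nd_nnsfun_approx.
transitivity (limn (fun n => \int[wmeasure]_x (f_ n x)%:E)%E).
  rewrite -monotone_convergence//=.
  - have E x : limn (fun n => (f_ n x)%:E) = (f x)%:E by exact/cvg_lim.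
    by congr integral; apply/funext => x; rewrite E.
  - by move=> n; exact/measurable_EFinP.
  - by move=> n x _; rewrite lee_fin.
  - by move=> x _ a b ab; rewrite lee_fin fnd.
have -> : (fun n => \int[wmeasure]_x (f_ n x)%:E)%E =
    (fun n => \int[mu]_x (f_ n x * w x)%:E)%E.
  by apply/funext => n; exact: integral_wmeas_nnsfun.
rewrite -monotone_convergence//=.
- apply: eq_integral => x _; apply/cvg_lim => //.
  under eq_fun do rewrite EFinM; rewrite EFinM.
  by apply: cvgeMr => //; exact: fcvg.
- by move=> n; apply/measurable_EFinP; exact: measurable_funM.
- by move=> n x _; rewrite lee_fin mulr_ge0.
- by move=> x _ a b ab; rewrite lee_fin ler_wpM2r ?fnd.
Qed.

End density.

Section dominated.
Context d (T : measurableType d) (R : realType) (mu : {measure set T -> \bar R}).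

Lemma dominated_null (h : nat -> T -> R) (v : T -> R) :
  (forall m, measurable_fun setT (h m)) -> mu.-integrable setT (EFin \o v) ->
  (forall m x, 0 <= h m x <= v x) -> (forall x, null_seq (h ^~ x)) ->
  forall e : R, 0 < e -> exists N, forall m, (N <= m)%N ->
    (\int[mu]_x (h m x)%:E <= e%:E)%E.
Proof.
move=> mh iv hv h0 e e0.
have [] := @dominated_convergence _ _ _ mu setT measurableT (fun m x => (h m x)%:E)
  (cst 0%E) (EFin \o v).
- by move=> m; exact/measurable_EFinP.
- exact: measurable_cst.
- apply: aeW => x _ /=; apply: cvg_EFin; first exact: nearW.
  apply/cvgrPdist_lt => a a0; have [N hN] := h0 x a a0.
  exists N => // m /hN; rewrite /= sub0r normrN ger0_norm//.
  by have /andP[] := hv m x.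
- by [].
- apply: aeW => m x _ /=; rewrite lee_fin ger0_norm; by have /andP[] := hv x m.
move=> _ + _ => /fine_cvgP[_ /cvgrPdist_lt /(_ _ e0)[N _ hN]].
exists N => // m Nm; have := hN m Nm; rewrite /= sub0r normrN.
have -> : (\int[mu]_x `|(h m x)%:E - cst 0%E x| = \int[mu]_x (h m x)%:E)%E.
  by apply: eq_integral => x _; rewrite sube0 gee0_abs// lee_fin; have /andP[] := hv m x.
have im : mu.-integrable setT (EFin \o h m).
  apply: int_le iv _ => // x; rewrite ger0_norm; by have /andP[] := hv m x.
move=> /ltW; rewrite -[fine _]/(\int[mu]_x (h m x)) => H.
rewrite -Rint_ge0E//; last by move=> x; have /andP[] := hv m x.
by rewrite lee_fin; apply: le_trans (ler_norm _) H.
Qed.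

(** The inequality on sets compares the push-forward under [phi] with a multiple of the measure, and
    this passes to integrals. It replaces a change of variables when [lambda] is only
    quasi-invariant. *)
Lemma wmeas_chg (w : T -> R) (mw : measurable_fun setT w) (w0 : forall x, 0 <= w x)
    (phi : T -> T) (mphi : measurable_fun setT phi) (C : R) : 0 <= C ->
  (forall E, measurable E -> (wmeas mu w (phi @^-1` E) <= C%:E * wmeas mu w E)%E) ->
  forall g : T -> R, measurable_fun setT g -> (forall x, 0 <= g x) ->
  (\int[mu]_x (g (phi x) * w x)%:E <= C%:E * \int[mu]_x (g x * w x)%:E)%E.
Proof.
move=> C0 hC g mg g0; rewrite -!(integral_wmeas mu mw w0)//; last exact: measurableT_comp.
have -> : (\int[wmeasure mu mw w0]_x (g (phi x))%:E =
    \int[pushforward (wmeasure mu mw w0) phi]_x (g x)%:E)%E.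
  by rewrite ge0_integral_pushforward//; [exact/measurable_EFinP|move=> y _; rewrite lee_fin].
pose c := NngNum C0.
rewrite -ge0_integralZl//; last 2 first.
- exact/measurable_EFinP.
- by move=> x _; rewrite lee_fin.
have E : (\int[mscale c (wmeasure mu mw w0)]_x (g x)%:E =
   \int[wmeasure mu mw w0]_x (C%:E * (g x)%:E))%E.
  rewrite ge0_integral_mscale//; last by move=> x _; rewrite lee_fin.
    by rewrite ge0_integralZl//; [exact/measurable_EFinP|move=> x _; rewrite lee_fin].
  exact/measurable_EFinP.
rewrite -E; apply: ge0_le_measure_integral => //.
exact/measurable_EFinP.
Qed.

End dominated.

(** * Schur's test *)

Section schur_test.
Context d (T : measurableType d) (R : realType) (mu : {sigma_finite_measure set T -> \bar R}).
Variables (k : T * T -> R) (p : T -> R) (dl : R).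
Hypotheses (mk : measurable_fun setT k) (mp : measurable_fun setT p).
Hypotheses (k0 : forall x, 0 <= k x) (p0 : forall x, 0 < p x) (dl0 : 0 < dl).
Hypothesis k1 : forall w, (\int[mu]_u (k (w, u) * p u)%:E <= (dl * p w)%:E)%E.
Hypothesis k2 : forall u, (\int[mu]_w (k (w, u) * p w)%:E <= (dl * p u)%:E)%E.

Lemma schur_test (f g : T -> R) : measurable_fun setT f -> measurable_fun setT g ->
  (forall x, 0 <= f x) -> (forall x, 0 <= g x) ->
  (forall w, (g w)%:E <= \int[mu]_u (k (w, u) * f u)%:E)%E ->
  (\int[mu]_w (g w ^+ 2)%:E <= (dl ^+ 2)%:E * \int[mu]_u (f u ^+ 2)%:E)%E.
Proof.
move=> mf mg f0 g0 gk.
have mkw w : measurable_fun setT (fun u => k (w, u)) by exact: measurableT_comp.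
have mku u : measurable_fun setT (fun w => k (w, u)) by exact: measurableT_comp.
have mpV : measurable_fun setT (fun u => (p u)^-1).
  under eq_fun do rewrite -powR_inv1 ?(ltW (p0 _))//.
  exact: (measurableT_comp (measurable_powR (-1)) mp).
have mq : measurable_fun setT (fun u => f u ^+ 2 / p u).
  by apply: measurable_funM => //; exact: measurable_funX.
pose G w := (\int[mu]_u (k (w, u) * (f u ^+ 2 / p u))%:E)%E.
have mh : measurable_fun setT (fun x : T * T => (p x.1 * (k x * (f x.2 ^+ 2 / p x.2)))%:E).
  apply/measurable_EFinP; apply: measurable_funM; first exact: measurableT_comp.
  by apply: measurable_funM => //; apply: (measurableT_comp mq).
have mG : measurable_fun setT G.
  apply: (measurable_fun_fubini_tonelli_F
    (fun x : T * T => (k x * (f x.2 ^+ 2 / p x.2))%:E)).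
    apply/measurable_EFinP; apply: measurable_funM => //; exact: (measurableT_comp mq).
  by move=> x; rewrite lee_fin mulr_ge0// divr_ge0// ?sqr_ge0// ltW.
have G0 w : (0 <= G w)%E.
  by apply: integral_ge0 => u _; rewrite lee_fin mulr_ge0// divr_ge0// ?sqr_ge0// ltW.
have gG w : ((g w ^+ 2)%:E <= dl%:E * ((p w)%:E * G w))%E.
  have [->|gn0] := eqVneq (g w) 0.
    by rewrite expr0n /=; apply: mule_ge0; [rewrite lee_fin ltW|apply: mule_ge0 => //; rewrite lee_fin ltW].
  have gp : 0 < g w by rewrite lt_def gn0 g0.
  have dp : 0 < dl * p w by rewrite mulr_gt0.
  have a0' : 0 < g w / (dl * p w) by rewrite divr_gt0.
  (* The integral of [2 f <= a p + f^2 / (a p)] against the kernel. Taking [a = g w / (dl p w)]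
     gives what the Cauchy-Schwarz inequality would. *)
  have H (a : R) : 0 < a -> (2%:E * (g w)%:E <= a%:E * (dl * p w)%:E + a^-1%:E * G w)%E.
    move=> a0; apply: (@le_trans _ _ (\int[mu]_u (2 * (k (w, u) * f u))%:E)%E).
      under eq_integral do rewrite EFinM.
      rewrite ge0_integralZl//; last 2 first.
      - by apply/measurable_EFinP; exact: measurable_funM.
      - by move=> u _; rewrite lee_fin mulr_ge0.
      by apply: lee_pmul => //; rewrite ?lee_fin.
    apply: (@le_trans _ _ (\int[mu]_u ((a * (k (w, u) * p u))%:E +
        (a^-1 * (k (w, u) * (f u ^+ 2 / p u)))%:E))%E).
      apply: ge0_le_integral => //.
      - by move=> u _; rewrite lee_fin !mulr_ge0.
      - by apply/measurable_EFinP; do ?apply: measurable_funM.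
      - by apply: emeasurable_funD; apply/measurable_EFinP; do ?apply: measurable_funM => //.
      move=> u _; rewrite -EFinD lee_fin.
      have := p0 u; have ak := mulr_ge0 (k0 (w, u)) (mulr_ge0 (ltW (p0 u)) (sqr_ge0 (a - f u / p u))).
      move=> pu; rewrite -subr_ge0.
      have -> : a * (k (w, u) * p u) + a^-1 * (k (w, u) * (f u ^+ 2 / p u)) - 2 * (k (w, u) * f u)
        = a^-1 * (k (w, u) * (p u * (a - f u / p u) ^+ 2)).
        field; by rewrite !gt_eqF.
      by rewrite mulr_ge0// ltW// invr_gt0.
    rewrite ge0_integralD//; last 4 first.
    - by move=> u _; rewrite lee_fin !mulr_ge0// ltW.
    - by apply/measurable_EFinP; do ?apply: measurable_funM => //.
    - by move=> u _; rewrite lee_fin !mulr_ge0// ?invr_ge0 ?sqr_ge0// ltW.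
    - by apply/measurable_EFinP; do ?apply: measurable_funM => //.
    under eq_integral do rewrite EFinM.
    rewrite ge0_integralZl//; last 3 first.
    - by apply/measurable_EFinP; do ?apply: measurable_funM => //.
    - by move=> u _; rewrite lee_fin !mulr_ge0// ltW.
    - by rewrite lee_fin ltW.
    under [X in (_ + X <= _)%E]eq_integral do rewrite EFinM.
    rewrite ge0_integralZl//; last 3 first.
    - by apply/measurable_EFinP; do ?apply: measurable_funM => //.
    - by move=> u _; rewrite lee_fin !mulr_ge0// ?invr_ge0 ?sqr_ge0// ltW.
    - by rewrite lee_fin ltW// invr_gt0.
    by apply: leeD => //; apply: lee_pmul => //; rewrite ?lee_fin ?(ltW a0)//;
      apply: integral_ge0 => u _; rewrite lee_fin !mulr_ge0// ltW.
  move: (H _ a0') (G0 w); case: (G w) => [r| |] //; last first.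
    by move=> _ _; rewrite !gt0_muley ?lte_fin// leey.
  rewrite -!EFinM -EFinD !lee_fin => {}H r0.
  have dn : dl * p w != 0 by rewrite gt_eqF.
  have : g w * (2 * g w) <= g w * (g w / (dl * p w) * (dl * p w) + (g w / (dl * p w))^-1 * r).
    by rewrite ler_pM2l.
  rewrite divfK// invf_div mulrDr.
  have -> : g w * (dl * p w / g w * r) = dl * (p w * r) by field.
  rewrite expr2; lra.
apply: (@le_trans _ _ (\int[mu]_w (dl%:E * ((p w)%:E * G w)))%E).
  apply: ge0_le_integral => //.
  - by move=> w _; rewrite lee_fin sqr_ge0.
  - by apply/measurable_EFinP; exact: measurable_funX.
  - by apply: emeasurable_funM => //; apply: emeasurable_funM => //; exact/measurable_EFinP.
rewrite ge0_integralZl//; last 3 first.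
- by apply: emeasurable_funM => //; exact/measurable_EFinP.
- by move=> w _; apply: mule_ge0 => //; rewrite lee_fin ltW.
- by rewrite lee_fin ltW.
have -> : (\int[mu]_w ((p w)%:E * G w) =
    \int[mu]_w \int[mu]_u (p w * (k (w, u) * (f u ^+ 2 / p u)))%:E)%E.
  apply: eq_integral => w _; under [RHS]eq_integral do rewrite EFinM.
  rewrite ge0_integralZl//.
  - by apply/measurable_EFinP; apply: measurable_funM.
  - by move=> u _; rewrite lee_fin mulr_ge0// divr_ge0// ?sqr_ge0// ltW.
  - by rewrite lee_fin ltW.
rewrite (fubini_tonelli (fun x : T * T => (p x.1 * (k x * (f x.2 ^+ 2 / p x.2)))%:E))//; last first.
  by move=> x; rewrite lee_fin !mulr_ge0// ?invr_ge0 ?sqr_ge0// ltW.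
rewrite expr2 EFinM -muleA lee_pmul2l ?lte_fin//.
rewrite -ge0_integralZl//; last 3 first.
- by apply/measurable_EFinP; exact: measurable_funX.
- by move=> u _; rewrite lee_fin sqr_ge0.
- by rewrite lee_fin ltW.
apply: ge0_le_integral => //.
- by move=> u _; apply: integral_ge0 => w _; rewrite lee_fin !mulr_ge0// ?invr_ge0 ?sqr_ge0// ltW.
- apply: (measurable_fun_fubini_tonelli_G
   (fun x : T * T => (p x.1 * (k x * (f x.2 ^+ 2 / p x.2)))%:E)) => // x.
  by rewrite lee_fin !mulr_ge0// ?invr_ge0 ?sqr_ge0// ltW.
- by apply: emeasurable_funM => //; apply/measurable_EFinP; exact: measurable_funX.
move=> u _ /=.
have -> : (\int[mu]_w (p w * (k (w, u) * (f u ^+ 2 / p u)))%:E =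
    (f u ^+ 2 / p u)%:E * \int[mu]_w (k (w, u) * p w)%:E)%E.
  rewrite -ge0_integralZl//.
  - by apply: eq_integral => w _; rewrite -EFinM; congr EFin; ring.
  - by apply/measurable_EFinP; apply: measurable_funM.
  - by move=> w _; rewrite lee_fin mulr_ge0// ltW.
  - by rewrite lee_fin divr_ge0 ?sqr_ge0// ltW.
apply: (@le_trans _ _ ((f u ^+ 2 / p u)%:E * (dl * p u)%:E)%E).
  by apply: lee_wpmul2l => //; rewrite lee_fin divr_ge0 ?sqr_ge0 ?ltW.
rewrite -!EFinM lee_fin le_eqVlt; apply/orP; left; apply/eqP.
by field; rewrite gt_eqF.
Qed.

End schur_test.

(** * Analytic functions on a domain *)

Section differentiability.
Context {K : numFieldType} {V W : normedModType K}.

Lemma near_eq_differentiable (f g : V -> W) (x : V) : (\near x, f x = g x) ->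
  differentiable f x -> differentiable g x.
Proof.
move=> fg df; have [cf lf] := (diff_locallyP _ _).1 df.
have gx : g x = f x by rewrite (nbhs_singleton fg).
have fg0 : \forall h \near 0, f (h + x) = g (h + x).
  have := fg; rewrite (near_shift 0).
  by apply: filterS => y; rewrite /= subr0.
have lg : g \o shift x = cst (g x) + 'd f x +o_ 0 id.
  apply/eqaddoP => e e0; move/eqaddoP : lf => /(_ e e0).
  apply: filterS2 fg0 => y E; rewrite !fctE /= E gx.
  exact.
have E := diff_unique cf lg.
by apply/diff_locallyP; rewrite E.
Qed.

End differentiability.

Section complex_diff.
Context {R : realType}.

Lemma complex_gt0 (e : R[i]) : 0 < e -> e = (cRe e)%:C%C /\ 0 < cRe e.
Proof.
by case: e => a b; rewrite ltcE /= => /andP[/eqP -> ->].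
Qed.

Lemma differentiable_cdiff (f : R[i]^o -> R[i]^o) (z : R[i]^o) :
  differentiable f z -> cdiff (f : R[i] -> R[i]) z.
Proof.
move=> df; exists ('d f z 1) => e e0.
have /eqaddoP := diff_locally df => /(_ e%:C%C).
rewrite ltcR => /(_ e0) /nbhs_ballP[r /complex_gt0[rE r0] hr].
exists (cRe r) => // w wz.
have := hr (w - z : R[i]^o).
rewrite /ball /= !fctE /= sub0r normrN rE -!cmod_norm ltcR -rmorphM lecR subrK opprD addrA.
move=> /(_ wz); rewrite -[X in 'd f z X]mulr1 -[_ * 1]/((w - z) *: (1 : R[i]^o)) linearZ.
by rewrite ['d f z 1 * _]mulrC.
Qed.

End complex_diff.

(** * Analytic functions in several variables and the identity theorem *)

Section points.
Context {R : realType} {n : nat} (D : domain R n).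
Local Notation rV := 'rV[R[i]^o]_n.

Definition nearby (r : R) (x y : rV) := forall j, cmod (x 0 j - y 0 j) < r.

Lemma nbhs_rV (x : rV) (A : set rV) :
  nbhs x A <-> exists2 r : R, 0 < r & forall y, nearby r x y -> A y.
Proof.
split.
  move=> /nbhs_ballP[r /complex_gt0[rE r0] hr]; exists (cRe r) => //.
  move=> y xy; apply: hr; split; first by rewrite rE ltcR.
  move=> i j. rewrite ord1.
  by rewrite rE /ball /= -cmod_norm ltcR.
move=> [r r0 hr]; apply/nbhs_ballP; exists r%:C%C; first by rewrite /= ltcR.
move=> y [_ xy]; apply: hr => j; have := xy 0 j.
by rewrite /ball /= -cmod_norm ltcR.
Qed.

Definition inD (x : rV) (Dx : dset D x) : pt D := SigSub (mem_set Dx).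

Lemma valL_in (f : pt D -> R[i]^o) (z : pt D) :
  'valL_ 0 (f : set_type D -> R[i]^o) (set_val z) = f z.
Proof.
by rewrite /valL_ /= oinv_set_val /= valK.
Qed.

Lemma nbhs_pt (z : pt D) (A : set (pt D)) :
  nbhs z A <-> exists2 r : R, 0 < r & forall w : pt D, nearby r (set_val z) (set_val w) -> A w.
Proof.
split.
  move=> [B [ [U oU <-] zU UA] ].
  have /nbhs_rV[r r0 hr] : nbhs (set_val z) U by exact: open_nbhs_nbhs.
  by exists r => // w zw; apply: UA; exact: hr.
move=> [r r0 hr].
exists (set_val @^-1` (interior [set y | nearby r (set_val z) y])).
  split.
  - by exists (interior [set y | nearby r (set_val z) y]) => //; exact: open_interior.
  - by apply/nbhs_rV; exists r.
by move=> w /interior_subset; exact: hr.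
Qed.

Lemma inDK (x : rV) (Dx : dset D x) : set_val (inD Dx) = x.
Proof. by []. Qed.

Lemma pt_in (z : pt D) : dset D (set_val z).
Proof. exact: set_valP. Qed.

Lemma pt_inj (z w : pt D) : set_val z = set_val w -> z = w.
Proof. exact: val_inj. Qed.

Lemma pt_measurability (phi : pt D -> pt D) : continuous phi -> measurable_fun setT phi.
Proof.
move=> cphi; apply: (@measurability _ _ _ _ setT phi (@open (pt D))) => // _ [V oV <-].
rewrite setTI; apply: sub_sigma_algebra; exact: open_comp.
Qed.

Local Notation ext f := ('valL_ 0 (f : set_type D -> R[i]^o) : rV -> R[i]^o).

Lemma analytic_ext (f : pt D -> R[i]^o) : analytic f <->
  forall x : rV, dset D x -> differentiable (ext f) x.
Proof.
split=> [af x Dx|h z]; last exact/h/pt_in.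
by rewrite -(inDK Dx); exact: af.
Qed.

Hypothesis oD : open (D : set rV).

Lemma nbhs_dset (x : rV) : dset D x -> nbhs x (D : set rV).
Proof. by move=> Dx; exact: open_nbhs_nbhs. Qed.

Lemma near_ext (f : pt D -> R[i]^o) (F : rV -> R[i]^o) (z : pt D) :
  (forall w : pt D, F (set_val w) = f w) -> \forall x \near set_val z, F x = ext f x.
Proof.
move=> Ff; near=> x; have Dx : dset D x by near: x; exact/nbhs_dset/pt_in.
by rewrite -(inDK Dx) valL_in.
Unshelve. all: by end_near. Qed.

Lemma analytic_of (f : pt D -> R[i]^o) (F : rV -> R[i]^o) :
  (forall w : pt D, F (set_val w) = f w) ->
  (forall z : pt D, differentiable F (set_val z)) -> analytic f.
Proof. by move=> Ff dF z; apply: near_eq_differentiable (dF z); exact: near_ext. Qed.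

Lemma analytic_cst (a : R[i]^o) : analytic (fun _ : pt D => a).
Proof.
by apply: (@analytic_of _ (cst a)) => // z; exact: differentiable_cst.
Qed.

Lemma analytic_lin (a : R[i]) (f g : pt D -> R[i]^o) : analytic f -> analytic g ->
  analytic (a *: f + g).
Proof.
move=> af ag; apply: (@analytic_of _ (cst a * ext f + ext g)) => [w|z].
  by rewrite !fctE !valL_in.
apply: differentiableD; last exact: ag.
by apply: differentiableM; [exact: differentiable_cst|exact: af].
Qed.

Lemma analytic_mul (f g : pt D -> R[i]^o) : analytic f -> analytic g ->
  analytic (fun z => f z * g z).
Proof.
move=> af ag; apply: (@analytic_of _ (ext f * ext g)) => [w|z].
  by rewrite !fctE !valL_in.
exact: differentiableM.
Qed.

Lemma analytic_comp (f : pt D -> R[i]^o) (phi : pt D -> pt D) : analytic f ->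
  analytic_map phi -> analytic (f \o phi).
Proof.
(* The sum of the [G j] extends [phi] to a map between row vectors, assembled from its
   coordinates. *)
move=> af aphi; pose G j : rV -> rV := fun x => ext (fun z => set_val (phi z) ord0 j) x *: delta_mx 0 j.
have GE w : (\sum_j G j) (set_val w) = set_val (phi w).
  rewrite fct_sumE [RHS]row_sum_delta; apply: eq_bigr => j _.
  by rewrite /G valL_in.
apply: (@analytic_of _ (ext f \o (\sum_j G j))) => [w|z].
  by rewrite -[LHS]/(ext f ((\sum_j G j) (set_val w))) GE valL_in.
apply: differentiable_comp; last by rewrite GE; exact: af.
by apply: differentiable_sum => j; apply: differentiableZl; exact: aphi.
Qed.

Lemma analytic_continuous (f : pt D -> R[i]^o) (z : pt D) : analytic f -> forall e : R, 0 < e ->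
  exists2 r : R, 0 < r & forall w : pt D, nearby r (set_val z) (set_val w) -> cmod (f z - f w) < e.
Proof.
move=> af e e0; have /cvgrPdist_lt := differentiable_continuous (af z).
move=> /(_ e%:C%C); rewrite ltcR => /(_ e0) /nbhs_rV[r r0 hr]; exists r => // w /hr.
by rewrite !valL_in -cmod_norm ltcR.
Qed.

Lemma analytic_map_continuous (phi : pt D -> pt D) : analytic_map phi -> continuous phi.
Proof.
move=> aphi z A /nbhs_pt[r r0 hr]; apply/nbhs_pt.
have {}aphi j := analytic_continuous z (aphi j) r0.
pose rr j := s2val (cid2 (aphi j)).
exists (\big[Order.min/1]_j rr j).
  by apply: lt_bigmin => // j _; exact: s2valP (cid2 (aphi j)).
move=> w zw; apply: hr => j; apply: (s2valP' (cid2 (aphi j))) => k.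
by apply: lt_le_trans (zw k) _; exact: bigmin_le_cond.
Qed.

Lemma analytic_line (f : pt D -> R[i]^o) (p v : rV) (u : R[i]) : analytic f ->
  dset D (p + (u : R[i]^o) *: v) -> cdiff (fun u : R[i] => ext f (p + (u : R[i]^o) *: v)) u.
Proof.
move=> af Du; apply: (@differentiable_cdiff _ (fun u : R[i]^o => ext f (p + u *: v))).
apply: (@differentiable_comp _ _ _ _ (fun u : R[i]^o => p + u *: v) (ext f)).
  apply: differentiableD; first exact: differentiable_cst.
  exact: differentiableZl.
by move/analytic_ext : af; exact.
Qed.

(** The set [S] of points near which [f] vanishes is open and closed in [D]. Near a limit point [x],
    any [y] is reached from some [q] in [S] along a complex line, on which [identity_square]
    applies. *)
Lemma identity_theorem (f : pt D -> R[i]^o) (r0 : R) : connected (D : set rV) -> analytic f -> 0 < r0 ->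
  (forall z, nearby r0 (set_val (origin D)) (set_val z) -> f z = 0) -> f = (fun=> 0).
Proof.
move=> cD af r00 f0.
pose S : set rV := [set x | dset D x /\ \forall y \near x, dset D y /\ ext f y = 0].
have SD : S = D.
  apply: cD.
  - exists (set_val (origin D)); split; first exact: pt_in.
    have /nbhs_rV[r r1 hr] := nbhs_dset (pt_in (origin D)).
    apply/nbhs_rV; exists (Num.min r r0); first by rewrite lt_min r1.
    move=> y hy; have Dy : dset D y by apply: hr => j; have := hy j; rewrite lt_min => /andP[].
    split => //; rewrite -(inDK Dy) valL_in f0// => j; have := hy j.
    by rewrite lt_min => /andP[].
  - exists S; last by apply/seteqP; split => [x []|x []//].
    rewrite openE => x [Dx /nbhs_interior h]; apply: filterS h => y hy; split => //.
    by case: (nbhs_singleton hy).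
  - exists (closure S); first exact: closed_closure.
    apply/seteqP; split => [x Sx|x [Dx cS]]; first by split; [case: Sx|exact: subset_closure].
    split => //.
    have /nbhs_rV[r r1 hr] := nbhs_dset Dx.
    (* With [q] and [y] this close to [x], the point [q + u (y - q)] stays in [D] for [|u| <= 4].
       This covers the square of half-side 2, which contains the parameter [u = 1] of [y]. *)
    have r16 : 0 < r / 16 by rewrite divr_gt0.
    have [q [[Dq qS] xq]] : S `&` [set y | nearby (r / 16) x y] !=set0.
      by apply: cS; apply/nbhs_rV; exists (r / 16).
    apply/nbhs_rV; exists (r / 16) => // y xy.
    have Dy : dset D y by apply: hr => j; apply: lt_le_trans (xy j) _; lra.
    split => //.
    have [v vy] : exists v, v = y - q by exists (y - q).
    have vj j : cmod (v 0 j) < r / 8.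
      rewrite vy !mxE; have -> : y 0 j - q 0 j = (x 0 j - q 0 j) - (x 0 j - y 0 j) by ring.
      apply: le_lt_trans (cmodB _ _) _; have := xy j; have := xq j; lra.
    have vE (u : R[i]) j : (q + (u : R[i]^o) *: v) 0 j = q 0 j + u * v 0 j.
      by rewrite mxE [X in _ + X]mxE.
    have hq : forall u : R[i], cmod u <= 4 -> dset D (q + (u : R[i]^o) *: v).
      move=> u u4; apply: hr => j; rewrite vE opprD addrA.
      apply: le_lt_trans (cmodB _ _) _; rewrite cmodM.
      have := xq j; have : cmod u * cmod (v 0 j) <= 4 * (r / 8).
        by apply: ler_pM => //; exact/ltW/vj.
      by lra.
    have : (fun u : R[i] => ext f (q + (u : R[i]^o) *: v)) 1 = 0.
      have /nbhs_rV[rho rho0 hrho] := qS.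
      have rr0 : 0 < rho / r by rewrite divr_gt0.
      apply: (@identity_square R 2 _ (fun u : R[i] => ext f (q + (u : R[i]^o) *: v)) (rho / r)) => //.
      - move=> u [u1 u2]; apply: analytic_line => //; apply: hq.
        apply: (le_trans (cmod_leRI _)); move: u1 u2; rewrite -!ler_norml; lra.
      - move=> u ur; apply: (proj2 (hrho _ _)) => j; rewrite vE opprD addrA subrr sub0r.
        rewrite cmodN cmodM; have H : cmod u * cmod (v 0 j) <= rho / r * (r / 8).
          by apply: ler_pM => //; apply/ltW => //; exact: vj.
        apply: le_lt_trans H _.
        rewrite mulrA divfK ?gt_eqF//; lra.
      - by rewrite cmod1; lra.
    by rewrite scale1r vy addrC subrK.
apply/funext => z; have : S (set_val z) by rewrite SD; exact: pt_in.
by move=> [_ /nbhs_singleton[_]]; rewrite valL_in.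
Qed.

(** Density is Euclidean here, since analytic functions are continuous for that topology; [d_dense]
    is the analogue for the metric. *)
Lemma rational_points : exists q : nat -> pt D, forall (z : pt D) (r : R), 0 < r ->
  exists a, nearby r (set_val z) (set_val (q a)).
Proof.
pose of_rat (m : 'rV[rat * rat]_n) : rV :=
  \row_j (ratr (m 0 j).1 +i* ratr (m 0 j).2)%C.
pose q a : pt D := if unpickle a is Some m then
  (if pselect (dset D (of_rat m)) is left h then inD h else origin D) else origin D.
exists q => z r r0; have /nbhs_rV[r' r'0 hr'] := nbhs_dset (pt_in z).
pose e := Num.min r r' / 2; have e0 : 0 < e by rewrite divr_gt0// lt_min r0.
have hx (x : R) : exists c : rat, `|x - ratr c| < e.
  have [c /=] := @rat_in_itvoo R (x - e) (x + e) ltac:(lra).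
  by rewrite in_itv /= => /andP[c1 c2]; exists c; rewrite ltr_norml; apply/andP; split; lra.
have [c hc] := choice hx.
pose m : 'rV[rat * rat]_n := \row_j (c (cRe (set_val z 0 j)), c (cIm (set_val z 0 j))).
have zm : nearby (Num.min r r') (set_val z) (of_rat m).
  move=> j; apply: (le_lt_trans (cmod_leRI _)); rewrite cReB cImB !mxE /= .
  have := hc (cRe (set_val z 0 j)); have := hc (cIm (set_val z 0 j)); rewrite /e; lra.
have Dm : dset D (of_rat m) by apply: hr' => j; have := zm j; rewrite lt_min => /andP[].
exists (pickle m); rewrite /q pickleK; case: pselect => // h.
by rewrite inDK => j; have := zm j; rewrite lt_min => /andP[].
Qed.

End points.

(** * The scalar Bergman-type space *)

Section scalar_space.
Context {R : realType} {n : nat} (B : bergman_data R n) (hB : bergman_type_space B).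
Local Notation D := (dom B).
Local Notation phi := (@inv_aut _ _ B).
Local Notation d := (@dist _ _ B).
Local Notation K := (@ker _ _ B).
Local Notation S := (scalar_bergman B).
Local Notation L := (L2 (sigma B)).
Local Notation nrm := (hnorm L).
Local Notation kn := (@knorm _ _ B).
Local Notation o := (origin D).
Implicit Types (f g h : pt D -> R[i]^o) (z w u v : pt D).

Lemma ptopen : open (D : set 'rV[R[i]^o]_n).
Proof. by case: hB => -[]. Qed.

Lemma ptconnected : connected (D : set 'rV[R[i]^o]_n).
Proof. by case: hB => -[]. Qed.

Lemma phiK z : involutive (phi z).
Proof. by case: hB => -[_ _ /(_ z)[]]. Qed.

Lemma phi0 z : phi z o = z.
Proof. by case: hB => -[_ _ /(_ z)[]]. Qed.

Lemma phiz z : phi z z = o.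
Proof. by rewrite -[X in phi z X](phi0 z) phiK. Qed.

Lemma phi_an z : analytic_map (phi z).
Proof. by case: hB => -[_ _ /(_ z)[[]]]. Qed.

Lemma phi_meas z : measurable_fun setT (phi z).
Proof. by apply: pt_measurability; apply: analytic_map_continuous; exact: phi_an. Qed.

Lemma SL f : S f -> L f.
Proof. by case. Qed.

Lemma S_of f : analytic f -> L f -> S f.
Proof. by move=> af [mf lf]. Qed.

Lemma S_ph : prehilbert S.
Proof.
have Lp := L2_ph (sigma B); split.
- apply: S_of; last exact: ph0.
  exact: (analytic_cst ptopen 0).
- move=> a f g hf hg; apply: S_of; last exact: phL (SL hf) (SL hg).
  by apply: (analytic_lin ptopen); [case: hf|case: hg].
- by move=> a f g h hf hg hh; exact: (ph_ipL Lp _ (SL hf) (SL hg) (SL hh)).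
- by move=> f g hf hg; exact: (ph_ipC Lp (SL hf) (SL hg)).
- by move=> f hf; exact: (ph_ge0 Lp (SL hf)).
Qed.

Lemma S_complete : hcomplete S.
Proof. by case: hB => _ [_ [[]]]. Qed.

Lemma K_S z : S (K z).
Proof. by case: hB => _ [_ [[_ _ /(_ z)]]]. Qed.

Lemma repro z f : S f -> f z = hip S f (K z).
Proof.
case: hB => _ [_ [[_ _ _ [+ _] _] _]] => /(_ z f) h hf; rewrite h//.
by apply: cinteg_ext => w; rewrite mulrC.
Qed.

Lemma S_one : S (fun=> 1).
Proof.
apply: S_of; first exact: analytic_cst ptopen 1.
split; first exact: cmeas_cst.
rewrite /sqint; under eq_integral do rewrite cmod1 expr1n.
rewrite integral_cst// mul1e ltey_eq; apply/orP; left.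
exact: fin_num_measure.
Qed.

Lemma eval_le z f : S f -> cmod (f z) <= kn z * nrm f.
Proof. by move=> hf; rewrite (repro z hf) mulrC; exact: cauchy_schwarz S_ph _ _ hf (K_S z). Qed.

Lemma S_def : hdefinite S.
Proof.
move=> f hf f0; apply/funext => z; apply/eqP; rewrite -cmod_eq0 eq_le cmod_ge0 andbT.
by have := eval_le z hf; rewrite -[nrm f]/(hnorm S f) f0 mulr0.
Qed.

(** The constant 1 belongs to the space because [sigma] is finite, and its value at [z] is not 0. *)
Lemma kn_gt0 z : 0 < kn z.
Proof.
rewrite lt_def hnorm_ge0 andbT; apply/eqP => k0.
have := eval_le z S_one; rewrite k0 mul0r cmod1; lra.
Qed.

Lemma kn_ge0 z : 0 <= kn z. Proof. exact/ltW/kn_gt0. Qed.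

Lemma kn_neq0 z : kn z != 0. Proof. by rewrite gt_eqF ?kn_gt0. Qed.

Lemma keripE z w : kerip z w = K z w.
Proof. by rewrite (repro w (K_S z)). Qed.

Lemma KJ z w : K w z = (K z w)^*%C.
Proof. by rewrite -!keripE /kerip (hipC S_ph (K_S z) (K_S w)). Qed.

Lemma kn2 z : (kn z ^+ 2)%:C%C = K z z.
Proof. by rewrite -keripE /kerip (hipff S_ph (K_S z)). Qed.

(** The correlation [|<k_z, k_w>|], see [corrE]. *)
Definition corr z w : R := cmod (K z w) / (kn z * kn w).

Lemma corr_ge0 z w : 0 <= corr z w.
Proof. by rewrite divr_ge0// mulr_ge0// kn_ge0. Qed.

Lemma corrC z w : corr z w = corr w z.
Proof. by rewrite /corr KJ cmodJ [kn z * _]mulrC. Qed.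

Lemma cmodK z w : cmod (K z w) = corr z w * (kn z * kn w).
Proof. by rewrite divfK// mulf_neq0// kn_neq0. Qed.

Lemma nkerE z : nker z = ((kn z)^-1)%:C%C *: K z :> (pt D -> R[i]^o).
Proof.
by apply/funext => w; rewrite /nker fctE -[_ *: _]/(_ * _) mulrC fmorphV.
Qed.

Lemma nker_S z : S (nker z).
Proof. by rewrite nkerE; apply: hZ S_ph _ _ (K_S z). Qed.

Lemma nrm_nker z : nrm (nker z) = 1.
Proof.
rewrite nkerE -[LHS]/(hnorm S _) (hnormZ S_ph _ (K_S z)) cmodr ger0_norm ?invr_ge0 ?kn_ge0//.
by rewrite mulVf// kn_neq0.
Qed.

Lemma hip_nker f z : S f -> hip S f (nker z) = ((kn z)^-1)%:C%C * f z.
Proof.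
move=> hf; rewrite nkerE (hipZr S_ph _ (K_S z) hf) -(repro z hf); congr (_ * _).
by apply: complex_ext; rewrite ?cReJ ?cImJ //= oppr0.
Qed.

Lemma corrE z w : corr z w = cmod (hip S (nker z) (nker w)).
Proof.
rewrite (hip_nker _ (nker_S z)) cmodM cmodr /nker cmodM cmodV cmodr /corr.
rewrite !ger0_norm ?invr_ge0 ?kn_ge0// invfM; ring.
Qed.

Lemma corr_est : exists2 C : R, 0 < C & forall z w,
  corr z w <= C / kn (phi z w) /\ (kn (phi z w))^-1 <= C * corr z w.
Proof.
case: hB => _ [_ [_ [_ [[C C0 hC] _]]]]; exists C => // z w.
by have := hC z w; rewrite !mul1r -corrE.
Qed.

Lemma quasi : exists2 C : R, 1 <= C & forall z u v,
  d u v <= C * d (phi z u) (phi z v) /\ d (phi z u) (phi z v) <= C * d u v.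
Proof.
case: hB => _ [[[C C0 hC] _ _] _]; exists (Num.max C 1); first by rewrite le_max lexx orbT.
have d0 u v : 0 <= d u v.
  by have := dist_triangle v u u; rewrite distxx (distC v u); lra.
move=> z u v; have [h1 h2] := hC z u v; split.
  by apply: le_trans h1 _; rewrite ler_wpM2r// le_max lexx.
by apply: le_trans h2 _; rewrite ler_wpM2r// le_max lexx.
Qed.

Lemma blowup (M : R) : exists r : R, forall z, r < d z o -> M < kn z.
Proof.
case: hB => _ [_ [_ [_ [_ [_ h]]]]].
have [r _ hr] := h [set x | M < x] (nbhs_pinfty_gt (num_real M)).
by exists r.
Qed.

Lemma ball_meas z r : measurable (dball z r).
Proof. by case: hB => _ [_ [_ [[_ +_] _]]]; exact. Qed.

Lemma d_dense : exists q : nat -> pt D, forall z (e : R), 0 < e -> exists a, d z (q a) < e.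
Proof.
case: hB => _ [[_ [A cA dA] _] _].
have /ppcard_leP[F] := cA.
exists (fun k => xget o [set a | A a /\ F a = k]) => z e e0.
have [a [/= Aa za]] : A `&` (ball (z : mpt B) e) !=set0.
  have [|x [bx Ax]] := dA (interior (ball (z : mpt B) e)) _ (open_interior _).
    by exists (z : mpt B); exact: nbhsx_ballx.
  by exists x; split => //; exact: interior_subset.
exists (F a); case: xgetP => [b _ [/= Ab Fab]|/(_ a)]; last by case.
have -> // : b = a by apply: (@inj _ _ _ F) => //; exact: mem_set.
Qed.

(** By separability the set is a countable union of products of balls with rational radii, hence
    measurable for the product of the Borel sets. *)
Lemma d_meas r : measurable [set p : pt D * pt D | d p.1 p.2 < r].
Proof.
have [q hq] := d_dense.
have -> : [set p : pt D * pt D | d p.1 p.2 < r] =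
    \bigcup_(k : nat) \bigcup_(a : rat) (dball (q k) (ratr a) `*` dball (q k) (r - ratr a)).
  apply/seteqP; split => [[u v] /= uv|[u v] [k _ [a _ [/= h1 h2]]]]; last first.
    have := dist_triangle (q k) u v; rewrite (distC u (q k)); rewrite /dball /= in h1 h2; lra.
  have e0 : 0 < (r - d u v) / 2 by lra.
  have [k hk] := hq u _ e0.
  have [a] := @rat_in_itvoo R (d u (q k)) ((r - d u v) / 2) hk.
  rewrite in_itv /= => /andP[a1 a2]; exists k => //; exists a => //; split; rewrite /dball /=.
    by rewrite distC.
  have := dist_triangle u (q k) v; rewrite (distC (q k) u); lra.
apply: bigcup_measurable => k _; apply: bigcupT_measurable_rat => a.
by apply: measurableX; exact: ball_meas.
Qed.

Lemma K_total : exists q : nat -> pt D, forall f, S f ->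
  (forall a, hip S f (K (q a)) = 0) -> nrm f = 0.
Proof.
have [q hq] := rational_points ptopen; exists q => f hf f0.
have -> : f = 0; last exact: hnorm0 (L2_ph _).
apply/funext => z; apply/eqP; rewrite -cmod_eq0 eq_le cmod_ge0 andbT.
apply: le_eps => e e0; rewrite add0r.
have [r r0 hr] := analytic_continuous z (let: And3 af _ _ := hf in af) e0.
have [a /hr] := hq z r r0; rewrite (repro (q a) hf) f0 subr0; exact: ltW.
Qed.

(** Joint measurability, needed for Tonelli's theorem, comes from the orthogonal expansion of [K z]:
    the kernel is a pointwise limit of finite sums of products of a function of [z] and one of
    [w]. *)
Lemma K_meas2 : cmeas (fun p : pt D * pt D => K p.1 p.2).
Proof.
have [q qtot] := K_total; pose x a := K (q a); have xH a : S (x a) by exact: K_S.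
pose y k := residual (H := S) x k (x k); have yH k : S (y k) by exact: (residualH S_ph xH _ (xH k)).
apply: (@cmeas_cvg _ _ _ (fun N (p : pt D * pt D) => \sum_(k < N) 
   ((y k p.1)^*%C / hip S (y k) (y k)) * y k p.2)).
  move=> N; apply: cmeas_sum => k; have [_ my _] := yH k.
  apply: cmeasM; last by split; [exact: (measurableT_comp (proj1 my))|exact: (measurableT_comp (proj2 my))].
  apply: cmeasM; last exact: cmeas_cst.
  by apply: cmeasJ; split; [exact: (measurableT_comp (proj1 my))|exact: (measurableT_comp (proj2 my))].
move=> [z w] /=.
apply: (@null_seq_le _ _ (fun N => kn w * nrm (residual (H := S) x N (K z)))); last first.
  apply: null_seqZ; first exact: kn_ge0.
  exact: (residual_null S_ph S_complete xH qtot (K_S z)).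
move=> N; have rE := residualE x N (K z).
have -> : \sum_(k < N) (y k z)^*%C / hip S (y k) (y k) * y k w - K z w = - (residual (H := S) x N (K z) w).
  have : (K z - residual (H := S) x N (K z)) w = \sum_(k < N) (y k z)^*%C / hip S (y k) (y k) * y k w.
    rewrite rE fct_sumE; apply: eq_bigr => k _.
    rewrite !fctE -[_ *: _]/(_ * _) (hipC S_ph (yH k) (K_S z)) -(repro z (yH k)) //.
  by move=> <-; rewrite !fctE; ring.
by rewrite cmodN; apply: eval_le; exact: (residualH S_ph xH N (K_S z)).
Qed.

(** The continuity assumed of [kn] refers to the metric, the Borel sets to the Euclidean topology;
    measurability is read off the diagonal of [K]. *)
Lemma kn_meas : measurable_fun setT kn.
Proof.
have -> : kn = fun z => Num.sqrt (cRe (K z z)).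
  by apply/funext => z; rewrite -kn2 /= sqrtr_sqr ger0_norm ?kn_ge0.
apply: (measurableT_comp (f := @Num.sqrt R)).
  by apply: continuous_measurable_fun; exact: sqrt_continuous.
apply: (measurableT_comp (proj1 K_meas2) (g := fun z : pt D => (z, z))).
exact: measurable_fun_pair.
Qed.

Lemma kn2_meas : measurable_fun setT (fun z => kn z ^+ 2).
Proof. exact: measurable_funX kn_meas. Qed.

Lemma kn2_ge0 z : 0 <= kn z ^+ 2. Proof. exact: sqr_ge0. Qed.

Local Notation lam := (wmeas (sigma B) (fun z => kn z ^+ 2)).

Lemma lam_inv : exists2 C : R, 0 < C & forall z E, measurable E ->
  (lam (phi z @^-1` E) <= C%:E * lam E)%E.
Proof.
case: hB => _ [_ [_ [[[C C0 hC] _ _] _]]]; exists C => // z E mE.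
have [_ ] := hC z E mE; congr (lambda _ <= _)%E.
apply/seteqP; split => [_ [u Eu <-]|u Eu]; first by rewrite /= phiK.
by exists (phi z u) => //; rewrite phiK.
Qed.

Lemma int_inv : exists2 C : R, 0 < C & forall z (g : pt D -> R),
  measurable_fun setT g -> (forall x, 0 <= g x) ->
  (\int[sigma B]_w (g (phi z w) * kn w ^+ 2)%:E <=
   C%:E * \int[sigma B]_w (g w * kn w ^+ 2)%:E)%E.
Proof.
have [C C0 hC] := lam_inv; exists C => // z g mg g0.
apply: (wmeas_chg kn2_meas kn2_ge0 (phi_meas z) (ltW C0)) => // E mE; exact: hC.
Qed.

End scalar_space.

(** * Band-dominated operators *)

Section bands.
Context {R : realType} {n : nat} (B : bergman_data R n) (hB : bergman_type_space B).
Local Notation D := (dom B).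
Local Notation phi := (@inv_aut _ _ B).
Local Notation d := (@dist _ _ B).
Local Notation K := (@ker _ _ B).
Local Notation S := (scalar_bergman B).
Local Notation L := (L2 (sigma B)).
Local Notation nrm := (hnorm L).
Local Notation kn := (@knorm _ _ B).
Local Notation o := (origin D).
Local Notation lam := (wmeas (sigma B) (fun z => (@knorm _ _ B) z ^+ 2)).
Implicit Types (f g h : pt D -> R[i]^o) (z w u v : pt D).

Let Lp := L2_ph (sigma B).
Let Sp := S_ph hB.

Lemma le_lam E F : measurable E -> measurable F -> E `<=` F -> (lam E <= lam F)%E.
Proof.
move=> mE mF EF; apply: ge0_subset_integral => //.
  by apply/measurable_EFinP; apply: measurable_funTS; exact: kn2_meas hB.
by move=> x _; rewrite lee_fin sqr_ge0.
Qed.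

Lemma lam_ball_fin r : (lam (dball o r) < +oo)%E.
Proof.
have [_ [[_ _ cpt] [[_ _ _ _ ck] _]]] := hB.
have [M [_ hM]] : bounded_set (kn @` ([set w | d o w <= r] : set (mpt B))).
  apply: compact_bounded; apply: continuous_compact => //.
  by apply: continuous_subspaceT => x; exact: ck.
have {}hM w : d o w <= r -> kn w <= `|M| + 1.
  move=> dw; apply: le_trans (ler_norm _) _; apply: hM; last by exists w.
  by apply: le_lt_trans (ler_norm M) _; rewrite ltrDl.
apply: (@le_lt_trans _ _ (\int[sigma B]_(x in dball o r) ((`|M| + 1) ^+ 2)%:E)%E).
  apply: ge0_le_integral => //; first exact: ball_meas hB _ _.
  - by move=> x _; rewrite lee_fin sqr_ge0.
  - by apply/measurable_EFinP; apply: measurable_funTS; exact: kn2_meas hB.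
  - by move=> x /ltW xr; rewrite lee_fin ler_sqr ?nnegrE ?addr_ge0// ?hM// kn_ge0.
rewrite integral_cst; last exact: ball_meas hB _ _.
rewrite lte_mul_pinfty ?lee_fin ?sqr_ge0//.
rewrite ltey_eq; apply/orP; left; apply: fin_num_measure; exact: ball_meas hB _ _.
Qed.

Lemma doubling : exists2 C : R, 1 < C & forall z (r : R) k, 0 < r ->
  (lam (dball z (2 ^+ k * r)) <= (C ^+ k)%:E * lam (dball z r))%E.
Proof.
have [_ [_ [_ [[_ _ [C C1 hC]] _]]]] := hB.
exists C => // z r k r0; elim: k => [|k IH]; first by rewrite !expr0 mul1r mul1e.
rewrite exprS -mulrA; apply: (le_trans (hC z _ _)); first by rewrite mulr_gt0// exprn_gt0.
rewrite exprS EFinM -muleA; apply: lee_wpmul2l => //.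
by rewrite lee_fin; lra.
Qed.

(** Evaluating the constant 1 bounds [kn] from below. *)
Lemma sigma_le_lam E : measurable E ->
  (sigma B E <= (nrm (fun=> 1) ^+ 2)%:E * lam E)%E.
Proof.
move=> mE; rewrite /wmeas -ge0_integralZl//; last 3 first.
- by apply/measurable_EFinP; apply: measurable_funTS; exact: kn2_meas hB.
- by move=> x _; rewrite lee_fin sqr_ge0.
- by rewrite lee_fin sqr_ge0.
rewrite -[X in (X <= _)%E]mul1e -integral_cst//; apply: ge0_le_integral => //.
- apply: emeasurable_funM; first exact: measurable_cst.
  by apply/measurable_EFinP; apply: measurable_funTS; exact: kn2_meas hB.
move=> x _ /=; rewrite lee_fin -exprMn -(expr1n R 2) ler_sqr ?nnegrE ?mulr_ge0 ?hnorm_ge0//.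
by rewrite mulrC -[X in X <= _]cmod1; exact: eval_le hB x _ (S_one hB).
Qed.

Lemma ball_cover r : 0 < r -> \bigcup_k dball o (2 ^+ k * r) = setT.
Proof.
move=> r0; apply/seteqP; split => // z _; have [k hk] : exists k : nat, d o z / r < k%:R.
  by exists (Num.trunc (d o z / r)).+1; exact: truncnS_gt.
exists k => //; rewrite /dball /= -ltr_pdivrMr//; apply: lt_le_trans hk _.
by rewrite -natrX ler_nat ltnW// ltn_expl.
Qed.

(** By doubling, one null ball about [o] would make all of them null. Then [sigma] would vanish and
    the constant 1 would have norm 0, contradicting its evaluation at [o]. *)
Lemma lam_ball_gt0 r : 0 < r -> (0 < lam (dball o r))%E.
Proof.
move=> r0; rewrite lt_neqAle; apply/andP; split; last first.
  by apply: integral_ge0 => x _; rewrite lee_fin sqr_ge0.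
apply/eqP => lr; have [C _ hC] := doubling.
have s0 k : sigma B (dball o (2 ^+ k * r)) = 0%E.
  apply/eqP; rewrite eq_le measure_ge0 andbT.
  apply: (le_trans (sigma_le_lam (ball_meas hB _ _))).
  apply: (@le_trans _ _ ((nrm (fun=> 1) ^+ 2)%:E * ((C ^+ k)%:E * lam (dball o r)))%E).
    by apply: lee_wpmul2l; [rewrite lee_fin sqr_ge0|exact: hC].
  by rewrite -lr !mule0.
have sT : sigma B setT = 0%E.
  rewrite -(ball_cover r0); apply/eqP; rewrite eq_le measure_ge0 andbT.
  have mk k : measurable (dball o (2 ^+ k * r)) by exact: ball_meas hB _ _.
  have mU : measurable (\bigcup_k dball o (2 ^+ k * r)) by exact: bigcupT_measurable.
  apply: (le_trans (measure_sigma_subadditive (sigma B) mk mU (@subset_refl _ _))).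
  by rewrite eseries0// => k _ _; exact: s0.
have : nrm (fun=> 1) = 0.
  apply/eqP; rewrite -sqrf_eq0; apply/eqP.
  have := hnorm_L2 (SL (S_one hB)); rewrite /sqint.
  under eq_integral do rewrite cmod1 expr1n.
  have -> : (\int[sigma B]__ 1 = 0)%E by rewrite integral_cst// mul1e; exact: sT.
  by case.
move=> n0; have := eval_le hB o (S_one hB); rewrite n0 mulr0 cmod1; lra.
Qed.

(** The involution [phi w] exchanges balls about [o] and about [w] up to a factor in the radius.
    Quasi-invariance of [lambda] and doubling then make the volume depend only on [r], up to
    constants. *)
Lemma volume : exists2 c : R, 0 < c & forall r : R, 0 < r -> exists2 V : R, 0 < V &
  forall w, (V%:E <= c%:E * lam (dball w r))%E /\ (lam (dball w (2 * r)) <= (c * V)%:E)%E.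
Proof.
have [C C1 hC] := doubling; have [Q Q1 hQ] := quasi hB; have [M M0 hM] := lam_inv hB.
(* [k] doublings absorb the quasi-invariance constant [Q] of the metric. *)
have [k hk] : exists k : nat, Q <= 2 ^+ k.
  exists (Num.trunc Q).+1; apply: ltW; apply: lt_le_trans (truncnS_gt Q) _.
  by rewrite -natrX ler_nat ltnW// ltn_expl.
have Q0 : 0 < Q by lra.
have C0 : 0 < C by lra.
exists (M * C ^+ k.+1); first by rewrite mulr_gt0// exprn_gt0.
move=> r r0; pose V := fine (lam (dball o r)).
have VE : V%:E = lam (dball o r).
  by rewrite /V fineK// ge0_fin_numE ?lam_ball_fin//; apply: ltW; exact: lam_ball_gt0.
have mb := ball_meas hB.
exists V; first by rewrite -lte_fin VE lam_ball_gt0.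
have Ck : C ^+ k <= C ^+ k.+1 by apply: ler_weXn2l => //; lra.
move=> w; split.
  have rQ : 0 < r / Q by rewrite divr_gt0.
  rewrite VE; apply: (@le_trans _ _ (lam (dball o (2 ^+ k * (r / Q))))).
    apply: le_lam => // u; rewrite /dball /= => /lt_le_trans; apply.
    by rewrite mulrA ler_pdivlMr// mulrC ler_pM2r.
  apply: (le_trans (hC _ _ _ rQ)).
  rewrite [M * _]mulrC EFinM -muleA; apply: lee_pmul.
  - by rewrite lee_fin exprn_ge0// ltW.
  - by apply: ltW; exact: lam_ball_gt0.
  - by rewrite lee_fin.
  apply: (le_trans _ (hM w _ (mb w r))); apply: le_lam => //.
    by rewrite -(setTI (_ @^-1` _)); exact: phi_meas hB _ _ _ _.
  move=> u; rewrite /dball /= => ou.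
  have [_] := hQ w o u; rewrite (phi0 hB) => /le_lt_trans; apply.
  by rewrite mulrC -ltr_pdivlMr.
apply: (@le_trans _ _ (lam (phi w @^-1` dball o (2 ^+ k.+1 * r)))).
  apply: le_lam => //.
    by rewrite -(setTI (_ @^-1` _)); exact: phi_meas hB _ _ _ _.
  move=> u; rewrite /dball /= => wu.
  have [_] := hQ w w u; rewrite (phiz hB) => /le_lt_trans; apply.
  rewrite exprSr -mulrA; apply: lt_le_trans (_ : Q * (2 * r) <= _).
    by rewrite ltr_pM2l.
  by rewrite ler_pM2r// mulr_gt0.
apply: (le_trans (hM w _ (mb _ _))); rewrite EFinM EFinM -muleA VE.
by apply: lee_wpmul2l; [rewrite lee_fin ltW|exact: hC].
Qed.

Lemma corr_meas : measurable_fun setT (fun p : pt D * pt D => corr p.1 p.2).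
Proof.
have mk := kn_meas hB.
have mk2 : measurable_fun setT (fun p : pt D * pt D => kn p.1 * kn p.2).
  by apply: measurable_funM; exact: (measurableT_comp mk).
apply: measurable_funM; first exact: cmeas_cmod (K_meas2 hB).
under eq_fun do rewrite -powR_inv1 ?mulr_ge0 ?(kn_ge0 hB)//.
exact: (measurableT_comp (measurable_powR (-1)) mk2).
Qed.

(** (A.6) in terms of [corr], with [ga = (r + s) / 2] and [t = (r - s) / 2]. The gain is [ga < 1],
    that is [r + s < 2]. *)
Lemma rudin_forelli_corr : exists (ga t C : R), [/\ 0 < ga, ga < 1, 0 < C & forall z,
  (\int[sigma B]_w ((corr z w `^ ga * (kn z `^ t * kn w `^ (- t))) * kn w ^+ 2)%:E <= C%:E)%E].
Proof.
have key (r s : R) : 0 < r -> 0 < s -> r + s < 2 -> schur_bound B r s ->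
    exists (ga t C : R), [/\ 0 < ga, ga < 1, 0 < C & forall z,
    (\int[sigma B]_w ((corr z w `^ ga * (kn z `^ t * kn w `^ (- t))) * kn w ^+ 2)%:E <= C%:E)%E].
  move=> r0 s0 rs [C hC]; exists ((r + s) / 2), ((r - s) / 2), (Num.max C 1).
  split; [lra|lra|by rewrite lt_max ltr01 orbT|move=> z].
  apply: (@le_trans _ _ C%:E); last by rewrite lee_fin le_max lexx.
  apply: le_trans (hC z).
  have mg : measurable_fun setT (fun w => cmod (kerip z w) `^ ((r + s) / 2) / (kn z `^ s * kn w `^ r)).
    apply: measurable_funM.
      apply: (measurableT_comp (measurable_powR _)); under eq_fun do rewrite (keripE hB).
      by apply: cmeas_cmod; exact: (proj1 (SL (K_S hB z))).
    under eq_fun do rewrite -powR_inv1 ?mulr_ge0 ?powR_ge0//.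
    apply: (measurableT_comp (measurable_powR (-1))).
    apply: measurable_funM; first exact: measurable_cst.
    exact: (measurableT_comp (measurable_powR _) (kn_meas hB)).
  have := integral_wmeas (sigma B) (kn2_meas hB) (@kn2_ge0 _ _ B) mg.
  have g0 x : 0 <= cmod (kerip z x) `^ ((r + s) / 2) / (kn z `^ s * kn x `^ r).
    by rewrite divr_ge0// ?mulr_ge0// powR_ge0.
  move=> /(_ g0) E; rewrite le_eqVlt; apply/orP; left; apply/eqP.
  apply: etrans (esym E) => {E}; apply: eq_integral => w _; congr (_ * _)%:E.
  have az := kn_gt0 hB z; have aw := kn_gt0 hB w.
  rewrite (keripE hB) (cmodK hB) powRM ?corr_ge0 ?mulr_ge0 ?ltW// powRM ?ltW//.
  have -> : (r - s) / 2 = (r + s) / 2 - s by field.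
  have -> : - ((r + s) / 2 - s) = (r + s) / 2 - r by field.
  rewrite !powRB ?(gt_eqF az) ?(gt_eqF aw) ?implybT// invfM.
  have alg (a b c e f : R) : a * (b * c * (e * f)) = a * (b * e) * (c * f) by ring.
  exact: alg.
have [_ [_ [_ [_ [_ [[[kap /andP[k0 k2] hk]|hk] _]]]]]] := hB; last first.
  by apply: (key 2^-1 2^-1) => //; [lra|apply: hk; lra].
(* [r = 1 + kap / 2] lies strictly between [kap] and 2; [s] is below [kap] and small enough for
   [r + s < 2]. *)
pose s := Num.min kap (1 - kap / 2) / 2.
have ms : Num.min kap (1 - kap / 2) <= kap by rewrite ge_min lexx.
have ms2 : Num.min kap (1 - kap / 2) <= 1 - kap / 2 by rewrite ge_min lexx orbT.
have m0 : 0 < Num.min kap (1 - kap / 2) by rewrite lt_min k0; lra.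
have s0 : 0 < s by rewrite /s; lra.
apply: (key (1 + kap / 2) s) => //; rewrite ?/s; try lra.
by apply: hk; rewrite /s; lra.
Qed.

(** The integral formula of the orthogonal projection onto [S]; [oproj_bproj] identifies it with the
    vector selected by [oproj]. *)
Definition bproj f : pt D -> R[i]^o := fun w => hip L f (K w).

Lemma bprojP f : L f -> S (bproj f) /\ forall h, S h -> hip L f h = hip L (bproj f) h.
Proof.
move=> hf; have [||g hg gP] := riesz Sp (S_complete hB) (l := fun h => hip L h f) (M := nrm f).
- by move=> a h h' hh hh'; exact: (ph_ipL Lp _ (SL hh) (SL hh') hf).
- by move=> h hh; rewrite mulrC; exact: (cauchy_schwarz Lp (SL hh) hf).
have E h : S h -> hip L f h = hip L g h.
  by move=> hh; rewrite (hipC Lp (SL hh) hf) gP// -(hipC Sp hh hg).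
suff -> : bproj f = g by [].
by apply/funext => w; rewrite /bproj E ?(repro hB w hg)//; exact: K_S hB w.
Qed.

Lemma bproj_S f : L f -> S (bproj f). Proof. by move=> /bprojP[]. Qed.

Lemma bproj_L f : L f -> L (bproj f). Proof. by move=> /bproj_S/SL. Qed.

Lemma bproj_id f : S f -> bproj f = f.
Proof. by move=> hf; apply/funext => w; rewrite (repro hB w hf). Qed.

Lemma bproj_le f : L f -> nrm (bproj f) <= nrm f.
Proof.
move=> hf; have [hP P] := bprojP hf.
apply: (hip_bound_le Sp hP (hnorm_ge0 f)) => g hg.
by have := cauchy_schwarz Lp hf (SL hg); rewrite P.
Qed.

Lemma bproj_uniq f g : L f -> S g -> (forall h, S h -> hip L (f - g) h = 0) -> g = bproj f.
Proof.
move=> hf hg gP; have [hP P] := bprojP hf; have Ssub := hsubr Sp; have hgP := Ssub _ _ hg hP.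
apply: subr0_eq; apply: (S_def hB hgP); apply/eqP; rewrite -sqrf_eq0; apply/eqP.
rewrite (hnorm2 Sp hgP); have -> : hip S (g - bproj f) (g - bproj f) = 0; last by [].
rewrite -[LHS]/(hip L (g - bproj f) (g - bproj f)) (hipBl Lp (SL hg) (SL hP) (SL hgP)).
rewrite -P// -[X in X - _]opprK -[RHS]oppr0 -opprB; congr (- _).
rewrite -(gP _ hgP) (hipBl Lp hf (SL hg) (SL hgP)).
by rewrite opprK addrC.
Qed.

Lemma bproj_perp f h : L f -> S h -> hip L (f - bproj f) h = 0.
Proof.
move=> hf hh; have [hP P] := bprojP hf.
by rewrite (hipBl Lp hf (SL hP) (SL hh)) P// subrr.
Qed.

Lemma oproj_bproj f : L f -> oproj S f = bproj f.
Proof.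
move=> hf; rewrite /oproj; case: xgetP => [g _ [hg gP]|/(_ (bproj f))].
  exact: bproj_uniq hf hg gP.
by case; split; [exact: bproj_S|move=> h hh; exact: bproj_perp].
Qed.

Lemma bproj_bounded : bounded_op L bproj.
Proof.
split; [exact: bproj_L| |by exists 1 => f hf; rewrite mul1r bproj_le].
move=> a f g hf hg; apply/funext => w.
exact: (ph_ipL Lp a hf hg (SL (K_S hB w))).
Qed.

(** Norm approximation by maps of finite propagation. [A] may be nonlinear, and its locality is a
    statement about values at every point, not almost everywhere. *)
Definition band (T : (pt D -> R[i]^o) -> pt D -> R[i]^o) := forall e : R, 0 < e ->
  exists r A, [/\ 0 < r, forall f, L f -> L (A f) /\ nrm (T f - A f) <= e * nrm f &
    forall f g w, L f -> L g -> (forall u, d w u < r -> f u = g u) -> A f w = A g w].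

Lemma band_approx T (e : R) : bounded_op L T -> 0 < e ->
  (exists T', band T' /\ forall f, L f -> L (T' f) /\ nrm (T f - T' f) <= e / 2 * nrm f) ->
  exists r A, [/\ 0 < r, forall f, L f -> L (A f) /\ nrm (T f - A f) <= e * nrm f &
    forall f g w, L f -> L g -> (forall u, d w u < r -> f u = g u) -> A f w = A g w].
Proof.
move=> [TL _ _] e0 [T' [bT' hT']]; have e20 : 0 < e / 2 by rewrite divr_gt0.
have [r [A [r0 A1 A2]]] := bT' _ e20; exists r, A; split => // f hf.
have [hA nA] := A1 f hf; have [hT nT] := hT' f hf; split => //.
apply: (le_trans (hnorm_tri Lp (TL _ hf) hT hA)); rewrite [X in X * _]splitr mulrDl.
exact: lerD.
Qed.

Lemma band_limit T : bounded_op L T -> (forall e : R, 0 < e -> exists T', band T' /\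
  forall f, L f -> L (T' f) /\ nrm (T f - T' f) <= e * nrm f) -> band T.
Proof. by move=> bT h e e0; apply: band_approx => //; apply: h; rewrite divr_gt0. Qed.

Lemma band_add T1 T2 : bounded_op L T1 -> bounded_op L T2 -> band T1 -> band T2 ->
  band (fun f => T1 f + T2 f).
Proof.
move=> b1 b2 B1 B2 e e0; have e20 : 0 < e / 2 by rewrite divr_gt0.
have [r1 [A1 [r10 A1P A1B]]] := B1 _ e20; have [r2 [A2 [r20 A2P A2B]]] := B2 _ e20.
exists (Num.max r1 r2), (fun f => A1 f + A2 f); split; first by rewrite lt_max r10.
- move=> f hf; have [h1 n1] := A1P f hf; have [h2 n2] := A2P f hf.
  have [H1 _ _] := b1; have [H2 _ _] := b2.
  split; first exact: hD.
  have -> : T1 f + T2 f - (A1 f + A2 f) = (T1 f - A1 f) + (T2 f - A2 f).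
    by rewrite opprD addrACA.
  apply: (le_trans (hnormD Lp (hsubr Lp (H1 _ hf) h1) (hsubr Lp (H2 _ hf) h2))).
  by rewrite [X in X * _]splitr mulrDl; exact: lerD.
- move=> f g w hf hg fg; rewrite !fctE (A1B f g)// ?(A2B f g)// => u uw; apply: fg;
    by rewrite lt_max uw ?orbT.
Qed.

Lemma band_comp T1 T2 : bounded_op L T1 -> bounded_op L T2 -> band T1 -> band T2 ->
  band (T1 \o T2).
Proof.
move=> b1 b2 B1 B2 e e0.
have [M1 M10 hM1] := bounded_op_bound b1; have [M2 M20 hM2] := bounded_op_bound b2.
(* The composite errs by [M1 e1 + e1 (M2 + e1)], at most [e1 (M1 + M2 + 1)]. *)
pose e1 := Num.min 1 (e / (M1 + M2 + 1)).
have sM : 0 < M1 + M2 + 1 by rewrite !addr_gt0.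
have e10 : 0 < e1 by rewrite lt_min ltr01 divr_gt0.
have e11 : e1 <= 1 by rewrite ge_min lexx.
have e1e : e1 * (M1 + M2 + 1) <= e by rewrite -ler_pdivlMr// ge_min lexx orbT.
have [r1 [A1 [r10 A1P A1B]]] := B1 _ e10; have [r2 [A2 [r20 A2P A2B]]] := B2 _ e10.
have [H1 _ _] := b1; have [H2 _ _] := b2.
exists (r1 + r2), (A1 \o A2); split; first exact: addr_gt0.
- move=> f hf; have [h2 n2] := A2P f hf; have [h1 n1] := A1P _ h2; split => //.
  apply: (le_trans (hnorm_tri Lp (H1 _ (H2 _ hf)) (H1 _ h2) h1)).
  rewrite -(bounded_opB Lp b1)//; last exact: H2.
  have nA : nrm (A2 f) <= (M2 + e1) * nrm f.
    have -> : A2 f = T2 f - (T2 f - A2 f) by rewrite opprB addrC subrK.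
    apply: (le_trans (hnormB Lp (H2 _ hf) (hsubr Lp (H2 _ hf) h2))).
    by rewrite mulrDl lerD// hM2.
  apply: (@le_trans _ _ (M1 * (e1 * nrm f) + e1 * ((M2 + e1) * nrm f))).
    apply: lerD.
      apply: (le_trans (hM1 _ (hsubr Lp (H2 _ hf) h2))); apply: ler_wpM2l => //; exact: ltW.
    apply: (le_trans n1); apply: ler_wpM2l => //; exact: ltW.
  have -> : M1 * (e1 * nrm f) + e1 * ((M2 + e1) * nrm f) = e1 * (M1 + M2 + e1) * nrm f by ring.
  rewrite ler_wpM2r//; apply: le_trans e1e; rewrite ler_wpM2l ?(ltW e10)//; lra.
- move=> f g w hf hg fg; apply: A1B; [by have [] := A2P f hf|by have [] := A2P g hg|].
  move=> u uw; apply: A2B => // v uv; apply: fg.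
  apply: (le_lt_trans (dist_triangle u w v)); exact: ltrD.
Qed.

Lemma band_local T : (forall f, L f -> L (T f)) ->
  (forall f g w, f w = g w -> T f w = T g w) -> band T.
Proof.
move=> TL h e e0; exists 1, T; split => //.
- move=> f hf; split; first exact: TL.
  by rewrite subrr (hnorm0 Lp) mulr_ge0// ltW.
- by move=> f g w hf hg fg; apply: h; apply: fg; rewrite distxx.
Qed.

End bands.
Arguments bproj {R n B} f _.

Section parametric.
Context d1 d2 (T1 : measurableType d1) (T2 : measurableType d2) (R : realType)
  (mu : {sigma_finite_measure set T2 -> \bar R}).

Lemma Rintegral_meas (h : T1 * T2 -> R) : measurable_fun setT h ->
  measurable_fun setT (fun w => \int[mu]_u h (w, u)).
Proof.
move=> mh; apply: measurableT_comp => //.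
have mE : measurable_fun setT (EFin \o h) by exact/measurable_EFinP.
under eq_fun do rewrite integralE.
apply: emeasurable_funB.
  have M := @measurable_fun_fubini_tonelli_F _ _ _ _ _ mu ((EFin \o h)^\+)%E
    (measurable_funepos mE) (fun x => funepos_ge0 _ x).
  rewrite (_ : (fun x => _) = fubini_F mu ((EFin \o h)^\+)%E)//.
  by apply/funext => x; apply: eq_integral => u _; rewrite !funeposE.
have M := @measurable_fun_fubini_tonelli_F _ _ _ _ _ mu ((EFin \o h)^\-)%E
  (measurable_funeneg mE) (fun x => funeneg_ge0 _ x).
  rewrite (_ : (fun x => _) = fubini_F mu ((EFin \o h)^\-)%E)//.
  by apply/funext => x; apply: eq_integral => u _; rewrite !funenegE.
Qed.

Lemma cinteg_meas (h : T1 * T2 -> R[i]) : cmeas h ->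
  cmeas (fun w => cinteg mu (fun u => h (w, u))).
Proof. by move=> [h1 h2]; split; [exact: (Rintegral_meas (h := fun x => cRe (h x)))|exact: (Rintegral_meas (h := fun x => cIm (h x)))]. Qed.

End parametric.

Local Opaque knorm.

(** * Band-domination of the projection *)

Section projection_band.
Context {R : realType} {n : nat} (B : bergman_data R n) (hB : bergman_type_space B).
Local Notation D := (dom B).
Local Notation d := (@dist _ _ B).
Local Notation K := (@ker _ _ B).
Local Notation L := (L2 (sigma B)).
Local Notation kn := (@knorm _ _ B).
Local Notation o := (origin D).
Implicit Types (f g h : pt D -> R[i]^o) (z w u v : pt D).

Let Lp := L2_ph (sigma B).

(** By (A.5) [corr w u] is bounded by a multiple of [1 / kn (phi w u)]. If [u] is far from [w], then
    [phi w u] is far from [o], and (A.7) applies. *)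
Lemma corr_small (e : R) : 0 < e -> exists2 r : R, 0 < r & forall w u, r <= d w u -> corr w u <= e.
Proof.
move=> e0; have [C C0 hC] := corr_est hB; have [Q Q1 hQ] := quasi hB.
have [r0 hr0] := blowup hB (C / e); have Q0 : 0 < Q by lra.
exists (Q * (`|r0| + 1)); first by rewrite mulr_gt0// ltr_wpDl.
move=> w u wu; apply: le_trans (proj1 (hC w u)) _.
rewrite ler_pdivrMr ?kn_gt0// mulrC -ler_pdivrMr//; apply/ltW/hr0.
have [h _] := hQ w w u; rewrite (phiz hB) (distC o) in h.
apply: (@lt_le_trans _ _ (`|r0| + 1)); first by rewrite ltr_pwDr// ler_norm.
by rewrite -(ler_pM2l Q0) (le_trans wu).
Qed.

Let far r : pt D * pt D -> R := fun p => 1 - \1_[set p : pt D * pt D | d p.1 p.2 < r] p.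

Let farE r w u : far r (w, u) = if d w u < r then 0 else 1.
Proof.
rewrite /far indicE; case: ifP => h; last by rewrite memNset ?subr0//= h.
by rewrite mem_set// subrr.
Qed.

Let far_meas r : measurable_fun setT (far r).
Proof. by apply: measurable_funB => //; apply: measurable_indic; exact: d_meas hB r. Qed.

(** On far pairs [corr <= corr^ga * eta^(1 - ga)], so the surplus power makes the integral of
    [rudin_forelli_corr] small. The weight is [p = kn^(1 - t)]. *)
Lemma schur_kernel (e : R) : 0 < e -> exists r (p : pt D -> R), [/\ 0 < r,
  measurable_fun setT p, forall x, 0 < p x & forall w,
  (\int[sigma B]_u (far r (w, u) * cmod (K w u) * p u)%:E <= (e * p w)%:E)%E].
Proof.
move=> e0; have [ga [t [C [ga0 ga1 C0 hC]]]] := rudin_forelli_corr hB.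
have g1 : 0 < 1 - ga by lra.
(* Chosen so that [eta^(1 - ga) * C = e]. *)
pose eta := (e / C) `^ (1 - ga)^-1.
have eta0 : 0 < eta by rewrite powR_gt0// divr_gt0.
have etaE : eta `^ (1 - ga) = e / C.
  by rewrite -powRrM mulVf ?gt_eqF// powRr1// divr_ge0 ?ltW.
have [r r0 hr] := corr_small eta0.
have kn0 := kn_gt0 hB; have mkn := kn_meas hB.
have mp (a : R) : measurable_fun setT (fun x => kn x `^ a).
  exact: (measurableT_comp (measurable_powR a) mkn).
exists r, (fun x => kn x `^ (1 - t)); split => //; first by move=> x; rewrite powR_gt0.
move=> w.
have mcw : measurable_fun setT (corr w).
  exact: (measurableT_comp (corr_meas hB) (measurable_pair1 w)).
have mKw : measurable_fun setT (fun u => cmod (K w u)).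
  exact: cmeas_cmod (proj1 (SL (K_S hB w))).
have mI : measurable_fun setT (fun u => corr w u `^ ga * (kn w `^ t * kn u `^ (- t)) * kn u ^+ 2).
  apply: measurable_funM; last exact: kn2_meas hB.
  apply: measurable_funM; first exact: (measurableT_comp (measurable_powR ga) mcw).
  by apply: measurable_funM.
have I0 u : 0 <= corr w u `^ ga * (kn w `^ t * kn u `^ (- t)) * kn u ^+ 2.
  by rewrite !mulr_ge0 ?powR_ge0 ?(kn_ge0 hB).
have c0 : 0 <= e / C * kn w `^ (1 - t) by rewrite mulr_ge0 ?powR_ge0// divr_ge0 ?ltW.
apply: (@le_trans _ _ (\int[sigma B]_u ((e / C * kn w `^ (1 - t))%:E *
  (corr w u `^ ga * (kn w `^ t * kn u `^ (- t)) * kn u ^+ 2)%:E))%E).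
  apply: ge0_le_integral; first by [].
  - by move=> u _; rewrite lee_fin !mulr_ge0 ?powR_ge0// farE; case: ifP.
  - apply/measurable_EFinP; apply: measurable_funM => //; apply: measurable_funM => //.
    exact: (measurableT_comp (far_meas r) (measurable_pair1 w)).
  - by apply: emeasurable_funM => //; exact/measurable_EFinP.
  move=> u _; rewrite -EFinM lee_fin farE; case: ifP => wu; first by rewrite !mul0r mulr_ge0.
  rewrite mul1r (cmodK hB).
  have cle : corr w u <= corr w u `^ ga * (e / C).
    have [->|cn0] := eqVneq (corr w u) 0; first by rewrite powR0 ?gt_eqF// mul0r.
    have cp : 0 < corr w u by rewrite lt_def cn0 (corr_ge0 hB).
    rewrite -[X in X <= _](@powRr1 _ (corr w u) (ltW cp)).
    rewrite [X in _ `^ X](_ : 1 = ga + (1 - ga)); last by ring.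
    rewrite powRD ?cn0 ?implybT// -etaE ler_wpM2l ?powR_ge0//.
    by apply: ge0_ler_powR; rewrite ?nnegrE ?(corr_ge0 hB) ?(ltW eta0) ?(ltW g1) ?hr// leNgt wu.
  have wE : kn w = kn w `^ (1 - t) * kn w `^ t.
    by rewrite -powRD ?subrK ?(powRr1 (ltW (kn0 w)))// (gt_eqF (kn0 w)) implybT.
  have uE : kn u * kn u `^ (1 - t) = kn u `^ (- t) * kn u ^+ 2.
    rewrite powRD; last by rewrite (gt_eqF (kn0 u)) implybT.
    by rewrite (powRr1 (ltW (kn0 u))) mulrA -expr2 mulrC.
  have -> : corr w u * (kn w * kn u) * kn u `^ (1 - t) =
      corr w u * (kn w * (kn u `^ (- t) * kn u ^+ 2)) by rewrite -uE; ring.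
  have alg (a b c e' f g : R) : a * b * (c * (e' * f) * g) = (c * a) * (b * e' * (f * g)) by ring.
  rewrite alg.
  rewrite -[X in _ <= _ * (X * _)]wE; apply: ler_wpM2r => //.
  apply: mulr_ge0; first exact: kn_ge0 hB w.
  by apply: mulr_ge0; [exact: powR_ge0|exact: sqr_ge0].
rewrite ge0_integralZl//; last 2 first.
- exact/measurable_EFinP.
- by move=> u _; rewrite lee_fin.
apply: (@le_trans _ _ ((e / C * kn w `^ (1 - t))%:E * C%:E)%E).
  by apply: lee_wpmul2l; [rewrite lee_fin|exact: hC].
by rewrite -EFinM lee_fin mulrAC divfK// gt_eqF.
Qed.

(** The approximant integrates over the ball of radius [r] around [w] only; Schur's test bounds the
    remaining integral operator. *)
Lemma band_bproj : band (@bproj _ _ B).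
Proof.
move=> e e0; have e20 : 0 < e / 2 by rewrite divr_gt0.
have [r [p [r0 mp p0 hp]]] := schur_kernel e20.
pose k (x : pt D * pt D) := far r x * cmod (K x.1 x.2).
have mk : measurable_fun setT k.
  by apply: measurable_funM => //; exact: cmeas_cmod (K_meas2 hB).
have k0 x : 0 <= k x by case: x => w u; rewrite mulr_ge0// farE; case: ifP.
have kC w u : k (w, u) = k (u, w) by rewrite /k !farE /= distC (KJ hB) cmodJ.
pose A f : pt D -> R[i]^o := fun w => hip L (chi (dball w r) f) (K w).
have mb w : measurable (dball w r) by exact: ball_meas hB _ _.
have LK w : L (K w) := SL (K_S hB w).
exists r, A; split => //; last first.
  move=> f g w hf hg fg; rewrite /A; congr (hip L _ (K w)); apply/funext => u.
  have [uw|uw] := pselect (dball w r u); last by rewrite !chi_out.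
  by rewrite !chi_in// fg.
move=> f hf; have mf := proj1 hf.
have mA : cmeas (A f).
  apply: (@cinteg_meas _ _ _ _ _ (sigma B) (fun x : pt D * pt D =>
    (\1_[set p : pt D * pt D | d p.1 p.2 < r] x)%:C%C * f x.2 * (K x.1 x.2)^*%C)).
  apply: cmeasM; last exact: cmeasJ (K_meas2 hB).
  apply: cmeasM; first by apply: cmeas_real; apply: measurable_indic; exact: d_meas hB r.
  by split; [exact: (measurableT_comp (proj1 mf))|exact: (measurableT_comp (proj2 mf))].
have mP := proj1 (bproj_L hB hf).
have mPA : cmeas (bproj f - A f) by apply: cmeasD => //; exact: cmeasN.
(* [cinteg_le] loses a factor 2, which is why Schur's test is run with [e / 2]. *)
have hle w : ((cmod (bproj f w - A f w) / 2)%:E <=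
    \int[sigma B]_u (k (w, u) * cmod (f u))%:E)%E.
  have -> : bproj f w - A f w = hip L (f - chi (dball w r) f) (K w).
    by rewrite (hipBl Lp hf (L2_chi (mb w) hf) (LK w)).
  have mfc : cmeas (f - chi (dball w r) f).
    exact: (proj1 (hsubr Lp hf (L2_chi (mb w) hf))).
  have E u : cmod ((f - chi (dball w r) f) u * (K w u)^*%C) = k (w, u) * cmod (f u).
    rewrite cmodM cmodJ /k farE /= mulrAC [RHS]mulrC mulrC; congr (_ * _).
    rewrite !fctE; case: ifP => wu; first by rewrite chi_in// subrr cmod0 mul0r.
    by rewrite chi_out ?subr0 ?mul1r// /dball /= wu.
  have iv : (sigma B).-integrable setT (EFin \o (fun u => k (w, u) * cmod (f u))).
    apply: (int_le _ (intD (L2_int hf) (L2_int (LK w)))).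
      apply: measurable_funM; last exact: cmeas_cmod.
      exact: (measurableT_comp mk (measurable_pair1 w)).
    move=> u; rewrite ger0_norm; last exact: mulr_ge0.
    rewrite -E; apply: le_trans (cmod_mul_le _ _) _.
    rewrite lerD2r !fctE; have [uw|uw] := pselect (dball w r u).
      by rewrite chi_in// subrr cmod0 expr0n sqr_ge0.
    by rewrite chi_out// subr0.
  have mF : cmeas (fun u => (f - chi (dball w r) f) u * (K w u)^*%C).
    by apply: cmeasM => //; apply: cmeasJ; exact: (proj1 (LK w)).
  rewrite -Rint_ge0E//; last by move=> u; rewrite mulr_ge0.
  rewrite lee_fin ler_pdivrMr// mulrC.
  by apply: (cinteg_le mF iv) => u; rewrite E.
have := schur_test mk mp k0 p0 e20 hp _ (cmeas_cmod mf) _ _ _ hle.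
have hp2 u : (\int[sigma B]_w (k (w, u) * p w)%:E <= (e / 2 * p u)%:E)%E.
  by under eq_integral do rewrite kC; exact: hp.
have mg : measurable_fun setT (fun w => cmod (bproj f w - A f w) / 2).
  by apply: measurable_funM => //; exact: cmeas_cmod mPA.
have g0 w : 0 <= cmod (bproj f w - A f w) / 2 by rewrite divr_ge0.
move=> /(_ hp2 mg (fun=> cmod_ge0 _) g0) H.
have sq : (sqint (sigma B) (bproj f - A f)%R <= (e ^+ 2)%:E * sqint (sigma B) f)%E.
  have -> : sqint (sigma B) (bproj f - A f)%R =
      (4%:E * \int[sigma B]_w ((cmod (bproj f w - A f w) / 2) ^+ 2)%:E)%E.
    rewrite -ge0_integralZl//.
    - by apply: eq_integral => w _; rewrite -EFinM; congr EFin; rewrite !fctE; field.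
    - by apply/measurable_EFinP; exact: measurable_funX.
    - by move=> w _; rewrite lee_fin sqr_ge0.
  apply: (@le_trans _ _ (4%:E * (((e / 2) ^+ 2)%:E * sqint (sigma B) f))%E).
    by apply: lee_wpmul2l => //; rewrite lee_fin.
  by rewrite muleA -EFinM le_eqVlt; apply/orP; left; apply/eqP; congr (_%:E * _)%E; field.
have LPA : L (bproj f - A f).
  split => //; apply: le_lt_trans sq _.
  by rewrite -(hnorm_L2 hf) -EFinM ltry.
have LA : L (A f).
  have -> : A f = bproj f - (bproj f - A f) by rewrite opprB addrC subrK.
  by have Lsub := hsubr Lp; exact: (Lsub _ _ (bproj_L hB hf) LPA).
split => //; rewrite -ler_sqr ?nnegrE ?mulr_ge0 ?(ltW e0) ?hnorm_ge0//.
by rewrite exprMn -lee_fin [leRHS]EFinM (hnorm_L2 LPA) (hnorm_L2 hf).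
Qed.

End projection_band.

(** * Images of the normalized kernels *)

Local Opaque corr.

Section normalized_kernel_pairs.
Context {R : realType} {n : nat} (B : bergman_data R n) (hB : bergman_type_space B).
Local Notation D := (dom B).
Local Notation phi := (@inv_aut _ _ B).
Local Notation d := (@dist _ _ B).
Local Notation K := (@ker _ _ B).
Local Notation S := (scalar_bergman B).
Local Notation L := (L2 (sigma B)).
Local Notation nrm := (hnorm S).
Local Notation kn := (@knorm _ _ B).
Local Notation o := (origin D).
Implicit Types (f g h : pt D -> R[i]^o) (z w u v : pt D).

Let Sp := S_ph hB.
Let Sc := S_complete hB.

Definition escapes (zs : nat -> pt D) := forall M : R, exists N, forall m, (N <= m)%N ->
  M < d (zs m) o.

Lemma escapes_phi zs w : escapes zs -> escapes (fun m => phi (zs m) w).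
Proof.
move=> ez M; have [Q Q1 hQ] := quasi hB; have [N hN] := ez (M + Q * d o w).
exists N => m /hN h; have [_ h2] := hQ (zs m) o w; rewrite (phi0 hB) in h2.
have := dist_triangle (phi (zs m) w) (zs m) o; lra.
Qed.

Lemma escapes_sub zs (s : nat -> nat) : {homo s : i j / (i < j)%N} -> escapes zs -> escapes (zs \o s).
Proof.
move=> hs ez M; have [N hN] := ez M; exists N => m Nm; apply: hN.
apply: leq_trans Nm _; elim: m => // m IH; exact: leq_ltn_trans IH (hs _ _ (ltnSn _)).
Qed.

Lemma S_ext f g : S f -> S g -> (forall h, S h -> hip S h f = hip S h g) -> f = g.
Proof.
move=> hf hg fg; apply/funext => w; rewrite (repro hB w hf) (repro hB w hg).
by rewrite (hipC Sp (K_S hB w) hf) (hipC Sp (K_S hB w) hg) fg//; exact: K_S hB w.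
Qed.

Lemma cmod_nker z w : cmod (nker z w) = corr z w * kn w.
Proof.
rewrite /nker cmodM cmodV cmodr (ger0_norm (kn_ge0 hB z)) (cmodK hB).
have alg (a b c : R) : b != 0 -> a * (b * c) / b = a * c by move=> b0; field.
exact/alg/(kn_neq0 hB).
Qed.

(** The weight [k_z] compensates, up to constants, the distortion of [sigma] by [phi z]. *)
Definition wcomp z f : pt D -> R[i]^o := fun w => f (phi z w) * nker z w.

(** (A.5) bounds [|k_z(w)|] by a multiple of [kn w / kn (phi z w)]; the squared norm becomes an
    integral of [|f|^2 / kn^2], taken at [phi z w], against the quasi-invariant [lambda]. *)
Lemma wcomp_bound : exists2 C : R, 0 < C & forall z f, S f ->
  S (wcomp z f) /\ nrm (wcomp z f) <= C * nrm f.
Proof.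
have [C1 C10 hC1] := corr_est hB; have [C2 C20 hC2] := int_inv hB.
have C0 : 0 < C1 * (C2 + 1) by rewrite mulr_gt0// ltr_wpDl// ltW.
exists (C1 * (C2 + 1)) => // z f hf; have [af mf _] := hf.
have kn0 := kn_gt0 hB; have mkn := kn_meas hB.
have mfp : cmeas (fun w => f (phi z w)).
  by split; [exact: (measurableT_comp (proj1 mf) (phi_meas hB z))
            |exact: (measurableT_comp (proj2 mf) (phi_meas hB z))].
have mU : cmeas (wcomp z f) by apply: cmeasM => //; case: (nker_S hB z).
pose g x := cmod (f x) ^+ 2 * (kn x `^ (-1)) ^+ 2.
have mg : measurable_fun setT g.
  apply: measurable_funM; first exact: cmeas_cmod2.
  by apply: measurable_funX; exact: (measurableT_comp (measurable_powR (-1)) mkn).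
have g0 x : 0 <= g x by rewrite mulr_ge0 ?sqr_ge0.
have gE x : g x * kn x ^+ 2 = cmod (f x) ^+ 2.
  by rewrite /g (powR_inv1 (ltW (kn0 x))) -mulrA -exprMn mulVf ?expr1n ?mulr1// gt_eqF.
have sq : (sqint (sigma B) (wcomp z f) <= (C1 ^+ 2 * C2)%:E * sqint (sigma B) f)%E.
  apply: (@le_trans _ _ (\int[sigma B]_w ((C1 ^+ 2)%:E * (g (phi z w) * kn w ^+ 2)%:E))%E).
    have mG : measurable_fun setT (fun w => (g (phi z w) * kn w ^+ 2)%:E).
      apply/measurable_EFinP; apply: measurable_funM; last exact: kn2_meas hB.
      exact: (measurableT_comp mg (phi_meas hB z)).
    apply: ge0_le_integral; first by [].
    - by move=> w _; rewrite lee_fin sqr_ge0.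
    - by apply/measurable_EFinP; exact: cmeas_cmod2.
    - by apply: emeasurable_funM.
    move=> w _; rewrite -EFinM lee_fin /wcomp cmodM exprMn cmod_nker.
    rewrite /g exprMn (powR_inv1 (ltW (kn0 _))).
    have H : corr z w ^+ 2 <= (C1 / kn (phi z w)) ^+ 2.
      by rewrite ler_sqr ?nnegrE ?(corr_ge0 hB) ?divr_ge0 ?(ltW C10) ?(ltW (kn0 _))//; case: (hC1 z w).
    rewrite [leRHS]exprMn in H.
    have alg (a b c e : R) : a * (b * c * e) = b * (a * c * e) by ring.
    rewrite [leRHS]alg; apply: ler_wpM2l; first exact: sqr_ge0.
    by apply: ler_wpM2r; first exact: sqr_ge0.
  rewrite ge0_integralZl//; last 3 first.
  - apply/measurable_EFinP; apply: measurable_funM; last exact: kn2_meas hB.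
    exact: (measurableT_comp mg (phi_meas hB z)).
  - by move=> w _; rewrite lee_fin mulr_ge0 ?sqr_ge0.
  - by rewrite lee_fin sqr_ge0.
  rewrite [(C1 ^+ 2 * C2)%:E]EFinM -muleA; apply: lee_wpmul2l; first by rewrite lee_fin sqr_ge0.
  apply: (le_trans (hC2 z g mg g0)); rewrite le_eqVlt; apply/orP; left; apply/eqP.
  by congr (_ * _)%E; apply: eq_integral => w _; rewrite gE.
have LU : L (wcomp z f).
  split => //; apply: le_lt_trans sq _.
  by rewrite -(hnorm_L2 (SL hf)) -EFinM ltry.
have SU : S (wcomp z f).
  apply: S_of => //; apply: (analytic_mul (ptopen hB)); last by case: (nker_S hB z).
  exact: (analytic_comp (ptopen hB) af (phi_an hB z)).
split => //; rewrite -ler_sqr ?nnegrE ?mulr_ge0 ?(ltW C0)//.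
  rewrite exprMn -lee_fin [leRHS]EFinM -[nrm (wcomp z f)]/(hnorm L (wcomp z f)) (hnorm_L2 LU).
  rewrite -[nrm f]/(hnorm L f) (hnorm_L2 (SL hf)); apply: le_trans sq _.
  apply: lee_wpmul2r; first by apply: integral_ge0 => x _; rewrite lee_fin sqr_ge0.
  rewrite lee_fin exprMn ler_wpM2l ?sqr_ge0// expr2; nra.
all: by rewrite ?(ltW C10) ?addr_ge0 ?(ltW C20)//; exact: hnorm_ge0.
Qed.

(** The formula on kernels dualizes [(wcomp z h)(w) = h (phi z w) k_z(w)]. *)
Lemma wcomp_adjoint : exists V : pt D -> (pt D -> R[i]^o) -> pt D -> R[i]^o,
  exists2 C : R, 0 < C & forall z,
  [/\ forall f, S f -> S (V z f) /\ nrm (V z f) <= C * nrm f,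
      forall a f g, S f -> S g -> V z (a *: f + g) = a *: V z f + V z g &
      forall w, V z (K w) = (nker z w)^*%C *: K (phi z w)].
Proof.
have [C C0 hC] := wcomp_bound.
have bU z : bounded_op S (wcomp z).
  split; [by move=> f /(hC z)[]| |by exists C => f /(hC z)[]].
  by move=> a f g _ _; apply/funext => w; rewrite /wcomp !fctE mulrDl -[_ *: _]/(_ * _) -mulrA.
have /choice[V hV] z : exists V, (forall g, S g -> S (V g)) /\
    forall f g, S f -> S g -> hip S (wcomp z f) g = hip S f (V g).
  by have [V V1 V2] := adjoint_ex Sp Sc (bU z); exists V.
exists V, C => // z; have [V1 V2] := hV z; split.
- move=> f hf; split; first exact: V1.
  have h := hip_bound_le Sp (V1 _ hf); apply: h; first by rewrite mulr_ge0// ltW.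
  move=> g hg; rewrite (hipC Sp hg (V1 _ hf)) cmodJ -V2//.
  have [hU nU] := hC z g hg.
  apply: (le_trans (cauchy_schwarz Sp hU hf)).
  by rewrite [C * nrm f]mulrC -mulrA mulrC ler_wpM2l.
- move=> a f g hf hg; have hfg := phL Sp a hf hg.
  apply: S_ext; [exact: V1|exact: (phL Sp a (V1 _ hf) (V1 _ hg))|move=> h hh].
  rewrite -(V2 _ _ hh hfg).
  have [hU _] := hC z h hh.
  rewrite (hipDr Sp (hZ Sp a hf) hg hU) (hipZr Sp a hf hU) (V2 _ _ hh hf) (V2 _ _ hh hg).
  by rewrite (hipDr Sp (hZ Sp a (V1 _ hf)) (V1 _ hg) hh) (hipZr Sp a (V1 _ hf) hh).
- move=> w; have hK := K_S hB; apply: S_ext; [exact: V1|exact: (hZ Sp _ (hK _))|move=> h hh].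
  have [hU _] := hC z h hh.
  rewrite -(V2 _ _ hh (hK w)) (hipZr Sp)// conjcK -(repro hB _ hh) -(repro hB _ hU).
  by rewrite mulrC.
Qed.

Variable T : (pt D -> R[i]^o) -> pt D -> R[i]^o.
Hypothesis bT : bounded_op S T.
Hypothesis ber : forall e : R, 0 < e -> exists r : R, forall z, r < d z o ->
  cmod (hip S (T (nker z)) (nker z)) < e.

Lemma hip_TK z w : hip S (T (K z)) (K w) = (kn z * kn w)%:C%C * hip S (T (nker z)) (nker w).
Proof.
have [TS _ _] := bT.
have KE u : K u = (kn u)%:C%C *: nker u.
  apply/funext => x; rewrite fctE /nker -[_ *: _]/(_ * _) mulrC divfK//.
  by rewrite eq_complex /= negb_and (kn_neq0 hB).
rewrite {1}(KE z) {1}(KE w) (bounded_opZ Sp)//; last exact: nker_S hB z.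
have hn := nker_S hB; rewrite (hipZl Sp) ?(hipZr Sp)//.
- rewrite mulrA; congr (_ * _); rewrite rmorphM; congr (_ * _).
  by apply: complex_ext; rewrite ?cReJ ?cImJ //= oppr0.
- exact: TS.
- exact: TS.
- exact: (hZ Sp).
Qed.

(** Since [phi (zs m) o = zs m], only the pair [(K o, K w)] of the limit form matters. If the claim
    fails, a subsequence of pairings stays above some [e], which keeps the limit form away from 0 at
    this pair. *)
Lemma berezin_offdiag zs w : escapes zs ->
  null_seq (fun m => cmod (hip S (T (nker (zs m))) (nker (phi (zs m) w)))).
Proof.
move=> ez0; apply: contrapT => /not_null_seq[//|e e0 [s hs he0]].
have ez := escapes_sub hs ez0; have [ys ysE] : exists ys, ys = zs \o s by exists (zs \o s).
have {he0} he m : e <= cmod (hip S (T (nker (ys m))) (nker (phi (ys m) w))).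
  by rewrite ysE; exact: he0.
rewrite -ysE in ez; clear ysE hs ez0 s zs; rename ys into zs.
have [C1 C10 hC1] := corr_est hB; have [V [C C0 hV]] := wcomp_adjoint.
have [M M0 hM] := bounded_op_bound bT; have [TS _ _] := bT.
have kn0 := kn_gt0 hB; have KS := K_S hB.
pose F m f g := hip S (T (V (zs m) f)) (V (zs m) g).
have VS m f : S f -> S (V (zs m) f) by move=> hf; have [/(_ f hf)[]] := hV (zs m).
have Vn m f : S f -> nrm (V (zs m) f) <= C * nrm f.
  by move=> hf; have [/(_ f hf)[]] := hV (zs m).
have Vl m a f g : S f -> S g -> V (zs m) (a *: f + g) = a *: V (zs m) f + V (zs m) g.
  by have [_ + _] := hV (zs m); exact.
have Fb m f g : S f -> S g -> cmod (F m f g) <= M * C * C * nrm f * nrm g.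
  move=> hf hg; have hVf := VS m f hf; have hVg := VS m g hg.
  apply: (le_trans (cauchy_schwarz Sp (TS _ hVf) hVg)).
  have -> : M * C * C * nrm f * nrm g = M * (C * nrm f) * (C * nrm g) by ring.
  apply: ler_pM; [exact: hnorm_ge0|exact: hnorm_ge0| |exact: Vn].
  apply: (le_trans (hM _ hVf)); apply: ler_wpM2l; [exact: ltW|exact: Vn].
have [U [UU oU]] := ultra_oo.
have /choice[lim hlim] (p : (pt D -> R[i]^o) * (pt D -> R[i]^o)) : exists l : R[i],
    S p.1 -> S p.2 -> ulim_to U (fun m => F m p.1 p.2) l.
  have [[h1 h2]|no] := pselect (S p.1 /\ S p.2); last by exists 0 => h1 h2; case: no.
  by have [l hl] := ulim_ex (U := U) (fun m => Fb m _ _ h1 h2); exists l.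
pose Q f g := lim (f, g).
have hQ f g : S f -> S g -> ulim_to U (fun m => F m f g) (Q f g).
  by move=> hf hg; exact: hlim.
have QL a f g h : S f -> S g -> S h -> Q (a *: f + g) h = a * Q f h + Q g h.
  move=> hf hg hh; have hfg := phL Sp a hf hg.
  apply: (ulim_unique (hQ _ _ hfg hh)); have := ulimD a (hQ _ _ hf hh) (hQ _ _ hg hh) => /(_ UU).
  congr (ulim_to U _ _); apply/funext => m; rewrite /F Vl//.
  have [_ Tl _] := bT; rewrite Tl; [|exact: VS|exact: VS].
  by rewrite (ph_ipL Sp a (TS _ (VS m f hf)) (TS _ (VS m g hg)) (VS m h hh)).
have QR a f g h : S f -> S g -> S h -> Q h (a *: f + g) = a^*%C * Q h f + Q h g.
  move=> hf hg hh; have hfg := phL Sp a hf hg.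
  apply: (ulim_unique (hQ _ _ hh hfg)); have := ulimD a^*%C (hQ _ _ hh hf) (hQ _ _ hh hg) => /(_ UU).
  congr (ulim_to U _ _); apply/funext => m; rewrite /F Vl//.
  have hT := TS _ (VS m h hh).
  by rewrite (hipDr Sp (hZ Sp a (VS m f hf)) (VS m g hg) hT) (hipZr Sp a (VS m f hf) hT).
have Qb f g : S f -> S g -> cmod (Q f g) <= M * C * C * nrm f * nrm g.
  by move=> hf hg; apply: (ulim_le (hQ _ _ hf hg)) => m; exact: Fb.
(* By (A.5) each of the first two factors is comparable, uniformly in [m], to [kn u] and [kn v]
   respectively. *)
have FK m u v : cmod (F m (K u) (K v)) = corr (zs m) u * kn u * kn (phi (zs m) u) *
    (corr (zs m) v * kn v * kn (phi (zs m) v)) *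
    cmod (hip S (T (nker (phi (zs m) u))) (nker (phi (zs m) v))).
  rewrite /F; have [_ _ VK] := hV (zs m); rewrite !VK (bounded_opZ Sp _ bT (KS _)).
  have hTK := TS _ (KS (phi (zs m) u)); have hKv := KS (phi (zs m) v).
  rewrite (hipZl Sp _ hTK (hZ Sp _ hKv)) (hipZr Sp _ hKv hTK).
  rewrite conjcK hip_TK cmodM cmodJ cmod_nker cmodM cmod_nker cmodM cmodr normrM !(ger0_norm (kn_ge0 hB _)).
  have alg (a b c a' b' c' x : R) : a * b * (a' * b' * (c * c' * x)) = a * b * c * (a' * b' * c') * x by ring.
  exact: alg.
(* The points [phi (zs m) u] escape together with [zs m], so the Berezin hypothesis applies to
   them. *)
have Qdiag u : Q (K u) (K u) = 0.
  apply: (ulim_unique (hQ _ _ (KS u) (KS u))); apply: ulim_null => // a a0.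
  pose c := (C1 * kn u) ^+ 2; have c0 : 0 < c by rewrite exprn_gt0// mulr_gt0.
  have [r hr] := ber (divr_gt0 a0 c0).
  have [N hN] := escapes_phi u ez r; exists N => m /hN /hr hb.
  rewrite FK; have kc : corr (zs m) u * kn u * kn (phi (zs m) u) <= C1 * kn u.
    rewrite mulrAC ler_wpM2r ?(kn_ge0 hB)// -ler_pdivlMr//; by case: (hC1 (zs m) u).
  have kc0 : 0 <= corr (zs m) u * kn u * kn (phi (zs m) u).
    apply: mulr_ge0; last exact: kn_ge0 hB _.
    by apply: mulr_ge0; [exact: corr_ge0 hB _ _|exact: kn_ge0 hB _].
  apply: (@le_lt_trans _ _ (c * cmod (hip S (T (nker (phi (zs m) u))) (nker (phi (zs m) u))))).
    by apply: ler_wpM2r; [exact: cmod_ge0|rewrite /c expr2; apply: ler_pM].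
  by rewrite mulrC -ltr_pdivlMr.
have [r1 r10 hr1] := (nbhs_rV _ _).1 (nbhs_dset (ptopen hB) (pt_in o)).
(* On the complex line through [o] and [u] these points have parameters 0 and 1, and the square of
   half-side 2 stays in [D]; polarization in one variable suffices. *)
have near0 u : nearby (r1 / 8) (set_val o) (set_val u) -> Q (K o) (K u) = 0.
  move=> ou; pose p (x : R[i]) : 'rV[R[i]^o]_n := set_val o + (x : R[i]^o) *: (set_val u - set_val o).
  have Dp x : in_rect (- 2) 2 (- 2) 2 x -> dset D (p x).
    move=> [x1 x2]; apply: hr1 => j.
    have gen (a b : 'rV[R[i]^o]_n) : a 0 j - (a + (x : R[i]^o) *: (b - a)) 0 j =
        x * (a 0 j - b 0 j) by rewrite !mxE; ring.
    have -> : set_val o 0 j - p x 0 j = x * (set_val o 0 j - set_val u 0 j) by exact: gen.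
    rewrite cmodM; have cx : cmod x <= 4.
      apply: (le_trans (cmod_leRI _)); move: x1 x2; rewrite -!ler_norml; lra.
    apply: (@le_lt_trans _ _ (4 * (r1 / 8))); last by lra.
    by apply: ler_pM => //; exact/ltW/ou.
  pose k (x : R[i]) : pt D -> R[i]^o := K (if pselect (dset D (p x)) is left h then inD h else o).
  have kS x : S (k x) by exact: KS.
  have kE (x : R[i]) w0 : p x = set_val w0 -> k x = K w0.
    rewrite /k => pw; congr (K _); case: pselect => [h|[]]; first exact: pt_inj.
    by rewrite pw; exact: pt_in.
  have := @polarization R _ S Sp Sc 2 _ k (fun (x : R[i]) _ => kS x) _ Q _ _ QL QR Qb.
  move=> /(_ _ _ _ _ 0 1); rewrite cmod0 cmod1.
  have p0 : p 0 = set_val o by rewrite /p scale0r addr0.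
  have p1 : p 1 = set_val u by rewrite /p scale1r addrC subrK.
  rewrite (kE 0 o p0) (kE 1 u p1).
  apply; rewrite ?ltr0n//.
  - move=> f hf; exists (fun x => 'valL_ 0 (f : set_type D -> R[i]^o) (p x)) => x sx.
    have Dx := Dp x sx; split; last by apply: analytic_line => //; case: hf.
    by rewrite (kE x (inD Dx) erefl) -(repro hB _ hf) -valL_in.
  - by rewrite !mulr_ge0// ltW.
  - by move=> x _; exact: Qdiag.
  - by rewrite ltr1n.
(* Riesz makes [u |-> Q (K o) (K u)] an element of [S], hence analytic, so its vanishing near [o]
   extends to the whole domain. *)
have [||hh Shh hhE] := riesz Sp Sc (l := fun g => (Q (K o) g)^*%C) (M := M * C * C * nrm (K o)).
- by move=> a f g hf hg; rewrite (QR a f g (K o) hf hg (KS o)) conjcD conjcM conjcK.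
- by move=> f hf; rewrite cmodJ; exact: Qb.
have hhK u : hh u = Q (K o) (K u).
  by rewrite (repro hB u Shh) (hipC Sp (KS u) Shh) -hhE// conjcK.
have hh0 : hh = (fun=> 0).
  apply: (@identity_theorem _ _ _ (ptopen hB) hh (r1 / 8) (ptconnected hB)).
  - by case: Shh.
  - by rewrite divr_gt0.
  - by move=> u ou; rewrite hhK near0.
have Q0 : Q (K o) (K w) = 0 by rewrite -hhK hh0.
(* The lower bound for [|F m (K o) (K w)|] given by (A.5) and the assumed bound [e]. *)
pose c := kn o / C1 * (kn w / C1) * e.
have c0 : 0 < c by rewrite !mulr_gt0// invr_gt0.
have [m /=] := filter_ex (hQ _ _ (KS o) (KS w) c c0).
rewrite Q0 subr0 ltNge FK => /negP; apply; rewrite (phi0 hB).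
have lo u : kn u / C1 <= corr (zs m) u * kn u * kn (phi (zs m) u).
  rewrite mulrAC [kn u / C1]mulrC; apply: ler_wpM2r; first exact: kn_ge0 hB u.
  have h := proj2 (hC1 (zs m) u).
  rewrite -(ler_pM2r (kn0 (phi (zs m) u))) mulVf ?(kn_neq0 hB)// -mulrA in h.
  by rewrite -[leLHS]mulr1 ler_pdivrMl.
have lo0 := lo o; rewrite (phi0 hB) in lo0.
have p0 u : 0 <= kn u / C1 by rewrite divr_ge0 ?(kn_ge0 hB)// ltW.
apply: ler_pM => //; [by rewrite mulr_ge0|exact: ltW|exact: ler_pM].
Qed.

End normalized_kernel_pairs.

Lemma quarter_lt (R : realType) (a x y t : R) : 0 < a -> x < a / 4 -> y <= a / 4 + t ->
  t <= a / 4 -> x + y < a.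
Proof. lra. Qed.

(** * From pairings of kernels to norms of their images *)

Section normalized_kernel_images.
Context {R : realType} {n : nat} (B : bergman_data R n) (hB : bergman_type_space B).
Local Notation D := (dom B).
Local Notation phi := (@inv_aut _ _ B).
Local Notation d := (@dist _ _ B).
Local Notation S := (scalar_bergman B).
Local Notation L := (L2 (sigma B)).
Local Notation nrm := (hnorm L).
Local Notation kn := (@knorm _ _ B).
Local Notation o := (origin D).
Implicit Types (f g h : pt D -> R[i]^o) (z w u v : pt D).

Let Lp := L2_ph (sigma B).
Let Sp := S_ph hB.
Let mkn : measurable_fun setT kn := kn_meas hB.
Let mb z r : measurable (dball z r) := ball_meas hB z r.
Let mkV : measurable_fun setT (fun w => kn w `^ (-1)) := measurableT_comp (measurable_powR (-1)) mkn.
Let kVE w : kn w `^ (-1) = (kn w)^-1 := powR_inv1 (kn_ge0 hB w).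

Lemma chiD E f : chi E f + chi (~` E) f = f.
Proof.
apply/funext => w; rewrite fctE; have [Ew|Ew] := pselect (E w).
  by rewrite chi_in// chi_out ?addr0// => h; exact: h.
by rewrite chi_out// chi_in ?add0r.
Qed.

Lemma nrm_le_sqint f (e : R) : L f -> 0 <= e -> (sqint (sigma B) f <= (e ^+ 2)%:E)%E -> nrm f <= e.
Proof. by move=> hf e0; rewrite -(hnorm_L2 hf) lee_fin ler_sqr ?nnegrE ?hnorm_ge0. Qed.

Lemma dball_exhaust (e : R) : 0 < e -> exists2 r : R, 0 < r &
  (sigma B (~` dball o r) <= e%:E)%E.
Proof.
move=> e0; have [||m x|x a a0|N hN] := @dominated_null _ _ _ (sigma B)
  (fun m x => \1_(~` dball o m.+1%:R) x) (fun=> 1) _ _ _ _ e e0.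
- by move=> m; apply: measurable_indic; apply: measurableC.
- apply: int_lty; [exact: measurable_cst|by []|].
  rewrite integral_cst// mul1e ltey_eq; apply/orP; left; exact: fin_num_measure.
- by rewrite indicE; case: (_ \in _); rewrite lexx ler01.
- exists (Num.trunc (d o x)) => m hm; rewrite indicE memNset// => h; apply: h.
  rewrite /dball /=; apply: lt_le_trans (truncnS_gt _) _.
  by rewrite ler_nat.
exists N.+1%:R; first by rewrite ltr0n.
have := hN N (leqnn _); rewrite integral_indic ?setIT//; exact: measurableC.
Qed.

(** Transported by [phi z], the mass of [k_z] away from [z] is bounded by a multiple of the
    [sigma]-measure of the complement of a ball about [o], uniformly in [z]. *)
Lemma nker_tail (e : R) : 0 < e -> exists2 r : R, 0 < r &
  forall z, nrm (chi (~` dball z r) (nker z)) <= e.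
Proof.
move=> e0; have [C1 C10 hC1] := corr_est hB; have [C2 C20 hC2] := int_inv hB.
have [Q Q1 hQ] := quasi hB; have Q0 : 0 < Q by lra.
have c0 : 0 < C1 ^+ 2 * C2 by rewrite mulr_gt0// exprn_gt0.
have [r r0 hr] := dball_exhaust (divr_gt0 (exprn_gt0 2 e0) c0).
exists (Q * r); first by rewrite mulr_gt0.
move=> z; have Lk := SL (nker_S hB z); have mE : measurable (~` dball z (Q * r)) by exact: measurableC.
apply: nrm_le_sqint; [exact: L2_chi|exact: ltW|].
pose g x := \1_(~` dball o r) x * (kn x `^ (-1)) ^+ 2.
have mg : measurable_fun setT g.
  apply: measurable_funM; last exact: measurable_funX.
  by apply: measurable_indic; exact: measurableC.
have i0 (E : set (pt D)) x : 0 <= (\1_E x : R) by rewrite indicE; case: (_ \in _).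
have g0 x : 0 <= g x by rewrite mulr_ge0// sqr_ge0.
have mgk : measurable_fun setT (fun w => g (phi z w) * kn w ^+ 2).
  apply: measurable_funM; last exact: kn2_meas hB.
  exact: (measurableT_comp mg (phi_meas hB z)).
rewrite sqint_chi.
apply: (@le_trans _ _ (\int[sigma B]_w ((C1 ^+ 2)%:E * (g (phi z w) * kn w ^+ 2)%:E))%E).
  apply: ge0_le_integral; first by [].
  - by move=> w _; rewrite lee_fin mulr_ge0// sqr_ge0.
  - apply/measurable_EFinP; apply: measurable_funM; first exact: measurable_indic.
    by apply: cmeas_cmod2; exact: (proj1 Lk).
  - by apply: emeasurable_funM => //; exact/measurable_EFinP.
  move=> w _; rewrite -EFinM lee_fin cmod_nker// exprMn /g kVE.
  have [wz|wz] := pselect (dball z (Q * r) w).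
    have -> : \1_(~` dball z (Q * r)) w = 0 :> R by rewrite indicE memNset// => h; exact: h.
    rewrite mul0r.
    by rewrite mulr_ge0 ?sqr_ge0// mulr_ge0 ?sqr_ge0// mulr_ge0 ?sqr_ge0.
  have wo : (~` dball o r) (phi z w).
    move=> ow; apply: wz; rewrite /dball /= in ow *.
    have [h _] := hQ z z w; rewrite (phiz hB) in h.
    by apply: le_lt_trans h _; rewrite ltr_pM2l.
  rewrite !indicE !mem_set// !mul1r [leRHS]mulrA; apply: ler_wpM2r; first exact: sqr_ge0.
  rewrite -exprMn ler_sqr ?nnegrE; first by case: (hC1 z w).
    exact: corr_ge0 hB _ _.
  by apply: mulr_ge0; [exact: ltW|rewrite invr_ge0; exact: kn_ge0 hB _].
rewrite ge0_integralZl//; last 3 first.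
- exact/measurable_EFinP.
- by move=> w _; rewrite lee_fin mulr_ge0// sqr_ge0.
- by rewrite lee_fin sqr_ge0.
apply: (@le_trans _ _ ((C1 ^+ 2)%:E * (C2%:E * \int[sigma B]_w (g w * kn w ^+ 2)%:E))%E).
  by apply: lee_wpmul2l; [rewrite lee_fin sqr_ge0|exact: hC2].
have -> : (\int[sigma B]_w (g w * kn w ^+ 2)%:E = sigma B (~` dball o r))%E.
  apply: etrans (_ : \int[sigma B]_w (\1_(~` dball o r) w)%:E = _)%E; last first.
    by rewrite integral_indic ?setIT//; exact: measurableC.
  apply: eq_integral => w _; congr EFin; rewrite /g -mulrA kVE -exprMn mulVf ?expr1n ?mulr1//.
  exact: kn_neq0 hB w.
rewrite muleA -EFinM; apply: (@le_trans _ _ ((C1 ^+ 2 * C2)%:E * (e ^+ 2 / (C1 ^+ 2 * C2))%:E)%E).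
  by apply: lee_wpmul2l => //; rewrite lee_fin ltW.
by rewrite -EFinM lee_fin mulrC divfK// gt_eqF.
Qed.

Variable T : (pt D -> R[i]^o) -> pt D -> R[i]^o.
Hypothesis bT : bounded_op S T.
Hypothesis ber : forall e : R, 0 < e -> exists r : R, forall z, r < d z o ->
  cmod (hip S (T (nker z)) (nker z)) < e.
Hypothesis bandT : band (fun f => T (bproj f)).

Let TS f : S f -> S (T f). Proof. by case: bT => + _ _; exact. Qed.

Lemma hip_nker_cmod f w : S f -> cmod (f w) = kn w * cmod (hip S f (nker w)).
Proof.
move=> hf; rewrite (hip_nker hB w hf) cmodM cmodr ger0_norm ?invr_ge0 ?(kn_ge0 hB)//.
by rewrite mulrA mulfV ?mul1r// (kn_neq0 hB).
Qed.

(** [|T k_z|^2] integrated over the ball is [|<T k_z, k_w>|^2] integrated against [lambda].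
    Substituting [w = phi z x] moves the integral to a fixed ball about [o], where [berezin_offdiag]
    gives pointwise convergence and the constant [M^2] is a majorant. *)
Lemma inner_null zs (r : R) : 0 < r -> escapes zs ->
  null_seq (fun m => nrm (chi (dball (zs m) r) (T (nker (zs m))))).
Proof.
move=> r0 ez a a0; have [C2 C20 hC2] := int_inv hB.
have [Q Q1 hQ] := quasi hB; have Q0 : 0 < Q by lra.
have [M M0 hM] := bounded_op_bound bT.
have i0 (E : set (pt D)) x : 0 <= (\1_E x : R) by rewrite indicE; case: (_ \in _).
have i1 (E : set (pt D)) x : (\1_E x : R) <= 1 by rewrite indicE; case: (_ \in _).
have kS z : S (T (nker z)) by exact/TS/(nker_S hB).
pose c m x := cmod (hip S (T (nker (zs m))) (nker (phi (zs m) x))).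
have cM m x : c m x <= M.
  apply: (le_trans (cauchy_schwarz Sp (kS _) (nker_S hB _))).
  rewrite -[hnorm S (nker (phi _ _))]/(nrm _) (nrm_nker hB) mulr1.
  by apply: (le_trans (hM _ (nker_S hB _))); rewrite -[hnorm S _]/(nrm _) (nrm_nker hB) mulr1.
have mc m : measurable_fun setT (c m).
  have E x : c m x = kn (phi (zs m) x) `^ (-1) * cmod (T (nker (zs m)) (phi (zs m) x)).
    by rewrite (hip_nker_cmod _ (kS _)) kVE mulrA mulVf ?mul1r// (kn_neq0 hB).
  rewrite (_ : c m = fun x => kn (phi (zs m) x) `^ (-1) * cmod (T (nker (zs m)) (phi (zs m) x))).
    2: exact/funext/E.
  apply: measurable_funM.
    exact: (measurableT_comp mkV (phi_meas hB _)).
  exact: (measurableT_comp (cmeas_cmod (proj1 (SL (kS _)))) (phi_meas hB _)).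
(* It contains the image under [phi (zs m)] of every ball [dball (zs m) r]. *)
pose E := dball o (Q * r).
pose h m x := (\1_E x * c m x ^+ 2) * kn x ^+ 2.
have mi : measurable_fun setT (\1_E : pt D -> R) by apply: measurable_indic; exact: mb.
have mv : measurable_fun setT (fun x => \1_E x * M ^+ 2 * kn x ^+ 2).
  by apply: measurable_funM; [exact: measurable_funM|exact: kn2_meas hB].
have e2 : 0 < (a / 2) ^+ 2 / C2 by rewrite divr_gt0// exprn_gt0// divr_gt0.
have [||||N hN] := @dominated_null _ _ _ (sigma B) h (fun x => \1_E x * M ^+ 2 * kn x ^+ 2) _ _ _ _ _ e2.
- move=> m; apply: measurable_funM; last exact: kn2_meas hB.
  by apply: measurable_funM => //; exact: measurable_funX.
- apply: int_lty => //; first by move=> x; rewrite mulr_ge0 ?sqr_ge0// mulr_ge0 ?sqr_ge0.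
  have -> : (\int[sigma B]_x (\1_E x * M ^+ 2 * kn x ^+ 2)%:E =
      (M ^+ 2)%:E * wmeas (sigma B) (fun x => kn x ^+ 2)%R E)%E.
    rewrite (wmeas_indic _ _ (mb _ _)) -ge0_integralZl//.
    + by apply: eq_integral => x _; rewrite -EFinM; congr EFin; rewrite mulrAC mulrC.
    + by apply/measurable_EFinP; apply: measurable_funM => //; exact: kn2_meas hB.
    + by move=> x _; rewrite lee_fin mulr_ge0 ?sqr_ge0.
    + by rewrite lee_fin sqr_ge0.
  rewrite lte_mul_pinfty ?lee_fin ?sqr_ge0//; exact: lam_ball_fin hB _.
- move=> m x; apply/andP; split; first by rewrite mulr_ge0 ?sqr_ge0// mulr_ge0 ?sqr_ge0.
  apply: ler_wpM2r; first exact: sqr_ge0.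
  by apply: ler_wpM2l => //; rewrite ler_sqr ?nnegrE ?(ltW M0) ?cM// cmod_ge0.
- move=> x; have := berezin_offdiag hB bT ber x ez => cx b b0.
  have kp : 0 < kn x ^+ 2 + 1 by rewrite ltr_wpDl ?sqr_ge0.
  pose b1 := Num.min 1 (b / (kn x ^+ 2 + 1)).
  have b10 : 0 < b1 by rewrite lt_min ltr01 divr_gt0.
  have [N hN] := cx _ b10; exists N => m /hN; rewrite -/(c m x) => cb.
  have c0 : 0 <= c m x by exact: cmod_ge0.
  have cb2 : c m x ^+ 2 <= b1.
    rewrite expr2; apply: (@le_trans _ _ (b1 * 1)); last by rewrite mulr1.
    apply: ler_pM => //; [exact: ltW|apply: le_trans (ltW cb) _; by rewrite ge_min lexx].
  apply: (@le_lt_trans _ _ (b1 * kn x ^+ 2)).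
    apply: ler_wpM2r; first exact: sqr_ge0.
    by apply: le_trans cb2; rewrite ler_piMl ?sqr_ge0.
  apply: (@lt_le_trans _ _ (b1 * (kn x ^+ 2 + 1))); first by rewrite ltr_pM2l// ltrDl.
  by rewrite -ler_pdivlMr// ge_min lexx orbT.
exists N => m /hN hm; set z := zs m in hm *.
have LT := SL (kS z); apply: (@le_lt_trans _ _ (a / 2)); last by lra.
apply: nrm_le_sqint; [exact: L2_chi|by rewrite divr_ge0 ?ltW|].
pose g x := \1_(dball z r) (phi z x) * c m x ^+ 2.
have mg : measurable_fun setT g.
  apply: measurable_funM; last exact: measurable_funX.
  by apply: (measurableT_comp _ (phi_meas hB z)); apply: measurable_indic.
have g0 x : 0 <= g x by rewrite mulr_ge0 ?sqr_ge0.
have -> : (sqint (sigma B) (chi (dball z r) (T (nker z))) =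
    \int[sigma B]_w (g (phi z w) * kn w ^+ 2)%:E)%E.
  rewrite sqint_chi; apply: eq_integral => w _; congr EFin.
  by rewrite /g /c -/z !(phiK hB) -mulrA (hip_nker_cmod w (kS z)) exprMn [kn w ^+ 2 * _]mulrC.
apply: (le_trans (hC2 z g mg g0)).
apply: (@le_trans _ _ (C2%:E * ((a / 2) ^+ 2 / C2)%:E)%E); last first.
  by rewrite -EFinM lee_fin mulrC divfK// gt_eqF.
apply: lee_wpmul2l; first by rewrite lee_fin ltW.
apply: le_trans hm; apply: ge0_le_integral; first by [].
- by move=> x _; rewrite lee_fin mulr_ge0 ?sqr_ge0.
- by apply/measurable_EFinP; apply: measurable_funM => //; exact: kn2_meas hB.
- apply/measurable_EFinP; apply: measurable_funM; last exact: kn2_meas hB.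
  by apply: measurable_funM => //; exact: measurable_funX.
move=> x _; rewrite lee_fin; apply: ler_wpM2r; first exact: sqr_ge0.
apply: ler_wpM2r; first exact: sqr_ge0.
rewrite !indicE; case: (boolP (_ \in dball z r)) => [|_]; last by case: (_ \in _).
rewrite inE /dball /= => zx; rewrite mem_set// /E /dball /=.
have [h1 _] := hQ z o x; rewrite (phi0 hB) in h1.
by apply: le_lt_trans h1 _; rewrite ltr_pM2l.
Qed.

(** Near [z] this is [inner_null]. At distance at least [r + r0] the local approximant only sees the
    tail of [k_z] outside the ball of radius [r]. *)
Lemma TK_null zs : escapes zs -> null_seq (fun m => nrm (T (nker (zs m)))).
Proof.
move=> ez a a0; have [M M0 hM] := bounded_op_bound bT.
have a4 : 0 < a / 4 by lra.
have [r0 [A [r00 A1 A2]]] := bandT a4.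
(* The approximant satisfies [|A g| <= (M + a / 4) |g|]. *)
pose eta := a / 4 / (M + a / 4); have Ma : 0 < M + a / 4 by lra.
have eta0 : 0 < eta by rewrite divr_gt0.
have [r r1 hr] := nker_tail eta0.
have [N hN] := inner_null (addr_gt0 r1 r00) ez a4.
exists N => m /hN; set z := zs m => hm.
have Lk := SL (nker_S hB z); have LT := SL (TS (nker_S hB z)).
pose E := dball z (r + r0); have mE : measurable (~` E) by apply: measurableC; exact: mb.
pose g := chi (~` dball z r) (nker z).
have Lg : L g by apply: L2_chi => //; apply: measurableC; exact: mb.
have [LAk nAk] := A1 _ Lk; have [LAg nAg] := A1 _ Lg.
rewrite (bproj_id hB (nker_S hB z)) in nAk.
have AE : chi (~` E) (A (nker z)) = chi (~` E) (A g).
  apply/funext => w; have [Ew|Ew] := pselect (E w); first by rewrite !chi_out// => h; exact: h.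
  rewrite !chi_in//; apply: A2 => // u wu; rewrite /g chi_in// => zu; apply: Ew.
  rewrite /E /dball /= in zu *; have := dist_triangle u z w; rewrite (distC u w); lra.
have nA : nrm (chi (~` E) (T (nker z))) <= a / 4 + (M + a / 4) * nrm g.
  have -> : chi (~` E) (T (nker z)) = chi (~` E) (T (nker z) - A (nker z)) + chi (~` E) (A g).
    by rewrite -AE; apply/funext => w; rewrite /chi !fctE -mulrDr subrK.
  have LTA := hsubr Lp LT LAk.
  apply: (le_trans (hnormD Lp (L2_chi mE LTA) (L2_chi mE LAg))); apply: lerD.
    apply: (le_trans (hnorm_chi mE LTA)); apply: le_trans nAk _.
    by rewrite (nrm_nker hB) mulr1.
  apply: (le_trans (hnorm_chi mE LAg)).
  have Pg := bproj_S hB Lg; have LTP := SL (TS Pg).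
  have -> : A g = T (bproj g) - (T (bproj g) - A g) by rewrite opprB addrC subrK.
  have Lsub := hsubr Lp; apply: (le_trans (hnormB Lp LTP (Lsub _ _ LTP LAg))).
  rewrite mulrDl; apply: lerD => //.
  apply: (le_trans (hM _ Pg)); have Pn := bproj_le hB Lg.
  by rewrite -[hnorm S _]/(nrm (bproj g)); apply: ler_wpM2l => //; exact: ltW.
have ng : (M + a / 4) * nrm g <= a / 4 by rewrite mulrC -ler_pdivlMr//; exact: hr.
rewrite -(chiD E (T (nker z))).
apply: (le_lt_trans (hnormD Lp (L2_chi (mb _ _) LT) (L2_chi mE LT))).
exact: (quarter_lt a0 hm nA ng).
Qed.

End normalized_kernel_images.

(** * Scalar operators with vanishing Berezin transform *)

Section scalar_theorem.
Context {R : realType} {n : nat} (B : bergman_data R n) (hB : bergman_type_space B).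
Local Notation D := (dom B).
Local Notation d := (@dist _ _ B).
Local Notation S := (scalar_bergman B).
Local Notation L := (L2 (sigma B)).
Local Notation nrm := (hnorm L).
Local Notation kn := (@knorm _ _ B).
Local Notation lam := (wmeas (sigma B) (fun z => (@knorm _ _ B) z ^+ 2)).
Local Notation o := (origin D).
Implicit Types (f g h : pt D -> R[i]^o) (z w u v : pt D).

Let Lp := L2_ph (sigma B).
Let Sp := S_ph hB.
Let mb z r : measurable (dball z r) := ball_meas hB z r.
Let mk2 : measurable_fun setT (fun w => kn w ^+ 2) := kn2_meas hB.

Let indic01 (E : set (pt D)) x : 0 <= (\1_E x : R) <= 1.
Proof. by rewrite indicE; case: (_ \in _); rewrite lexx ler01. Qed.

Let i0 (E : set (pt D)) x : 0 <= (\1_E x : R). Proof. by case/andP: (indic01 E x). Qed.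

Definition ball_integral (r : R) (u : pt D -> R) z : \bar R :=
  (\int[sigma B]_w (\1_(dball z r) w * u w)%:E)%E.

Let joint_meas r (u : pt D -> R) : measurable_fun setT u -> measurable_fun setT
  (fun p : pt D * pt D => \1_(dball p.1 r) p.2 * u p.2).
Proof.
move=> mu; apply: measurable_funM; last exact: (measurableT_comp mu).
rewrite (_ : (fun p => _) = \1_[set p : pt D * pt D | d p.1 p.2 < r]).
  by apply: measurable_indic; exact: d_meas hB r.
by apply/funext => p; rewrite !indicE.
Qed.

Lemma ball_integral_ge0 r (u : pt D -> R) z : (forall w, 0 <= u w) -> (0 <= ball_integral r u z)%E.
Proof. by move=> u0; apply: integral_ge0 => w _; rewrite lee_fin mulr_ge0. Qed.

Lemma ball_integral_meas r (u : pt D -> R) : measurable_fun setT u -> (forall w, 0 <= u w) ->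
  measurable_fun setT (ball_integral r u).
Proof.
move=> mu u0; apply: (@measurable_fun_fubini_tonelli_F _ _ _ _ _ (sigma B)
  (fun p : pt D * pt D => (\1_(dball p.1 r) p.2 * u p.2)%:E)).
  by apply/measurable_EFinP; exact: joint_meas.
by move=> p; rewrite lee_fin mulr_ge0.
Qed.

(** Tonelli's theorem and the symmetry of the relation [d z w < r]. *)
Lemma averaging r (u t : pt D -> R) : measurable_fun setT u -> (forall w, 0 <= u w) ->
  measurable_fun setT t -> (forall w, 0 <= t w) ->
  (\int[sigma B]_z ((t z)%:E * ball_integral r u z) =
   \int[sigma B]_w ((u w)%:E * ball_integral r t w))%E.
Proof.
move=> mu u0 mt t0.
have E1 z : ((t z)%:E * ball_integral r u z =
    \int[sigma B]_w (t z * (\1_(dball z r) w * u w))%:E)%E.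
  under [RHS]eq_integral do rewrite EFinM.
  rewrite ge0_integralZl//.
  - apply/measurable_EFinP; exact: (measurableT_comp (joint_meas r mu) (measurable_pair1 z)).
  - by move=> w _; rewrite lee_fin mulr_ge0.
  - by rewrite lee_fin.
have E2 w : ((u w)%:E * ball_integral r t w =
    \int[sigma B]_z (t z * (\1_(dball z r) w * u w))%:E)%E.
  rewrite -ge0_integralZl//.
  - apply: eq_integral => z _; rewrite -EFinM; congr EFin.
    have -> : \1_(dball w r) z = \1_(dball z r) w :> R.
      rewrite !indicE; congr ((nat_of_bool _)%:R).
      by apply/idP/idP; rewrite !inE /dball /= distC.
    by rewrite mulrCA [RHS]mulrCA [u w * _]mulrC.
  - apply/measurable_EFinP; exact: (measurableT_comp (joint_meas r mt) (measurable_pair1 w)).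
  - by move=> z _; rewrite lee_fin mulr_ge0.
  - by rewrite lee_fin.
under eq_integral do rewrite E1; under [RHS]eq_integral do rewrite E2.
apply: (fubini_tonelli (fun p : pt D * pt D => (t p.1 * (\1_(dball p.1 r) p.2 * u p.2))%:E)).
  apply/measurable_EFinP; apply: measurable_funM; last exact: joint_meas.
  exact: (measurableT_comp mt).
by move=> p; rewrite lee_fin !mulr_ge0.
Qed.

Variable T : (pt D -> R[i]^o) -> pt D -> R[i]^o.
Hypothesis bT : bounded_op S T.
Hypothesis ber : forall e : R, 0 < e -> exists r : R, forall z, r < d z o ->
  cmod (hip S (T (nker z)) (nker z)) < e.
Hypothesis bandT : band (fun f => T (bproj f)).

Let TS f : S f -> S (T f). Proof. by case: bT => + _ _; exact. Qed.

Lemma TK_far (e : R) : 0 < e -> exists r : R, forall z, r <= d z o -> nrm (T (nker z)) <= e.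
Proof.
move=> e0; apply: contrapT => /forallNP no.
have /choice[zs hzs] (k : nat) : exists z, k%:R <= d z o /\ e < nrm (T (nker z)).
  have /existsNP[z /not_implyP[zk /negP]] := no k%:R; rewrite -ltNge => h.
  by exists z.
have ez : escapes zs.
  move=> M; exists (Num.trunc M).+1 => m hm; have [+ _] := hzs m; apply: lt_le_trans.
  by apply: lt_le_trans (truncnS_gt M) _; rewrite ler_nat.
have [N /(_ N (leqnn _))] := TK_null hB bT ber bandT ez e0.
by have [_ h] := hzs N; rewrite ltNge (ltW h).
Qed.

(** By duality. On [E] the adjoint satisfies [|(Ta g)(w)| = kn w |<g, T k_w>| <= eta |g| kn w], and
    the square of [kn] has integral [lam E] over [E]. *)
Lemma TP_local (E : set (pt D)) f (eta La : R) : measurable E -> L f -> 0 <= eta -> 0 <= La ->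
  (forall w, E w -> nrm (T (nker w)) <= eta) -> (lam E <= La%:E)%E ->
  nrm (T (bproj (chi E f))) <= eta * Num.sqrt La * nrm (chi E f).
Proof.
move=> mE hf eta0 La0 hE hLa; have Lh := L2_chi mE hf; set h := chi E f in Lh *.
have [Ta TaS TaE] := adjoint_ex Sp (S_complete hB) bT.
have Ph := bproj_S hB Lh; have hTP := TS Ph.
have bound := hip_bound_le Sp hTP; apply: bound.
  by rewrite !mulr_ge0 ?sqrtr_ge0 ?hnorm_ge0.
move=> g hg; have hTg := TaS g hg; have LTg := SL hTg.
rewrite TaE//; have [_ /(_ _ hTg) P2] := bprojP hB Lh.
rewrite -[hip S _ _]/(hip L (bproj h) (Ta g)) -P2.
have -> : hip L h (Ta g) = hip L h (chi E (Ta g)).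
  apply: cinteg_ext => w; rewrite /h; have [Ew|Ew] := pselect (E w); first by rewrite !chi_in.
  by rewrite !chi_out// !mul0r.
apply: (le_trans (cauchy_schwarz Lp Lh (L2_chi mE LTg))).
rewrite mulrC mulrAC; apply: ler_wpM2r; first exact: hnorm_ge0.
rewrite -[hnorm S g]/(nrm g).
apply: nrm_le_sqint; [exact: L2_chi| by rewrite !mulr_ge0 ?sqrtr_ge0 ?hnorm_ge0|].
have Ka w : E w -> cmod (Ta g w) <= eta * nrm g * kn w.
  move=> Ew; rewrite (hip_nker_cmod hB w hTg).
  have hk := nker_S hB w.
  rewrite mulrC; apply: ler_wpM2r; first exact: kn_ge0 hB w.
  rewrite (hipC Sp hk hTg) cmodJ -TaE//.
  apply: (le_trans (cauchy_schwarz Sp (TS hk) hg)); apply: ler_wpM2r; first exact: hnorm_ge0.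
  exact: hE.
rewrite sqint_chi; apply: (@le_trans _ _ (\int[sigma B]_w (((eta * nrm g) ^+ 2)%:E * (\1_E w * kn w ^+ 2)%:E))%E).
  apply: ge0_le_integral; first by [].
  - by move=> w _; rewrite lee_fin mulr_ge0 ?sqr_ge0.
  - apply/measurable_EFinP; apply: measurable_funM; first exact: measurable_indic.
    by apply: cmeas_cmod2; exact: (proj1 LTg).
  - by apply: emeasurable_funM => //; apply/measurable_EFinP; apply: measurable_funM.
  move=> w _; rewrite -EFinM lee_fin [leRHS]mulrCA indicE.
  case: (boolP (w \in E)) => [|_]; last by rewrite !mul0r.
  rewrite inE => Ew; rewrite !mul1r -exprMn ler_sqr ?nnegrE; first exact: Ka.
    exact: cmod_ge0.
  by rewrite !mulr_ge0 ?hnorm_ge0// (kn_ge0 hB).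
rewrite ge0_integralZl//; last 3 first.
- by apply/measurable_EFinP; apply: measurable_funM.
- by move=> w _; rewrite lee_fin mulr_ge0 ?sqr_ge0.
- by rewrite lee_fin sqr_ge0.
rewrite -(wmeas_indic _ _ mE); apply: (@le_trans _ _ (((eta * nrm g) ^+ 2)%:E * La%:E)%E).
  by apply: lee_wpmul2l => //; rewrite lee_fin sqr_ge0.
have -> : eta * Num.sqrt La * nrm g = eta * nrm g * Num.sqrt La by ring.
by rewrite -EFinM lee_fin [leRHS]exprMn sqr_sqrtr.
Qed.

Lemma sqint_add f g : L f -> L g -> (sqint (sigma B) (fun w => f w + g w)%R <=
  2%:E * sqint (sigma B) f + 2%:E * sqint (sigma B) g)%E.
Proof.
move=> hf hg; have mf := cmeas_cmod2 (proj1 hf); have mg := cmeas_cmod2 (proj1 hg).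
have mfg := cmeas_cmod2 (cmeasD (proj1 hf) (proj1 hg)).
rewrite -!ge0_integralZl//; try by [exact/measurable_EFinP|move=> w _; rewrite lee_fin sqr_ge0].
rewrite -ge0_integralD//; last 4 first.
- by move=> w _; rewrite -EFinM lee_fin mulr_ge0// sqr_ge0.
- by apply: emeasurable_funM => //; exact/measurable_EFinP.
- by move=> w _; rewrite -EFinM lee_fin mulr_ge0// sqr_ge0.
- by apply: emeasurable_funM => //; exact/measurable_EFinP.
apply: ge0_le_integral; first by [].
- by move=> w _; rewrite lee_fin sqr_ge0.
- exact/measurable_EFinP.
- by apply: emeasurable_funD; apply: emeasurable_funM => //; exact/measurable_EFinP.
by move=> w _; rewrite -!EFinM -EFinD lee_fin; exact: cmod_add2.
Qed.

(* Averaging the local estimate over [z] against [lambda]: the volume of a ball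
   enters linearly on both sides. *)
Lemma far_estimate : exists2 C : R, 0 < C & forall e : R, 0 < e -> exists r : R, forall f, S f ->
  nrm (chi (~` dball o r) (T f)) <= C * e * nrm f.
Proof.
(* The squared estimate ends with the constant [7 c^2], and [7 <= 3^2]. *)
have [c c0 vol] := volume hB; exists (3 * c); first by rewrite mulr_gt0.
move=> e e0; have [r [A [r0 A1 A2]]] := bandT e0.
have [V V0 hV] := vol r r0; have cV0 : 0 < c * V by rewrite mulr_gt0.
(* [c V] bounds the volume of balls of radius [2 r], so [TP_local] on such a ball gives the bound
   [e / 2]. *)
pose eta := e / (2 * Num.sqrt (c * V)).
have sV : 0 < Num.sqrt (c * V) by rewrite sqrtr_gt0.
have eta0 : 0 < eta by rewrite divr_gt0// mulr_gt0.
have [rho hrho] := TK_far eta0.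
(* A margin [r] leads from the points [w] to the centres [z] of the balls containing them, and [2 r]
   from [z] to the points whose values of [f] matter; these remain outside radius [rho]. *)
exists (rho + 3 * r) => f hf.
have Lf := SL hf; have LTf := SL (TS hf); have [LA nA] := A1 f Lf.
rewrite (bproj_id hB hf) in nA.
have LTA := hsubr Lp LTf LA.
pose th := \1_(~` dball o (rho + 2 * r)) : pt D -> R.
have mth : measurable_fun setT th by apply: measurable_indic; apply: measurableC; exact: mb.
have mt : measurable_fun setT (fun z => th z * kn z ^+ 2) by exact: measurable_funM.
have t0 z : 0 <= th z * kn z ^+ 2 by rewrite mulr_ge0 ?sqr_ge0.
pose sq g w := cmod (g w) ^+ 2.
have msq g : L g -> measurable_fun setT (sq g) by move=> [mg _]; exact: cmeas_cmod2.
have sq0 g w : 0 <= sq g w by exact: sqr_ge0.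
have biE s g z : ball_integral s (sq g) z = sqint (sigma B) (chi (dball z s) g).
  by rewrite sqint_chi.
(* [T f] is split into [T f - A f] and [A f]; on [dball z r] the latter depends only on [f] in
   [dball z (2 * r)]. There its norm is at most [e / 2 + e] times that of [f], and
   [2 (3/2)^2 <= 5]. *)
have loc z : th z != 0 -> (ball_integral r (sq (T f)) z <=
    2%:E * ball_integral r (sq (T f - A f)%R) z + (5 * e ^+ 2)%:E * ball_integral (2 * r) (sq f) z)%E.
  rewrite /th indicE; case: (boolP (_ \in _)) => [|_]; last by rewrite eqxx.
  rewrite inE => zfar _; rewrite !biE.
  have mE := mb z r; have mE2 := mb z (2 * r).
  set h := chi (dball z (2 * r)) f; have Lh : L h by exact: L2_chi.
  have [LAh nAh] := A1 h Lh.
  have AE : chi (dball z r) (A f) = chi (dball z r) (A h).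
    apply/funext => w; have [zw|zw] := pselect (dball z r w); last by rewrite !chi_out.
    rewrite !chi_in//; apply: A2 => // u wu; rewrite /h chi_in//.
    by rewrite /dball /= in zw *; have := dist_triangle w z u; lra.
  have -> : chi (dball z r) (T f) = fun w => chi (dball z r) (T f - A f) w + chi (dball z r) (A h) w.
    by rewrite -AE; apply/funext => w; rewrite /chi !fctE -mulrDr subrK.
  apply: (le_trans (sqint_add (L2_chi mE LTA) (L2_chi mE LAh))); apply: leeD => //.
  have nh : nrm (chi (dball z r) (A h)) <= 3 / 2 * e * nrm h.
    apply: (le_trans (hnorm_chi mE LAh)).
    have Ph := bproj_S hB Lh; have LTP := SL (TS Ph).
    have -> : A h = T (bproj h) - (T (bproj h) - A h) by rewrite opprB addrC subrK.
    have Lsub := hsubr Lp; apply: (le_trans (hnormB Lp LTP (Lsub _ _ LTP LAh))).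
    have Tl : nrm (T (bproj h)) <= eta * Num.sqrt (c * V) * nrm h.
      apply: TP_local => //; [exact: ltW|exact: ltW| |by have [] := hV z].
      move=> w zw; apply: hrho; rewrite /dball /= in zfar zw.
      have := dist_triangle w z o; rewrite [d z o]distC; move/negP: zfar; rewrite -leNgt; lra.
    have Ee : eta * Num.sqrt (c * V) = e / 2 by rewrite /eta; field; rewrite gt_eqF.
    rewrite Ee in Tl.
    have -> : 3 / 2 * e * nrm h = e / 2 * nrm h + e * nrm h by field.
    exact: lerD.
  rewrite -!hnorm_L2//; last exact: L2_chi.
  rewrite -!EFinM lee_fin.
  apply: (@le_trans _ _ (2 * (3 / 2 * e * nrm h) ^+ 2)).
    apply: ler_wpM2l => //; rewrite ler_sqr ?nnegrE ?hnorm_ge0//.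
    by rewrite !mulr_ge0 ?hnorm_ge0// ltW.
  have -> : 2 * (3 / 2 * e * nrm h) ^+ 2 = 9 / 2 * (e ^+ 2 * nrm h ^+ 2) by field.
  rewrite -[leRHS]mulrA; apply: ler_wpM2r; first by rewrite mulr_ge0 ?sqr_ge0.
  lra.
have lamE s w : ball_integral s (fun z => kn z ^+ 2) w = lam (dball w s).
  by rewrite (wmeas_indic _ _ (mb _ _)).
(* After the exchange of integrals the inner one is at most a ball volume, hence at most [c V]. *)
have upper s g : 0 < s -> s <= 2 * r -> L g -> (\int[sigma B]_z ((th z * kn z ^+ 2)%:E *
    ball_integral s (sq g) z) <= (c * V)%:E * sqint (sigma B) g)%E.
  move=> s0 sr hg; rewrite averaging//; last exact: msq.
  rewrite -ge0_integralZl//; last 3 first.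
  - by apply/measurable_EFinP; exact: msq.
  - by move=> w _; rewrite lee_fin sqr_ge0.
  - by rewrite lee_fin ltW.
  apply: ge0_le_integral; first by [].
  - by move=> w _; apply: mule_ge0; [rewrite lee_fin|exact: ball_integral_ge0].
  - by apply: emeasurable_funM; [apply/measurable_EFinP; exact: msq|exact: ball_integral_meas].
  - by apply: emeasurable_funM => //; apply/measurable_EFinP; exact: msq.
  move=> w _; rewrite muleC; apply: lee_wpmul2r; first by rewrite lee_fin.
  have [_ h2] := hV w; apply: le_trans h2; apply: (@le_trans _ _ (lam (dball w s))).
    rewrite -lamE; apply: ge0_le_integral; first by [].
    - by move=> z _; rewrite lee_fin mulr_ge0.
    - apply/measurable_EFinP; apply: measurable_funM => //; apply: measurable_indic; exact: mb.
    - apply/measurable_EFinP; apply: measurable_funM => //; apply: measurable_indic; exact: mb.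
    move=> z _; rewrite lee_fin; apply: ler_wpM2l => //.
    by rewrite ler_piMl ?sqr_ge0//; case/andP: (indic01 (~` dball o (rho + 2 * r)) z).
  apply: (le_lam hB); [exact: mb|exact: mb|move=> z; rewrite /dball /=; lra].
(* For [w] beyond [rho + 3 r] every centre within [r] of [w] has [th = 1], so the inner integral is
   a full ball volume, at least [V / c]. *)
have lower : (V%:E * sqint (sigma B) (chi (~` dball o (rho + 3 * r)) (T f)) <=
    c%:E * \int[sigma B]_z ((th z * kn z ^+ 2)%:E * ball_integral r (sq (T f)) z))%E.
  have mF : measurable (~` dball o (rho + 3 * r)) by apply: measurableC; exact: mb.
  have LF := L2_chi mF LTf.
  rewrite averaging//; last exact: msq.
  rewrite -!ge0_integralZl//; last 6 first.
  - by apply: emeasurable_funM; [apply/measurable_EFinP; exact: msq|exact: ball_integral_meas].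
  - by move=> w _; apply: mule_ge0; [rewrite lee_fin|exact: ball_integral_ge0].
  - by rewrite lee_fin ltW.
  - by apply/measurable_EFinP; exact: (msq _ LF).
  - by move=> w _; rewrite lee_fin sqr_ge0.
  - by rewrite lee_fin ltW.
  apply: ge0_le_integral; first by [].
  - by move=> w _; apply: mule_ge0; rewrite lee_fin ?sqr_ge0// ltW.
  - by apply: emeasurable_funM => //; apply/measurable_EFinP; exact: (msq _ LF).
  - apply: emeasurable_funM => //.
    by apply: emeasurable_funM; [apply/measurable_EFinP; exact: msq|exact: ball_integral_meas].
  move=> w _; rewrite cmod_chi indicE.
  case: (boolP (_ \in _)) => [|_]; last first.
    rewrite mul0r mule0; apply: mule_ge0; first by rewrite lee_fin ltW.
    by apply: mule_ge0; [rewrite lee_fin|exact: ball_integral_ge0].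
  rewrite inE mul1r => wfar; rewrite muleCA muleC; apply: lee_wpmul2l; first by rewrite lee_fin sqr_ge0.
  have [h1 _] := hV w; apply: le_trans h1 _; apply: lee_wpmul2l; first by rewrite lee_fin ltW.
  rewrite -lamE; apply: ge0_le_integral; first by [].
  - by move=> z _; rewrite lee_fin mulr_ge0 ?sqr_ge0.
  - apply/measurable_EFinP; apply: measurable_funM => //; apply: measurable_indic; exact: mb.
  - apply/measurable_EFinP; apply: measurable_funM => //; apply: measurable_indic; exact: mb.
  move=> z _; rewrite lee_fin indicE; case: (boolP (_ \in _)) => [|_]; last by rewrite !mul0r.
  rewrite inE !mul1r => wz; rewrite /th indicE mem_set ?mul1r// => oz; apply: wfar.
  rewrite /dball /= in wz oz *; have := dist_triangle z o w; rewrite (distC z w); lra.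
have LF : L (chi (~` dball o (rho + 3 * r)) (T f)).
  by apply: L2_chi => //; apply: measurableC; exact: mb.
have total : (V%:E * sqint (sigma B) (chi (~` dball o (rho + 3 * r)) (T f)) <=
    (c * (c * V) * (7 * e ^+ 2) * nrm f ^+ 2)%:E)%E.
  apply: (le_trans lower).
  have mB g s : L g -> measurable_fun setT (ball_integral s (sq g)).
    by move=> hg; apply: ball_integral_meas => //; exact: msq.
  have mtB g s : L g -> measurable_fun setT (fun z => (th z * kn z ^+ 2)%:E * ball_integral s (sq g) z)%E.
    by move=> hg; apply: emeasurable_funM; [exact/measurable_EFinP|exact: mB].
  have tB0 g s z : (0 <= (th z * kn z ^+ 2)%:E * ball_integral s (sq g) z)%E.
    by apply: mule_ge0; [rewrite lee_fin|exact: ball_integral_ge0].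
  have e5 : (0 <= (5 * e ^+ 2)%:E)%E by rewrite lee_fin mulr_ge0// sqr_ge0.
  have step : (\int[sigma B]_z ((th z * kn z ^+ 2)%:E * ball_integral r (sq (T f)) z) <=
      2%:E * \int[sigma B]_z ((th z * kn z ^+ 2)%:E * ball_integral r (sq (T f - A f)%R) z) +
      (5 * e ^+ 2)%:E * \int[sigma B]_z ((th z * kn z ^+ 2)%:E * ball_integral (2 * r) (sq f) z))%E.
    rewrite -!ge0_integralZl//; [|exact: mtB|exact: mtB].
    rewrite -ge0_integralD//; last 4 first.
    - by move=> z _; apply: mule_ge0.
    - by apply: emeasurable_funM => //; exact: mtB.
    - by move=> z _; apply: mule_ge0.
    - by apply: emeasurable_funM => //; exact: mtB.
    apply: ge0_le_integral; first by [].
    - by move=> z _.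
    - exact: mtB.
    - by apply: emeasurable_funD; apply: emeasurable_funM => //; exact: mtB.
    move=> z _; have [->|tz] := eqVneq (th z) 0.
      by rewrite mul0r !mul0e !mule0 adde0.
    rewrite muleCA [X in (_ <= _ + X)%E]muleCA -ge0_muleDr.
    - by apply: lee_wpmul2l; [rewrite lee_fin|exact: loc].
    - by apply: mule_ge0 => //; exact: ball_integral_ge0.
    - by apply: mule_ge0 => //; exact: ball_integral_ge0.
  apply: (@le_trans _ _ (c%:E * (2%:E * ((c * V)%:E * (e ^+ 2 * nrm f ^+ 2)%:E) +
      (5 * e ^+ 2)%:E * ((c * V)%:E * (nrm f ^+ 2)%:E)))%E).
    apply: lee_wpmul2l; first by rewrite lee_fin ltW.
    apply: (le_trans step); apply: leeD; apply: lee_wpmul2l => //.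
      apply: (le_trans (upper r _ r0 _ LTA)); first by lra.
      apply: lee_wpmul2l; first by rewrite lee_fin ltW.
      rewrite -hnorm_L2// lee_fin -exprMn ler_sqr ?nnegrE ?mulr_ge0 ?hnorm_ge0//; exact: ltW.
    apply: (le_trans (upper (2 * r) _ _ (lexx _) Lf)); first by rewrite mulr_gt0.
    by rewrite -hnorm_L2.
  have alg (x y v N : R) : (x%:E * (2%:E * (v%:E * (y * N)%:E) + (5 * y)%:E * (v%:E * N%:E)) =
      (x * v * (7 * y) * N)%:E)%E.
    by rewrite -[LHS]/((x * (2 * (v * (y * N)) + 5 * y * (v * N)))%:E); congr EFin; ring.
  by rewrite alg.
apply: nrm_le_sqint => //; first by rewrite !mulr_ge0 ?hnorm_ge0// ltW.
rewrite -(hnorm_L2 LF) -EFinM lee_fin in total.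
rewrite -(hnorm_L2 LF) lee_fin -(ler_pM2l V0); apply: le_trans total _.
have -> : V * (3 * c * e * nrm f) ^+ 2 = c * (c * V) * (9 * e ^+ 2) * nrm f ^+ 2 by ring.
apply: ler_wpM2r; first exact: sqr_ge0.
apply: ler_wpM2l; first by rewrite mulr_ge0// ltW.
by apply: ler_wpM2r; [exact: sqr_ge0|lra].
Qed.

(** [(T (f m)) w = <f m, Ta (K w)>] tends to 0 for each [w], and a multiple of [kn^2], integrable
    over the ball, is a majorant of the squares. *)
Lemma near_null (r : R) (f : nat -> pt D -> R[i]^o) : weakly_null (H := S) f ->
  null_seq (fun m => nrm (chi (dball o r) (T (f m)))).
Proof.
move=> [fS [F hF] f0] a a0; have [M M0 hM] := bounded_op_bound bT.
have [Ta TaS TaE] := adjoint_ex Sp (S_complete hB) bT.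
pose F1 := `|F| + 1; have F10 : 0 < F1 by rewrite ltr_wpDl.
have FF m : hnorm S (f m) <= F1 by apply: le_trans (hF m) _; rewrite (le_trans (ler_norm _))// lerDl.
have a20 : 0 < (a / 2) ^+ 2 by rewrite exprn_gt0// divr_gt0.
have mi : measurable_fun setT (\1_(dball o r) : pt D -> R) by apply: measurable_indic; exact: mb.
have LT m : L (T (f m)) by exact/SL/TS.
have [||||N hN] := @dominated_null _ _ _ (sigma B)
  (fun m w => \1_(dball o r) w * cmod (T (f m) w) ^+ 2)
  (fun w => (M * F1) ^+ 2 * (\1_(dball o r) w * kn w ^+ 2)) _ _ _ _ _ a20.
- by move=> m; apply: measurable_funM => //; apply: cmeas_cmod2; exact: (proj1 (LT m)).
- apply: intZ; apply: int_lty.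
  + exact: measurable_funM.
  + by move=> w; rewrite mulr_ge0 ?sqr_ge0.
  rewrite -(wmeas_indic _ _ (mb _ _)); exact: lam_ball_fin hB r.
- move=> m w; apply/andP; split; first by rewrite mulr_ge0 ?sqr_ge0.
  rewrite [leRHS]mulrCA; apply: ler_wpM2l => //.
  rewrite -exprMn ler_sqr ?nnegrE; first last.
  + by rewrite !mulr_ge0 ?(kn_ge0 hB)// ltW.
  + exact: cmod_ge0.
  apply: (le_trans (eval_le hB w (TS (fS m)))); rewrite mulrC; apply: ler_wpM2r; first exact: kn_ge0 hB w.
  apply: (le_trans (hM _ (fS m))); apply: ler_wpM2l; [exact: ltW|exact: FF].
- move=> w b b0.
  pose b1 := Num.min 1 b; have b10 : 0 < b1 by rewrite lt_min ltr01.
  have [N hN] := f0 _ (TaS _ (K_S hB w)) _ b10; exists N => m /hN.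
  rewrite -TaE ?fS//; last exact: K_S hB w.
  rewrite -(repro hB w (TS (fS m))) => h.
  have c0 := cmod_ge0 (T (f m) w).
  apply: (@le_lt_trans _ _ (cmod (T (f m) w) ^+ 2)).
    by rewrite ler_piMl ?sqr_ge0//; case/andP: (indic01 (dball o r) w).
  apply: (@lt_le_trans _ _ b1); last by rewrite ge_min lexx orbT.
  rewrite expr2; apply: (@le_lt_trans _ _ (cmod (T (f m) w) * 1)); last by rewrite mulr1.
  by apply: ler_wpM2l => //; apply: le_trans (ltW h) _; rewrite ge_min lexx.
exists N => m /hN hm; apply: (@le_lt_trans _ _ (a / 2)); last by lra.
apply: nrm_le_sqint; [by apply: L2_chi; [exact: mb|]|by rewrite divr_ge0// ltW|].
by rewrite sqint_chi.
Qed.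

Theorem scalar_weakly_null (f : nat -> pt D -> R[i]^o) : weakly_null (H := S) f ->
  null_seq (fun m => hnorm S (T (f m))).
Proof.
move=> wf a a0; have [C C0 hC] := far_estimate; have [fS [F hF] _] := wf.
pose F1 := `|F| + 1; have F10 : 0 < F1 by rewrite ltr_wpDl.
have FF m : nrm (f m) <= F1 by apply: le_trans (hF m) _; rewrite (le_trans (ler_norm _))// lerDl.
have e0 : 0 < a / 2 / (C * F1) by rewrite !divr_gt0// mulr_gt0.
have [r hr] := hC _ e0; have a20 : 0 < a / 2 by lra.
have [N hN] := near_null r wf a20; exists N => m /hN hm.
have LT := SL (TS (fS m)); have mE := mb o r.
rewrite -[hnorm S _]/(nrm _) -(chiD (dball o r) (T (f m))).
apply: (le_lt_trans (hnormD Lp (L2_chi mE LT) (L2_chi (measurableC mE) LT))).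
rewrite (splitr a); apply: ltr_leD => //.
apply: (le_trans (hr _ (fS m))).
apply: (@le_trans _ _ (C * (a / 2 / (C * F1)) * F1)).
  by apply: ler_wpM2l; [rewrite mulr_ge0 ?ltW|exact: FF].
by rewrite le_eqVlt; apply/orP; left; apply/eqP; field; rewrite !gt_eqF.
Qed.

End scalar_theorem.

(** * The vector-valued Bergman-type space *)

Local Transparent knorm corr.

Section ell2_space.
Context {R : realType}.
Implicit Types (u v : nat -> R[i]) (x y : nat -> R[i]^o).

Definition summable u := exists M : R, forall N, \sum_(k < N) cmod (u k) <= M.

Lemma real_series_null (a : nat -> R) (M : R) : (forall N, \sum_(k < N) `|a k| <= M) ->
  null_seq (fun N => `|\sum_(k < N) a k - limn (series a)|).
Proof.
move=> aM e e0.
have sE (b : nat -> R) N : series b N = \sum_(k < N) b k by rewrite /series /= big_mkord.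
have cn : cvgn [normed series a].
  apply: nondecreasing_is_cvgn.
    by move=> i j ij; rewrite /= -subr_ge0 sub_series_geq// sumr_ge0.
  by exists M => _ [N _ <-]; have := aM N; rewrite -(sE (fun k => `|a k|)).
have /cvgrPdistC_lt/(_ _ e0)[N _ hN] := normed_cvg cn.
by exists N => m /hN; rewrite sE.
Qed.

Lemma csum_null u : summable u -> null_seq (fun N => cmod (\sum_(k < N) u k - csum u)).
Proof.
move=> [M uM].
have hr N : \sum_(k < N) `|cRe (u k)| <= M.
  by apply: le_trans (uM N); apply: ler_sum => k _; exact: normr_cRe.
have hi N : \sum_(k < N) `|cIm (u k)| <= M.
  by apply: le_trans (uM N); apply: ler_sum => k _; exact: normr_cIm.
apply: null_seq_le (null_seqD (real_series_null (a := cRe \o u) hr) (real_series_null (a := cIm \o u) hi)) => N.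
by apply: (le_trans (cmod_leRI _)); rewrite cReB cImB cRe_sum cIm_sum.
Qed.

(** The algebra of [csum] follows from uniqueness and linearity of ultrafilter limits. *)
Lemma csum_ulim (U : set_system nat) {UU : UltraFilter U} u : \oo `<=` U -> summable u ->
  ulim_to U (fun N => \sum_(k < N) u k) (csum u).
Proof.
move=> oU su e e0; have [N hN] := csum_null su e0.
by apply: oU; exists N => // m /hN.
Qed.

Lemma csumL (a : R[i]) u v : summable u -> summable v ->
  csum (fun k => a * u k + v k) = a * csum u + csum v.
Proof.
move=> su sv; have [U [UU oU]] := ultra_oo.
have suv : summable (fun k => a * u k + v k).
  have [M uM] := su; have [N vN] := sv; exists (cmod a * M + N) => k.
  apply: (@le_trans _ _ (\sum_(j < k) (cmod a * cmod (u j) + cmod (v j)))).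
    by apply: ler_sum => j _; rewrite -cmodM; exact: cmodD.
  by rewrite big_split/= -mulr_sumr; exact: (lerD (ler_wpM2l (cmod_ge0 a) (uM k)) (vN k)).
apply: (ulim_unique (csum_ulim oU suv)).
have := ulimD a (csum_ulim (UU := UU) oU su) (csum_ulim (UU := UU) oU sv) => /(_ UU).
by congr (ulim_to U _ _); apply/funext => N; rewrite big_split/= mulr_sumr.
Qed.

Lemma csumJ u : summable u -> csum (fun k => (u k)^*%C) = (csum u)^*%C.
Proof.
move=> su; have [U [UU oU]] := ultra_oo.
have suJ : summable (fun k => (u k)^*%C).
  by have [M uM] := su; exists M => N; under eq_bigr do rewrite cmodJ.
apply: (ulim_unique (csum_ulim oU suJ)).
have := ulimJ (csum_ulim (UU := UU) oU su) => /(_ UU).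
by congr (ulim_to U _ _); apply/funext => N; rewrite conjc_sum.
Qed.

Lemma csum_le u (M : R) : (forall N, \sum_(k < N) cmod (u k) <= M) -> cmod (csum u) <= M.
Proof.
move=> uM; have [U [UU oU]] := ultra_oo.
apply: (ulim_le (csum_ulim oU (ex_intro _ M uM))) => N.
by apply: le_trans (uM N); exact: cmod_sum.
Qed.

Lemma csum_fin u (N : nat) : (forall k, (N <= k)%N -> u k = 0) -> csum u = \sum_(k < N) u k.
Proof.
move=> u0; have fin m : (N <= m)%N -> \sum_(k < m) u k = \sum_(k < N) u k.
  move=> Nm; rewrite -(subnKC Nm) big_split_ord/= [X in _ + X]big1 ?addr0// => k _.
  by rewrite u0// leq_addr.
have su : summable u.
  exists (\sum_(k < N) cmod (u k)) => m; have [/ltnW mN|Nm] := ltnP m N.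
    by rewrite -(subnKC mN) big_split_ord/= lerDl sumr_ge0.
  rewrite -(subnKC Nm) big_split_ord/= [X in _ + X]big1 ?addr0// => k _.
  by rewrite u0 ?cmod0// leq_addr.
apply/eqP; rewrite eq_sym -subr_eq0 -cmod_eq0 eq_le cmod_ge0 andbT.
apply: null_seq_le0 => e e0; have [m hm] := csum_null su e0.
by exists m => _ _; have := hm (maxn m N) (leq_maxl _ _); rewrite fin// leq_maxr.
Qed.

(** Meaningful on [ell2] only, as [fine] sends infinity to 0. *)
Definition sqn x : R := fine (sqnorm x).

Lemma sqnorm_ge0 x : (0 <= sqnorm x)%E.
Proof. by apply: nneseries_ge0 => k _; rewrite lee_fin sqr_ge0. Qed.

Lemma sqnE x : ell2 R x -> (sqn x)%:E = sqnorm x.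
Proof. by move=> hx; rewrite /sqn fineK// ge0_fin_numE ?sqnorm_ge0. Qed.

Lemma sqn_partial x N : ell2 R x -> \sum_(k < N) cmod (x k) ^+ 2 <= sqn x.
Proof.
move=> hx; rewrite -lee_fin sqnE// -sumEFin -(big_mkord xpredT (fun k => (cmod (x k) ^+ 2)%:E)).
by apply: nneseries_lim_ge => k _; rewrite lee_fin sqr_ge0.
Qed.

Lemma sqnorm_le x (M : R) : (forall N, \sum_(k < N) cmod (x k) ^+ 2 <= M) -> (sqnorm x <= M%:E)%E.
Proof.
move=> h; apply: lime_le; first by apply: is_cvg_nneseries => k _; rewrite lee_fin sqr_ge0.
by apply: nearW => N; rewrite big_mkord sumEFin lee_fin.
Qed.

Lemma ell2_summable x y : ell2 R x -> ell2 R y ->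
  forall N, \sum_(k < N) cmod (x k * (y k)^*%C) <= sqn x + sqn y.
Proof.
move=> hx hy N; apply: le_trans (lerD (sqn_partial N hx) (sqn_partial N hy)).
by rewrite -big_split; apply: ler_sum => k _; exact: cmod_mul_le.
Qed.

Lemma ell2L (a : R[i]) x y : ell2 R x -> ell2 R y ->
  (sqnorm (a *: x + y)%R <= (2 * cmod a ^+ 2 * sqn x + 2 * sqn y)%:E)%E.
Proof.
move=> hx hy; apply: sqnorm_le => N.
apply: (@le_trans _ _ (\sum_(k < N) (2 * cmod a ^+ 2 * cmod (x k) ^+ 2 + 2 * cmod (y k) ^+ 2))).
  apply: ler_sum => k _; rewrite !fctE; apply: (le_trans (cmod_add2 _ _)).
  by rewrite -[_ *: _]/(a * x k) cmodM exprMn mulrA.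
rewrite big_split/= -!mulr_sumr; apply: lerD.
  by apply: ler_wpM2l; [rewrite mulr_ge0// sqr_ge0|exact: sqn_partial].
by apply: ler_wpM2l => //; exact: sqn_partial.
Qed.

Lemma ell2_fin x (N : nat) : (forall k, (N <= k)%N -> x k = 0) -> ell2 R x.
Proof.
move=> x0; apply: (@le_lt_trans _ _ (\sum_(k < N) cmod (x k) ^+ 2)%:E); last by rewrite ltry.
apply: sqnorm_le => m; have [/ltnW mN|Nm] := ltnP m N.
  by rewrite -(subnKC mN) big_split_ord/= lerDl sumr_ge0// => k _; exact: sqr_ge0.
rewrite -(subnKC Nm) big_split_ord/= [X in _ + X]big1 ?addr0// => k _.
by rewrite x0 ?cmod0 ?expr0n// leq_addr.
Qed.

Lemma ell2_basisE k j : ell2_basis R k j = (j == k)%:R.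
Proof. by []. Qed.

Lemma ell2_basis_in k : ell2 R (ell2_basis R k).
Proof. by apply: (@ell2_fin _ k.+1) => j kj; rewrite ell2_basisE gtn_eqF. Qed.

Lemma hip_ell2_basis x i : hip (ell2 R) x (ell2_basis R i) = x i.
Proof.
rewrite /= (@csum_fin _ i.+1) => [|k ik].
  rewrite (bigD1 ord_max)//= big1 ?addr0 => [|k ki].
    by rewrite ell2_basisE eqxx conjc1 mulr1.
  by rewrite ell2_basisE -[_ == i]/(k == ord_max) (negbTE ki) conjc0 mulr0.
by rewrite ell2_basisE gtn_eqF// conjc0 mulr0.
Qed.

Lemma ell2_ge0 x : ell2 R x -> 0 <= cRe (hip (ell2 R) x x).
Proof.
move=> hx; have [U [UU oU]] := ultra_oo.
have sx : summable (fun k => x k * (x k)^*%C) by eexists; exact: (ell2_summable hx hx).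
have h := csum_ulim (UU := UU) oU sx.
rewrite leNgt; apply/negP; rewrite -oppr_gt0 => neg.
have [N /= hN] := filter_ex (h _ neg).
have : 0 <= cRe (\sum_(k < N) x k * (x k)^*%C).
  by rewrite cRe_sum sumr_ge0// => k _; rewrite mulcJ sqr_ge0.
by have := le_lt_trans (le_trans (ler_norm _) (normr_cRe _)) hN; rewrite cReB /=; lra.
Qed.

Lemma ell2_ph : prehilbert (ell2 R).
Proof.
have sm x y : ell2 R x -> ell2 R y -> summable (fun k => x k * (y k)^*%C).
  by move=> hx hy; eexists; exact: ell2_summable.
split.
- exact: (@ell2_fin _ 0%N).
- by move=> a x y hx hy; apply: le_lt_trans (ell2L a hx hy) _; exact: ltry.
- move=> a x y w hx hy hw; rewrite /= -csumL; try exact: sm.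
  by congr csum; apply/funext => k; rewrite !fctE -[_ *: _]/(a * _) mulrDl mulrA.
- move=> x y hx hy; rewrite -[RHS](csumJ (sm x y hx hy)).
  by congr csum; apply/funext => k; rewrite conjcM conjcK mulrC.
- exact: ell2_ge0.
Qed.

Lemma hnorm_ell2_le x : ell2 R x -> hnorm (ell2 R) x ^+ 2 <= sqn x.
Proof.
move=> hx; rewrite (hnorm2 ell2_ph hx); apply: (le_trans (cRe_le_cmod _)).
apply: csum_le => N; apply: le_trans (sqn_partial N hx).
by apply: ler_sum => k _; rewrite mulcJ cmodr ger0_norm// sqr_ge0.
Qed.

Lemma ell2_coord_le x i : ell2 R x -> cmod (x i) <= hnorm (ell2 R) x.
Proof.
move=> hx; have he := ell2_basis_in i.
rewrite -hip_ell2_basis; apply: (le_trans (cauchy_schwarz ell2_ph hx he)).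
rewrite -[leRHS]mulr1; apply: ler_wpM2l; first exact: hnorm_ge0.
by rewrite /hnorm hip_ell2_basis ell2_basisE eqxx /= sqrtr1.
Qed.

End ell2_space.

(** * The vector-valued space and its coordinates *)

Section bergman_space.
Context {R : realType} {n : nat} (B : bergman_data R n) (hB : bergman_type_space B).
Local Notation D := (dom B).
Local Notation S := (scalar_bergman B).
Local Notation H := (bergman B).
Implicit Types (f g h : pt D -> nat -> R[i]^o) (u v : pt D -> R[i]^o).

Let Sp := S_ph hB.

Lemma H_ell2 f z : H f -> ell2 R (f z). Proof. by case. Qed.

Lemma sqnorm_meas f : (forall k, cmeas (fun z => f z k)) ->
  measurable_fun setT (fun z => sqnorm (f z)).
Proof.
move=> mf; apply: ge0_emeasurable_sum => [k x _ _|k _].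
  by rewrite lee_fin sqr_ge0.
by apply/measurable_EFinP; exact: cmeas_cmod2.
Qed.

Lemma sqn_int f : H f -> (sigma B).-integrable setT (EFin \o (fun z => sqn (f z))).
Proof.
move=> [f2 _ mf If]; apply: int_lty.
- apply: (measurableT_comp (f := fine)) => //; exact: sqnorm_meas.
- by move=> z; rewrite fine_ge0// sqnorm_ge0.
by under eq_integral do rewrite (sqnE (f2 _)).
Qed.

Lemma hip_meas f g : H f -> H g -> cmeas (fun z => hip (ell2 R) (f z) (g z)).
Proof.
move=> hf hg; have [f2 _ mf _] := hf; have [g2 _ mg _] := hg.
apply: (@cmeas_cvg _ _ _ (fun N z => \sum_(k < N) f z k * (g z k)^*%C)).
  by move=> N; apply: cmeas_sum => k; apply: cmeasM; [exact: mf|apply: cmeasJ; exact: mg].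
move=> z; apply: csum_null; eexists; exact: ell2_summable.
Qed.

Lemma hip_cint f g : H f -> H g -> cintegrable (sigma B) (fun z => hip (ell2 R) (f z) (g z)).
Proof.
move=> hf hg; apply: (cintegrable_le (hip_meas hf hg) (intD (sqn_int hf) (sqn_int hg))).
by move=> z; apply: csum_le; apply: ell2_summable; exact: H_ell2.
Qed.

Lemma H_ph : prehilbert H.
Proof.
split.
- split.
  + by move=> z; apply: (@ell2_fin _ _ 0%N).
  + by move=> k; exact: (analytic_cst (ptopen hB) 0).
  + by move=> k; exact: cmeas_cst.
  + rewrite integral0_eq ?lt0y// => z _; apply: eseries0 => k _ _.
    by rewrite cmod0 expr0n.
- move=> a f g hf hg; have [f2 af mf If] := hf; have [g2 ag mg Ig] := hg; split.
  + move=> z; apply: le_lt_trans (ell2L a (f2 z) (g2 z)) _; exact: ltry.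
  + by move=> k; exact: (analytic_lin (ptopen hB) a (af k) (ag k)).
  + move=> k; apply: cmeasD; last exact: mg.
    by apply: cmeasM; [exact: cmeas_cst|exact: mf].
  + have mL k : cmeas (fun z => (a *: f + g) z k).
      apply: cmeasD; last exact: mg.
      by apply: cmeasM; [exact: cmeas_cst|exact: mf].
    have iv := intD (intZ (2 * cmod a ^+ 2) (sqn_int hf)) (intZ 2 (sqn_int hg)).
    have v0 z : 0 <= 2 * cmod a ^+ 2 * sqn (f z) + 2 * sqn (g z).
      rewrite addr_ge0// ?mulr_ge0 ?sqr_ge0//; exact/fine_ge0/sqnorm_ge0.
    apply: le_lt_trans (int_lt iv v0); apply: ge0_le_integral; first by [].
    * by move=> z _; exact: sqnorm_ge0.
    * exact: sqnorm_meas.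
    * by case/integrableP: iv.
    * by move=> z _; exact: ell2L.
- move=> a f g h hf hg hh /=; rewrite -(cintegL a (hip_cint hf hh) (hip_cint hg hh)).
  by apply: cinteg_ext => z; exact: (ph_ipL ell2_ph a (H_ell2 z hf) (H_ell2 z hg) (H_ell2 z hh)).
- move=> f g hf hg; rewrite -[RHS](cintegJ (hip_cint hf hg)).
  by apply: cinteg_ext => z; exact: (ph_ipC ell2_ph (H_ell2 z hf) (H_ell2 z hg)).
- by move=> f hf; apply: Rintegral_ge0 => z _; exact: (ell2_ge0 (H_ell2 z hf)).
Qed.

Lemma H_complete : hcomplete H.
Proof. by case: hB => _ [_ [[]]]. Qed.

Definition emb k u : pt D -> nat -> R[i]^o := fun z => u z *: ell2_basis R k.

Lemma embE k u z j : emb k u z j = if j == k then u z else 0.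
Proof.
rewrite /emb fctE ell2_basisE -[_ *: _]/(u z * _).
by case: eqP => _; rewrite ?mulr1 ?mulr0.
Qed.

Lemma H_coord f k : H f -> S (fun z => f z k).
Proof.
move=> [f2 af mf If]; split; [exact: af|exact: mf|].
apply: le_lt_trans If; apply: ge0_le_integral; first by [].
- by move=> z _; rewrite lee_fin sqr_ge0.
- by apply/measurable_EFinP; exact: (cmeas_cmod2 (mf k)).
- exact: sqnorm_meas.
move=> z _; rewrite -sqnE//; rewrite lee_fin.
apply: le_trans (sqn_partial k.+1 (f2 z)).
by rewrite big_ord_recr/= lerDr sumr_ge0// => j _; exact: sqr_ge0.
Qed.

Lemma emb_H k u : S u -> H (emb k u).
Proof.
move=> hu; have [au mu Iu] := hu; split.
- by move=> z; apply: (@ell2_fin _ _ k.+1) => j kj; rewrite embE gtn_eqF.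
- move=> j; rewrite (_ : _ ^~ j = if j == k then u else fun=> 0); last first.
    by apply/funext => z; rewrite embE; case: eqP.
  by case: eqP => _ //; exact: (analytic_cst (ptopen hB) 0).
- move=> j; rewrite (_ : _ ^~ j = if j == k then u else fun=> 0); last first.
    by apply/funext => z; rewrite embE; case: eqP.
  by case: eqP => _ //; exact: cmeas_cst.
- rewrite (eq_integral (fun z => (cmod (u z) ^+ 2)%:E))// => z _.
  have bound N : \sum_(j < N) cmod (emb k u z j) ^+ 2 <= cmod (u z) ^+ 2.
    have [kN|Nk] := ltnP k N; last first.
      rewrite big1 ?sqr_ge0// => j _; rewrite embE ltn_eqF ?cmod0 ?expr0n//.
      exact: leq_trans (ltn_ord j) Nk.
    rewrite (bigD1 (Ordinal kN))//= embE eqxx big1 ?addr0// => j /negbTE jk.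
    by rewrite embE -[_ == k]/(j == Ordinal kN) jk cmod0 expr0n.
  apply/eqP; rewrite eq_le (sqnorm_le bound) andTb.
  have he : ell2 R (emb k u z) by apply: le_lt_trans (sqnorm_le bound) _; exact: ltry.
  rewrite -sqnE// lee_fin; apply: le_trans (sqn_partial k.+1 he).
  by rewrite big_ord_recr/= embE eqxx lerDr sumr_ge0// => j _; exact: sqr_ge0.
Qed.

Lemma hip_emb f k u : hip H f (emb k u) = hip S (fun z => f z k) u.
Proof.
apply: cinteg_ext => z; rewrite /= (@csum_fin _ _ k.+1) => [|j kj].
  rewrite big_ord_recr/= embE eqxx big1 ?add0r// => j _.
  by rewrite embE ltn_eqF ?conjc0 ?mulr0.
by rewrite embE gtn_eqF// conjc0 mulr0.
Qed.

Lemma emb_coord k u : (fun z => emb k u z k) = u.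
Proof. by apply/funext => z; rewrite embE eqxx. Qed.

Lemma emb_coord0 j k u : j != k -> (fun z => emb k u z j) = (fun=> 0).
Proof. by move=> /negbTE jk; apply/funext => z; rewrite embE jk. Qed.

Lemma hnorm_emb k u : S u -> hnorm H (emb k u) = hnorm S u.
Proof. by move=> hu; rewrite /hnorm hip_emb emb_coord. Qed.

Lemma embL k (a : R[i]) u v : emb k (a *: u + v) = a *: emb k u + emb k v.
Proof.
apply/funext => z; apply/funext => j; rewrite !fctE !embE.
by case: eqP => _ //; rewrite scaler0 addr0.
Qed.

(** The square of the left-hand side is the inner product of [f] with the embedding of its own
    [k]-th coordinate. *)
Lemma coord_le f k : H f -> hnorm S (fun z => f z k) <= hnorm H f.
Proof.
move=> hf; have hk := H_coord k hf; have [->|k0] := eqVneq (hnorm S (fun z => f z k)) 0.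
  exact: hnorm_ge0.
have kp : 0 < hnorm S (fun z => f z k) by rewrite lt_def k0 hnorm_ge0.
rewrite -(ler_pM2r kp) -expr2 (hnorm2 Sp hk) -hip_emb//.
apply: (le_trans (cRe_le_cmod _)); apply: (le_trans (cauchy_schwarz H_ph hf (emb_H k hk))).
by rewrite hnorm_emb.
Qed.

Lemma H_sum f N : (forall z k, (N <= k)%N -> f z k = 0) ->
  f = \sum_(k < N) emb k (fun z => f z k).
Proof.
move=> f0; apply/funext => z; apply/funext => j; rewrite fct_sumE fct_sumE.
have [jN|Nj] := ltnP j N.
  rewrite (bigD1 (Ordinal jN))//= embE eqxx big1 ?addr0// => k.
  by rewrite embE -val_eqE/= eq_sym => /negbTE ->.
rewrite f0// big1// => k _; rewrite embE gtn_eqF//.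
exact: leq_trans (ltn_ord k) Nj.
Qed.

Definition trunc N f : pt D -> nat -> R[i]^o := fun z k => if (k < N)%N then f z k else 0.

Lemma truncE N f : trunc N f = \sum_(k < N) emb k (fun z => f z k).
Proof.
rewrite {1}(@H_sum (trunc N f) N) => [|z k Nk]; last by rewrite /trunc ltnNge Nk.
apply: eq_bigr => k _; congr emb; apply/funext => z.
by rewrite /trunc ltn_ord.
Qed.

Lemma trunc_H N f : H f -> H (trunc N f).
Proof.
move=> hf; rewrite truncE; apply: (hsum H_ph) => k _; apply: emb_H; exact: H_coord.
Qed.

Lemma trunc_le N f : H f -> hnorm H (trunc N f) <= hnorm H f.
Proof.
move=> hf; have ht := trunc_H N hf.
have E : hip H (trunc N f) (trunc N f) = hip H f (trunc N f).
  have hk (k : 'I_N) : H (emb k (fun z => f z k)) by apply: emb_H; exact: H_coord.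
  have gen g : H g -> hip H g (trunc N f) = \sum_(k < N) hip S (fun z => g z k) (fun z => f z k).
    move=> hg; rewrite truncE (hip_sumr H_ph)//; apply: eq_bigr => k _.
    by rewrite hip_emb.
  rewrite !gen//; apply: eq_bigr => k _; congr (hip S _ _); apply/funext => z.
  by rewrite /trunc ltn_ord.
have [->|k0] := eqVneq (hnorm H (trunc N f)) 0; first exact: hnorm_ge0.
have kp : 0 < hnorm H (trunc N f) by rewrite lt_def k0 hnorm_ge0.
rewrite -(ler_pM2r kp) -expr2 (hnorm2 H_ph ht) E.
by apply: (le_trans (cRe_le_cmod _)); exact: (cauchy_schwarz H_ph hf ht).
Qed.

End bergman_space.

(** * Toeplitz operators with finite symbols *)

Section multiplication.
Context d (T : measurableType d) (R : realType) (mu : {measure set T -> \bar R}).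
Implicit Types (a f : T -> R[i]^o) (M : R).

Lemma cinteg_sum (N : nat) (F : nat -> T -> R[i]) : (forall k, cintegrable mu (F k)) ->
  cinteg mu (fun x => \sum_(k < N) F k x) = \sum_(k < N) cinteg mu (F k).
Proof.
move=> iF; suff [] : cintegrable mu (fun x => \sum_(k < N) F k x) /\
  cinteg mu (fun x => \sum_(k < N) F k x) = \sum_(k < N) cinteg mu (F k) by [].
elim: N => [|N [IHi IHe]].
  have i0 : mu.-integrable setT (EFin \o (fun=> 0 : R)) by exact: integrable0.
  rewrite big_ord0; under eq_fun do rewrite big_ord0; split.
    by split; exact: i0.
  by rewrite /cinteg; apply: complex_ext; rewrite /= /Rintegral integral0_eq.
have E x : \sum_(k < N.+1) F k x = 1 * F N x + \sum_(k < N) F k x.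
  by rewrite big_ord_recr/= addrC mul1r.
have -> : (fun x => \sum_(k < N.+1) F k x) = (fun x => 1 * F N x + \sum_(k < N) F k x).
  exact/funext.
split; first exact: cintegrableL.
by rewrite cintegL// IHe big_ord_recr/= addrC mul1r.
Qed.

(** The bound is only almost everywhere because [Linf_fin] controls an essential supremum. *)
Lemma mul_L2 a M f : cmeas a -> 0 <= M -> {ae mu, forall x, cmod (a x) <= M} ->
  L2 mu f -> L2 mu (fun x => a x * f x) /\
  hnorm (L2 mu) (fun x => a x * f x) <= M * hnorm (L2 mu) f.
Proof.
move=> ma M0 aM hf; have mf := proj1 hf.
have maf : cmeas (fun x => a x * f x) by exact: cmeasM.
have I : (sqint mu (fun x => a x * f x)%R <= (M ^+ 2)%:E * sqint mu f)%E.
  rewrite /sqint -ge0_integralZl//; last 3 first.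
  - by apply/measurable_EFinP; exact: cmeas_cmod2.
  - by move=> x _; rewrite lee_fin sqr_ge0.
  - by rewrite lee_fin sqr_ge0.
  apply: ae_ge0_le_integral => //.
  - by move=> x _; rewrite lee_fin sqr_ge0.
  - by apply/measurable_EFinP; exact: cmeas_cmod2.
  - by move=> x _; rewrite mule_ge0// lee_fin sqr_ge0.
  - apply: measurable_funeM; apply/measurable_EFinP; exact: cmeas_cmod2.
  apply: filterS aM => x h _; rewrite lee_fin cmodM exprMn.
  by apply: ler_wpM2r; [exact: sqr_ge0|rewrite ler_sqr ?nnegrE ?cmod_ge0].
have L : L2 mu (fun x => a x * f x).
  split=> //; apply: le_lt_trans I _.
  by rewrite -hnorm_L2// -EFinM ltry.
split=> //; rewrite -ler_sqr ?nnegrE ?mulr_ge0 ?hnorm_ge0//.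
by rewrite -lee_fin exprMn [leRHS]EFinM !hnorm_L2.
Qed.

Lemma mul_bounded a M : cmeas a -> 0 <= M -> {ae mu, forall x, cmod (a x) <= M} ->
  bounded_op (L2 mu) (fun f x => a x * f x).
Proof.
move=> ma M0 aM; split.
- by move=> f hf; have [] := mul_L2 ma M0 aM hf.
- move=> c f g _ _; apply/funext => x; rewrite !fctE.
  by rewrite -![_ *: _]/(_ * _) mulrDr mulrCA.
- by exists M => f hf; have [] := mul_L2 ma M0 aM hf.
Qed.

End multiplication.

(** * Matrix coefficients of bounded operators on [ell2] *)

Section ell2_operators.
Context (R : realType).
Implicit Types x y : nat -> R[i]^o.
Local Notation nrm := (hnorm (ell2 R)).

Lemma sqn_cvg x (e : R) : ell2 R x -> 0 < e ->
  exists m, sqn x < \sum_(k < m) cmod (x k) ^+ 2 + e.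
Proof.
move=> hx e0; apply: contrapT => /forallNP h.
have : (sqnorm x <= (sqn x - e)%:E)%E.
  by apply: sqnorm_le => N; rewrite lerBrDr leNgt; apply/negP; exact: h.
by rewrite -sqnE// lee_fin; lra.
Qed.

Lemma ell2_tail x (e : R) : ell2 R x -> 0 < e -> exists m0, forall m, (m0 <= m)%N ->
  nrm (x - \sum_(k < m) x k *: ell2_basis R k) <= e.
Proof.
move=> hx e0; have e20 : 0 < e ^+ 2 by rewrite exprn_gt0.
have [m0 hm0] := sqn_cvg hx e20; exists m0 => m m0m.
have Lp := @ell2_ph R; have Lsub := hsubr Lp.
have hs : ell2 R (\sum_(k < m) x k *: ell2_basis R k).
  by apply: (hsum Lp) => k _; apply: (hZ Lp); exact: ell2_basis_in.
have ht := Lsub _ _ hx hs.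
rewrite -ler_sqr ?nnegrE ?hnorm_ge0 ?(ltW e0)//.
apply: (le_trans (hnorm_ell2_le ht)); rewrite -lee_fin sqnE//.
have tE j : (x - \sum_(k < m) x k *: ell2_basis R k) j = if (j < m)%N then 0 else x j.
  rewrite !fctE fct_sumE; case: ltnP => jm.
    rewrite (bigD1 (Ordinal jm))//= big1 => [|k kj].
      by rewrite fctE ell2_basisE eqxx addr0 -[_ *: _]/(_ * _) mulr1 subrr.
    rewrite fctE ell2_basisE -[_ *: _]/(_ * _) eq_sym -[_ == j]/(k == Ordinal jm).
    by rewrite (negbTE kj) mulr0.
  rewrite big1 ?subr0// => k _.
  rewrite fctE ell2_basisE -[_ *: _]/(_ * _) gtn_eqF ?mulr0//.
  exact: leq_trans (ltn_ord k) jm.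
apply: sqnorm_le => N; have := sqn_partial (m + N) hx; rewrite big_split_ord/=.
have : \sum_(k < m0) cmod (x k) ^+ 2 <= \sum_(k < m) cmod (x k) ^+ 2.
  rewrite -(subnKC m0m) big_split_ord/= lerDl sumr_ge0// => k _; exact: sqr_ge0.
suff : \sum_(k < N) cmod ((x - \sum_(k < m) x k *: ell2_basis R k) k) ^+ 2 <=
   \sum_(k < N) cmod (x (m + k)%N) ^+ 2 by move: hm0; lra.
have [Nm|mN] := leqP N m.
  rewrite big1 ?sumr_ge0// => [k _|k _]; first exact: sqr_ge0.
  by rewrite tE (leq_trans (ltn_ord k) Nm) cmod0 expr0n.
have [p ->] : exists p, N = (m + p)%N by exists (N - m)%N; rewrite subnKC// ltnW.
apply: (@le_trans _ _ (\sum_(k < p) cmod (x (m + k)%N) ^+ 2)).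
  rewrite big_split_ord/= big1 ?add0r => [|k _].
    by apply: ler_sum => k _; rewrite tE ltnNge leq_addr.
  by rewrite tE ltn_ord cmod0 expr0n.
rewrite addnC big_split_ord/= lerDl sumr_ge0// => k _; exact: sqr_ge0.
Qed.

(** The finiteness of a symbol only concerns basis vectors. Linearity reaches finite sums, and
    boundedness with [ell2_tail] all of [ell2]. *)
Lemma ell2_op_coord (T : (nat -> R[i]^o) -> nat -> R[i]^o) (N : nat) i x : bounded_op (ell2 R) T ->
  (forall k, (N <= k)%N -> T (ell2_basis R k) i = 0) -> ell2 R x ->
  T x i = \sum_(k < N) x k * T (ell2_basis R k) i.
Proof.
move=> bT T0 hx; have Lp := @ell2_ph R; have Lsub := hsubr Lp.
have [M M0 hM] := bounded_op_bound bT; have [TH _ _] := bT.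
have hs m : ell2 R (\sum_(k < m) x k *: ell2_basis R k).
  by apply: (hsum Lp) => k _; apply: (hZ Lp); exact: ell2_basis_in.
have E m : (N <= m)%N -> T (\sum_(k < m) x k *: ell2_basis R k) i =
    \sum_(k < N) x k * T (ell2_basis R k) i.
  move=> Nm; have := bounded_op_sum Lp (index_enum 'I_m) (P := xpredT) bT (F := fun k : 'I_m => x k *: ell2_basis R k).
  move=> -> //; last first.
    by move=> k _; apply: (hZ Lp); exact: ell2_basis_in.
  rewrite fct_sumE -(subnKC Nm) big_split_ord/= [X in _ + X]big1 ?addr0 => [|k _].
    apply: eq_bigr => k _; rewrite (bounded_opZ Lp _ bT)//; exact: ell2_basis_in.
  rewrite (bounded_opZ Lp _ bT); last exact: ell2_basis_in.
  by rewrite !fctE T0 ?leq_addr// scaler0.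
apply/eqP; rewrite -subr_eq0 -cmod_eq0 eq_le cmod_ge0 andbT leNgt; apply/negP => pos.
have e0 : 0 < cmod (T x i - \sum_(k < N) x k * T (ell2_basis R k) i) / (2 * M).
  by rewrite divr_gt0// mulr_gt0.
have [m0 hm0] := ell2_tail hx e0.
have hy := Lsub _ _ hx (hs (maxn m0 N)).
have := le_trans (ell2_coord_le i (TH _ hy)) (hM _ hy).
rewrite (bounded_opB Lp bT hx (hs _)) !fctE E ?leq_maxr// => h.
have := le_trans h (ler_wpM2l (ltW M0) (hm0 _ (leq_maxl _ _))).
have -> : M * (cmod (T x i - \sum_(k < N) x k * T (ell2_basis R k) i) / (2 * M)) =
  cmod (T x i - \sum_(k < N) x k * T (ell2_basis R k) i) / 2.
  by rewrite invfM mulrCA [M * _]mulrCA divff ?gt_eqF// mulr1.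
by move: pos; lra.
Qed.

Lemma opnorm_coord (T : (nat -> R[i]^o) -> nat -> R[i]^o) i k : bounded_op (ell2 R) T ->
  cmod (T (ell2_basis R k) i) <= opnorm (ell2 R) T.
Proof.
move=> bT; have he := @ell2_basis_in R k; have [TH _ _] := bT.
apply: (le_trans (ell2_coord_le i (TH _ he))).
have e1 : nrm (ell2_basis R k) <= 1.
  by rewrite /hnorm hip_ell2_basis ell2_basisE eqxx /= sqrtr1.
apply: sup_ubound; last by exists (ell2_basis R k).
have [M M0 hM] := bounded_op_bound bT.
exists M => _ [x [hx x1] <-]; apply: (le_trans (hM _ hx)).
by rewrite ger_pMr.
Qed.

End ell2_operators.

(** * Toeplitz operators as finite blocks of band-dominated entries *)

Section toeplitz_blocks.
Context {R : realType} {n : nat} (B : bergman_data R n) (hB : bergman_type_space B).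
Local Notation D := (dom B).
Local Notation S := (scalar_bergman B).
Local Notation H := (bergman B).
Local Notation L := (L2 (sigma B)).
Implicit Types (f g h : pt D -> nat -> R[i]^o).

Let Lp := L2_ph (sigma B).
Let Hp := H_ph hB.

Lemma hip_fin (w : pt D -> nat -> R[i]^o) h (N : nat) :
  (forall z k, (N <= k)%N -> w z k = 0) -> (forall k, L (fun z => w z k)) -> H h ->
  hip H w h = \sum_(k < N) hip L (fun z => w z k) (fun z => h z k).
Proof.
move=> w0 wL hh.
rewrite -(cinteg_sum N (F := fun k z => w z k * (h z k)^*%C)) => [|k].
  apply: cinteg_ext => z; rewrite /= (@csum_fin _ _ N)// => k Nk.
  by rewrite w0// mul0r.
by apply: L2_cint => //; apply: SL; exact: (H_coord k hh).
Qed.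

(** By [hip_fin] the pairing with an element of [H] splits into finitely many scalar pairings, so
    the projection acts on each coordinate separately. *)
Lemma oproj_fin (w : pt D -> nat -> R[i]^o) (N : nat) :
  (forall z k, (N <= k)%N -> w z k = 0) -> (forall k, L (fun z => w z k)) ->
  oproj H w = \sum_(k < N) emb k (bproj (fun z => w z k)).
Proof.
move=> w0 wL; pose G := \sum_(k < N) emb k (@bproj _ _ B (fun z => w z k)).
have hG : H G.
  apply: (hsum Hp) => k _; apply: (emb_H hB); exact: (bprojP hB (wL k)).1.
have GE k : (fun z => G z k) = bproj (fun z => w z k).
  apply/funext => z; rewrite /G fct_sumE fct_sumE; have [kN|Nk] := ltnP k N.
    rewrite (bigD1 (Ordinal kN))//= embE eqxx big1 ?addr0// => j jk.
    by rewrite embE eq_sym -[_ == k]/(j == Ordinal kN) (negbTE jk).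
  have -> : (fun z => w z k) = 0 by apply/funext => u; rewrite w0.
  rewrite (bounded_op0 Lp (bproj_bounded hB)) big1// => j _.
  by rewrite embE gtn_eqF// (leq_trans (ltn_ord j)).
rewrite /oproj; case: xgetP => [g _ [hg gP]|/(_ G)[]].
  apply/funext => z; apply/funext => k.
  suff : (fun z => g z k) = (fun z => G z k) by move=> /(congr1 (fun u => u z)).
  rewrite GE; apply: (bproj_uniq hB (wL k)); first exact: (H_coord k hg).
  by move=> u hu; have := gP _ (emb_H hB k hu); rewrite hip_emb.
split=> // h hh.
rewrite (@hip_fin _ _ N)// => [|z k Nk|k].
- apply: big1 => k _; rewrite (_ : (fun z => _) = (fun z => w z k) - (fun z => G z k))//.
  by rewrite GE; apply: (bproj_perp hB (wL k)); exact: (H_coord k hh).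
- have : G z k = 0.
    have wk0 : (fun z => w z k) = 0 by apply/funext => u; rewrite w0.
    have := congr1 (fun u => u z) (GE k); rewrite wk0 (bounded_op0 Lp (bproj_bounded hB)); exact.
  by rewrite !fctE => ->; rewrite w0// subrr.
- have Lsub := hsubr Lp; rewrite (_ : (fun z => _) = (fun z => w z k) - (fun z => G z k))//.
  by apply: Lsub; [exact: wL|rewrite GE; exact: (bproj_L hB (wL k))].
Qed.

Lemma Linf_fin_entries u : Linf_fin (B := B) u -> exists (N : nat) (a : nat -> nat -> pt D -> R[i]^o) (M : R),
  [/\ forall i k, cmeas (a i k), 0 <= M,
      forall i k, {ae sigma B, forall z, cmod (a i k z) <= M},
      forall z x i, (N <= i)%N -> ell2 R x -> u z x i = 0 &
      forall z x i, ell2 R x -> u z x i = \sum_(k < N) a i k z * x k].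
Proof.
move=> [bu mu iu [N uN]].
pose a i k z : R[i]^o := u z (ell2_basis R k) i.
have aE z i k : hip (ell2 R) (u z (ell2_basis R k)) (ell2_basis R i) = a i k z.
  exact: hip_ell2_basis.
have exp z x i : ell2 R x -> u z x i = \sum_(k < N) a i k z * x k.
  move=> hx; rewrite (ell2_op_coord (N := N) (bu z))// => [|k Nk].
    by apply: eq_bigr => k _; rewrite mulrC.
  by have := uN z k i; rewrite aE Nk; exact.
have [M M0 aM] : exists2 M, 0 <= M & {ae sigma B, forall z, opnorm (ell2 R) (u z) <= M}.
  have fin := sub_Lfun_finLfun iu; rewrite inE/= /finite_norm Lnorm.unlock /= in fin.
  (* The norm in question is an essential supremum only for a nonzero measure; for the zero measure
     every property holds almost everywhere. *)
  have [s0|s0] := ltP 0%E (sigma B setT); last first.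
    exists 0 => //; exists setT; split => //.
    by apply/eqP; rewrite eq_le measure_ge0 s0.
  rewrite s0 in fin.
  have := ess_sup_inf.ess_sup_ge (sigma B) (abse \o (fun z => (opnorm (ell2 R) (u z))%:E)).
  move: fin; move: (ess_sup_inf.ess_sup _ _) => c cfin hc.
  exists `|fine c|; first exact: normr_ge0.
  apply: filterS hc => z /=.
  case: c cfin => [c| |] //= _.
  rewrite lee_fin => h; apply: (le_trans (ler_norm _)); apply: (le_trans h); exact: ler_norm.
exists N, a, M; split => //.
- by move=> i k; have := mu i k; under eq_fun do rewrite aE.
- move=> i k; apply: filterS aM => z; apply: le_trans.
  exact: opnorm_coord.
- move=> z x i Ni hx; rewrite exp// big1// => k _.
  by have := uN z k i; rewrite aE Ni orbT => ->; rewrite ?mul0r.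
Qed.

(* Composed with [bproj] so that the entry acts on [L], where [band] is defined. *)
Definition entry (X : (pt D -> nat -> R[i]^o) -> pt D -> nat -> R[i]^o) i k
    (u : pt D -> R[i]^o) : pt D -> R[i]^o := fun z => X (emb k (bproj u)) z i.

Lemma emb_proj_H k u : L u -> H (emb k (bproj u)).
Proof. by move=> hu; apply: (emb_H hB); exact: (bprojP hB hu).1. Qed.

Lemma entry_le X M i k u : (forall f, H f -> H (X f) /\ hnorm H (X f) <= M * hnorm H f) -> 0 <= M -> L u ->
  S (entry X i k u) /\ hnorm L (entry X i k u) <= M * hnorm L u.
Proof.
move=> hX M0 hu; have he := emb_proj_H k hu; have [XH Xle] := hX _ he.
split; first exact: (H_coord i XH).
apply: (le_trans (coord_le hB i XH)); apply: (le_trans Xle); apply: ler_wpM2l => //.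
rewrite (hnorm_emb _ (bprojP hB hu).1); exact: (bproj_le hB hu).
Qed.

Lemma entry_bounded X i k : bounded_op H X -> bounded_op L (entry X i k).
Proof.
move=> bX; have [M M0 hM] := bounded_op_bound bX; have [XH Xlin _] := bX.
have h f : H f -> H (X f) /\ hnorm H (X f) <= M * hnorm H f by move=> hf; split; [exact: XH|exact: hM].
split.
- by move=> u hu; apply: SL; have [] := entry_le i k h (ltW M0) hu.
- move=> a u v hu hv; have [_ lin _] := bproj_bounded hB.
  apply/funext => z; rewrite /entry lin// embL Xlin//; exact: emb_proj_H.
- by exists M => u hu; have [] := entry_le i k h (ltW M0) hu.
Qed.

(** The last clause is [X = P X P] on [H], with [P] the projection onto the first [N]
    coordinates. *)
Definition blockop (X : (pt D -> nat -> R[i]^o) -> pt D -> nat -> R[i]^o) :=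
  [/\ bounded_op H X, forall i k, band (entry X i k) &
      exists N : nat, forall f, H f -> X (trunc N f) = X f /\ forall z i, (N <= i)%N -> X f z i = 0].

Lemma trunc_trunc N N' f : (N <= N')%N -> trunc N (trunc N' f) = trunc N f.
Proof.
move=> NN; apply/funext => z; apply/funext => k; rewrite /trunc.
by case: ltnP => // kN; rewrite (leq_trans kN NN).
Qed.

Lemma blockop_widen (X : (pt D -> nat -> R[i]^o) -> pt D -> nat -> R[i]^o) N N' : (N <= N')%N ->
  (forall f, H f -> X (trunc N f) = X f /\ forall z i, (N <= i)%N -> X f z i = 0) ->
  forall f, H f -> X (trunc N' f) = X f /\ forall z i, (N' <= i)%N -> X f z i = 0.
Proof.
move=> NN h f hf; split => [|z i Ni]; last by apply: (h f hf).2; exact: leq_trans NN Ni.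
by rewrite -(h _ (trunc_H hB N' hf)).1 trunc_trunc// (h f hf).1.
Qed.

Lemma blockop_add X Y : blockop X -> blockop Y -> blockop (fun f => X f + Y f).
Proof.
move=> [bX cX [N hN]] [bY cY [N' hN']]; split.
- have := bounded_op_lin Hp 1 bX bY; under eq_fun do rewrite scale1r; exact.
- move=> i k; rewrite (_ : entry _ i k = fun u => entry X i k u + entry Y i k u)//.
  by apply: band_add => //; exact: entry_bounded.
exists (maxn N N') => f hf.
have [E0 E1] := blockop_widen (leq_maxl N N') hN hf.
have [F0 F1] := blockop_widen (leq_maxr N N') hN' hf.
split=> [|z i Ni]; first by rewrite E0 F0.
by rewrite !fctE E1// F1// addr0.
Qed.

Lemma band_eq (T T' : (pt D -> R[i]^o) -> pt D -> R[i]^o) :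
  (forall u, L u -> T u = T' u) -> band T -> band T'.
Proof.
move=> TT h e e0; have [r [A [r0 A1 A2]]] := h e e0; exists r, A; split => // f hf.
by rewrite -TT//; exact: A1.
Qed.

Lemma band_sum N (F : nat -> (pt D -> R[i]^o) -> pt D -> R[i]^o) :
  (forall k, bounded_op L (F k)) -> (forall k, band (F k)) ->
  bounded_op L (fun u => \sum_(k < N) F k u) /\ band (fun u => \sum_(k < N) F k u).
Proof.
move=> bF cF; elim: N => [|N [IH1 IH2]].
  have E : (fun u : pt D -> R[i]^o => \sum_(k < 0) F k u) = fun=> 0.
    by apply/funext => u; rewrite big_ord0.
  rewrite E; split; last by apply: band_local => // u _; exact: (ph0 Lp).
  split; [by move=> u _; exact: (ph0 Lp)|by move=> *; rewrite scaler0 addr0|].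
  by exists 0 => f hf; rewrite (hnorm0 Lp) mul0r.
have E : (fun u : pt D -> R[i]^o => \sum_(k < N.+1) F k u) = fun u => \sum_(k < N) F k u + F N u.
  by apply/funext => u; rewrite big_ord_recr.
rewrite E; split; last exact: band_add.
have := bounded_op_lin Lp 1 IH1 (bF N); under eq_fun do rewrite scale1r; exact.
Qed.

Lemma blockop_comp X Y : blockop X -> blockop Y -> blockop (X \o Y).
Proof.
move=> [bX cX [N hN]] [bY cY [N' hN']]; split.
- exact: bounded_op_comp.
- move=> i k.
  (* Matrix multiplication; the sum stops at [N] because [X] reads only the first [N]
     coordinates. *)
  apply: (band_eq (T := fun u => \sum_(l < N) (entry X i l \o entry Y l k) u)); last first.
    apply: (band_sum N (F := fun l => entry X i l \o entry Y l k) _ _).2 => l.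
      by apply: bounded_op_comp; exact: entry_bounded.
    by apply: band_comp => //; exact: entry_bounded.
  move=> u hu; have he := emb_proj_H k hu; have [YH _ _] := bY; have hY := YH _ he.
  apply/funext => z; rewrite /entry /= -[in RHS](hN _ hY).1 truncE.
  rewrite (bounded_op_sum Hp _ (P := xpredT) bX) => [|l _]; last first.
    by apply: (emb_H hB); exact: (H_coord _ hY).
  rewrite !fct_sumE; apply: eq_bigr => l _; rewrite bproj_id//; exact: (H_coord _ hY).
exists (maxn N N') => f hf.
have [E0 E1] := blockop_widen (leq_maxr N N') hN' hf.
split=> [|z i Ni] /=; first by rewrite E0.
have [YH _ _] := bY; apply: (hN _ (YH _ hf)).2; exact: leq_trans (leq_maxl _ _) Ni.
Qed.

Lemma blockop_eq (X X' : (pt D -> nat -> R[i]^o) -> pt D -> nat -> R[i]^o) :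
  (forall f, H f -> X f = X' f) -> blockop X -> blockop X'.
Proof.
move=> XX [[XH Xlin [M hM]] cX [N hN]]; split.
- split; [by move=> f hf; rewrite -XX//; exact: XH| |by exists M => f hf; rewrite -XX//; exact: hM].
  move=> a f g hf hg; rewrite -!XX//; first exact: Xlin.
  exact: (phL Hp).
- move=> i k; apply: (band_eq (T := entry X i k)) => // u hu.
  by apply/funext => z; rewrite /entry XX//; exact: emb_proj_H.
exists N => f hf; rewrite -!XX//; first exact: hN.
exact: trunc_H.
Qed.

Lemma blockop0 : blockop (fun=> 0).
Proof.
split.
- split; [by move=> u _; exact: (ph0 Hp)|by move=> *; rewrite scaler0 addr0|].
  by exists 0 => f hf; rewrite (hnorm0 Hp) mul0r.
- move=> i k; apply: band_local => // u _; exact: (ph0 Lp).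
- by exists 0%N.
Qed.

Lemma blockop_sum N (F : nat -> (pt D -> nat -> R[i]^o) -> pt D -> nat -> R[i]^o) :
  (forall k, blockop (F k)) -> blockop (fun f => \sum_(k < N) F k f).
Proof.
move=> bF; elim: N => [|N IH].
  by apply: blockop_eq blockop0 => f _; rewrite big_ord0.
by apply: blockop_eq (blockop_add IH (bF N)) => f _; rewrite big_ord_recr.
Qed.

Lemma blockop_entry i k (a : pt D -> R[i]^o) M : cmeas a -> 0 <= M ->
  {ae sigma B, forall z, cmod (a z) <= M} ->
  blockop (fun f => emb i (bproj (fun z => a z * f z k))).
Proof.
move=> ma M0 aM; have bm := mul_bounded ma M0 aM; have [mL mlin _] := bm.
have [_ plin _] := bproj_bounded hB.
have fk f : H f -> L (fun z => f z k) by move=> hf; apply: SL; exact: (H_coord k hf).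
split.
- split.
  + by move=> f hf; apply: emb_proj_H; apply: mL; exact: fk.
  + move=> c f g hf hg; rewrite -embL -plin; try (apply: mL; exact: fk).
    by rewrite -mlin//; exact: fk.
  + exists M => f hf; have haf := mL _ (fk _ hf).
    rewrite (hnorm_emb _ (bprojP hB haf).1); apply: (le_trans (bproj_le hB haf)).
    apply: (le_trans (mul_L2 ma M0 aM (fk _ hf)).2); apply: ler_wpM2l => //.
    exact: (coord_le hB k hf).
- move=> j l.
  have [ij|ij] := eqVneq j i; last first.
    apply: (band_eq (T := fun=> 0)); last by apply: band_local => // u _; exact: (ph0 Lp).
    by move=> u hu; apply/funext => z; rewrite /entry embE (negbTE ij).
  have [kl|kl] := eqVneq k l; last first.
    apply: (band_eq (T := fun=> 0)); last by apply: band_local => // u _; exact: (ph0 Lp).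
    move=> u hu; apply/funext => z; rewrite /entry embE ij eqxx.
    have -> : (fun w => a w * emb l (bproj u) w k) = 0.
      by apply/funext => w; rewrite embE (negbTE kl) mulr0.
    by rewrite (bounded_op0 Lp (bproj_bounded hB)).
  (* The only nonzero entry: a local multiplication between two projections, the inner one coming
     from [entry]. *)
  apply: (band_eq (T := @bproj _ _ B \o ((fun v z => a z * v z) \o @bproj _ _ B))).
    move=> u hu; apply/funext => z; rewrite /entry embE ij eqxx /=; congr (bproj _ z).
    by apply/funext => w; rewrite embE kl eqxx.
  apply: band_comp; [exact: bproj_bounded|apply: bounded_op_comp => //; exact: bproj_bounded|exact: band_bproj|].
  apply: band_comp => //; [exact: bproj_bounded| |exact: band_bproj].
  by apply: band_local => // f g w ->.
exists (maxn i k).+1 => f hf; split=> [|z j ij].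
  by congr (emb i (bproj _)); apply/funext => z; rewrite /trunc ltnS leq_maxr.
by rewrite embE gtn_eqF// (leq_ltn_trans (leq_maxl i k)).
Qed.

Lemma toeplitz_block u : Linf_fin u -> blockop (toeplitz u).
Proof.
move=> /Linf_fin_entries[N [a [M [ma M0 aM uN uE]]]].
apply: (blockop_eq (X := fun f => \sum_(i < N) \sum_(k < N)
    emb i (bproj (fun z => a i k z * f z k)))); last first.
  apply: (blockop_sum N (F := fun i f => \sum_(k < N) emb i (bproj (fun z => a i k z * f z k)))) => i.
  apply: (blockop_sum N (F := fun k f => emb i (bproj (fun z => a i k z * f z k)))) => k.
  exact: (blockop_entry i k (ma i k) M0 (aM i k)).
move=> f hf.
have hak i k : L (fun z => a i k z * f z k).
  by have [] := mul_L2 (ma i k) M0 (aM i k) (SL (H_coord k hf)).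
have wE i : (fun z => u z (f z) i) = \sum_(k < N) (fun z => a i k z * f z k).
  by apply/funext => z; rewrite uE ?fct_sumE//; exact: H_ell2.
rewrite /toeplitz (@oproj_fin _ N) => [|z k Nk|k].
- apply: eq_bigr => i _; rewrite wE.
  rewrite (bounded_op_sum Lp _ (P := xpredT) (bproj_bounded hB))//.
  apply/funext => z; apply/funext => j; rewrite fct_sumE fct_sumE embE.
  under eq_bigr do rewrite embE.
  by case: eqP => _; rewrite ?fct_sumE// big1.
- by apply: uN => //; exact: H_ell2.
- by rewrite wE; apply: (hsum Lp) => j _; exact: hak.
Qed.

Lemma fin_sums_block X :
  fin_sums (fin_products [set toeplitz u | u in Linf_fin (B := B)]) X -> blockop X.
Proof.
elim=> [Y|Y Z _ IHY _ IHZ]; last exact: blockop_add.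
elim=> [_ [u hu <-]|Y' Z _ IHY _ IHZ]; first exact: toeplitz_block.
exact: blockop_comp.
Qed.

End toeplitz_blocks.

(** * From the Berezin transform to compactness *)

Section sufficiency.
Context {R : realType} {n : nat} (B : bergman_data R n) (hB : bergman_type_space B).
Local Notation D := (dom B).
Local Notation d := (@dist _ _ B).
Local Notation o := (origin D).
Local Notation K := (@ker _ _ B).
Local Notation S := (scalar_bergman B).
Local Notation H := (bergman B).
Implicit Types (f g h : pt D -> nat -> R[i]^o).

Let Sp := S_ph hB.
Let Hp := H_ph hB.

Lemma limsup_infty0P (g : pt D -> R) : limsup_infty (B := B) g = 0%E <->
  forall e : R, 0 < e -> exists r : R, forall z, r < d z o -> g z <= e.
Proof.
rewrite /limsup_infty; set X := limf_esup _ _; split => [X0 e e0|h].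
  have : (X < e%:E)%E.
    apply: (@le_lt_trans _ _ 0%E); last by rewrite lte_fin.
    by rewrite -X0 le_max lexx orbT.
  move=> /ereal_inf_lt[_ [A [r _ rA] <-] Ae]; exists r => z rz.
  rewrite -lee_fin; apply: le_trans (ltW Ae); apply: ereal_sup_ubound.
  by exists z => //; exact: rA.
apply/eqP; rewrite eq_le le_max lexx orTb andbT ge_max lexx andTb.
apply/lee_addgt0Pr => e e0; rewrite add0e.
have [r hr] := h e e0.
apply: (@le_trans _ _ (ereal_sup [set (g z)%:E | z in [set z | r < d z o]])).
  apply: ereal_inf_lbound; exists [set z | r < d z o] => //.
  by exists r.
by apply: ge_ereal_sup => _ [z rz <-]; rewrite lee_fin; exact: hr.
Qed.

Lemma total_sequence : exists x : nat -> pt D -> nat -> R[i]^o,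
  [/\ forall a, H (x a),
      forall f, H f -> (forall a, hip H f (x a) = 0) -> hnorm H f = 0 &
      forall a, exists i w, x a = emb i (K w)].
Proof.
have [q hq] := K_total hB.
(* An enumeration of all pairs of a coordinate and a point [q b]; numbers that encode no pair give
   [(0, 0)]. *)
pose x a := emb (odflt (0%N, 0%N) (unpickle a)).1 (K (q (odflt (0%N, 0%N) (unpickle a)).2)).
exists x; split; [by move=> a; apply: (emb_H hB); exact: K_S| |by move=> a; eexists; eexists].
move=> f hf f0; suff -> : f = 0 by exact: (hnorm0 Hp).
apply/funext => z; apply/funext => i.
suff : (fun z => f z i) = 0 by move=> /(congr1 (fun u => u z)).
have hi := H_coord i hf; apply: (S_def hB hi); apply: hq => // a.
by have := f0 (pickle (i, a)); rewrite /x pickleK -[odflt _ _]/(i, a) hip_emb.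
Qed.

Lemma coord_weakly_null (g : nat -> pt D -> nat -> R[i]^o) k :
  weakly_null (H := H) g -> weakly_null (H := S) (fun m z => g m z k).
Proof.
move=> [gH [M gM] g0]; split.
- by move=> m; exact: (H_coord k (gH m)).
- by exists M => m; exact: le_trans (coord_le hB k (gH m)) (gM m).
- move=> u hu; apply: null_seq_le (g0 _ (emb_H hB k hu)) => m.
  by rewrite hip_emb.
Qed.

Section band_operator.
Variable T : (pt D -> nat -> R[i]^o) -> pt D -> nat -> R[i]^o.
Hypothesis (bT : bounded_op H T).
Hypothesis (berT : forall i k, limsup_infty (B := B)
  (fun z => cmod (hip (ell2 R) (berezin T z (ell2_basis R k)) (ell2_basis R i))) = 0%E).
Hypothesis (appT : forall e : R, 0 < e -> exists2 X, blockop (B := B) X &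
  forall f, H f -> hnorm H (T f - X f) <= e * hnorm H f).

Lemma entry_band i k : band (entry (B := B) T i k).
Proof.
have Hsub := hsubr Hp; have [TH _ _] := bT.
apply: (band_limit (entry_bounded hB i k bT)) => e e0.
have [X [bX cX _] hX] := appT e0; exists (entry X i k); split; first exact: cX.
move=> u hu; have he := emb_proj_H hB k hu; have [XH _ _] := bX.
split; first by have [h _ _] := entry_bounded hB i k bX; exact: h.
have := coord_le hB i (Hsub _ _ (TH _ he) (XH _ he)).
move=> /le_trans; apply; apply: (le_trans (hX _ he)); apply: ler_wpM2l; first exact: ltW.
rewrite (hnorm_emb _ (bprojP hB hu).1); exact: (bproj_le hB hu).
Qed.

Lemma entry_weakly_null i k (u : nat -> pt D -> R[i]^o) : weakly_null (H := S) u ->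
  null_seq (fun m => hnorm S (fun z => T (emb k (u m)) z i)).
Proof.
have [TH Tlin _] := bT; have [M M0 hM] := bounded_op_bound bT.
apply: (scalar_weakly_null hB (T := fun u z => T (emb k u) z i)).
- split.
  + by move=> v hv; apply: (H_coord i); apply: TH; exact: (emb_H hB).
  + move=> a v w hv hw; apply/funext => z.
    by rewrite embL Tlin//; exact: (emb_H hB).
  + exists M => v hv; have he := emb_H hB k hv.
    apply: (le_trans (coord_le hB i (TH _ he))); apply: (le_trans (hM _ he)).
    by rewrite hnorm_emb.
- move=> e e0; have e20 : 0 < e / 2 by rewrite divr_gt0.
  have [r hr] := (limsup_infty0P _).1 (berT i k) _ e20; exists r => z rz.
  have := hr z rz; rewrite hip_ell2_basis /berezin.
  rewrite -[nker_vec z (ell2_basis R i)]/(emb i (nker z)) hip_emb.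
  by move=> h; apply: (le_lt_trans h); lra.
- exact: entry_band.
Qed.

Lemma compact_of_berezin : compact_op H T.
Proof.
have [x [xH xtot _]] := total_sequence; have [TH Tlin _] := bT.
have Hsub := hsubr Hp.
apply: (compact_of_weakly_null Hp (H_complete hB) bT xH xtot) => g wg.
have [gH [M gM] _] := wg; have M0 : 0 <= M := le_trans (hnorm_ge0 _) (gM 0%N).
move=> e e0; pose e1 := e / (4 * (M + 1)).
have e10 : 0 < e1 by rewrite divr_gt0//; lra.
have [X [bX _ [N hN]] hX] := appT e10; have [XH _ _] := bX.
have ns : null_seq (fun m => \sum_(i < N) \sum_(k < N)
    hnorm S (fun z => T (emb k (fun w => g m w k)) z i)).
  apply: null_seq_sum => i; apply: null_seq_sum => k; apply: entry_weakly_null.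
  exact: coord_weakly_null.
have e20 : 0 < e / 2 by rewrite divr_gt0.
have [N0 hN0] := ns _ e20; exists N0 => m /hN0 hm.
(* The Berezin transform of the approximant [X] is not known to vanish at infinity. So [X = P X P]
   only serves to replace [T] by [P T P], whose finitely many entries are entries of [T] itself. *)
have hg := gH m; have hgt := trunc_H hB N hg; set y := trunc N (T (trunc N (g m))).
have hy : H y by apply: (trunc_H hB); exact: TH.
have h1 : hnorm H (T (g m) - X (g m)) <= e1 * M.
  by apply: (le_trans (hX _ hg)); apply: ler_wpM2l; [exact: ltW|exact: gM].
have h2 : hnorm H (X (g m) - y) <= e1 * M.
  have -> : X (g m) - y = trunc N (X (trunc N (g m)) - T (trunc N (g m))).
    rewrite (hN _ hg).1; apply/funext => z; apply/funext => k.
    rewrite /y !fctE /trunc; case: ltnP => // Nk.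
    by rewrite (hN _ hg).2// subr0.
  apply: (le_trans (trunc_le hB N (Hsub _ _ (XH _ hgt) (TH _ hgt)))).
  rewrite (hnormBC Hp (XH _ hgt) (TH _ hgt)); apply: (le_trans (hX _ hgt)).
  by apply: ler_wpM2l; [exact: ltW|exact: le_trans (trunc_le hB N hg) (gM m)].
have h3 : hnorm H y < e / 2.
  apply: le_lt_trans hm; rewrite /y truncE.
  have hc i : S (fun z => T (trunc N (g m)) z i) by apply: (H_coord i); exact: TH.
  apply: (le_trans (hnorm_sum Hp _ (P := xpredT) _)) => [i _|]; first exact: (emb_H hB).
  apply: ler_sum => i _; rewrite (hnorm_emb _ (hc i)) truncE.
  have hk k : H (emb k (fun w => g m w k)) by apply: (emb_H hB); exact: (H_coord k hg).
  rewrite (bounded_op_sum Hp _ (P := xpredT) bT)//.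
  rewrite (_ : (fun z => _) = \sum_(k < N) (fun z => T (emb k (fun w => g m w k)) z i)); last first.
    by apply/funext => z; rewrite !fct_sumE.
  apply: (hnorm_sum Sp) => k _; apply: (H_coord i); exact: TH.
have h4 := hnorm_tri Hp (TH _ hg) (XH _ hg) hy.
have h5 := hnormD Hp (Hsub _ _ (TH _ hg) hy) hy; rewrite subrK in h5.
have e1M : e1 * M <= e / 4.
  have -> : e1 * M = e / 4 * (M / (M + 1)).
    by rewrite /e1 invfM mulrA -!mulrA [_ * M]mulrC.
  apply: ler_piMr; first by rewrite divr_ge0// ltW.
  by rewrite ler_pdivrMr ?ltr_wpDl// mul1r lerDl.
have split4 (a : R) : a = a / 4 + a / 4 + a / 2 by field.
apply: (le_lt_trans h5); rewrite [ltRHS]split4; apply: ler_ltD h3; apply: (le_trans h4).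
by apply: lerD; [exact: le_trans h1 e1M|exact: le_trans h2 e1M].
Qed.

End band_operator.
End sufficiency.

(** * Limits of Toeplitz operators *)

Section point_mass.
Context {R : realType} {n : nat} (D : domain R n) (w : pt D).
Implicit Types (f : pt D -> R[i]^o) (E : set (pt D)).

Import HBNNSimple.

(** The Jordan parts and the variation of a point mass are compared with Dirac and zero measures on
    measurable sets only, not as functions of arbitrary sets. *)
Lemma integral_set_ext d (T : measurableType d) (m m' : set T -> \bar R) (f : T -> \bar R) :
  (forall A, measurable A -> m A = m' A) -> (\int[m]_x f x = \int[m']_x f x)%E.
Proof.
move=> mm; rewrite /integral; congr (ereal_sup _ - ereal_sup _)%E;
  apply/seteqP; split => _ [h hf <-]; exists h => //; rewrite /sintegral;
  apply: eq_fsbigr => x _;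
  by rewrite mm//; exact: measurable_sfunP.
Qed.

Let delta : {finite_measure set (pt D) -> \bar R} := \d_w.
Let nu : {charge set (pt D) -> \bar R} := charge_of_finite_measure delta.
Let zero : {charge set (pt D) -> \bar R} := @czero _ (pt D) R.

(** The Dirac mass of any measurable part of a negative set is at most 0, hence 0; so the negative
    part vanishes for whichever Hahn decomposition [hahn] selects. *)
Lemma jordan_delta E : measurable E ->
  jordan_pos (hahn nu) E = \d_w E /\ jordan_neg (hahn nu) E = 0%E.
Proof.
move=> mE; have dec : \d_w E = (jordan_pos (hahn nu) E + (-1)%:E * jordan_neg (hahn nu) E)%E.
  exact: (jordan_decomp (hahn nu) mE).
have : jordan_neg (hahn nu) E = 0%E.
  rewrite jordan_negE cjordan_negE /crestr0/= mem_set// /crestr.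
  have [_ [mN +] _ _] := hahn nu => /(_ _ (measurableI _ _ mE mN) (@subIsetr _ _ _)) h.
  by apply/eqP; rewrite eqe_oppLR oppe0 eq_le h measure_ge0.
move=> n0; split=> //; by rewrite dec n0 mule0 adde0.
Qed.

Lemma jordan_zero E : measurable E ->
  jordan_pos (hahn zero) E = 0%E /\ jordan_neg (hahn zero) E = 0%E.
Proof.
move=> mE; split; [rewrite jordan_posE cjordan_posE|rewrite jordan_negE cjordan_negE];
  by rewrite /crestr0 mem_set// /crestr ?oppe0.
Qed.

Lemma cintegral_delta f : cmeas f ->
  cmeasure_integral (CMeasure nu zero) f = f w.
Proof.
move=> [m1 m2].
have Ip (g : pt D -> R) : measurable_fun setT g ->
    \int[jordan_pos (hahn nu)]_z g z = g w /\ \int[jordan_neg (hahn nu)]_z g z = 0.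
  move=> mg; rewrite /Rintegral; split.
    rewrite (integral_set_ext (m' := \d_w)) => [|E mE]; last by have [] := jordan_delta mE.
    by rewrite integral_dirac ?diracT ?mul1e//; exact/measurable_EFinP.
  rewrite (integral_set_ext (m' := mzero)) => [|E mE]; last by have [] := jordan_delta mE.
  by rewrite integral_measure_zero.
have Iz (g : pt D -> R) :
    \int[jordan_pos (hahn zero)]_z g z = 0 /\ \int[jordan_neg (hahn zero)]_z g z = 0.
  rewrite /Rintegral; split.
    rewrite (integral_set_ext (m' := mzero)) => [|E mE]; last by have [] := jordan_zero mE.
    by rewrite integral_measure_zero.
  rewrite (integral_set_ext (m' := mzero)) => [|E mE]; last by have [] := jordan_zero mE.
  by rewrite integral_measure_zero.
rewrite /cmeasure_integral /charge_integral /= /cintegral.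
rewrite (Ip _ m1).1 (Ip _ m1).2 (Ip _ m2).1 (Ip _ m2).2.
rewrite (Iz (fun z => cRe (f z))).1 (Iz (fun z => cRe (f z))).2.
rewrite (Iz (fun z => cIm (f z))).1 (Iz (fun z => cIm (f z))).2.
by rewrite subrr mulr0 addr0 -[(0 +i* 0)%C]/(0 : R[i]) subr0; case: (f w).
Qed.

Lemma variation_delta E : measurable E ->
  cmeasure_variation (CMeasure nu zero) E = \d_w E.
Proof.
move=> mE; rewrite /cmeasure_variation.
have val F : measurable F -> (cmod (cmeasure_val (CMeasure nu zero) F))%:E = \d_w F.
  move=> mF; have -> : cmeasure_val (CMeasure nu zero) F = (fine (\d_w F))%:C%C by [].
  by rewrite cmodr ger0_norm ?fine_ge0// fineK// fin_num_measure.
apply/eqP; rewrite eq_le; apply/andP; split.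
  apply: ge_ereal_sup => _ [F [mF tF <-] <-].
  have -> : \d_w (\bigcup_k F k) = (\sum_(k <oo) \d_w (F k))%E :> \bar R.
    by rewrite measure_bigcup//; apply: eq_eseriesl => k; rewrite in_setT.
  rewrite (eq_eseriesr (g := fun k => \d_w (F k)))// => k _; exact: val.
apply: ereal_sup_ubound; exists (fun k => if k is 0%N then E else set0).
  split=> [[]//| |]; first by apply/trivIsetP => -[|i] [|j] //= _ _ _; rewrite ?set0I ?setI0.
  apply/seteqP; split => [x [[|k] _]//|x Ex]; by exists 0%N.
rewrite (@nneseries_split _ _ 0 1)//; last by move=> k _; rewrite lee_fin cmod_ge0.
rewrite eseries0 ?adde0 => [|k k1 _].
  by rewrite add0n big_nat1; exact: val.
by case: k k1 => //= k _; rewrite val// measure0.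
Qed.

End point_mass.

(** * The closed algebra generated by finite symbols *)

Section closure_algebra.
Context {R : realType} {n : nat} (B : bergman_data R n) (hB : bergman_type_space B).
Local Notation D := (dom B).
Local Notation d := (@dist _ _ B).
Local Notation o := (origin D).
Local Notation K := (@ker _ _ B).
Local Notation S := (scalar_bergman B).
Local Notation H := (bergman B).
Local Notation L := (L2 (sigma B)).
Local Notation opH := ((pt D -> nat -> R[i]^o) -> pt D -> nat -> R[i]^o).
Local Notation gen := (fin_sums (fin_products [set toeplitz u | u in Linf_fin (B := B)])).
Local Notation clos := (toeplitz_Linf_fin (B := B)).
Implicit Types (f g h : pt D -> nat -> R[i]^o) (X Y : opH).

Let Lp := L2_ph (sigma B).
Let Sp := S_ph hB.
Let Hp := H_ph hB.

Lemma gen_bounded X : gen X -> bounded_op H X.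
Proof. by case/(fin_sums_block hB). Qed.

(** Products are distributed over sums. Operators are linear on [H] only, so [Z] agrees with the
    composite there. *)
Lemma gen_comp X Y : gen X -> gen Y -> exists2 Z, gen Z & forall f, H f -> Z f = X (Y f).
Proof.
move=> gX; elim: gX Y => [X' pX|X1 X2 _ IH1 _ IH2] Y gY; last first.
  have [Z1 g1 E1] := IH1 _ gY; have [Z2 g2 E2] := IH2 _ gY.
  by exists (fun f => Z1 f + Z2 f) => [|f hf]; [exact: fs_add|rewrite E1// E2].
have bX : bounded_op H X' by apply: gen_bounded; exact: fs_gen.
elim: gY => [Y' pY|Y1 Y2 g1 [Z1 gZ1 E1] g2 [Z2 gZ2 E2]].
  by exists (X' \o Y') => //; apply: fs_gen; exact: fp_mul.
exists (fun f => Z1 f + Z2 f) => [|f hf]; first exact: fs_add.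
have [H1 _ _] := gen_bounded g1; have [H2 _ _] := gen_bounded g2.
by rewrite E1// E2// (bounded_opD bX)//; [exact: H1|exact: H2].
Qed.

Lemma clos_limit X : bounded_op H X -> (forall e : R, 0 < e -> exists2 Y, clos Y &
  forall f, H f -> hnorm H (X f - Y f) <= e * hnorm H f) -> clos X.
Proof.
move=> bX h; split=> // e e0; have e20 : 0 < e / 2 by rewrite divr_gt0.
have [Y [bY hY] XY] := h _ e20; have [Z gZ YZ] := hY _ e20; exists Z => // f hf.
have [XH _ _] := bX; have [YH _ _] := bY; have [ZH _ _] := gen_bounded gZ.
apply: (le_trans (hnorm_tri Hp (XH _ hf) (YH _ hf) (ZH _ hf))).
apply: (le_trans (lerD (XY _ hf) (YZ _ hf))).
by rewrite -mulrDl -splitr.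
Qed.

Lemma clos_eq X Y : (forall f, H f -> X f = Y f) -> clos X -> clos Y.
Proof.
move=> E [[XH Xlin [M hM]] hX]; split.
  split; [by move=> f hf; rewrite -E//; exact: XH| |by exists M => f hf; rewrite -E//; exact: hM].
  move=> a f g hf hg; rewrite -!E//; first exact: Xlin.
  exact: (phL Hp).
move=> e /hX[Z gZ hZ]; exists Z; first by [].
by move=> f hf; rewrite -(E f hf); exact: (hZ f hf).
Qed.

Lemma clos_add X Y : clos X -> clos Y -> clos (fun f => X f + Y f).
Proof.
move=> [bX hX] [bY hY]; split.
  by have := bounded_op_lin Hp 1 bX bY; under eq_fun do rewrite scale1r; exact.
move=> e e0; have e20 : 0 < e / 2 by rewrite divr_gt0.
have [X' gX XX] := hX _ e20; have [Y' gY YY] := hY _ e20.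
exists (fun f => X' f + Y' f) => [|f hf]; first exact: fs_add.
have [XH _ _] := bX; have [YH _ _] := bY; have Hsub := hsubr Hp.
have [XH' _ _] := gen_bounded gX; have [YH' _ _] := gen_bounded gY.
rewrite opprD addrACA.
apply: (le_trans (hnormD Hp (Hsub _ _ (XH _ hf) (XH' _ hf)) (Hsub _ _ (YH _ hf) (YH' _ hf)))).
apply: (le_trans (lerD (XX _ hf) (YY _ hf))).
by rewrite -mulrDl -splitr.
Qed.

Lemma clos_comp X Y : clos X -> clos Y -> clos (X \o Y).
Proof.
move=> [bX hX] [bY hY]; split; first exact: bounded_op_comp.
move=> e e0; have [M M0 hM] := bounded_op_bound bY; have [XH _ _] := bX; have [YH _ _] := bY.
have eM : 0 < e / 2 / M by rewrite !divr_gt0.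
have [X' gX XX] := hX _ eM; have bX' := gen_bounded gX; have [XH' _ _] := bX'.
have [M' M'0 hM'] := bounded_op_bound bX'.
have eM' : 0 < e / 2 / M' by rewrite !divr_gt0.
have [Y' gY YY] := hY _ eM'; have [YH' _ _] := gen_bounded gY.
have [Z gZ ZE] := gen_comp gX gY; exists Z => // f hf; rewrite ZE//= .
have hYf := YH _ hf; have hYf' := YH' _ hf; have Hsub := hsubr Hp.
apply: (le_trans (hnorm_tri Hp (XH _ hYf) (XH' _ hYf) (XH' _ hYf'))).
rewrite -(bounded_opB Hp bX' hYf hYf').
have h1 : hnorm H (X (Y f) - X' (Y f)) <= e / 2 * hnorm H f.
  apply: (le_trans (XX _ hYf)); apply: (le_trans (ler_wpM2l (ltW eM) (hM _ hf))).
  by rewrite mulrA divfK ?gt_eqF.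
have h2 : hnorm H (X' (Y f - Y' f)) <= e / 2 * hnorm H f.
  apply: (le_trans (hM' _ (Hsub _ _ hYf hYf'))).
  apply: (le_trans (ler_wpM2l (ltW M'0) (YY _ hf))).
  by rewrite mulrA [M' * _]mulrC divfK ?gt_eqF.
by apply: (le_trans (lerD h1 h2)); rewrite -mulrDl -splitr.
Qed.

Lemma embZ k (a : R[i]) (u : pt D -> R[i]^o) : emb k (a *: u) = a *: emb k u.
Proof.
apply/funext => z; apply/funext => j; rewrite embE -[RHS]/(a * emb k u z j) embE.
by case: eqP => _; rewrite ?mulr0.
Qed.

(** The operator matrix whose only entry is [A], in row [j] and column [i]. *)
Definition lift i j (A : (pt D -> R[i]^o) -> pt D -> R[i]^o) : opH :=
  fun f => emb j (A (fun z => f z i)).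

Lemma lift_bounded i j A : bounded_op S A -> bounded_op H (lift i j A).
Proof.
move=> [AS Alin [M hM]]; split.
- by move=> f hf; apply: (emb_H hB); apply: AS; exact: (H_coord i hf).
- by move=> a f g hf hg; rewrite /lift -embL -Alin//; exact: H_coord.
exists `|M| => f hf; have hi := H_coord i hf.
rewrite /lift (hnorm_emb _ (AS _ hi)); apply: (le_trans (hM _ hi)).
apply: (@le_trans _ _ (`|M| * hnorm S (fun z => f z i))).
  by apply: ler_wpM2r => //; exact: ler_norm.
by apply: ler_wpM2l => //; exact: (coord_le hB i hf).
Qed.

(** This property is carried from scalar Toeplitz operators through algebra and limits to the
    operators supplied by (A.8). All positions are required at once because [A o A'] at [(i, j)]
    uses [A] at [(j, j)]. *)
Definition liftable (A : (pt D -> R[i]^o) -> pt D -> R[i]^o) :=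
  bounded_op S A /\ forall i j, clos (lift i j A).

Lemma liftable_eq A A' : (forall u, S u -> A u = A' u) -> liftable A -> liftable A'.
Proof.
move=> E [[AS Alin [M hM]] hA]; split.
  split; [by move=> f hf; rewrite -E//; exact: AS| |by exists M => f hf; rewrite -E//; exact: hM].
  move=> a f g hf hg; rewrite -!E//; first exact: Alin.
  exact: (phL Sp).
move=> i j; apply: clos_eq (hA i j) => f hf; rewrite /lift E//; exact: (H_coord i hf).
Qed.

Lemma liftable_add A A' : liftable A -> liftable A' -> liftable (fun u => A u + A' u).
Proof.
move=> [bA hA] [bA' hA']; split.
  by have := bounded_op_lin Sp 1 bA bA'; under eq_fun do rewrite scale1r; exact.
move=> i j; apply: clos_eq (clos_add (hA i j) (hA' i j)) => f _.
by rewrite /lift -[X in emb j (X + _)]scale1r embL scale1r.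
Qed.

Lemma liftable_comp A A' : liftable A -> liftable A' -> liftable (A \o A').
Proof.
move=> [bA hA] [bA' hA']; split; first exact: bounded_op_comp.
move=> i j; apply: clos_eq (clos_comp (hA j j) (hA' i j)) => f _.
by rewrite /lift /= emb_coord.
Qed.

Lemma liftable_limit A : bounded_op S A -> (forall e : R, 0 < e -> exists2 A', liftable A' &
  forall u, S u -> hnorm S (A u - A' u) <= e * hnorm S u) -> liftable A.
Proof.
move=> bA h; split=> // i j; apply: clos_limit; first exact: lift_bounded.
move=> e e0; have [A' [bA' hA'] AA] := h e e0; exists (lift i j A') => [|f hf]; first exact: hA'.
have hi := H_coord i hf; have [AS _ _] := bA; have [AS' _ _] := bA'; have Ssub := hsubr Sp.
rewrite /lift (_ : emb j _ - _ = emb j (A (fun z => f z i) - A' (fun z => f z i))); last first.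
  by rewrite -[X in _ = emb j (_ + X)]scaleN1r [X in _ = emb j X]addrC embL scaleN1r addrC.
rewrite (hnorm_emb _ (Ssub _ _ (AS _ hi) (AS' _ hi))); apply: (le_trans (AA _ hi)).
by apply: ler_wpM2l; [exact: ltW|exact: (coord_le hB i hf)].
Qed.

Definition unit_symbol i j (a : pt D -> R[i]^o) (z : pt D) (x : nat -> R[i]^o) : nat -> R[i]^o :=
  (a z * x i) *: ell2_basis R j.

Lemma unit_symbolE i j a z x k : unit_symbol i j a z x k = if k == j then a z * x i else 0.
Proof.
rewrite /unit_symbol fctE ell2_basisE -[_ *: _]/(_ * _).
by case: eqP => _; rewrite ?mulr1 ?mulr0.
Qed.

Lemma unit_symbol_op i j a z : bounded_op (ell2 R) (unit_symbol i j a z) /\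
  opnorm (ell2 R) (unit_symbol i j a z) = cmod (a z).
Proof.
have Ep := @ell2_ph R.
have le x : ell2 R x -> hnorm (ell2 R) (unit_symbol i j a z x) <= cmod (a z) * hnorm (ell2 R) x.
  move=> hx; rewrite /unit_symbol (hnormZ Ep _ (ell2_basis_in j)).
  have -> : hnorm (ell2 R) (ell2_basis R j) = 1.
    by rewrite /hnorm hip_ell2_basis ell2_basisE eqxx /= sqrtr1.
  rewrite mulr1 cmodM; apply: ler_wpM2l; [exact: cmod_ge0|exact: ell2_coord_le].
have b : bounded_op (ell2 R) (unit_symbol i j a z).
  split; [by move=> x hx; apply: (hZ Ep); exact: ell2_basis_in| |by exists (cmod (a z))].
  move=> c x y _ _; apply/funext => k; rewrite !fctE !unit_symbolE.
  case: eqP => _; last by rewrite scaler0 addr0.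
  by rewrite -![_ *: _]/(_ * _) mulrDr mulrCA.
split=> //; apply/eqP; rewrite eq_le; apply/andP; split; last first.
  by have := opnorm_coord j i b; rewrite unit_symbolE eqxx ell2_basisE eqxx mulr1.
apply: ge_sup; first by exists (hnorm (ell2 R) (unit_symbol i j a z 0)); exists 0 => //;
  split; [exact: (ph0 Ep)|rewrite (hnorm0 Ep)].
move=> _ [x [hx x1] <-]; apply: (le_trans (le _ hx)).
by apply: ler_piMr => //; exact: cmod_ge0.
Qed.

(** Continuity is metric, measurability Euclidean: by separability each strict sublevel set is a
    countable union of balls, and these are Borel sets. *)
Lemma dist_cont_meas (g : pt D -> R) :
  (forall z e, 0 < e -> exists2 r : R, 0 < r & forall u, d z u < r -> `|g z - g u| < e) ->
  measurable_fun setT g.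
Proof.
move=> cg _; apply: (measurability _ (RGenInftyO.measurableE R)) => //.
move=> _ [_ [y ->] <-]; rewrite setTI.
have [q hq] := d_dense hB.
pose P a m := dball (q a) (m.+1%:R^-1 : R) `<=` [set z | g z < y].
have -> : g @^-1` `]-oo, y[%classic =
    \bigcup_a \bigcup_(m in [set m | P a m]) dball (q a) (m.+1%:R^-1 : R).
  apply/seteqP; split => [z /=|z [a _ [m /= Pm zm]]]; rewrite in_itv/=; last exact: Pm.
  move=> gz; have e0 : 0 < y - g z by rewrite subr_gt0.
  have [r r0 hr] := cg z _ e0; have r20 : 0 < r / 2 by rewrite divr_gt0.
  have [N hN] := @null_seq_inv R _ r20; have mN := hN N (leqnn N).
  have p0 : 0 < (N.+1%:R^-1 : R) by rewrite invr_gt0.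
  have [a ha] := hq z _ p0; exists a => //; exists N; last by rewrite /dball /= distC.
  move=> u /= hu; rewrite /dball /= in hu.
  have : `|g z - g u| < y - g z.
    apply: hr; apply: le_lt_trans (dist_triangle (q a) z u) _.
    by rewrite [ltRHS]splitr; apply: ltrD; [exact: lt_trans ha mN|exact: lt_trans hu mN].
  by rewrite distrC => /(le_lt_trans (ler_norm _)); lra.
apply: bigcup_measurable => a _; apply: bigcup_measurable => m _; exact: ball_meas.
Qed.

Lemma buc_meas a : buc_symbol (B := B) a -> cmeas a.
Proof.
move=> [_ uc].
have c z e : 0 < e -> exists2 r : R, 0 < r & forall u, d z u < r -> cmod (a z - a u) < e.
  move=> e0; have eC : 0 < (e%:C%C : R[i]) by rewrite ltcR.
  have := uc [set xy : R[i]^o * R[i]^o | ball xy.1 (e%:C%C : R[i]) xy.2].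
  rewrite -!entourage_ballE => /(_ _)[|r /= r0 hr]; first by exists (e%:C%C).
  by exists r => // u zu; have := hr (z, u) zu; rewrite /= /ball/= -ltcR.
split; apply: dist_cont_meas => z e /(c z)[r r0 hr]; exists r => // u /hr; apply: le_lt_trans.
  by rewrite -cReB; exact: normr_cRe.
by rewrite -cImB; exact: normr_cIm.
Qed.

Lemma unit_symbol_Linf i j a : buc_symbol a -> Linf_fin (B := B) (unit_symbol i j a).
Proof.
move=> ba; have ma := buc_meas ba; have [[M aM] _] := ba; split.
- by move=> z; exact: (unit_symbol_op i j a z).1.
- move=> k l; rewrite (_ : (fun z => _) = fun z => if k == j then a z * (ell2_basis R l i) else 0); last first.
    by apply/funext => z; rewrite hip_ell2_basis unit_symbolE.
  case: eqP => _; last exact: cmeas_cst.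
  by apply: cmeasM => //; exact: cmeas_cst.
- have E : (fun z => opnorm (ell2 R) (unit_symbol i j a z)) = (fun z => cmod (a z)).
    by apply/funext => z; exact: (unit_symbol_op i j a z).2.
  rewrite E; apply/andP; split; first by rewrite inE; exact: cmeas_cmod.
  rewrite inE /=.
  rewrite /finite_norm Lnorm.unlock /=; case: ifP => // _.
  apply: (@le_lt_trans _ _ M%:E); last exact: ltry.
  by apply/ess_sup_inf.ess_supP; apply: nearW => z /=; rewrite lee_fin ger0_norm.
exists (maxn i j).+1 => z k l; rewrite hip_ell2_basis unit_symbolE.
rewrite ![(maxn _ _ < _)%N]gtn_max => h; case: eqP => // lj.
rewrite ell2_basisE; case: eqP => [ik|_]; last by rewrite mulr0.
by move: h; rewrite -lj -ik !ltnn !andbF.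
Qed.

Lemma liftable_toeplitz a : buc_symbol a -> liftable (scalar_toeplitz a).
Proof.
move=> ba; have ma := buc_meas ba; have [[M0 aM0] _] := ba.
have M0' : 0 <= `|M0| by exact: normr_ge0.
have aM : {ae sigma B, forall z, cmod (a z) <= `|M0|}.
  by apply: nearW => z; exact: le_trans (aM0 z) (ler_norm _).
have hm u : S u -> L (fun z => a z * u z) by move=> hu; have [] := mul_L2 ma M0' aM (SL hu).
have E u : S u -> scalar_toeplitz a u = bproj (fun z => a z * u z).
  by move=> hu; rewrite /scalar_toeplitz (oproj_bproj hB (hm _ hu)).
split.
  have [_ plin _] := bproj_bounded hB; have [_ mlin _] := mul_bounded ma M0' aM.
  split.
  - by move=> u hu; rewrite E//; exact: (bprojP hB (hm _ hu)).1.
  - move=> c u v hu hv; rewrite !E//; last exact: (phL Sp).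
    by rewrite -plin; [rewrite -mlin//; exact: SL|exact: hm|exact: hm].
  - exists `|M0| => u hu; rewrite E//; apply: (le_trans (bproj_le hB (hm _ hu))).
    exact: (mul_L2 ma M0' aM (SL hu)).2.
move=> i j; have uL := unit_symbol_Linf i j ba.
have gU : gen (toeplitz (unit_symbol i j a)) by apply: fs_gen; apply: fp_gen; exists (unit_symbol i j a).
apply: (clos_eq (X := toeplitz (unit_symbol i j a))); last first.
  split; first exact: gen_bounded.
  move=> e e0; exists (toeplitz (unit_symbol i j a)) => // f hf.
  by rewrite subrr (hnorm0 Hp) mulr_ge0// ltW.
move=> f hf; have hi := H_coord i hf; rewrite /lift E//.
have wE k : (fun z => unit_symbol i j a z (f z) k) = if k == j then (fun z => a z * f z i) else 0.
  by apply/funext => z; rewrite unit_symbolE; case: eqP.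
rewrite /toeplitz (oproj_fin hB (N := j.+1)) => [|z k jk|k].
- rewrite big_ord_recr/= wE eqxx big1 ?add0r// => k _; rewrite wE ltn_eqF//.
  rewrite (bounded_op0 Lp (bproj_bounded hB)); apply/funext => z; apply/funext => l.
  by rewrite embE; case: eqP.
- by rewrite unit_symbolE gtn_eqF.
- by rewrite wE; case: eqP => _; [exact: hm|exact: (ph0 Lp)].
Qed.

(** Finite sums of products do not include scalar multiples explicitly; a scalar enters as the
    Toeplitz operator with constant symbol. *)
Lemma liftable_scale (c : R[i]) A : liftable A -> liftable (fun u => c *: A u).
Proof.
move=> hA; have bc : buc_symbol (B := B) (fun=> c).
  split; first by exists (cmod c).
  move=> E entE; apply: (@filterS _ (@entourage (mpt B)) _ setT) => [xy _|]; last exact: filterT.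
  exact: (entourage_refl (c : R[i]^o) entE).
have [[AS _ _] _] := hA.
apply: liftable_eq (liftable_comp (liftable_toeplitz bc) hA) => u hu /=.
have hAu := AS _ hu; have hc : S (fun z => c * A u z) by apply: (hZ Sp c hAu).
by rewrite /scalar_toeplitz (oproj_bproj hB (SL hc)) (bproj_id hB hc).
Qed.

Lemma liftable_BUC A : toeplitz_BUC A -> liftable A.
Proof.
move=> [bA hA]; apply: liftable_limit => // e /hA[A' gA' AA]; exists A' => //.
elim: gA' {AA} => [_ [a ba <-]|A1 A2 _ IH1 _ IH2|c A1 _ IH1|A1 A2 _ IH1 _ IH2].
- exact: liftable_toeplitz.
- exact: liftable_add.
- exact: liftable_scale.
- exact: liftable_comp.
Qed.

Hypothesis hA8 : carleson_toeplitz_BUC B.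

Lemma liftable_point (w : pt D) : liftable (fun u => u w *: K w).
Proof.
pose delta : {finite_measure set (pt D) -> \bar R} := \d_w.
pose mu := CMeasure (charge_of_finite_measure delta) (@czero _ (pt D) R).
have hmu : carleson (B := B) (cmeasure_variation mu).
  (* For a point mass the Carleson condition is the boundedness of evaluation at [w]. *)
  exists (@knorm _ _ B w ^+ 2) => u hu; have [_ mu' _] := hu.
  rewrite (integral_set_ext (m' := \d_w)) => [|E mE]; last exact: variation_delta.
  rewrite integral_dirac//; last by apply/measurable_EFinP; exact: cmeas_cmod2.
  rewrite diracT mul1e -[X in (_ <= _ * X)%E](hnorm_L2 (SL hu)) -EFinM lee_fin -exprMn.
  rewrite ler_sqr ?nnegrE ?cmod_ge0 ?mulr_ge0 ?hnorm_ge0 ?(kn_ge0 hB)//.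
  exact: (eval_le hB w hu).
apply: liftable_eq (liftable_BUC (hA8 hmu)) => u hu; have [_ mu' _] := hu.
apply/funext => z; rewrite /toeplitz_cmeasure cintegral_delta ?(keripE hB)//.
  by rewrite fctE mulrC.
apply: (cmeasM (f := fun v => kerip v z)) => //.
rewrite (_ : (fun v => kerip v z) = fun v => (K z v)^*%C); last first.
  by apply/funext => v; rewrite (keripE hB) (KJ hB z v).
by apply: cmeasJ; have [_ ? _] := K_S hB z.
Qed.

(** The lower estimate in (A.5) excludes zeros of the kernel. *)
Lemma K_neq0 (z w : pt D) : K w z != 0.
Proof.
have [C C0 hC] := corr_est hB; have [_ h] := hC w z.
have pos : 0 < C * corr w z by apply: lt_le_trans h; rewrite invr_gt0 (kn_gt0 hB).
rewrite pmulr_rgt0// in pos; rewrite -cmod_eq0 (cmodK hB) gt_eqF// mulr_gt0//.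
by rewrite mulr_gt0// (kn_gt0 hB).
Qed.

Lemma liftable_kernels (z w : pt D) (c : R[i]) : liftable (fun u => (c * u w) *: K z).
Proof.
have h := liftable_scale (c / K w z) (liftable_comp (liftable_point z) (liftable_point w)).
apply: liftable_eq h => u hu /=; rewrite !scalerA; congr (_ *: _).
by rewrite fctE -[_ *: K w z]/(_ * _) [u w * _]mulrC mulrA divfK ?K_neq0.
Qed.

Lemma clos0 : clos (fun=> 0).
Proof.
have := (liftable_kernels o o 0).2 0%N 0%N; apply: clos_eq => f hf.
apply/funext => z; apply/funext => k; rewrite /lift embE mul0r scale0r.
by case: eqP.
Qed.

Variable x : nat -> pt D -> nat -> R[i]^o.
Hypothesis xE : forall a, exists i w, x a = emb i (K w).

Let xH a : H (x a).
Proof. by have [i [w ->]] := xE a; apply: (emb_H hB); exact: K_S. Qed.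

Let spanH u : hspan (range x) u -> H u.
Proof. by apply: (hspan_sub Hp) => _ [a _ <-]. Qed.

Lemma clos_rank_one u v : hspan (range x) u -> hspan (range x) v ->
  forall c : R[i], clos (fun f => (c * hip H f v) *: u).
Proof.
move=> su sv; elim: su => [|a _ u' [k _ <-] su' IH] c.
  by apply: clos_eq clos0 => f _; rewrite scaler0.
apply: (clos_eq (X := fun f => (c * a * hip H f v) *: x k + (c * hip H f v) *: u')).
  by move=> f _; rewrite scalerDr scalerA mulrAC.
apply: clos_add; last exact: IH.
elim: sv (c * a) => [|b _ v' [l _ <-] sv' IHv] c'.
  by apply: clos_eq clos0 => f hf; rewrite (hip0r Hp hf) mulr0 scale0r.
apply: (clos_eq (X := fun f => (c' * b^*%C * hip H f (x l)) *: x k + (c' * hip H f v') *: x k)).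
  move=> f hf; rewrite (hipDr Hp) ?(hipZr Hp)//; [|exact: (hZ Hp)|exact: spanH].
  by rewrite -scalerDl mulrDr mulrA.
apply: clos_add; last exact: IHv.
have [i [w wE]] := xE l; have [j [z zE]] := xE k; rewrite wE zE.
apply: clos_eq ((liftable_kernels z w (c' * b^*%C)).2 i j) => f hf.
rewrite hip_emb -(repro hB w (H_coord i hf)) /lift.
exact: embZ.
Qed.

Lemma clos_compact T : bounded_op H T -> compact_op H T ->
  (forall f, H f -> (forall a, hip H f (x a) = 0) -> hnorm H f = 0) -> clos T.
Proof.
move=> bT cT xtot; apply: clos_limit => // e e0.
have [N [u [v [su sv hN]]]] := compact_finite_rank Hp (H_complete hB) xH xtot bT cT e0.
exists (fun f => \sum_(k < N) hip H f (v k) *: u k); last exact: hN.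
elim: N {hN} => [|N IH]; first by apply: clos_eq clos0 => f _; rewrite big_ord0.
apply: clos_eq (clos_add IH (clos_rank_one (su N) (sv N) 1)) => f _.
by rewrite big_ord_recr/= mul1r.
Qed.

End closure_algebra.

(** * Compact operators have vanishing Berezin transform *)

Section necessity.
Context {R : realType} {n : nat} (B : bergman_data R n) (hB : bergman_type_space B).
Local Notation D := (dom B).
Local Notation d := (@dist _ _ B).
Local Notation o := (origin D).
Local Notation K := (@ker _ _ B).
Local Notation S := (scalar_bergman B).
Local Notation H := (bergman B).

Let Hp := H_ph hB.

(** Boundedness reduces the claim to the total family [emb i (K w)], against which the pairings are
    at most [knorm w * corr w (zs m)], small by [corr_small]. *)
Lemma nker_weakly_null (zs : nat -> pt D) k : escapes zs ->
  weakly_null (H := H) (fun m => emb k (nker (zs m))).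
Proof.
move=> ez; have [x [xH xtot xE]] := total_sequence hB.
apply: (weakly_null_total Hp (H_complete hB) (X := range x) (M := 1)).
- by move=> _ [a _ <-].
- by move=> f hf f0; apply: xtot => // a; apply: f0; exists a.
- by move=> m; apply: (emb_H hB); exact: (nker_S hB).
- by move=> m; rewrite (hnorm_emb _ (nker_S hB (zs m))) -[leLHS]/(hnorm (L2 (sigma B)) (nker (zs m))) (nrm_nker hB).
move=> _ [a _ <-]; have [i [w ->]] := xE a.
have bd m : cmod (hip H (emb k (nker (zs m))) (emb i (K w))) <= knorm w * corr w (zs m).
  rewrite hip_emb; have [->|ik] := eqVneq i k; last first.
    rewrite emb_coord0// (hip0l (S_ph hB) (K_S hB w)) cmod0.
    by rewrite mulr_ge0 ?(kn_ge0 hB) ?(corr_ge0 hB).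
  rewrite emb_coord -(repro hB w (nker_S hB (zs m))) /nker cmodM cmodV cmodr.
  rewrite ger0_norm ?(kn_ge0 hB)// (cmodK hB) (corrC hB).
  rewrite -mulrA mulrC [knorm (zs m) * _]mulrC mulfK ?(kn_neq0 hB)//.
apply: null_seq_le bd _; apply: null_seqZ; first exact: (kn_ge0 hB).
move=> e e0; have e20 : 0 < e / 2 by rewrite divr_gt0.
have [r r0 hr] := corr_small hB e20; have [N hN] := ez (r + d o w).
exists N => m /hN hm; apply: (@le_lt_trans _ _ (e / 2)); last by lra.
apply: hr; have := dist_triangle w (zs m) o; rewrite (distC w o) (distC w); lra.
Qed.

Lemma berezin_compact T i k : bounded_op H T -> compact_op H T ->
  limsup_infty (B := B)
    (fun z => cmod (hip (ell2 R) (berezin T z (ell2_basis R k)) (ell2_basis R i))) = 0%E.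
Proof.
move=> bT cT; have [TH _ _] := bT; apply/limsup_infty0P => e e0; apply: contrapT => /forallNP h.
have {h} h (m : nat) : exists z, m%:R < d z o /\
    e < cmod (hip (ell2 R) (berezin T z (ell2_basis R k)) (ell2_basis R i)).
  have /existsNP[z /not_implyP[z1 z2]] := h m%:R; exists z; split => //.
  by rewrite ltNge; apply/negP.
have [zs hzs] := choice h.
have ez : escapes zs.
  move=> M; exists (Num.trunc `|M|).+1 => m Nm; apply: lt_le_trans (ltW (hzs m).1).
  apply: (le_lt_trans (ler_norm _)); apply: (lt_le_trans (truncnS_gt _)).
  by rewrite ler_nat.
have := compact_weakly_null Hp (H_complete hB) bT cT (nker_weakly_null k ez).
move=> /(_ _ e0)[N /(_ N (leqnn N))]; have [_ ] := hzs N.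
have hk j : H (emb j (nker (zs N))) by apply: (emb_H hB); exact: (nker_S hB).
rewrite hip_ell2_basis /berezin -[nker_vec _ (ell2_basis R k)]/(emb k (nker (zs N))).
rewrite -[nker_vec _ (ell2_basis R i)]/(emb i (nker (zs N))).
have := cauchy_schwarz Hp (TH _ (hk k)) (hk i).
have nk : hnorm S (nker (zs N)) = 1 := nrm_nker hB (zs N).
rewrite (hnorm_emb _ (nker_S hB (zs N))) nk mulr1 => h1 h2 h3.
by have := lt_trans (lt_le_trans h2 h1) h3; rewrite ltxx.
Qed.

End necessity.

Theorem theorem5p1 (R : realType) (n : nat) (B : bergman_data R n)
    (hB : bergman_type_space B) (hA8 : carleson_toeplitz_BUC B)
    (T : (pt (dom B) -> nat -> R[i]^o) -> (pt (dom B) -> nat -> R[i]^o))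
    (hT : bounded_op (bergman B) T) :
  compact_op (bergman B) T <->
  (forall i k : nat,
     limsup_infty (fun z : pt (dom B) =>
       cmod (hip (ell2 R) (berezin T z (ell2_basis R k)) (ell2_basis R i))) = 0%E) /\
  toeplitz_Linf_fin T.
Proof.
split=> [cT|[berT [_ appT]]].
  split; first by move=> i k; exact: berezin_compact.
  have [x [xH xtot xE]] := total_sequence hB.
  exact: (clos_compact hB hA8 xE hT cT xtot).
apply: (compact_of_berezin hB hT berT) => e /appT[X gX hX].
by exists X; [exact: fin_sums_block|exact: hX].
Qed.
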